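(* Let $T>0$ and $x_0\in\mathbb{R}^n$. Let $b:[0,T]\times\mathbb{R}^n\to\mathbb{R}^n$ and $\sigma:[0,T]\times\mathbb{R}^n\to\mathbb{R}^{n\times d}$ be continuous, and suppose there is $L>0$ with $$|b(t,x)-b(t,x')|+|\sigma(t,x)-\sigma(t,x')|\le L|x-x'|,\qquad \forall t\in[0,T],\ x,x'\in\mathbb{R}^n.$$ Let $\psi:[0,T]\times\mathbb{R}^n\times\mathbb{R}^n\to\mathbb{R}^m$ and $g:\Delta[0,T]\times\mathbb{R}^n\times\mathbb{R}^n\times\mathbb{R}^m\times\mathbb{R}^{m\times d}\to\mathbb{R}^m$ be continuous and suppose that for some $L>0$ $$|\psi(t,\xi,x)-\psi(t',\xi',x')|\le L\big(|t-t'|+|\xi-\xi'|+|x-x'|\big),$$ $$|g(t,s,\xi,x,y,z)-g(t',s,\xi',x',y',z')|\le L\big(|t-t'|+|\xi-\xi'|+|x-x'|+|y-y'|+|z-z'|\big)$$ for all arguments in the respective domains. Let $\Theta:\Delta[0,T]\times\mathbb{R}^n\times\mathbb{R}^n\to\mathbb{R}^m$ be the classical solution of $$\begin{cases}\Theta_s(t,s,\xi,x)+\frac12\sigma(s,x)^\top\Theta_{xx}(t,s,\xi,x)\sigma(s,x)+\Theta_x(t,s,\xi,x)b(s,x)\\ \qquad+g\big(t,s,\xi,x,\Theta(s,s,x,x),\Theta_x(t,s,\xi,x)\sigma(s,x)\big)=0,\quad (t,s,\xi,x)\in\Delta[0,T]\times\mathbb{R}^n\times\mathbb{R}^n,\\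 \Theta(t,T,\xi,x)=\psi(t,\xi,x),\quad (t,\xi,x)\in[0,T]\times\mathbb{R}^n\times\mathbb{R}^n.\end{cases}$$ Let $X(\cdot)$ be the solution of $$dX(t)=b(t,X(t))\,dt+\sigma(t,X(t))\,dW(t),\quad t\in[0,T],\qquad X(0)=x_0,$$ and let $(Y(\cdot),Z(\cdot,\cdot))$ be the adapted solution of the backward stochastic Volterra integral equation $$Y(t)=\psi(t,X(t),X(T))+\int_t^Tg\big(t,s,X(t),X(s),Y(s),Z(t,s)\big)ds-\int_t^TZ(t,s)\,dW(s),\quad t\in[0,T].$$ Then $$Y(s)=\Theta(s,s,X(s),X(s)),\ s\in[0,T],\qquad Z(t,s)=\Theta_x(t,s,X(t),X(s))\,\sigma(s,X(s)),\ (t,s)\in\Delta[0,T].$$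
   Context: $(\Omega,\mathcal{F},\mathbb{F},\mathbb{P})$ is a complete filtered probability space carrying a standard $d$-dimensional Brownian motion $W(\cdot)$, with $\mathbb{F}=\{\mathcal{F}_t\}_{t\ge0}$ the natural filtration of $W$ augmented by all $\mathbb{P}$-null sets. $\Delta[0,T]=\{(t,s)\in[0,T]^2: 0\le t\le s\le T\}$. For $\Theta=(\Theta^1,\dots,\Theta^m)^\top$ and $\sigma=(\sigma_1,\dots,\sigma_d)$ (columns), $\sigma^\top\Theta_{xx}\sigma$ denotes the vector in $\mathbb{R}^m$ whose $i$-th component is $\sum_{k=1}^d\sigma_k^\top\Theta^i_{xx}\sigma_k$. $\Theta_x\in\mathbb{R}^{m\times n}$ is the Jacobian with respect to the last variable $x$, and $\Theta_s$ is the derivative in the second variable. Classical solution: $\Theta,\Theta_s,\Theta_x,\Theta_{xx}$ exist and are continuous on $\Delta[0,T]\times\mathbb{R}^n\times\mathbb{R}^n$, and the equation and terminal condition hold pointwise. Adapted solution of the integral equation: a pair $(Y(\cdot),Z(\cdot,\cdot))$, with $Y$ on $[0,T]$ valued in $\mathbb{R}^m$ and $Z$ on $\Delta[0,T]$ valued in $\mathbb{R}^{m\times d}$, such that for each $t\in[0,T)$ the map $s\mapsto(Y(s),Z(t,s))$ is $\mathbb{F}$-adapted on $[t,T]$, and the equation holds in the usual Itô sense; the solution is taken in the square-integrable class $\mathbb{E}\int_0^T|Y(t)|^2dt+\mathbb{E}\int_0^T\int_t^T|Z(t,s)|^2ds\,dt<\infty$. Under the stated hypotheses on $b,\sigma,\psi,g$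 it exists and is unique; solutions are identified when they agree almost everywhere in time, almost surely, and the identities in the conclusion are understood in that sense.
   Formalization: Added hypothesis: the pair (Θ(s,s,X(s),X(s)), Θ_x(t,s,X(t),X(s))σ(s,X(s))) is square-integrable like (Y,Z). Without it the claim fails (Tychonoff's nonzero heat solution with zero terminal data); the conclusion itself implies it. *)

(* Defs.v *)
From HB Require Import structures.
From mathcomp Require Import all_boot all_order all_algebra.
From mathcomp Require Import all_classical all_reals all_analysis.
Set Implicit Arguments.
Unset Strict Implicit.
Unset Printing Implicit Defensive.
Import Order.TTheory GRing.Theory Num.Theory numFieldNormedType.Exports.
Local Open Scope classical_set_scope.
Local Open Scope ring_scope.

(* Conventions: R^k is 'cV[R]_k.  A function of time is a total function on R
   whose values matter only on [0, T] (or on the triangle); all hypotheses and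
   conclusions are restricted to these domains. *)

Section deterministic.
Context {R : realType}.
Implicit Types (T t s : R).

(* Euclidean (Frobenius) norm; the library norm `|A| on matrices is the sup
   norm. *)
Definition enorm p q (A : 'M[R]_(p, q)) : R :=
  Num.sqrt (\sum_i \sum_j A i j ^+ 2).

Definition triangle T : set (R * R) :=
  [set u | [&& 0 <= u.1, u.1 <= u.2 & u.2 <= T]].

Definition vintegral p (D : set R) (f : R -> 'cV[R]_p) : 'cV[R]_p :=
  \col_i (\int[lebesgue_measure]_(s in D) f s i 0)%R.

Definition jac n m (f : 'cV[R]_n -> 'cV[R]_m) (x : 'cV[R]_n) : 'M[R]_(m, n) :=
  \matrix_(i, j) 'D_(delta_mx j 0) (fun y => f y i 0) x.

Definition hess n (f : 'cV[R]_n -> R) (x : 'cV[R]_n) : 'M[R]_n :=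
  \matrix_(j, k) 'D_(delta_mx k 0) (fun y => 'D_(delta_mx j 0) f y) x.

Definition twice_derivable n (f : 'cV[R]_n -> R) : Prop :=
  (forall x j, derivable f x (delta_mx j 0)) /\
  (forall x j k,
     derivable (fun y => 'D_(delta_mx j 0) f y) x (delta_mx k 0)).

(* One-sided at an endpoint of an interval D, and no constraint on l if D is
   reduced to a point. *)
Definition derivative_within p (D : set R) (f : R -> 'cV[R]_p) s
    (l : 'cV[R]_p) : Prop :=
  (fun r => (r - s)^-1 *: (f r - f s)) @ within D s^' --> l.

Section coefficients.
Variables (n d m : nat) (T : R).

Definition continuous_coefficient q (a : R -> 'cV[R]_n -> 'M[R]_(n, q)) : Prop :=
  {within `[0, T] `*` setT, continuous (fun u => a u.1 u.2)}.

Definition sde_lipschitz (b : R -> 'cV[R]_n -> 'cV[R]_n)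
    (sigma : R -> 'cV[R]_n -> 'M[R]_(n, d)) : Prop :=
  exists2 L : R, 0 < L & forall t x x', 0 <= t <= T ->
    enorm (b t x - b t x') + enorm (sigma t x - sigma t x') <= L * enorm (x - x').

Definition psi_assumption (psi : R -> 'cV[R]_n -> 'cV[R]_n -> 'cV[R]_m)
    (L : R) : Prop :=
  {within `[0, T] `*` setT `*` setT,
     continuous (fun u => psi u.1.1 u.1.2 u.2)} /\
  forall t t' xi xi' x x', 0 <= t <= T -> 0 <= t' <= T ->
    enorm (psi t xi x - psi t' xi' x') <=
    L * (`|t - t'| + enorm (xi - xi') + enorm (x - x')).

Definition g_assumption
    (g : R -> R -> 'cV[R]_n -> 'cV[R]_n -> 'cV[R]_m -> 'M[R]_(m, d) ->
         'cV[R]_m) (L : R) : Prop :=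
  {within triangle T `*` setT `*` setT `*` setT `*` setT,
     continuous (fun u => g u.1.1.1.1.1 u.1.1.1.1.2 u.1.1.1.2 u.1.1.2 u.1.2 u.2)} /\
  forall t t' s xi xi' x x' y y' z z', triangle T (t, s) -> triangle T (t', s) ->
    enorm (g t s xi x y z - g t' s xi' x' y' z') <=
    L * (`|t - t'| + enorm (xi - xi') + enorm (x - x')
         + enorm (y - y') + enorm (z - z')).

(* The s-derivative is one-sided at s = t and s = T.  At t = s = T the segment
   [t, T] is a point, and the value of Theta_s there is the one given by
   continuity on the closed triangle. *)
Definition classical_solution
    (b : R -> 'cV[R]_n -> 'cV[R]_n) (sigma : R -> 'cV[R]_n -> 'M[R]_(n, d))
    (psi : R -> 'cV[R]_n -> 'cV[R]_n -> 'cV[R]_m)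
    (g : R -> R -> 'cV[R]_n -> 'cV[R]_n -> 'cV[R]_m -> 'M[R]_(m, d) ->
         'cV[R]_m)
    (Theta : R -> R -> 'cV[R]_n -> 'cV[R]_n -> 'cV[R]_m) : Prop :=
  let dom := triangle T `*` setT `*` setT in
  exists Theta_s : R -> R -> 'cV[R]_n -> 'cV[R]_n -> 'cV[R]_m,
  [/\ (forall t s xi x, triangle T (t, s) ->
         derivative_within `[t, T] (fun r => Theta t r xi x) s
           (Theta_s t s xi x)) /\
      (forall t s xi i, triangle T (t, s) ->
         twice_derivable (fun x => Theta t s xi x i 0)),
      {within dom, continuous (fun u => Theta u.1.1.1 u.1.1.2 u.1.2 u.2)} /\
      {within dom, continuous (fun u => Theta_s u.1.1.1 u.1.1.2 u.1.2 u.2)},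
      {within dom, continuous
         (fun u => jac (Theta u.1.1.1 u.1.1.2 u.1.2) u.2)} /\
      (forall i, {within dom, continuous
         (fun u => hess (fun x => Theta u.1.1.1 u.1.1.2 u.1.2 x i 0) u.2)}),
      (forall t s xi x, triangle T (t, s) ->
         Theta_s t s xi x
         + 2^-1 *: (\col_i \sum_(k < d)
             ((col k (sigma s x))^T
              *m hess (fun y => Theta t s xi y i 0) x
              *m col k (sigma s x)) 0 0)
         + jac (Theta t s xi) x *m b s x
         + g t s xi x (Theta s s x x) (jac (Theta t s xi) x *m sigma s x) = 0)
    & (forall t xi x, 0 <= t <= T -> Theta t T xi x = psi t xi x)].

End coefficients.
End deterministic.

Section stochastic.
Context {R : realType} {dO : measure_display} {Omega : measurableType dO}.
Variable P : probability Omega R.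

(* Entrywise measurability; on column vectors and matrices of finite size this
   is Borel measurability. *)
Definition measurable_mx d' (S : measurableType d') p q (D : set S)
    (f : S -> 'M[R]_(p, q)) : Prop :=
  forall i j, measurable_fun D (fun w => f w i j).

Definition measurable_wrt (G : set (set Omega)) p q
    (f : Omega -> 'M[R]_(p, q)) : Prop :=
  forall i j (B : set R), measurable B -> G ((fun w => f w i j) @^-1` B).

Definition independent_classes (G H : set (set Omega)) : Prop :=
  forall A B, G A -> H B -> P (A `&` B) = (P A * P B)%E.

Definition sigma_past d (W : R -> Omega -> 'cV[R]_d) (t : R) :
    set (set Omega) :=
  <<s [set A | exists r k (B : set R), [/\ 0 <= r <= t, measurable B &
                 A = (fun w => W r w k 0) @^-1` B]] >>.

Definition sigma_vector d (V : Omega -> 'cV[R]_d) : set (set Omega) :=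
  <<s [set A | exists k (B : set R), measurable B /\
                 A = (fun w => V w k 0) @^-1` B] >>.

Definition augmented_filtration d (W : R -> Omega -> 'cV[R]_d) (t : R) :
    set (set Omega) :=
  <<s sigma_past W t `|` P.-negligible >>.

(* normal_prob takes the standard deviation; increments are considered for
   s < t only, since normal_prob with deviation 0 is not a Dirac mass. *)
Definition brownian_motion d (W : R -> Omega -> 'cV[R]_d) : Prop :=
  [/\ (forall t, 0 <= t -> measurable_mx setT (W t)),
      {ae P, forall w, W 0 w = 0},
      {ae P, forall w, {within `[0, +oo[, continuous (fun t => W t w)}},
      (forall s t, 0 <= s -> s < t ->
         independent_classes (sigma_past W s)
           (sigma_vector (fun w => W t w - W s w)))
    & (forall s t, 0 <= s -> s < t ->
         forall B : 'I_d -> set R, (forall k, measurable (B k)) ->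
         P [set w | forall k, B k ((W t w - W s w) k 0)] =
         (\prod_(k < d) normal_prob 0 (Num.sqrt (t - s)) (B k))%E)].

(* The simple process
     \sum_(i < sp_size) 1_(sp_time i, sp_time i.+1] sp_val i. *)
Record simple_process p d := SimpleProcess {
  sp_size : nat ;
  sp_time : nat -> R ;
  sp_val : nat -> Omega -> 'M[R]_(p, d) }.

Definition simple_adapted (F : R -> set (set Omega)) (a b : R) p d
    (S : simple_process p d) : Prop :=
  [/\ (forall i, (i <= sp_size S)%N -> a <= sp_time S i <= b),
      (forall i, (i < sp_size S)%N -> sp_time S i <= sp_time S i.+1),
      (forall i, (i < sp_size S)%N ->
         measurable_wrt (F (sp_time S i)) (sp_val S i))
    & (exists C : R, forall i w, (i < sp_size S)%N ->
         enorm (sp_val S i w) <= C)].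

Definition simple_value p d (S : simple_process p d) (s : R) (w : Omega) :
    'M[R]_(p, d) :=
  \sum_(i < sp_size S)
     \1_(`]sp_time S i, sp_time S i.+1] : set R) s *: sp_val S i w.

Definition simple_integral p d (W : R -> Omega -> 'cV[R]_d)
    (S : simple_process p d) (w : Omega) : 'cV[R]_p :=
  \sum_(i < sp_size S)
     sp_val S i w *m (W (sp_time S i.+1) w - W (sp_time S i) w).

Definition cvg0_in_probability (U : nat -> Omega -> \bar R) : Prop :=
  forall e : R, 0 < e -> P [set w | (e%:E <= U k w)%E] @[k --> \oo] --> 0%E.

(* I is (a version of) the Ito integral of H over [a, b] with respect to W, for
   integrands that are almost surely square integrable in time:
   int_a^b |S_k - H|^2 ds -> 0 and int_a^b S_k dW -> I in probability for some
   sequence of simple adapted processes S_k. *)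
Definition is_ito_integral (F : R -> set (set Omega)) d
    (W : R -> Omega -> 'cV[R]_d) (a b : R) p
    (H : R -> Omega -> 'M[R]_(p, d)) (I : Omega -> 'cV[R]_p) : Prop :=
  measurable_mx setT I /\
  exists S : nat -> simple_process p d,
  [/\ (forall k, simple_adapted F a b (S k)),
      cvg0_in_probability (fun k w =>
        (\int[lebesgue_measure]_(s in `[a, b])
           (enorm (simple_value (S k) s w - H s w) ^+ 2)%:E)%E)
    & cvg0_in_probability (fun k w =>
        (enorm (simple_integral W (S k) w - I w))%:E)].

Definition sde_solution (F : R -> set (set Omega)) n d
    (W : R -> Omega -> 'cV[R]_d) (T : R) (x0 : 'cV[R]_n)
    (b : R -> 'cV[R]_n -> 'cV[R]_n) (sigma : R -> 'cV[R]_n -> 'M[R]_(n, d))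
    (X : R -> Omega -> 'cV[R]_n) : Prop :=
  [/\ (forall t, 0 <= t <= T -> measurable_wrt (F t) (X t)),
      {ae P, forall w, {within `[0, T], continuous (fun t => X t w)}},
      {ae P, forall w, X 0 w = x0}
    & (forall t, 0 <= t <= T ->
       exists2 I, is_ito_integral F W 0 t (fun s w => sigma s (X s w)) I &
         {ae P, forall w,
            X t w = x0 + vintegral `[0, t] (fun s => b s (X s w)) + I w})].

Definition square_integrable_pair m d (T : R) (Y : R -> Omega -> 'cV[R]_m)
    (Z : R -> R -> Omega -> 'M[R]_(m, d)) : Prop :=
  (\int[P]_w \int[lebesgue_measure]_(t in `[0%R, T]) (enorm (Y t w) ^+ 2)%:E +
   \int[P]_w \int[lebesgue_measure]_(t in `[0%R, T])
     \int[lebesgue_measure]_(s in `[t, T]) (enorm (Z t s w) ^+ 2)%:E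
   < +oo)%E.

(* The equation is required for almost every t only, solutions being identified
   when they agree almost everywhere in time, almost surely. *)
Definition bsvie_adapted_solution (F : R -> set (set Omega)) n d m
    (W : R -> Omega -> 'cV[R]_d) (T : R)
    (psi : R -> 'cV[R]_n -> 'cV[R]_n -> 'cV[R]_m)
    (g : R -> R -> 'cV[R]_n -> 'cV[R]_n -> 'cV[R]_m -> 'M[R]_(m, d) ->
         'cV[R]_m)
    (X : R -> Omega -> 'cV[R]_n)
    (Y : R -> Omega -> 'cV[R]_m)
    (Z : R -> R -> Omega -> 'M[R]_(m, d)) : Prop :=
  [/\ measurable_mx (`[0, T] `*` setT) (fun u : R * Omega => Y u.1 u.2) /\
      measurable_mx (triangle T `*` setT)
        (fun u : R * R * Omega => Z u.1.1 u.1.2 u.2),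
      (forall t s, 0 <= t < T -> t <= s <= T ->
         measurable_wrt (F s) (Y s) /\ measurable_wrt (F s) (Z t s)),
      square_integrable_pair T Y Z
    & {ae lebesgue_measure, forall t, 0 <= t <= T ->
       exists2 I, is_ito_integral F W t T (Z t) I &
         {ae P, forall w,
            Y t w = psi t (X t w) (X T w)
              + vintegral `[t, T]
                  (fun s => g t s (X t w) (X s w) (Y s w) (Z t s w))
              - I w}}].

End stochastic.

(* Main.v *)
(* Ito's formula applied to s |-> Theta(t, s, X(t), X(s)) and the equation for
   Theta show that the pair (Theta(s, s, X(s), X(s)), Theta_x sigma) satisfies,
   for every t < T, the same Volterra equation as (Y, Z).  For the difference
   (dY, dZ) this reads dY(t) = int_t^T dG ds - int_t^T dZ dW with
   |dG|^2 <= C (|dY(s)|^2 + |dZ(t, s)|^2).  On a fine uniform grid of [t, T],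
   orthogonality of the increments of the Ito integral absorbs the dZ-part of
   dG, so that E|dY(t)|^2 + E int_t^T |dZ(t, s)|^2 ds <= K int_t^T E|dY(s)|^2 ds
   for almost every t, with K independent of t; Gronwall's lemma concludes.

   Ito integrals with almost surely square integrable integrands are handled
   through elementary approximations only: truncating the energy of an
   elementary integrand replaces stopping times, and Ito's formula follows from
   a Taylor expansion along uniform grids, every remainder tending to 0 in
   probability because continuous paths have tight norms and moduli of
   continuity. *)
From HB Require Import structures.
Require Import Defs.
From mathcomp Require Import all_boot all_order all_algebra.
From mathcomp Require Import all_classical all_reals all_analysis.
From mathcomp Require Import measurable_realfun ring lra.
Set Implicit Arguments.
Unset Strict Implicit.
Unset Printing Implicit Defensive.
Import Order.TTheory GRing.Theory Num.Theory numFieldNormedType.Exports.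
Local Open Scope classical_set_scope.
Local Open Scope ring_scope.

(** * Expectations and high probability *)

(** Freezing t is what makes the Volterra equation tractable: for a fixed t the difference solves an
    ordinary backward equation in s whose unknown is dZ(t, .), while dY(s) for s > t enters only
    through the forcing [q]. One use of the isometry on all of [t, T] would put a factor C (T - t)
    in front of the energy of dZ, too large to absorb unless T is small. On one grid step the factor
    is C dt, and [8 * m * C0 * dt <= 1] leaves half of the energy on the left. The price is a factor
    2 per step, whence [2 ^+ N.+2]; the number of steps is computed from T instead of T - t, so the
    constant is the same for all t and Gronwall applies. Ito's formula only produces an integral in
    the sense of convergence in probability, whereas the estimate needs expectations. [ItoP_L2]
    bridges the gap: finite expected energy of the integrand turns approximation in probability into
    approximation in mean square. This is where square integrability of both pairs enters. Errors
    are measured by exceptional events of small probability, so suprema along paths may be used even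
    when they are not random variables. *)

Section high_probability.
Context {R : realType} {dO : measure_display} {Omega : measurableType dO}.
Variable P : probability Omega R.
Implicit Types (e c : R) (Q : Omega -> Prop) (f : Omega -> R).

(* [hp e Q]: Q holds off a measurable set of probability at most e; Q itself
   need not be measurable. *)
Definition hp e Q := exists A : set Omega,
  [/\ measurable A, (P A <= e%:E)%E & forall w, ~ A w -> Q w].

Lemma hpS e e' Q Q' : e <= e' -> (forall w, Q w -> Q' w) -> hp e Q -> hp e' Q'.
Proof.
move=> ee QQ [A [mA PA AQ]]; exists A; split=> // [|w /AQ /QQ//].
by apply: (le_trans PA); rewrite lee_fin.
Qed.

Lemma hpI e e' Q Q' : hp e Q -> hp e' Q' -> hp (e + e') (fun w => Q w /\ Q' w).
Proof.
move=> [A [mA PA AQ]] [B [mB PB BQ]]; exists (A `|` B); split.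
- exact: measurableU.
- apply: (@le_trans _ _ (P A + P B)%E); first exact: measureU2.
  by rewrite EFinD leeD.
- by move=> w /not_orP[/AQ ? /BQ].
Qed.

Lemma hp_ae Q : {ae P, forall w, Q w} -> hp 0 Q.
Proof.
move=> [A [mA PA AQ]]; exists A; split => //; first by rewrite PA.
by move=> w nA; apply: contrapT => nQ; apply/nA/AQ.
Qed.

Lemma hp_all n e (Q : 'I_n -> Omega -> Prop) : (forall i, hp e (Q i)) ->
  hp (n%:R * e) (fun w => forall i, Q i w).
Proof.
elim: n Q => [|n IH] Q hQ.
  exists set0; rewrite mul0r; split => //; first by rewrite measure0.
  by move=> w _ [].
have := hpI (hQ ord0) (IH (fun i => Q (lift ord0 i)) (fun i => hQ _)).
apply: hpS; first by rewrite -natr1 mulrDl mul1r addrC.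
move=> w [Q0 QS] i; case: (unliftP ord0 i) => [j ->|-> //]; exact: QS.
Qed.

Lemma hp_markov e c f : 0 < c -> measurable_fun setT f -> (forall w, 0 <= f w) ->
  (\int[P]_w (f w)%:E <= (c * e)%:E)%E -> hp e (fun w => f w <= c).
Proof.
move=> c0 mf f0 If; exists [set w | c < f w]; split.
- rewrite -[X in measurable X]setTI; have := mf measurableT `]c, +oo[%classic.
  rewrite (_ : _ @^-1` _ = [set w | c < f w]); first by apply; exact: measurable_itv.
  by apply/seteqP; split=> w /=; rewrite in_itv/= andbT.
- set A := [set _ | _].
  have mA : measurable A.
    rewrite -[X in measurable X]setTI; have := mf measurableT `]c, +oo[%classic.
    rewrite (_ : _ @^-1` _ = A); first by apply; exact: measurable_itv.
    by apply/seteqP; split=> w /=; rewrite /A/= in_itv/= andbT.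
  have : (c%:E * P A <= (c * e)%:E)%E.
    apply: le_trans If; rewrite -(setIT A) -integral_indic//.
    rewrite -ge0_integralZl_EFin//=; first last.
    - exact: ltW.
    - by apply/measurable_EFinP; exact: measurable_indic.
    apply: ge0_le_integral => //=.
    - by move=> w _; rewrite -EFinM lee_fin mulr_ge0// ltW.
    - by apply: measurable_funeM; apply/measurable_EFinP; exact: measurable_indic.
    - by apply/measurable_EFinP.
    move=> w _; rewrite -EFinM lee_fin indicE.
    have [|_] := boolP (w \in A); last by rewrite mulr0.
    by rewrite inE /A/= mulr1 => /ltW.
  by rewrite EFinM lee_pmul2l// lte_fin.
- by move=> w /= /negP; rewrite -leNgt.
Qed.

End high_probability.

(** * Integrable and square integrable random variables *)

Section L2.
Context {R : realType} {dO : measure_display} {Omega : measurableType dO}.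
Variable P : probability Omega R.
Implicit Types (e c : R) (f g : Omega -> R).

Definition L1 f := P.-integrable setT (EFin \o f).
Definition L2 f := measurable_fun setT f /\ L1 (fun w => f w ^+ 2).
Definition Ex f : R := (\int[P]_w f w)%R.
Definition bddf f := exists C : R, forall w, `|f w| <= C.

Lemma L1_le f g : measurable_fun setT f -> L1 g -> (forall w, `|f w| <= g w) -> L1 f.
Proof.
move=> mf ig fg; apply: (le_integrable _ _ _ ig) => //=; first exact/measurable_EFinP.
move=> w _; rewrite lee_fin; apply: le_trans (fg w) _; exact: ler_norm.
Qed.

Lemma L1_meas f : L1 f -> measurable_fun setT f.
Proof. by move=> /measurable_int /measurable_EFinP. Qed.

Lemma L1D f g : L1 f -> L1 g -> L1 (fun w => f w + g w).
Proof. by move=> i1 i2; apply: (integrableD measurableT i1 i2). Qed.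

Lemma L1Z c f : L1 f -> L1 (fun w => c * f w).
Proof. by move=> i1; apply: (integrableZl measurableT c i1). Qed.

Lemma L1B f g : L1 f -> L1 g -> L1 (fun w => f w - g w).
Proof. by move=> i1 i2; apply: (integrableB measurableT i1 i2). Qed.

Lemma L1_cst c : L1 (fun=> c).
Proof. exact: finite_measure_integrable_cst. Qed.

Lemma L1_sum I (r : seq I) (Q : pred I) (F : I -> Omega -> R) :
  (forall i, Q i -> L1 (F i)) -> L1 (fun w => \sum_(i <- r | Q i) F i w).
Proof.
move=> h; elim: r => [|i r IH].
  by rewrite (_ : (fun _ => _) = fun=> 0); [exact: L1_cst|apply/funext => w; rewrite big_nil].
rewrite (_ : (fun _ => _) = fun w => (if Q i then F i w else 0) + \sum_(i <- r | Q i) F i w).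
  by apply: (L1D _ IH); case: (boolP (Q i)) => [/h//|_]; exact: L1_cst.
by apply/funext => w; rewrite big_cons; case: ifP => // _; rewrite add0r.
Qed.

Lemma L2_meas f : L2 f -> measurable_fun setT f. Proof. by case. Qed.

Lemma L2_L1 f : L2 f -> L1 f.
Proof.
move=> [mf if2]; apply: (L1_le mf (L1D (L1_cst 1) if2)) => w.
have := sqr_ge0 (`|f w| - 1); rewrite sqrrB real_normK ?num_real// expr1n mulr1.
have := normr_ge0 (f w); nra.
Qed.

Lemma L2M f g : L2 f -> L2 g -> L1 (fun w => f w * g w).
Proof.
move=> [mf if2] [mg ig2].
apply: (L1_le (measurable_funM mf mg) (L1D if2 ig2)) => w.
rewrite normrM -(real_normK (num_real (f w))) -(real_normK (num_real (g w))).
have := normr_ge0 (f w); have := normr_ge0 (g w); nra.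
Qed.

Lemma L2D f g : L2 f -> L2 g -> L2 (fun w => f w + g w).
Proof.
move=> Lf Lg; split; first exact: (measurable_funD (L2_meas Lf) (L2_meas Lg)).
rewrite (_ : (fun w => _) = fun w => f w ^+ 2 + (2 * (f w * g w) + g w ^+ 2)).
  by apply: L1D (Lf.2) (L1D (L1Z 2 (L2M Lf Lg)) Lg.2).
by apply/funext => w; ring.
Qed.

Lemma L2Z c f : L2 f -> L2 (fun w => c * f w).
Proof.
move=> [mf if2]; split; first exact: measurable_funM.
by under eq_fun do rewrite exprMn; exact: L1Z.
Qed.

Lemma L2N f : L2 f -> L2 (fun w => - f w).
Proof. by move/(L2Z (-1)); under eq_fun do rewrite mulN1r. Qed.

Lemma L2B f g : L2 f -> L2 g -> L2 (fun w => f w - g w).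
Proof. by move=> Lf /L2N; exact: L2D. Qed.

Lemma L2_cst c : L2 (fun=> c).
Proof. by split => //; exact: L1_cst. Qed.

Lemma L2_sum I (r : seq I) (Q : pred I) (F : I -> Omega -> R) :
  (forall i, Q i -> L2 (F i)) -> L2 (fun w => \sum_(i <- r | Q i) F i w).
Proof.
move=> h; elim: r => [|i r IH].
  by rewrite (_ : (fun _ => _) = fun=> 0); [exact: L2_cst|apply/funext => w; rewrite big_nil].
rewrite (_ : (fun _ => _) = fun w => (if Q i then F i w else 0) + \sum_(i <- r | Q i) F i w).
  by apply: (L2D _ IH); case: (boolP (Q i)) => [/h//|_]; exact: L2_cst.
by apply/funext => w; rewrite big_cons; case: ifP => // _; rewrite add0r.
Qed.

Lemma L2_le f g : measurable_fun setT f -> L2 g -> (forall w, `|f w| <= `|g w|) -> L2 f.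
Proof.
move=> mf [_ ig] fg; split=> //; apply: (L1_le _ ig) => [|w].
  exact: measurable_funX.
by rewrite normrX -(real_normK (num_real (g w))) lerXn2r ?nnegrE.
Qed.

Lemma L2_bdd f : measurable_fun setT f -> bddf f -> L2 f.
Proof.
move=> mf [C fC]; apply: (L2_le mf (L2_cst C)) => w.
by apply: le_trans (fC w) _; exact: ler_norm.
Qed.

Lemma L2_bddM f g : measurable_fun setT f -> bddf f -> L2 g -> L2 (fun w => f w * g w).
Proof.
move=> mf [C fC] Lg.
apply: (L2_le (measurable_funM mf (L2_meas Lg)) (L2Z C Lg)) => w.
rewrite !normrM ler_wpM2r//; exact: le_trans (fC w) (ler_norm _).
Qed.

Lemma bddfM f g : bddf f -> bddf g -> bddf (fun w => f w * g w).
Proof.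
move=> [C fC] [D gD]; exists (C * D) => w; rewrite normrM.
by apply: ler_pM.
Qed.

Lemma ExD f g : L1 f -> L1 g -> Ex (fun w => f w + g w) = Ex f + Ex g.
Proof. by move=> *; exact: RintegralD. Qed.

Lemma ExB f g : L1 f -> L1 g -> Ex (fun w => f w - g w) = Ex f - Ex g.
Proof. by move=> *; exact: RintegralB. Qed.

Lemma ExZ c f : L1 f -> Ex (fun w => c * f w) = c * Ex f.
Proof. by move=> *; exact: RintegralZl. Qed.

Lemma Ex_cst c : Ex (fun=> c) = c.
Proof. by rewrite /Ex Rintegral_cst//= (@probability_setT _ _ _ P) mulr1. Qed.

Lemma Ex_sum I (r : seq I) (Q : pred I) (F : I -> Omega -> R) :
  (forall i, Q i -> L1 (F i)) ->
  Ex (fun w => \sum_(i <- r | Q i) F i w) = \sum_(i <- r | Q i) Ex (F i).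
Proof.
move=> h; elim: r => [|i r IH].
  by under eq_fun do rewrite big_nil; rewrite Ex_cst big_nil.
rewrite big_cons -IH.
under eq_fun do rewrite big_cons.
by case: ifP => // Qi; rewrite ExD//; [exact: h|exact: L1_sum].
Qed.

Lemma Ex_ge0 f : (forall w, 0 <= f w) -> 0 <= Ex f.
Proof. by move=> f0; apply: Rintegral_ge0. Qed.

Lemma Ex_le f g : L1 f -> L1 g -> (forall w, f w <= g w) -> Ex f <= Ex g.
Proof. by move=> i1 i2 fg; apply: le_Rintegral. Qed.

Lemma ExE f : L1 f -> (\int[P]_w (f w)%:E)%E = (Ex f)%:E.
Proof. by move=> i1; rewrite /Ex /Rintegral fineK//; exact: integrable_fin_num. Qed.

Lemma Ex_ae f g : L1 f -> L1 g -> {ae P, forall w, f w = g w} -> Ex f = Ex g.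
Proof.
move=> i1 i2 fg; rewrite /Ex /Rintegral; congr fine.
apply: ae_eq_integral => //; [exact: measurable_int i1|exact: measurable_int i2|].
by apply: filterS fg => w ->.
Qed.

(** The hypothesis says that the law of (X, Y) and the product of the two laws agree on rectangles,
    hence everywhere by uniqueness of the product measure. The left side is then the integral of xy
    over a product, which Fubini splits. *)
Lemma indep_Ex (X Y : Omega -> R) : L1 X -> L1 Y -> L1 (fun w => X w * Y w) ->
  (forall A B : set R, measurable A -> measurable B ->
     P (X @^-1` A `&` Y @^-1` B) = (P (X @^-1` A) * P (Y @^-1` B))%E) ->
  Ex (fun w => X w * Y w) = Ex X * Ex Y.
Proof.
move=> iX iY iXY ind.
have mX := L1_meas iX; have mY := L1_meas iY.
pose fX : {RV P >-> R} := HB.pack_for {RV P >-> R} X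
  (isMeasurableFun.Build _ _ _ _ X mX).
pose fY : {RV P >-> R} := HB.pack_for {RV P >-> R} Y
  (isMeasurableFun.Build _ _ _ _ Y mY).
pose XY w := (X w, Y w).
have mXY : measurable_fun setT XY by exact: measurable_fun_pair.
pose fXY : {mfun Omega >-> (R * R)%type} := HB.pack_for
  {mfun Omega >-> (R * R)%type} XY (isMeasurableFun.Build _ _ _ _ XY mXY).
pose PX := distribution P fX; pose PY := distribution P fY.
pose PXY := distribution P fXY.
have PE : forall S, measurable S -> (PX \x PY)%E S = PXY S.
  apply: product_measure_unique => A B mA mB.
  by rewrite /PXY/PX/PY /distribution/pushforward/= -ind.
have mp : measurable_fun setT (fun z : R * R => (z.1 * z.2)%:E).
  by apply/measurable_EFinP; apply: measurable_funM.
have mnorm : measurable_fun setT (fun y : R => `|y|%:E).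
  by apply/measurable_EFinP; exact: normr_measurable.
have E1 : (\int[PX]_x \int[PY]_y (x * y)%:E = (Ex X * Ex Y)%:E)%E.
  have -> : (fun x => \int[PY]_y (x * y)%:E)%E = fun x : R => (x%:E * (Ex Y)%:E)%E.
    apply/funext => x; rewrite -(ExE iY).
    under eq_integral do rewrite EFinM.
    rewrite integralZl//.
      congr (_ * _)%E; rewrite integral_distribution//.
    by apply: integrable_pushforward => //; exact: mY.
  rewrite integralZr//; last by apply: integrable_pushforward => //; exact: mX.
  by rewrite integral_distribution// EFinM (ExE iX).
have E2 : (PX \x PY)%E.-integrable setT (fun z : R * R => (z.1 * z.2)%:E).
  apply/integrable12ltyP => //=.
  have -> : (fun x => \int[PY]_y `|(x * y)%:E|)%E =
      fun x : R => (`|x|%:E * \int[P]_w (`|Y w|)%:E)%E.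
    apply/funext => x.
    transitivity (\int[PY]_y (`|x|%:E * `|y|%:E))%E.
      by apply: eq_integral => y _; rewrite /= normrM EFinM.
    rewrite ge0_integralZl//=.
    by congr (_ * _)%E; rewrite (@ge0_integral_distribution _ _ _ _ _ P fY (fun y => `|y|%:E) mnorm).
  rewrite ge0_integralZr//; last by apply: integral_ge0.
  rewrite (@ge0_integral_distribution _ _ _ _ _ P fX (fun y => `|y|%:E) mnorm)//.
  have := integrable_norm iX; have := integrable_norm iY.
  move=> /integrable_fin_num h1 /integrable_fin_num h2.
  by rewrite ltey_eq fin_numM//; [exact: h2|exact: h1].
apply: EFin_inj; rewrite -E1 -(ExE iXY).
rewrite -(@integral_distribution _ _ _ _ _ P fXY (fun z : R * R => (z.1 * z.2)%:E))//.
transitivity (\int[(PX \x PY)%E]_z (z.1 * z.2)%:E)%E.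
  by apply: eq_measure_integral => A mA _; rewrite [RHS]PE.
by rewrite -integral12_prod_meas1.
Qed.

End L2.

(** * Measurability of compositions *)

Section borel.
Context {R : realType}.

Definition sep (E : pseudoMetricType R) := exists u : nat -> E,
  forall x (e : R), 0 < e -> exists k, ball x e (u k).

(* Borel measurability through balls, which is enough for maps into a separable
   space and spares a Borel structure on the product spaces. *)
Definition bm d (S : measurableType d) (E : pseudoMetricType R) (D : set S)
  (phi : S -> E) := forall c (e : R), measurable (D `&` phi @^-1` ball c e).

Lemma sep_R : sep R.
Proof.
exists (fun k => if unpickle k is Some q then ratr q else 0) => x e e0.
have [q] : exists q, (ratr q : R) \in `]x, (x + e)[.
  by apply: rat_in_itvoo; rewrite ltrDl.
rewrite in_itv/= => /andP[xq qx]; exists (pickle q); rewrite pickleK.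
by rewrite /ball/= ltr_distlC; apply/andP; split => //; lra.
Qed.

Lemma sep_prod (E F : pseudoMetricType R) : sep E -> sep F -> sep (E * F)%type.
Proof.
move=> [u hu] [v hv].
exists (fun k => if (unpickle k : option (nat * nat)) is Some (i, j)
  then (u i, v j) else (u 0%N, v 0%N)) => -[x y] e e0.
have [i xi] := hu x e e0; have [j yj] := hv y e e0.
by exists (pickle (i, j)); rewrite pickleK; split.
Qed.

Lemma sep_mx p q : sep 'M[R]_(p, q).
Proof.
exists (fun k => if (unpickle k : option 'M[rat]_(p, q)) is Some M
  then map_mx ratr M else 0) => x e e0.
have h (ij : 'I_p * 'I_q) : exists r, (ratr r : R) \in `](x ij.1 ij.2), (x ij.1 ij.2 + e)[.
  by apply: rat_in_itvoo; rewrite ltrDl.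
have [r hr] := choice h.
exists (pickle (\matrix_(i, j) r (i, j))); rewrite pickleK; split => // i j.
rewrite !mxE; have := hr (i, j); rewrite in_itv/= => /andP[xq qx].
by rewrite /ball/= ltr_distlC; apply/andP; split => //; lra.
Qed.

Section bm.
Context {d : measure_display} {S : measurableType d}.
Variable D : set S.
Hypothesis mD : measurable D.

Lemma bm_pair (E F : pseudoMetricType R) (f : S -> E) (g : S -> F) :
  bm D f -> bm D g -> bm D (fun s => (f s, g s)).
Proof.
move=> bf bg [c1 c2] e.
rewrite (_ : _ `&` _ = (D `&` f @^-1` ball c1 e) `&` (D `&` g @^-1` ball c2 e)).
  exact: measurableI.
by apply/seteqP; split=> s /=; [move=> [Ds [h1 h2]]|move=> [[Ds h1] [_ h2]]].
Qed.

Lemma bm_R (f : S -> R) : measurable_fun D f -> bm D f.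
Proof.
move=> mf c e; have := mf mD (`](c - e), (c + e)[%classic) (measurable_itv _).
congr measurable; congr (_ `&` _); apply/seteqP.
by split=> s /=; rewrite in_itv/= /ball/= ltr_distlC.
Qed.

Lemma bm_mx p q (f : S -> 'M[R]_(p, q)) :
  (forall i j, measurable_fun D (fun s => f s i j)) -> bm D f.
Proof.
move=> mf c e.
have [e0|e0] := leP e 0.
  rewrite (_ : _ `&` _ = set0)//; apply/seteqP; split => // s [_ [+ _]].
  by rewrite ltNge e0.
rewrite (_ : _ `&` _ = D `&` \bigcap_(ij : 'I_p * 'I_q)
    (D `&` (fun s => f s ij.1 ij.2) @^-1` ball (c ij.1 ij.2) e)).
  case: (pselect (exists ij : 'I_p * 'I_q, True)) => [_|nij]; last first.
    rewrite (_ : \bigcap_(_ in _) _ = setT) ?setIT//.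
    by apply/seteqP; split => // s _ ij; case: nij; exists ij.
  apply: measurableI => //; apply: fin_bigcap_measurable; first exact: finite_finset.
  by move=> ij _; exact: (bm_R (mf _ _)).
apply/seteqP; split=> s /= [Ds].
  by move=> [_ h]; split=> // ij _; split => //; exact: h.
by move=> h; split=> //; split => // i j; have [] := h (i, j) I.
Qed.

(** An open set is the union of those balls contained in it that have a centre in the dense sequence
    and a radius 1/(m+1). There are countably many of them, and their preimages are measurable by
    [bm]. *)
Lemma bm_open (E : pseudoMetricType R) (f : S -> E) (O : set E) :
  sep E -> bm D f -> open O -> measurable (D `&` f @^-1` O).
Proof.
move=> [u hu] bf oO.
pose G k m := if `[< ball (u k) (m.+1%:R^-1 : R) `<=` O >]
  then D `&` f @^-1` ball (u k) (m.+1%:R^-1 : R) else set0.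
rewrite (_ : _ `&` _ = \bigcup_k \bigcup_m G k m).
  apply: bigcupT_measurable => k; apply: bigcupT_measurable => m.
  by rewrite /G; case: ifP.
apply/seteqP; split=> [s [Ds Ofs]|s [k _ [m _]]]; last first.
  by rewrite /G; case: asboolP => // h [Ds /h].
have /nbhs_ballP[r /= r0 hr] : nbhs (f s) O by move: oO; rewrite openE; exact.
have [m mr] : exists m, m.+1%:R^-1 < r / 2.
  have /ltr_add_invr[m] : 0 < r / 2 by exact: divr_gt0.
  by rewrite add0r; exists m.
have m0 : 0 < (m.+1%:R^-1 : R) by rewrite invr_gt0.
have [k hk] := hu (f s) _ m0.
exists k => //; exists m => //; rewrite /G; case: asboolP => [_|]; last first.
  case=> y hy; apply: hr; apply: (@le_ball _ _ _ (m.+1%:R^-1 + m.+1%:R^-1)).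
    by rewrite [leRHS](splitr r) lerD// ltW.
  exact: ball_triangle hk hy.
by split=> //=; exact: ball_sym.
Qed.

(** Relative continuity makes the preimage of an open ray the trace on C of an open set V; since f
    takes its values in C, its preimages of V and of this trace coincide. This serves coefficients
    that are continuous only on a strip or on the triangle. *)
Lemma bm_within (E : pseudoMetricType R) (C : set E) (h : E -> R) (f : S -> E) :
  sep E -> bm D f -> (forall s, D s -> C (f s)) -> {within C, continuous h} ->
  measurable_fun D (h \o f).
Proof.
move=> sE bf Cf ch _; apply: (measurability _ (RGenOInfty.measurableE R)) => //.
move=> _ [_ [x ->] <-].
have oI : open `]x, +oo[%classic by exact: itv_open_ends_open.
have /continuousP/(_ _ oI) := ch.
move=> /open_subspaceP[V oV VC].
have := bm_open sE bf oV; congr measurable.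
apply/seteqP; split=> s /= [Ds h1]; split => //.
  have : (V `&` C) (f s) by split => //; exact: Cf.
  by rewrite VC => -[].
have : (V `&` C) (f s) by rewrite VC; split => //; exact: Cf.
by case.
Qed.

End bm.

End borel.

Section joint.
Context {R : realType} {d : measure_display} {S : measurableType d}.

(** Continuity in time makes X the pointwise limit of X evaluated at times rounded down to multiples
    of 1/(k+1), and each of these functions has countable unions of rectangles as preimages. *)
Lemma measurable_fun_joint (X : R -> S -> R) :
  (forall s, measurable_fun setT (X s)) -> (forall w, continuous (fun s => X s w)) ->
  measurable_fun setT (fun u : R * S => X u.1 u.2).
Proof.
move=> mX cX.
pose q (k : nat) (s : R) : R := (Num.floor (s * k.+1%:R))%:~R / k.+1%:R.
apply: (measurable_fun_cvg (h := fun k u => X (q k u.1) u.2)).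
  move=> k _ B mB; rewrite setTI.
  pose G (z : int) := `[(z%:~R / k.+1%:R : R), ((z + 1)%:~R / k.+1%:R)[%classic `*`
     (X (z%:~R / k.+1%:R) @^-1` B).
  rewrite (_ : _ @^-1` _ = \bigcup_n (if unpickle n is Some z then G z else set0)).
    apply: bigcupT_measurable => n; case: unpickle => // z.
    apply: measurableX; first exact: measurable_itv.
    by rewrite -[X in measurable X]setTI; exact: mX.
  apply/seteqP; split=> [[s w]/= Bs|[s w] [n _]].
    set z := Num.floor (s * k.+1%:R).
    have [n hn] : exists n, unpickle n = Some z by exists (pickle z); exact: pickleK.
    exists n; first by []; rewrite hn /G; split; last by [].
    rewrite /z /=.
    rewrite in_itv/= ler_pdivrMr// ltr_pdivlMr//.
    by rewrite floor_le_tmp floorD1_gt.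
  case: unpickle => //= z []/=; rewrite in_itv/= ler_pdivrMr// ltr_pdivlMr//.
  by move=> zs; rewrite /q (@floor_def _ _ z).
move=> [s w] _ /=.
apply: (cvg_comp (fun k => q k s) (X^~ w) _ (cX w s)).
apply/cvgrPdist_le => e e0.
near=> k; rewrite /q.
have k0 : 0 < (k.+1%:R : R) by [].
have h1 := floor_le_tmp (s * k.+1%:R); have h2 := floorD1_gt (s * k.+1%:R).
set z := Num.floor _ in h1 h2 *.
have hk : k.+1%:R^-1 <= e.
  apply: ltW; near: k; exact: (near_infty_natSinv_lt (PosNum e0)).
rewrite ger0_norm; last by rewrite subr_ge0 ler_pdivrMr.
apply: le_trans hk; rewrite lerBlDr -[X in _ <= X + _]div1r -mulrDl ler_pdivlMr//.
by rewrite addrC; move: h2; rewrite intrD => /ltW.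
Unshelve. all: by end_near.
Qed.

End joint.

(** * Brownian increments *)

Section normal_moments.
Context {R : realType}.
Notation mu := (@lebesgue_measure R).
Variable s : R.
Hypothesis s0 : 0 < s.
Let sn0 : s != 0. Proof. by rewrite gt_eqF. Qed.
Notation pdf := (normal_pdf 0 s).
Notation N := (normal_prob 0 s).

(** Mean and variance of the normal law are read off from explicit antiderivatives on [-n, n];
    dominated convergence carries the result to the whole line. *)
Lemma cvg_integral_sym (g : R -> R) : mu.-integrable setT (EFin \o g) ->
  (\int[mu]_(x in `[(- n%:R)%R, n%:R%R]) (g x)%:E)%E @[n --> \oo] -->
  (\int[mu]_x (g x)%:E)%E.
Proof.
move=> ig.
have mg := measurable_int _ ig.
rewrite (_ : (fun n : nat => _) =
    (fun n : nat => \int[mu]_x ((EFin \o g) \_ `[(- n%:R)%R, n%:R%R]) x)%E); last first.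
  by apply/funext => n; rewrite -integral_mkcond.
apply: (@dominated_cvg _ _ _ mu setT _ _ _ (abse \o (EFin \o g))) => //.
- by move=> n; apply/(measurable_restrictT _ _).1 => //; exact: measurable_funTS.
- move=> x _; apply: cvg_near_cst; near=> n.
  rewrite patchE ifT// inE/= in_itv/= -ler_norml.
  near: n; exact: nbhs_infty_ger.
- exact: integrable_abse.
- move=> n x _; rewrite patchE; case: ifP => // _.
  by rewrite /= normr0 lee_fin.
Unshelve. all: by end_near. Qed.

Lemma FTC_sym (F g : R -> R) (n : nat) : (0 < n)%N ->
  (forall x : R, is_derive x 1 F (g x)) -> continuous g ->
  (\int[mu]_(x in `[(- n%:R)%R, n%:R%R]) (g x)%:E = (F n%:R - F (- n%:R))%:E)%E.
Proof.
move=> n0 dF cg.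
have cF : continuous F.
  move=> x; apply/differentiable_continuous; rewrite -derivable1_diffP.
  by case: (dF x).
rewrite (@continuous_FTC2 _ g F)//.
- by rewrite -subr_gt0 opprK addr_gt0// ltr0n.
- exact: continuous_subspaceT.
- split => [x _||]; first by case: (dF x).
  + by apply: cvg_at_right_filter; exact: cF.
  + by apply: cvg_at_left_filter; exact: cF.
- by move=> x _; rewrite derive1E; case: (dF x).
Qed.

Lemma normal_pdf_is_derive (x : R) : is_derive x 1 pdf (- (x / s ^+ 2) * pdf x).
Proof.
rewrite normal_pdfE//.
pose c := - (s ^+ 2 *+ 2)^-1.
have E : normal_fun 0 s = expR \o (fun y => c * (y * y)).
  apply/funext => y; rewrite /normal_fun subr0 /=; congr expR.
  by rewrite /c mulNr mulrC !mulNr expr2.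
rewrite E.
have d1 : is_derive x 1 (fun y : R => c * (y * y)) (c *: (x *: 1 + x *: 1)).
  exact: (is_deriveZ c (is_deriveM (is_derive_id x 1) (is_derive_id x 1))).
have d2 := @is_derive1_comp R expR (fun y => c * (y * y)) x _ _ (is_derive_expR _) d1.
have d3 := is_deriveZ (normal_peak s) d2.
apply: (is_derive_eq d3).
rewrite /c /= /GRing.scale/=.
field.
by rewrite sn0.
Qed.

Lemma normal_pdf_continuous : continuous pdf.
Proof. exact: continuous_normal_pdf. Qed.

(** Half of the Gaussian exponent absorbs the power: with u = x^2 / (4 s^2) one has x^4 = 16 s^4 u^2
    and u^2 exp(-u) <= 2, and the remaining exp(-u) is the profile of deviation sqrt 2 s, whose peak
    is at least half of that of deviation s. Hence 64 = 16 * 2 * 2. *)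
Lemma normal_pdf4_le (x : R) :
  x ^+ 4 * pdf x <= 64 * s ^+ 4 * normal_pdf 0 (Num.sqrt 2 * s) x.
Proof.
have s20 : Num.sqrt 2 * s != 0 by rewrite mulf_neq0// sqrtr_eq0 -ltNge.
rewrite normal_pdfE// normal_pdfE//.
rewrite /normal_fun subr0.
have -> : (Num.sqrt 2 * s) ^+ 2 = 2 * s ^+ 2.
  by rewrite exprMn sqr_sqrtr.
have hp : normal_peak s <= 2 * normal_peak (Num.sqrt 2 * s).
  rewrite /normal_peak exprMn sqr_sqrtr//.
  have -> : 2 * s ^+ 2 * pi *+ 2 = 2 * (s ^+ 2 * pi *+ 2) by ring.
  rewrite sqrtrM// invfM mulrA ler_peMl ?invr_ge0 ?sqrtr_ge0//.
  rewrite ler_pdivlMr ?sqrtr_gt0// mul1r.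
  by rewrite -[leRHS]gtr0_norm// -sqrtr_sqr ler_sqrt//; lra.
set u := x ^+ 2 / (4 * s ^+ 2).
have u0 : 0 <= u by rewrite divr_ge0// ?sqr_ge0// mulr_ge0// sqr_ge0.
have xu : x ^+ 2 = 4 * s ^+ 2 * u.
  by rewrite /u; field; rewrite sn0.
have -> : - x ^+ 2 / (s ^+ 2 *+ 2) = - u - u.
  by rewrite xu; field; rewrite sn0.
have -> : - x ^+ 2 / (2 * s ^+ 2 *+ 2) = - u.
  by rewrite xu; field; rewrite sn0.
have -> : x ^+ 4 = 16 * s ^+ 4 * u ^+ 2.
  by rewrite -[4%N]/(2 * 2)%N exprM xu; ring.
rewrite expRD.
have eu : u ^+ 2 * expR (- u) <= 2.
  have /= := expR_ge1Dxn 1 u0; rewrite -[2`!]/2%N => h.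
  rewrite expRN ler_pdivrMr ?expR_gt0//.
  have := expR_gt0 u; lra.
have e0 := expR_gt0 (- u).
have p0 := normal_peak_ge0 s.
have p1 := normal_peak_ge0 (Num.sqrt 2 * s).
have s4 : 0 <= s ^+ 4 by rewrite exprn_ge0// ltW.
set a := normal_peak s in hp p0 *; set b := normal_peak _ in hp p1 *.
set e := expR (- u) in eu e0 *.
have -> : 16 * s ^+ 4 * u ^+ 2 * (a * (e * e)) = (16 * s ^+ 4) * ((u ^+ 2 * e) * (a * e)) by ring.
have -> : 64 * s ^+ 4 * (b * e) = (16 * s ^+ 4) * (2 * (2 * b * e)) by ring.
apply: ler_wpM2l; first by rewrite mulr_ge0.
apply: ler_pM => //.
- by rewrite mulr_ge0// ?sqr_ge0// ltW.
- by rewrite mulr_ge0// ltW.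
- by rewrite ler_wpM2r// ltW.
Qed.

Lemma normal_moment4_le : (\int[mu]_x (x ^+ 4 * pdf x)%:E <= (64 * s ^+ 4)%:E)%E.
Proof.
have s20 : Num.sqrt 2 * s != 0 by rewrite mulf_neq0// sqrtr_eq0 -ltNge.
rewrite -[leRHS]mule1 -(integral_normal_pdf 0 (Num.sqrt 2 * s)).
rewrite -ge0_integralZl_EFin.
- apply: ge0_le_integral => //=.
  + move=> x _; rewrite lee_fin mulr_ge0 ?normal_pdf_ge0//.
    by rewrite -[4%N]/(2 * 2)%N exprM sqr_ge0.
  + apply/measurable_EFinP; apply: measurable_funM; last exact: measurable_normal_pdf.
    exact: measurable_funX.
  + apply: measurable_funeM; apply/measurable_EFinP; exact: measurable_normal_pdf.
  + by move=> x _; rewrite -EFinM lee_fin normal_pdf4_le.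
- exact: measurableT.
- by move=> x _; rewrite lee_fin normal_pdf_ge0.
- by apply/measurable_EFinP; exact: measurable_normal_pdf.
- by rewrite mulr_ge0// exprn_ge0// ltW.
Qed.

Let meas_xpdf (k : nat) : measurable_fun setT (fun x : R => x ^+ k * pdf x).
Proof.
apply: measurable_funM; last exact: measurable_normal_pdf.
exact: measurable_funX.
Qed.

Lemma normal_int_pow (k : nat) : (k <= 4)%N ->
  mu.-integrable setT (EFin \o (fun x : R => x ^+ k * pdf x)).
Proof.
move=> k4.
have i4 : mu.-integrable setT (EFin \o (fun x => x ^+ 4 * pdf x)).
  apply/integrableP; split; first by apply/measurable_EFinP; exact: meas_xpdf.
  apply: le_lt_trans (ltry (64 * s ^+ 4)); apply: le_trans normal_moment4_le.
  apply: ge0_le_integral => //=.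
  + by apply/measurable_EFinP; apply: measurableT_comp => //; exact: meas_xpdf.
  + by apply/measurable_EFinP; exact: meas_xpdf.
  + move=> x _; rewrite lee_fin ger0_norm// mulr_ge0 ?normal_pdf_ge0//.
    by rewrite -[4%N]/(2 * 2)%N exprM sqr_ge0.
have i0 := integrable_normal_pdf 0 s.
apply: (le_integrable _ _ _ (integrableD measurableT i0 i4)) => //=.
  by apply/measurable_EFinP; exact: meas_xpdf.
move=> x _; rewrite /= lee_fin.
have p0 := normal_pdf_ge0 0 s x.
have x4 : 0 <= x ^+ 4 by rewrite -[4%N]/(2 * 2)%N exprM sqr_ge0.
have x5 : 0 <= pdf x + x ^+ 4 * pdf x.
  by apply: addr_ge0 => //; apply: mulr_ge0.
rewrite [leRHS]ger0_norm//.
rewrite normrM (ger0_norm p0) -[X in _ <= X + _]mul1r -mulrDl ler_wpM2r//.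
rewrite normrX.
have -> : x ^+ 4 = `|x| ^+ 4 by rewrite -normrX ger0_norm.
have [x1|x1] := leP `|x| 1.
  rewrite (@le_trans _ _ 1)//; first by rewrite exprn_ile1.
  by rewrite lerDl exprn_ge0.
rewrite (@le_trans _ _ (`|x| ^+ 4))//; last by rewrite lerDr.
by rewrite ler_weXn2l// ltW.
Qed.

Lemma normal_mean : (\int[mu]_x (x * pdf x)%:E = 0)%E.
Proof.
have ig := @normal_int_pow 1%N isT.
have c := cvg_integral_sym ig.
have : (\int[mu]_(x in `[(- n%:R)%R, n%:R%R]) (x ^+ 1 * pdf x)%:E)%E @[n --> \oo] --> (0 : \bar R)%E.
  apply: cvg_near_cst; near=> n.
  have dF (x : R) : is_derive x 1 (fun x => - s ^+ 2 * pdf x) (x ^+ 1 * pdf x).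
    apply: (is_derive_eq (is_deriveZ (- s ^+ 2) (normal_pdf_is_derive x))).
    by rewrite /GRing.scale/=; field; rewrite sn0.
  have cg : continuous (fun x : R => x ^+ 1 * pdf x).
    move=> x; apply: cvgM; last exact: normal_pdf_continuous.
    by apply: exprn_continuous.
  have n0 : (0 < n)%N by near: n; exists 1%N.
  rewrite (FTC_sym n0 dF cg) (_ : pdf (- n%:R) = pdf n%:R) ?subrr//.
  by rewrite normal_pdfE// /normal_fun !subr0 sqrrN.
move=> c'; have e : (0 = \int[mu]_x (x ^+ 1 * pdf x)%:E)%E.
  by apply: (cvg_unique _ c' c); exact: ereal_hausdorff.
by rewrite [RHS]e.
Unshelve. all: by end_near. Qed.

Lemma normal_variance : (\int[mu]_x (x ^+ 2 * pdf x)%:E = (s ^+ 2)%:E)%E.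
Proof.
(* [g] is the derivative of - s^2 x pdf(x), whose boundary values vanish in the limit by the
   pointwise bound on x^4 pdf(x); so [g] has integral 0 and the second moment equals s^2. *)
pose g x := x ^+ 2 * pdf x - s ^+ 2 * pdf x.
have i2 := @normal_int_pow 2%N isT.
have i0 : mu.-integrable setT (EFin \o (fun x => s ^+ 2 * pdf x)).
  exact: (integrableZl measurableT (s ^+ 2) (integrable_normal_pdf 0 s)).
have ig : mu.-integrable setT (EFin \o g).
  exact: (integrableB measurableT i2 i0).
have c := cvg_integral_sym ig.
have c0 : (\int[mu]_(x in `[(- n%:R)%R, n%:R%R]) (g x)%:E)%E @[n --> \oo] --> (0 : \bar R)%E.
  have c1 : (((- 2 * s ^+ 2) * (n%:R * pdf n%:R))%:E)%E @[n --> \oo] --> (0 : \bar R)%E.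
    apply: cvg_EFin; first by near=> n.
    rewrite /=.
    rewrite -[X in _ --> X](mulr0 (- 2 * s ^+ 2)).
    apply: cvgM; first exact: cvg_cst.
    apply: (@squeeze_cvgr _ _ _ _ (fun=> 0) (fun n : nat => 64 * s ^+ 4 * normal_peak (Num.sqrt 2 * s) * n%:R^-1)).
    - near=> n.
      have n0 : 0 < (n%:R : R) by rewrite ltr0n; near: n; exists 1%N.
      rewrite mulr_ge0 ?normal_pdf_ge0//= ler_pdivlMr//.
      have s20 : Num.sqrt 2 * s != 0 by rewrite mulf_neq0// sqrtr_eq0 -ltNge.
      have c0 : 0 <= 64 * s ^+ 4 by rewrite mulr_ge0// exprn_ge0// ltW.
      have := le_trans (normal_pdf4_le n%:R) (ler_wpM2l c0 (normal_pdf_ub 0 n%:R s20)).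
      apply: le_trans; rewrite mulrAC -expr2 ler_wpM2r ?normal_pdf_ge0//.
      by rewrite ler_weXn2l// ler1n; near: n; exists 1%N.
    - exact: cvg_cst.
    - rewrite -[X in _ --> X](mulr0 (64 * s ^+ 4 * normal_peak (Num.sqrt 2 * s))).
      apply: cvgM; first exact: cvg_cst.
      by rewrite -cvg_shiftS; exact: cvg_harmonic.
  apply: cvg_trans c1; apply: near_eq_cvg; near=> n.
  have dF (x : R) : is_derive x 1 (fun x : R => - s ^+ 2 * (x * pdf x)) (g x).
    have h := is_deriveZ (- s ^+ 2) (is_deriveM (is_derive_id x 1) (normal_pdf_is_derive x)).
    apply: (is_derive_eq h).
    by rewrite /g /GRing.scale/=; field; rewrite sn0.
  have cg : continuous g.
    move=> x; apply: cvgB; apply: cvgM; try exact: normal_pdf_continuous.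
      by apply: exprn_continuous.
    exact: cvg_cst.
  have n0 : (0 < n)%N by near: n; exists 1%N.
  rewrite (FTC_sym n0 dF cg) (_ : pdf (- n%:R) = pdf n%:R); last first.
    by rewrite normal_pdfE// /normal_fun !subr0 sqrrN.
  by congr EFin; ring.
have e0 : (\int[mu]_x (g x)%:E = 0)%E.
  by apply/esym/(cvg_unique _ c0 c); exact: ereal_hausdorff.
have : (\int[mu]_x (g x)%:E = \int[mu]_x (x ^+ 2 * pdf x)%:E - (s ^+ 2)%:E)%E.
  rewrite [LHS](integralB_EFin measurableT i2 i0); congr (_ - _)%E.
  under eq_integral do rewrite EFinM.
  by rewrite integralZl ?integral_normal_pdf ?mule1//; exact: integrable_normal_pdf.
rewrite e0 => /esym/eqP; rewrite sube_eq ?add0e; last 2 first.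
- by rewrite integrable_fin_num.
- by rewrite fin_num_adde_defl.
by move=> /eqP.
Unshelve. all: by end_near. Qed.

(** [pdf] and the Radon-Nikodym derivative of [normal_prob] have the same integral over every
    measurable set, so they agree almost everywhere and can be exchanged under the integral. *)
Lemma integral_normal_prob (f : R -> R) : measurable_fun setT f ->
  (forall x, 0 <= f x) ->
  (\int[N]_x (f x)%:E = \int[mu]_x (f x * pdf x)%:E)%E.
Proof.
move=> mf f0.
have dom : N `<< mu by exact: normal_prob_dominates.
rewrite -(@Radon_Nikodym_SigmaFinite.change_of_variables _ _ _ N mu dom (EFin \o f) setT)//=; last first.
  exact/measurable_EFinP.
have mpdf : measurable_fun setT (EFin \o pdf).
  by apply/measurable_EFinP; exact: measurable_normal_pdf.
apply: ae_eq_integral => //=.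
- apply: emeasurable_funM; first exact/measurable_EFinP.
  apply: (measurable_int mu); exact: Radon_Nikodym_SigmaFinite.f_integrable.
- by apply/measurable_EFinP; apply: measurable_funM => //; exact: measurable_normal_pdf.
- rewrite (_ : (fun x => (f x * pdf x)%:E) = ((EFin \o f) \* (EFin \o pdf))%E); last first.
    by apply/funext => x /=; rewrite EFinM.
  apply: ae_eqe_mul2l.
  apply: integral_ae_eq => //=.
  + exact: Radon_Nikodym_SigmaFinite.f_integrable.
  + by move=> E _ mE; rewrite -Radon_Nikodym_SigmaFinite.f_integral.
Qed.

End normal_moments.

Section negligible_lemmas.
Context {R : realType} {dO : measure_display} {Omega : measurableType dO}.
Variable P : probability Omega R.

Lemma measure_eq_negligible (A B : set Omega) : measurable A -> measurable B ->
  P.-negligible ((A `\` B) `|` (B `\` A)) -> P A = P B.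
Proof.
move=> mA mB [N [mN N0 sN]].
have h (C D : set Omega) : measurable C -> measurable D -> C `\` D `<=` N -> (P C <= P D)%E.
  move=> mC mD CD; rewrite -[leRHS]adde0 -N0.
  apply: (@le_trans _ _ (P (D `|` N))); last exact: measureU2.
  apply: le_measure; rewrite ?inE//; first exact: measurableU.
  move=> w Cw; have [?|?] := pselect (D w); first by left.
  by right; apply: CD.
apply/eqP; rewrite eq_le; apply/andP; split; apply: h => //.
  by apply: subset_trans sN; exact: subsetUl.
by apply: subset_trans sN; exact: subsetUr.
Qed.

End negligible_lemmas.

(** * The augmented filtration and the moments of Brownian increments *)

Section filtration.
Context {R : realType} {dO : measure_display} {Omega : measurableType dO}.
Variable P : probability Omega R.
Hypothesis cP : measure_is_complete P.
Variables (d : nat) (W : R -> Omega -> 'cV[R]_d).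
Hypothesis BM : brownian_motion P W.

Definition Gt t := sigma_past W t `|` P.-negligible.
(* Measurability with respect to the augmented filtration at time t. *)
Definition Fm t (f : Omega -> R) :=
  measurable_fun [set: g_sigma_algebraType (Gt t)] (f : g_sigma_algebraType (Gt t) -> R).

Lemma Fm_wrt t p q (f : Omega -> 'M[R]_(p, q)) :
  measurable_wrt (augmented_filtration P W t) f <-> forall i j, Fm t (fun w => f w i j).
Proof.
split=> h i j.
  by move=> _ B mB; rewrite setTI; exact: h.
by move=> B mB; have := h i j measurableT B mB; rewrite setTI.
Qed.

Lemma Fm_mono s t f : s <= t -> Fm s f -> Fm t f.
Proof.
move=> st hf _ B mB; have := hf measurableT B mB.
apply: sub_sigma_algebra2; apply: setSU.
apply: sub_sigma_algebra2 => A [r [k [C [/andP[r0 rs] mC ->]]]].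
by exists r, k, C; split => //; rewrite r0 (le_trans rs).
Qed.

Lemma sigma_past_measurable t : sigma_past W t `<=` measurable.
Proof.
apply: smallest_sub; first exact: sigma_algebra_measurable.
move=> A [r [k [B [/andP[r0 _] mB ->]]]].
have [mW _ _ _ _] := BM.
by rewrite -[X in measurable X]setTI; apply: mW.
Qed.

Lemma Fset_measurable t : <<s Gt t >> `<=` measurable.
Proof.
apply: smallest_sub; first exact: sigma_algebra_measurable.
by move=> A [/sigma_past_measurable//|/cP].
Qed.

Lemma Fm_meas t f : Fm t f -> measurable_fun setT f.
Proof.
move=> hf _ B mB; have := hf measurableT B mB; rewrite !setTI.
exact: Fset_measurable.
Qed.

Lemma Fm_W t r k : 0 <= r <= t -> Fm t (fun w => W r w k 0).
Proof.
move=> rt _ B mB; rewrite setTI; apply: sub_sigma_algebra; left.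
by apply: sub_sigma_algebra; exists r, k, B.
Qed.

(** All negligible sets belong to the sigma-algebra at every time, so a change on one of them
    preserves measurability. This keeps versions of X adapted. *)
Lemma Fm_ae t f g : Fm t f -> {ae P, forall w, f w = g w} -> Fm t g.
Proof.
move=> hf [N [mN N0 sN]] _ B mB; rewrite setTI.
have hB := hf measurableT B mB; rewrite setTI in hB.
have nN A : A `<=` N -> (<<s Gt t >>) A.
  by move=> AN; apply: sub_sigma_algebra; right; exists N.
have -> : g @^-1` B = (f @^-1` B `\` N) `|` (g @^-1` B `&` N).
  apply/seteqP; split=> w.
    move=> gB; have [Nw|Nw] := pselect (N w); [by right|left; split=> //=].
    suff -> : f w = g w by [].
    by apply: contrapT => h; apply/Nw/sN.
  move=> [[fB Nw]|[]//] /=; suff <- : f w = g w by [].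
  by apply: contrapT => h; apply/Nw/sN.
apply: (@measurableU _ (g_sigma_algebraType (Gt t))).
  by apply: measurableD => //; exact: nN.
by apply: nN; exact: subIsetr.
Qed.

(** The sets that differ by a negligible set from some event of the raw past form a sigma-algebra,
    and it contains both families of generators. *)
Lemma Fset_past t A : <<s Gt t >> A ->
  exists2 A', sigma_past W t A' & P.-negligible ((A `\` A') `|` (A' `\` A)).
Proof.
pose D := [set A | exists2 A', sigma_past W t A' &
  P.-negligible ((A `\` A') `|` (A' `\` A))].
suff : <<s Gt t >> `<=` D by exact.
have sp : sigma_algebra setT (sigma_past W t) by exact: smallest_sigma_algebra.
have [sp0 spC spU] := sp.
apply: smallest_sub.
  split.
  - by exists set0 => //; rewrite setD0 setU0; exact: negligible_set0.
  - move=> B [B' sB' nB]; exists (setT `\` B'); first exact: spC.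
    apply: negligibleS nB => w [[[_ nB] nB']|[[_ nB] nB']].
      by right; split => //; apply: contrapT => h; apply: nB'.
    by left; split => //; apply: contrapT => h; apply: nB'.
  - move=> F hF.
    have hF' k : exists B', sigma_past W t B' /\ P.-negligible ((F k `\` B') `|` (B' `\` F k)).
      by have [B' ? ?] := hF k; exists B'.
    have [G hG] := choice hF'.
    exists (\bigcup_k G k); first by apply: spU => k; have [] := hG k.
    have := negligible_bigcup (fun k => (hG k).2).
    apply: negligibleS => w [[[k _ Fw] nG]|[[k _ Gw] nF]]; exists k => //.
      by left; split => // Gw; apply: nG; exists k.
    by right; split => // Fw; apply: nF; exists k.
move=> B [sB|nB].
  by exists B => //; rewrite setDv setU0; exact: negligible_set0.
by exists set0 => //; rewrite setD0 set0D setU0.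
Qed.

Definition dW s t k w := W t w k 0 - W s w k 0.
Definition Vt s t : set (set Omega) := [set A | exists k (B : set R), measurable B /\
                 A = (fun w => (W t w - W s w) k 0) @^-1` B].
(* Measurability with respect to the increment W t - W s. *)
Definition Vm s t (f : Omega -> R) :=
  measurable_fun [set: g_sigma_algebraType (Vt s t)] (f : g_sigma_algebraType (Vt s t) -> R).

Lemma Vm_dW s t k : Vm s t (dW s t k).
Proof.
move=> _ B mB; rewrite setTI; apply: sub_sigma_algebra; exists k, B; split => //.
by apply/seteqP; split => w /=; rewrite !mxE.
Qed.

Lemma dW_meas s t k : 0 <= s -> 0 <= t -> measurable_fun setT (dW s t k).
Proof.
move=> s0 t0; have [mW _ _ _ _] := BM.
by apply: measurable_funB; apply: mW.
Qed.

Lemma Vm_meas s t f : 0 <= s -> 0 <= t -> Vm s t f -> measurable_fun setT f.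
Proof.
move=> s0 t0 hf _ B mB; have := hf measurableT B mB; rewrite !setTI.
apply: smallest_sub; first exact: sigma_algebra_measurable.
move=> A [k [C [mC ->]]]; rewrite -[X in measurable X]setTI.
have := dW_meas k s0 t0 measurableT mC; congr measurable; congr (_ `&` _).
by apply/seteqP; split => w /=; rewrite !mxE.
Qed.

(** Independence of the increment is given for the raw past only. By [Fset_past] an event of the
    augmented past can be replaced by a raw one without changing either probability. *)
Lemma Fm_indep s t f h : 0 <= s -> s < t -> Fm s f -> Vm s t h ->
  forall A B : set R, measurable A -> measurable B ->
  P (f @^-1` A `&` h @^-1` B) = (P (f @^-1` A) * P (h @^-1` B))%E.
Proof.
move=> s0 st hf hh A B mA mB.
have FA := hf measurableT A mA; rewrite setTI in FA.
have VB := hh measurableT B mB; rewrite setTI in VB.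
have t0 : 0 <= t by rewrite ltW// (le_lt_trans s0).
have mfA : measurable (f @^-1` A) by apply: Fset_measurable FA.
have mhB : measurable (h @^-1` B).
  by rewrite -[X in measurable X]setTI; apply: (Vm_meas s0 t0 hh).
have [A' sA' nA] := Fset_past FA.
have mA' := sigma_past_measurable sA'.
rewrite (measure_eq_negligible mfA mA' nA).
have [_ _ _ ind _] := BM.
rewrite -(ind s t s0 st _ _ sA' VB); apply: measure_eq_negligible.
- exact: measurableI.
- exact: measurableI.
- apply: negligibleS nA => w [[[Aw Bw] h1]|[[Aw Bw] h1]]; [left|right]; split => //.
    by move=> A'w; apply: h1.
  by move=> A'w; apply: h1.
Qed.

Lemma Fm_Ex s t f h : 0 <= s -> s < t -> Fm s f -> Vm s t h ->
  L1 P f -> L1 P h -> L1 P (fun w => f w * h w) ->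
  Ex P (fun w => f w * h w) = Ex P f * Ex P h.
Proof.
move=> s0 st hf hh i1 i2 i3; apply: indep_Ex => // A B mA mB.
exact: (Fm_indep s0 st).
Qed.

(** The law of an increment is given on boxes: taking the whole line in all coordinates except one
    yields the marginals, and except two the joint law of a pair of coordinates. *)
Lemma dW_indep s t k l : 0 <= s -> s < t -> k != l ->
  forall A B : set R, measurable A -> measurable B ->
  P (dW s t k @^-1` A `&` dW s t l @^-1` B) = (P (dW s t k @^-1` A) * P (dW s t l @^-1` B))%E.
Proof.
move=> s0 st kl A B mA mB; have [_ _ _ _ law] := BM.
have st0 : Num.sqrt (t - s) != 0 by rewrite sqrtr_eq0 -ltNge subr_gt0.
have NT : normal_prob 0 (Num.sqrt (t - s)) [set: R] = 1%E by exact: probability_setT.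
have one i (C : set R) : measurable C ->
    P (dW s t i @^-1` C) = normal_prob 0 (Num.sqrt (t - s)) C.
  move=> mC.
  have := law s t s0 st (fun j => if j == i then C else setT).
  rewrite (bigD1 i)//= eqxx big1 ?mule1; last by move=> j /negPf ->.
  move=> <-; last by move=> j; case: ifP.
  congr (P _); apply/seteqP; split=> w /=.
    by move=> Cw j; case: eqP => // ->; rewrite !mxE.
  by move=> /(_ i); rewrite eqxx !mxE.
rewrite !one//.
have := law s t s0 st (fun j => if j == k then A else if j == l then B else setT).
have lk : l != k by rewrite eq_sym.
rewrite (bigD1 k)//= eqxx (bigD1 l)//= (negPf lk) eqxx big1 ?mule1; last first.
  by move=> j /andP[/negPf -> /negPf ->].
move=> <-; last by move=> j; case: ifP => // _; case: ifP.
congr (P _); apply/seteqP; split=> w /=.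
  move=> [Aw Bw] j; have [->|_] := eqVneq j k; first by rewrite !mxE.
  by have [->|//] := eqVneq j l; rewrite !mxE.
move=> h; split; first by have := h k; rewrite eqxx !mxE.
by have := h l; rewrite (negPf lk) eqxx !mxE.
Qed.

Lemma dW_law s t k (f : R -> R) : 0 <= s -> s < t -> measurable_fun setT f ->
  (forall x, 0 <= f x) ->
  (\int[P]_w (f (dW s t k w))%:E =
   \int[@lebesgue_measure R]_x (f x * normal_pdf 0 (Num.sqrt (t - s)) x)%:E)%E.
Proof.
move=> s0 st mf f0; have [_ _ _ _ law] := BM.
have st0 : 0 < Num.sqrt (t - s) by rewrite sqrtr_gt0 subr_gt0.
have t0 : 0 <= t by rewrite ltW// (le_lt_trans s0).
have mdW := dW_meas k s0 t0.
rewrite -integral_normal_prob//.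
have mdW' : measurable_fun setT (dW s t k : Omega -> measurableTypeR R) by exact: mdW.
pose fX : {mfun Omega >-> measurableTypeR R} := HB.pack_for {mfun Omega >-> measurableTypeR R}
  (dW s t k : Omega -> measurableTypeR R)
  (isMeasurableFun.Build _ _ _ _ (dW s t k : Omega -> measurableTypeR R) mdW').
transitivity (\int[distribution P fX]_x (f x)%:E)%E.
  by rewrite ge0_integral_distribution//; exact/measurable_EFinP.
apply: eq_measure_integral => A mA _.
have := law s t s0 st (fun j => if j == k then A else setT).
rewrite (bigD1 k)//= eqxx big1 ?mule1; last first.
  by move=> j /negPf ->; exact: probability_setT.
move=> <-; last by move=> j; case: ifP.
rewrite /distribution/pushforward/=.
congr (P _); apply/seteqP; split=> w /=.
  by move=> Cw j; case: eqP => // ->; rewrite !mxE.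
by move=> /(_ k); rewrite eqxx !mxE.
Qed.

Lemma dW_L2 s t k : 0 <= s -> s < t -> L2 P (dW s t k).
Proof.
move=> s0 st; have t0 : 0 <= t by rewrite ltW// (le_lt_trans s0).
have st0 : 0 < Num.sqrt (t - s) by rewrite sqrtr_gt0 subr_gt0.
have mdW := dW_meas k s0 t0.
split => //; apply/integrableP; split.
  by apply/measurable_EFinP; exact: measurable_funX.
under eq_integral do rewrite /= ger0_norm ?sqr_ge0//.
rewrite (dW_law k (f := fun x => x ^+ 2) s0 st)//.
- by rewrite normal_variance// ltry.
- by move=> x; exact: sqr_ge0.
Qed.

Lemma dW_sqr_L2 s t k : 0 <= s -> s < t -> L2 P (fun w => dW s t k w ^+ 2).
Proof.
move=> s0 st; have t0 : 0 <= t by rewrite ltW// (le_lt_trans s0).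
have st0 : 0 < Num.sqrt (t - s) by rewrite sqrtr_gt0 subr_gt0.
have mdW := dW_meas k s0 t0.
split; first exact: measurable_funX.
apply/integrableP; split.
  by apply/measurable_EFinP; do 2 apply: measurable_funX.
under eq_integral do rewrite /= ger0_norm ?sqr_ge0// -exprM.
rewrite (dW_law k (f := fun x => x ^+ 4) s0 st)//.
- exact: le_lt_trans (normal_moment4_le st0) (ltry _).
- by move=> x; rewrite -[4%N]/(2 * 2)%N exprM sqr_ge0.
Qed.

Lemma Ex_dW2 s t k : 0 <= s -> s < t -> Ex P (fun w => dW s t k w ^+ 2) = t - s.
Proof.
move=> s0 st; have st0 : 0 < Num.sqrt (t - s) by rewrite sqrtr_gt0 subr_gt0.
apply: EFin_inj; rewrite -ExE; last by case: (dW_L2 k s0 st).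
rewrite (dW_law k (f := fun x => x ^+ 2) s0 st).
- by rewrite normal_variance// sqr_sqrtr// subr_ge0 ltW.
- exact: measurable_funX.
- by move=> x; exact: sqr_ge0.
Qed.

Lemma Ex_dW4 s t k : 0 <= s -> s < t ->
  Ex P (fun w => (dW s t k w ^+ 2) ^+ 2) <= 64 * (t - s) ^+ 2.
Proof.
move=> s0 st; have st0 : 0 < Num.sqrt (t - s) by rewrite sqrtr_gt0 subr_gt0.
rewrite -lee_fin -ExE; last by case: (dW_sqr_L2 k s0 st).
under eq_integral do rewrite /= -exprM.
rewrite (dW_law k (f := fun x => x ^+ 4) s0 st).
- apply: (le_trans (normal_moment4_le st0)); rewrite lee_fin.
  by rewrite -[4%N]/(2 * 2)%N exprM sqr_sqrtr// subr_ge0 ltW.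
- exact: measurable_funX.
- by move=> x; rewrite -[4%N]/(2 * 2)%N exprM sqr_ge0.
Qed.

(** [dW_law] covers nonnegative functions, so positive and negative parts are transported separately
    to the normal density and recombined there. *)
Lemma Ex_dW s t k : 0 <= s -> s < t -> Ex P (dW s t k) = 0.
Proof.
move=> s0 st; have st0 : 0 < Num.sqrt (t - s) by rewrite sqrtr_gt0 subr_gt0.
have LW := dW_L2 k s0 st.
have pos_le (x : R) : 0 <= Num.max x 0 by rewrite le_max lexx orbT.
have E : dW s t k = fun w => Num.max (dW s t k w) 0 - Num.max (- dW s t k w) 0.
  by apply/funext => w; rewrite /Num.max; case: ifPn; case: ifPn; lra.
have mmax (g : R -> R) : measurable_fun setT g -> measurable_fun setT (fun x => Num.max (g x) 0).
  by move=> mg; exact: measurable_maxr.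
have L1p : L1 P (fun w => Num.max (dW s t k w) 0).
  apply: L2_L1; apply: (L2_le _ LW).
    by apply: measurable_maxr => //; exact: LW.1.
  by move=> w; rewrite /Num.max; case: ifPn => // _; rewrite normr0.
have L1n : L1 P (fun w => Num.max (- dW s t k w) 0).
  apply: L2_L1; apply: (L2_le _ LW).
    by apply: measurable_maxr => //; apply: measurable_funN; exact: LW.1.
  by move=> w; rewrite /Num.max; case: ifPn => // _; rewrite ?normr0 ?normrN.
rewrite E ExB//; apply/eqP; rewrite subr_eq0; apply/eqP/EFin_inj.
rewrite -(ExE L1p) -(ExE L1n).
rewrite (dW_law k (f := fun x => Num.max x 0) s0 st)//; last exact: mmax.
rewrite (dW_law k (f := fun x => Num.max (- x) 0) s0 st)//; last first.
  by apply: mmax; exact: measurable_funN.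
have i1 := @normal_int_pow _ _ st0 1%N isT.
have m1 := @normal_mean _ _ st0.
set pdf := normal_pdf 0 _ in i1 m1 *.
have ip : (@lebesgue_measure R).-integrable setT (fun x => (Num.max x 0 * pdf x)%:E).
  apply: (le_integrable _ _ _ i1) => //.
    apply/measurable_EFinP; apply: measurable_funM; last exact: measurable_normal_pdf.
    exact: mmax.
  move=> x _; rewrite lee_fin !normrM ler_wpM2r// expr1 /Num.max.
  by case: ifPn; rewrite ?normr0.
have im : (@lebesgue_measure R).-integrable setT (fun x => (Num.max (- x) 0 * pdf x)%:E).
  apply: (le_integrable _ _ _ i1) => //.
    apply/measurable_EFinP; apply: measurable_funM; last exact: measurable_normal_pdf.
    by apply: mmax; exact: measurable_funN.
  move=> x _; rewrite lee_fin !normrM ler_wpM2r// expr1 /Num.max.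
  by case: ifPn; rewrite ?normr0 ?normrN.
have : (\int[@lebesgue_measure R]_x ((Num.max x 0 * pdf x)%:E - (Num.max (- x) 0 * pdf x)%:E) = 0)%E.
  rewrite -[RHS]m1; apply: eq_integral => x _; rewrite -EFinB -mulrBl; congr (_ * _)%:E.
  by rewrite /Num.max; case: ifPn; case: ifPn; lra.
rewrite (integralB measurableT ip im) => /eqP; rewrite sube_eq ?add0e.
- by move=> /eqP.
- exact: integrable_fin_num.
- by rewrite fin_num_adde_defr.
Qed.

Lemma Ex_dWdW s t k l : 0 <= s -> s < t ->
  Ex P (fun w => dW s t k w * dW s t l w) = if k == l then t - s else 0.
Proof.
move=> s0 st; have [<-|kl] := eqVneq k l; first exact: Ex_dW2.
have LW := dW_L2 k s0 st; have LW' := dW_L2 l s0 st.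
rewrite indep_Ex; first by rewrite Ex_dW// mul0r.
- exact: L2_L1.
- exact: L2_L1.
- exact: L2M.
- exact: dW_indep.
Qed.

Lemma Ex_Fm_dW r s t f k : r <= s -> 0 <= s -> s <= t -> Fm r f -> L2 P f ->
  Ex P (fun w => f w * dW s t k w) = 0.
Proof.
move=> rs s0; rewrite le_eqVlt => /orP[/eqP <- _ _|st hf Lf].
  under eq_fun do rewrite /dW subrr mulr0.
  by rewrite Ex_cst.
have LW := dW_L2 k s0 st.
rewrite (Fm_Ex s0 st) ?Ex_dW ?mulr0//.
- exact: (Fm_mono rs).
- exact: Vm_dW.
- exact: L2_L1.
- exact: L2_L1.
- exact: L2M.
Qed.

Lemma dW_L2' s t k : 0 <= s -> s <= t -> L2 P (dW s t k).
Proof.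
move=> s0; rewrite le_eqVlt => /orP[/eqP <-|]; last exact: dW_L2.
rewrite (_ : dW s s k = fun=> 0); first exact: L2_cst.
by apply/funext => w; rewrite /dW subrr.
Qed.

Lemma Vm_quad s t k l : Vm s t (fun w => dW s t k w * dW s t l w - (if k == l then t - s else 0)).
Proof.
apply: measurable_funB; last exact: measurable_cst.
by apply: measurable_funM; exact: Vm_dW.
Qed.

Lemma dWdW_L2 s t k l : 0 <= s -> s < t ->
  L2 P (fun w => dW s t k w * dW s t l w).
Proof.
move=> s0 st; have t0 : 0 <= t by rewrite ltW// (le_lt_trans s0).
apply: (L2_le _ (L2D (dW_sqr_L2 k s0 st) (dW_sqr_L2 l s0 st))).
  by apply: measurable_funM; exact: dW_meas.
move=> w; rewrite [leRHS]ger0_norm ?addr_ge0 ?sqr_ge0// normrM.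
rewrite -(real_normK (num_real (dW s t k w))) -(real_normK (num_real (dW s t l w))).
have := sqr_ge0 (`|dW s t k w| - `|dW s t l w|).
have := normr_ge0 (dW s t k w); have := normr_ge0 (dW s t l w); nra.
Qed.

(** From (xy - c)^2 <= x^4 + y^4 + 2 c^2 with c^2 <= (t - s)^2 and the fourth moment bound; the sum
    64 + 64 + 2 stays well below 200. *)
Lemma Ex_quad_sqr s t k l : 0 <= s -> s < t ->
  Ex P (fun w => (dW s t k w * dW s t l w - (if k == l then t - s else 0)) ^+ 2)
    <= 200 * (t - s) ^+ 2.
Proof.
move=> s0 st; set c := if _ then _ else _.
have c2 : c ^+ 2 <= (t - s) ^+ 2.
  by rewrite /c; case: eqP => // _; rewrite expr0n/= sqr_ge0.
have Lk := dW_sqr_L2 k s0 st; have Ll := dW_sqr_L2 l s0 st.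
have Lq := L2B (dWdW_L2 k l s0 st) (L2_cst P c).
apply: (@le_trans _ _ (Ex P (fun w => ((dW s t k w ^+ 2) ^+ 2 + (dW s t l w ^+ 2) ^+ 2) + 2 * (t - s) ^+ 2))).
  apply: Ex_le; first exact: Lq.2.
    by apply: L1D; [apply: L1D; [exact: Lk.2|exact: Ll.2]|exact: L1_cst].
  move=> w; set x := dW s t k w; set y := dW s t l w.
  have := sqr_ge0 (x * y + c); have := sqr_ge0 (x ^+ 2 - y ^+ 2); nra.
rewrite ExD; [|by apply: L1D; [exact: Lk.2|exact: Ll.2]|exact: L1_cst].
rewrite ExD; [|exact: Lk.2|exact: Ll.2].
rewrite Ex_cst; have := Ex_dW4 k s0 st; have := Ex_dW4 l s0 st.
have := sqr_ge0 (t - s); lra.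
Qed.

End filtration.

(** * Clamping times to an interval *)

Section clamp.
Context {R : realType}.
Implicit Types (u v x y : R).

Definition clamp u v x : R := Num.max u (Num.min x v).

Lemma clamp_ge u v x : u <= clamp u v x.
Proof. by rewrite le_max lexx. Qed.

Lemma clamp_le u v x : u <= v -> clamp u v x <= v.
Proof. by move=> uv; rewrite ge_max uv ge_min lexx orbT. Qed.

Lemma clamp_homo u v x y : x <= y -> clamp u v x <= clamp u v y.
Proof. by move=> xy; apply: le_max2 => //; exact: le_min2. Qed.

Lemma clamp_id u v x : u <= x <= v -> clamp u v x = x.
Proof. by move=> /andP[ux xv]; rewrite /clamp min_l// max_r. Qed.

Lemma clampl u v x : u <= v -> x <= u -> clamp u v x = u.
Proof.
move=> uv xu; apply/eqP; rewrite eq_le clamp_ge andbT.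
by rewrite ge_max lexx /= ge_min xu.
Qed.

Lemma clampr u v x : u <= v -> v <= x -> clamp u v x = v.
Proof. by move=> uv vx; rewrite /clamp min_r// max_r. Qed.

(** Since a and b are grid points, no step straddles them: clamping to [a, b] leaves the selected
    steps unchanged and collapses all others to a point. The selected sum is therefore the full sum
    of clamped increments, which telescopes. *)
Lemma clamp_telescope (g : nat -> R) N (y : R -> R) a b ia ib :
  (forall i j, (i <= j <= N)%N -> g i <= g j) -> (ia <= N)%N -> (ib <= N)%N ->
  a = g ia -> b = g ib -> a <= b ->
  \sum_(j < N | (a <= g j) && (g j < b)) (y (g j.+1) - y (g j)) = y b - y a.
Proof.
move=> gh iaN ibN ea eb ab.
rewrite big_mkcond/=.
transitivity (\sum_(j < N) (y (clamp a b (g j.+1)) - y (clamp a b (g j)))).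
  apply: eq_bigr => j _.
  have [ag|ga] := leP a (g j); have [gb|bg] := ltP (g j) b => /=.
  - have gb' : g j.+1 <= b.
      rewrite eb; apply: (gh _ _); rewrite ibN andbT ltnNge; apply/negP => ij.
      by move: gb; rewrite eb ltNge gh// ij ltnW.
    have ga : a <= g j.+1 by rewrite (le_trans ag)// gh// leqnSn ltn_ord.
    by rewrite (@clamp_id a b (g j.+1)) ?ga// (@clamp_id a b (g j)) ?ag ?ltW.
  - rewrite !clampr ?subrr//; apply: (le_trans bg); apply: (gh _ _).
    by rewrite leqnSn ltn_ord.
  - rewrite !clampl ?subrr//; first by rewrite ltW.
    rewrite ea; apply: (gh _ _); rewrite iaN andbT ltnNge; apply/negP => ij.
    by move: ga; rewrite ea ltNge gh// ij ltnW.
  - have ba : b <= a by rewrite (le_trans bg)// ltW.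
    have /eqP -> : a == b by rewrite eq_le ab ba.
    by rewrite /clamp; rewrite !(max_l, max_r)// ?ge_min ?lexx ?orbT// subrr.
rewrite -(big_mkord xpredT (fun j => y (clamp a b (g j.+1)) - y (clamp a b (g j)))).
rewrite telescope_sumr//; congr (y _ - y _).
  by apply: clampr => //; rewrite eb; apply: (gh _ _); rewrite ibN leqnn.
by apply: clampl => //; rewrite ea; apply: (gh _ _); rewrite leq0n.
Qed.

End clamp.

(** * Elementary stochastic integrals *)

Section simple.
Context {R : realType} {dO : measure_display} {Omega : measurableType dO}.
Variable P : probability Omega R.
Hypothesis cP : measure_is_complete P.
Variables (d : nat) (W : R -> Omega -> 'cV[R]_d).
Hypothesis BM : brownian_motion P W.
Notation Fm := (Fm P W).
Notation L2 := (L2 P).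
Notation Ex := (Ex P).
Notation mu := (@lebesgue_measure R).

(* A list of such records stands for the row-valued elementary process
   sum_e 1_(ea e, eb e] ex e in the coordinates ek e. *)
Record elementary := Elt { ea : R ; eb : R ; ek : 'I_d ; ex : Omega -> R }.
HB.instance Definition _ := gen_eqMixin elementary.

Implicit Types (L : seq elementary) (e : elementary) (y : 'I_d -> R -> R).

(* The integral of L against a path y; the elementary process itself is the
   pairing with the paths x |-> 1_{s <= x} ([gval]), and its stochastic integral
   over [u, v] the pairing with W stopped outside [u, v] ([gint]). *)
Definition pairing L y w :=
  \sum_(e <- L) ex e w * (y (ek e) (eb e) - y (ek e) (ea e)).
Definition gval L k s w := pairing L (fun l x => ((l == k) && (s <= x))%:R) w.
Definition gint L u v w := pairing L (fun l x => W (clamp u v x) w l 0) w.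
Definition gsq L s w := \sum_k gval L k s w ^+ 2.

(** Adaptedness is asked of nonempty intervals only. Restriction to [u, v] clamps an interval lying
    beyond v to the point v, where its coefficient is not yet known; such an empty interval
    contributes nothing to any pairing. *)
Definition adapted_list lo hi L := forall e, e \in L -> [/\ lo <= ea e, ea e <= eb e, eb e <= hi,
  measurable_fun setT (ex e) /\ bddf (ex e) & ea e < eb e -> Fm (ea e) (ex e)].

Definition glist N (g : nat -> R) (v : nat -> 'I_d -> Omega -> R) : seq elementary :=
  [seq Elt (g j) (g j.+1) k (v j k) | j <- iota 0 N, k <- enum 'I_d].

Lemma pairing_glist N g v y w : pairing (glist N g v) y w =
  \sum_(j < N) \sum_k v j k w * (y k (g j.+1) - y k (g j)).
Proof.
rewrite /pairing /glist big_allpairs_dep/=.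
rewrite -(big_mkord xpredT (fun j => \sum_k v j k w * (y k (g j.+1) - y k (g j)))).
rewrite /index_iota subn0; apply: eq_bigr => j _.
by rewrite big_enum.
Qed.

Definition adapted_grid lo hi N (g : nat -> R) (v : nat -> 'I_d -> Omega -> R) :=
  [/\ (forall j, (j <= N)%N -> lo <= g j <= hi),
      (forall i j, (i <= j <= N)%N -> g i <= g j) &
      (forall j k, (j < N)%N -> Fm (g j) (v j k) /\ bddf (v j k))].

Lemma adapted_list_glist lo hi N g v : adapted_grid lo hi N g v -> adapted_list lo hi (glist N g v).
Proof.
move=> [gb gh hv] e /allpairsP[[j k]] /=; rewrite mem_iota add0n => -[/andP[_ jN] _ ->] /=.
have [Fv bv] := hv j k jN.
split.
- by have /andP[] := gb j (ltnW jN).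
- by apply: (gh _ _); rewrite leqnSn.
- by have /andP[] := gb j.+1 jN.
- by split => //; exact: (Fm_meas cP BM Fv).
- by [].
Qed.

Lemma pairing_cat L L' y w : pairing (L ++ L') y w = pairing L y w + pairing L' y w.
Proof. by rewrite /pairing big_cat. Qed.

Definition lneg L := [seq Elt (ea e) (eb e) (ek e) (fun w => - ex e w) | e <- L].

Lemma pairing_neg L y w : pairing (lneg L) y w = - pairing L y w.
Proof.
by rewrite /pairing big_map -sumrN; apply: eq_bigr => e _ /=; rewrite mulNr.
Qed.

Lemma pairingD L y z w :
  pairing L (fun k x => y k x + z k x) w = pairing L y w + pairing L z w.
Proof. by rewrite /pairing -big_split/=; apply: eq_bigr => e _; ring. Qed.

Lemma adapted_list_cat lo hi L L' : adapted_list lo hi L -> adapted_list lo hi L' -> adapted_list lo hi (L ++ L').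
Proof. by move=> h h' e; rewrite mem_cat => /orP[/h|/h']. Qed.

Lemma adapted_list_neg lo hi L : adapted_list lo hi L -> adapted_list lo hi (lneg L).
Proof.
move=> h e /mapP[e' /h[? ? ? [m [C b]] F] ->]; split => //=.
  split; first exact: measurable_funN.
  by exists C => w; rewrite normrN.
by move=> /F; exact: measurable_funN.
Qed.

Lemma adapted_list_sub lo hi lo' hi' L : lo' <= lo -> hi <= hi' -> adapted_list lo hi L -> adapted_list lo' hi' L.
Proof.
move=> l h H e /H[h1 h2 h3 h4 h5]; split => //; [exact: le_trans h1|exact: le_trans h3 _].
Qed.

Definition res u v L := [seq Elt (clamp u v (ea e)) (clamp u v (eb e)) (ek e) (ex e) | e <- L].

Lemma pairing_res u v L y w :
  pairing (res u v L) y w = pairing L (fun k x => y k (clamp u v x)) w.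
Proof. by rewrite /pairing big_map. Qed.

Lemma adapted_list_res lo hi u v L : u <= v -> adapted_list lo hi L -> adapted_list u v (res u v L).
Proof.
move=> uv h e /mapP[e' /h[h1 h2 h3 h4 h5] ->]; split => //=.
- exact: clamp_ge.
- exact: clamp_homo.
- exact: clamp_le.
move=> ab; have av : ea e' <= v.
  rewrite leNgt; apply/negP => va; move: ab.
  by rewrite !clampr ?ltxx// ltW// (lt_le_trans va).
have aa : ea e' <= clamp u v (ea e') by rewrite /clamp min_l// le_max lexx orbT.
apply: (Fm_mono aa); apply: h5; rewrite lt_neqAle h2 andbT.
by apply/eqP => E; move: ab; rewrite E ltxx.
Qed.

Lemma gval_res u v L k s w : gval (res u v L) k s w =
  if (u < s) && (s <= v) then gval L k s w else 0.
Proof.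
rewrite /gval pairing_res /pairing; case: ifPn => [/andP[us sv]|].
  apply: eq_bigr => e _; rewrite /clamp.
  by rewrite !le_max !le_min sv !andbT !(leNgt s u) us.
rewrite negb_and -leNgt -ltNge => h; apply: big1 => e _; rewrite /clamp.
case/orP: h => [su|vs]; first by rewrite !le_max su/= subrr mulr0.
have [us|su] := ltP u s; last by rewrite !le_max su/= subrr mulr0.
by rewrite !le_max !le_min !(leNgt s u) us/= !(leNgt s v) vs/= !andbF subrr mulr0.
Qed.

Lemma gint_res u v L w : gint L u v w = pairing (res u v L) (fun l x => W x w l 0) w.
Proof. by rewrite pairing_res. Qed.

Lemma gintD L u v z w : u <= v -> v <= z -> gint L u z w = gint L u v w + gint L v z w.
Proof.
move=> uv vz; rewrite /gint -pairingD /pairing; apply: eq_bigr => e _; congr (_ * _).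
have h x : W (clamp u v x) w (ek e) 0 + W (clamp v z x) w (ek e) 0 =
    W (clamp u z x) w (ek e) 0 + W v w (ek e) 0.
  have uz := le_trans uv vz.
  have [xv|vx] := leP x v.
    rewrite (clampl vz xv); congr (W _ w _ _ + _).
    by rewrite /clamp !min_l// (le_trans xv).
  rewrite (clampr uv (ltW vx)) addrC; congr (W _ w _ _ + _).
  rewrite /clamp; have : v <= Num.min x z by rewrite le_min vz ltW.
  by move=> vm; rewrite !max_r// (le_trans uv).
by rewrite !h; ring.
Qed.

(** Sorting all end points gives a common refinement; on each of its steps the new coefficient is
    the sum of the coefficients of the intervals that contain the step. The equality holds against
    every path y, so it covers the process and its stochastic integral at once. *)
Lemma sorted_grid_form lo hi L : lo <= hi -> adapted_list lo hi L ->
  exists N g v, adapted_grid lo hi N g v /\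
   forall y w, pairing L y w = pairing (glist N g v) y w.
Proof.
move=> lohi hL.
pose pts0 := flatten [seq [:: ea e; eb e] | e <- L].
pose pts := sort <=%R pts0.
pose N := (size pts).-1.
(* The default value [hi] matters for an empty list: then N = 0 and the grid is the single point
   hi. *)
pose g j := nth hi pts j.
pose v j k w := \sum_(e <- L | (ek e == k) && ((ea e <= g j) && (g j < eb e))) ex e w.
have inpts x : x \in pts -> exists2 i, (i <= N)%N & x = g i.
  move=> xp; exists (index x pts); last by rewrite /g nth_index.
  by rewrite /N -ltnS prednK ?index_mem//; case: (pts) xp.
have eap e : e \in L -> ea e \in pts.
  move=> eL; rewrite mem_sort; apply/flattenP; exists [:: ea e; eb e].
    by apply/mapP; exists e.
  by rewrite inE eqxx.
have ebp e : e \in L -> eb e \in pts.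
  move=> eL; rewrite mem_sort; apply/flattenP; exists [:: ea e; eb e].
    by apply/mapP; exists e.
  by rewrite !inE eqxx orbT.
have gh i j : (i <= j <= N)%N -> g i <= g j.
  move=> /andP[ij jN].
  have [s0|s0] := posnP (size pts).
    by rewrite /g !nth_default// s0.
  apply: (sorted_leq_nth le_trans le_refl) => //; first exact: sort_le_sorted.
    by rewrite inE (leq_ltn_trans ij)// (leq_ltn_trans jN)// /N prednK.
  by rewrite inE (leq_ltn_trans jN)// /N prednK.
have gb j : (j <= N)%N -> lo <= g j <= hi.
  move=> jN; have [s0|s0] := posnP (size pts).
    by rewrite /g nth_default ?s0// lohi lexx.
  have : g j \in pts by apply: mem_nth; rewrite (leq_ltn_trans jN)// /N prednK.
  rewrite mem_sort => /flattenP[_ /mapP[e eL ->]].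
  have [h1 h2 h3 _ _] := hL _ eL.
  by rewrite !inE => /orP[/eqP ->|/eqP ->]; rewrite ?h1 ?h3 ?(le_trans h1 h2) ?(le_trans h2 h3).
exists N, g, v; split.
  split => // j k jN; split.
    rewrite /v.
    rewrite [X in Fm _ X](_ : _ = fun w => \sum_(e <- L) (if (e \in L) && ((ek e == k) && ((ea e <= g j) && (g j < eb e))) then ex e w else 0)); last first.
      by apply/funext => w; rewrite big_mkcond/= [LHS]big_seq [RHS]big_seq; apply: eq_bigr => e ->.
    apply: (@measurable_sum _ (g_sigma_algebraType (Gt P W (g j)))) => e.
    have [/and4P[eL _ ag gb']|_] :=
      boolP [&& e \in L, ek e == k, ea e <= g j & g j < eb e]; last exact: measurable_cst.
    have [_ _ _ _ F] := hL _ eL.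
    exact: (Fm_mono ag (F (le_lt_trans ag gb'))).
  have : {subset L <= L} by [].
  rewrite /v; elim: {1 3}L => [_|e L' IH sL].
    by exists 0 => w; rewrite big_nil normr0.
  have [C hC] : bddf (fun w => \sum_(e0 <- L' | (ek e0 == k) && ((ea e0 <= g j) && (g j < eb e0))) ex e0 w).
    by apply: IH => x xL; apply: sL; rewrite inE xL orbT.
  have [_ _ _ [_ [D hD]] _] := hL e (sL e (mem_head _ _)).
  exists (D + C) => w; rewrite big_cons; case: ifP => _.
    by apply: (le_trans (ler_normD _ _)); exact: lerD.
  by apply: (le_trans (hC w)); rewrite lerDr (le_trans _ (hD w)).
move=> y w; rewrite pairing_glist /pairing.
transitivity (\sum_(e <- L) \sum_(j < N) \sum_(k | (ek e == k) && ((ea e <= g j) && (g j < eb e))) ex e w * (y k (g j.+1) - y k (g j))).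
  rewrite [LHS]big_seq [RHS]big_seq; apply: eq_bigr => e eL.
  have [ia iaN Ea] := inpts _ (eap _ eL); have [ib ibN Eb] := inpts _ (ebp _ eL).
  have [_ ab _ _ _] := hL _ eL.
  rewrite -(clamp_telescope (y (ek e)) gh iaN ibN Ea Eb ab) mulr_sumr big_mkcond/=.
  apply: eq_bigr => j _; case: ifP => _; last by rewrite big_pred0// => k; rewrite andbF.
  by rewrite (big_pred1 (ek e))// => k; rewrite andbT eq_sym.
rewrite exchange_big/=; apply: eq_bigr => j _.
transitivity (\sum_(e <- L) \sum_k (if (ek e == k) && ((ea e <= g j) && (g j < eb e)) then ex e w * (y k (g j.+1) - y k (g j)) else 0)).
  by apply: eq_bigr => e _; rewrite big_mkcond.
rewrite exchange_big/=; apply: eq_bigr => k _.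
by rewrite -big_mkcond /v mulr_suml.
Qed.


(** Pythagoras for martingale increments: the partial sum is measurable at time t k and square
    integrable, so the third hypothesis removes its product with the next increment. Both properties
    are carried along the induction. *)
Lemma orth_sum N (t : nat -> R) (G : nat -> Omega -> R) :
  (forall i j, (i <= j <= N)%N -> t i <= t j) ->
  (forall j, (j < N)%N -> Fm (t j.+1) (G j) /\ L2 (G j)) ->
  (forall j f, (j < N)%N -> Fm (t j) f -> L2 f -> Ex (fun w => f w * G j w) = 0) ->
  Ex (fun w => (\sum_(j < N) G j w) ^+ 2) = \sum_(j < N) Ex (fun w => G j w ^+ 2).
Proof.
move=> th hG ort.
suff H k : (k <= N)%N -> [/\ Fm (t k) (fun w => \sum_(j < k) G j w),
    L2 (fun w => \sum_(j < k) G j w) &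
    Ex (fun w => (\sum_(j < k) G j w) ^+ 2) = \sum_(j < k) Ex (fun w => G j w ^+ 2)].
  by have [] := H N (leqnn _).
elim: k => [_|k IH kN].
  split; [|by apply: L2_sum => -[]|].
    by under eq_fun do rewrite big_ord0; exact: measurable_cst.
  by under eq_fun do rewrite big_ord0 expr0n; rewrite big_ord0 Ex_cst.
have [F L E] := IH (ltnW kN).
have [Fk Lk] := hG k kN.
split.
- under eq_fun do rewrite big_ord_recr/=.
  apply: measurable_funD => //; apply: (Fm_mono _ F); apply: th.
  by rewrite leqnSn.
- by under eq_fun do rewrite big_ord_recr/=; exact: L2D.
rewrite big_ord_recr/= -E.
have -> : (fun w => (\sum_(j < k.+1) G j w) ^+ 2) = fun w =>
    ((\sum_(j < k) G j w) ^+ 2 + 2 * ((\sum_(j < k) G j w) * G k w)) + G k w ^+ 2.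
  by apply/funext => w; rewrite big_ord_recr/=; ring.
have i1 : L1 P (fun w => 2 * ((\sum_(j < k) G j w) * G k w)) by apply: L1Z; exact: L2M.
rewrite ExD; [|by apply: L1D => //; exact: L.2|exact: Lk.2].
rewrite ExD//; last exact: L.2.
by rewrite (ExZ 2 (L2M L Lk)) (ort k _ kN F L) mulr0 addr0.
Qed.

Definition ginc (g : nat -> R) (v : nat -> 'I_d -> Omega -> R) j w :=
  \sum_k v j k w * dW W (g j) (g j.+1) k w.

Definition qf N (g : nat -> R) (v : nat -> 'I_d -> Omega -> R) w :=
  \sum_(j < N) (\sum_k v j k w ^+ 2) * (g j.+1 - g j).

(** The coefficients are known at g j, so expectations factor into those of coefficients and of
    products dW_k dW_l, and only k = l survives. Steps of length 0 are treated apart, since the law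
    of an increment is given for s < t only. *)
Lemma ginc_orth lo hi N g v j : 0 <= lo -> adapted_grid lo hi N g v -> (j < N)%N ->
  [/\ Fm (g j.+1) (ginc g v j), L2 (ginc g v j),
   (forall f, Fm (g j) f -> L2 f -> Ex (fun w => f w * ginc g v j w) = 0) &
   Ex (fun w => ginc g v j w ^+ 2) = Ex (fun w => (\sum_k v j k w ^+ 2) * (g j.+1 - g j))].
Proof.
move=> lo0 [gb gh hv] jN.
have /andP[l1 h1] := gb j (ltnW jN).
have /andP[l2 h2] := gb j.+1 jN.
have g0 := le_trans lo0 l1.
have gg : g j <= g j.+1 by apply: gh; rewrite leqnSn.
have LW k : L2 (dW W (g j) (g j.+1) k) by exact: (dW_L2' BM).
have mv k : measurable_fun setT (v j k) := Fm_meas cP BM (hv j k jN).1.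
have Lv k : L2 (fun w => v j k w * dW W (g j) (g j.+1) k w).
  by apply: L2_bddM => //; exact: (hv j k jN).2.
split.
- apply: (@measurable_sum _ (g_sigma_algebraType (Gt P W (g j.+1)))) => k.
  apply: measurable_funM; first exact: (Fm_mono gg (hv j k jN).1).
  by apply: measurable_funB; apply: (Fm_W); rewrite ?lexx ?gg ?(le_trans g0 gg) ?g0.
- exact: L2_sum.
- move=> f Ff Lf; rewrite /ginc.
  under eq_fun do rewrite mulr_sumr.
  rewrite Ex_sum => [|k _]; last exact: L2M.
  rewrite big1// => k _.
  under eq_fun do rewrite mulrA.
  apply: (Ex_Fm_dW cP BM (f := fun x => f x * v j k x) k (lexx _) g0 gg).
    by apply: measurable_funM => //; exact: (hv j k jN).1.
  under eq_fun do rewrite mulrC.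
  by apply: L2_bddM => //; exact: (hv j k jN).2.
- rewrite /ginc.
  have -> : (fun w => (\sum_k v j k w * dW W (g j) (g j.+1) k w) ^+ 2) =
     fun w => \sum_k \sum_l (v j k w * v j l w) * (dW W (g j) (g j.+1) k w * dW W (g j) (g j.+1) l w).
    apply/funext => w; rewrite expr2 mulr_suml; apply: eq_bigr => k _.
    by rewrite mulr_sumr; apply: eq_bigr => l _; ring.
  have bvv k l : bddf (fun w => v j k w * v j l w).
    by apply: bddfM; [exact: (hv j k jN).2|exact: (hv j l jN).2].
  have Lvv k l : L2 (fun w => v j k w * v j l w).
    by apply: L2_bdd; [exact: measurable_funM|exact: bvv].
  have iq k l : L1 P (fun w => (v j k w * v j l w) * (dW W (g j) (g j.+1) k w * dW W (g j) (g j.+1) l w)).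
    rewrite (_ : (fun w => _) = (fun w => (v j k w * dW W (g j) (g j.+1) k w) * (v j l w * dW W (g j) (g j.+1) l w))); first exact: L2M.
    by apply/funext => w; ring.
  rewrite Ex_sum => [|k _]; last by apply: L1_sum => l _.
  rewrite [X in _ = Ex X](_ : _ = fun w => \sum_k v j k w ^+ 2 * (g j.+1 - g j)); last first.
    by apply/funext => w; rewrite mulr_suml.
  rewrite [RHS]Ex_sum => [|k _]; last first.
    under eq_fun do rewrite mulrC expr2.
    by apply: L1Z; exact: L2_L1.
  apply: eq_bigr => k _.
  rewrite Ex_sum => [|l _]; last exact: iq.
  have Eq l : Ex (fun w => (v j k w * v j l w) * (dW W (g j) (g j.+1) k w * dW W (g j) (g j.+1) l w)) =
      Ex (fun w => v j k w * v j l w) * (if k == l then g j.+1 - g j else 0).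
    move: gg; rewrite le_eqVlt => /orP[/eqP E|gg'].
      rewrite -E subrr if_same mulr0.
      under eq_fun do rewrite /dW !subrr mulr0 mulr0.
      exact: Ex_cst.
    rewrite (Fm_Ex cP BM g0 gg')//; first by rewrite (Ex_dWdW BM k l g0 gg').
    + by apply: measurable_funM; [exact: (hv j k jN).1|exact: (hv j l jN).1].
    + by apply: measurable_funM; exact: Vm_dW.
    + exact: L2_L1.
    + exact: L2M.
  under eq_bigr do rewrite Eq.
  rewrite (bigD1 k)//= eqxx big1 ?addr0; last by move=> l; rewrite eq_sym => /negPf ->; rewrite mulr0.
  by rewrite [RHS](RintegralZr _ measurableT (L2_L1 (Lvv k k))).
Qed.

Lemma isometry_grid lo hi N g v : 0 <= lo -> adapted_grid lo hi N g v ->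
  [/\ Fm hi (fun w => pairing (glist N g v) (fun l x => W x w l 0) w),
    L2 (fun w => pairing (glist N g v) (fun l x => W x w l 0) w),
    (forall f, Fm lo f -> L2 f -> Ex (fun w => f w * pairing (glist N g v) (fun l x => W x w l 0) w) = 0) &
    Ex (fun w => pairing (glist N g v) (fun l x => W x w l 0) w ^+ 2) = Ex (qf N g v)].
Proof.
move=> lo0 G; have [gb gh hv] := G.
have E : (fun w => pairing (glist N g v) (fun l x => W x w l 0) w) = fun w => \sum_(j < N) ginc g v j w.
  by apply/funext => w; rewrite pairing_glist.
have Lg j : (j < N)%N -> L2 (ginc g v j).
  by move=> jN; have [] := ginc_orth lo0 G jN.
have Lsum : L2 (fun w => \sum_(j < N) ginc g v j w).
  by apply: L2_sum => j _; exact: Lg.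
rewrite E; split => //.
- apply: (@measurable_sum _ (g_sigma_algebraType (Gt P W hi))) => j.
  have [F _ _ _] := ginc_orth lo0 G (ltn_ord j).
  by apply: (Fm_mono _ F); have /andP[] := gb j.+1 (ltn_ord j).
- move=> f Ff Lf; under eq_fun do rewrite pairing_glist mulr_sumr.
  rewrite Ex_sum => [|j _]; last by apply: L2M => //; exact: Lg.
  apply: big1 => j _; have [_ _ o _] := ginc_orth lo0 G (ltn_ord j).
  by apply: o => //; apply: (Fm_mono _ Ff); have /andP[] := gb j (ltnW (ltn_ord j)).
have -> : (fun w => pairing (glist N g v) (fun l x => W x w l 0) w ^+ 2) =
    fun w => (\sum_(j < N) ginc g v j w) ^+ 2.
  by apply/funext => w; rewrite pairing_glist.
rewrite (orth_sum (t := g))//.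
- rewrite /qf Ex_sum.
    by apply: eq_bigr => j _; have [_ _ _ ->] := ginc_orth lo0 G (ltn_ord j).
  move=> j _; under eq_fun do rewrite mulrC.
  apply: L1Z; apply: L1_sum => k _.
  have [Fv bv] := hv j k (ltn_ord j).
  by have [] := L2_bdd P (Fm_meas cP BM Fv) bv.
- by move=> j jN; have [] := ginc_orth lo0 G jN.
- by move=> j f jN; have [_ _ o _] := ginc_orth lo0 G jN; exact: o.
Qed.

(** The intervals of a grid are disjoint, so at most one term is nonzero at s and the square of the
    sum is the sum of the squares. *)
Lemma gsq_glist N g v s w : (forall i j, (i <= j <= N)%N -> g i <= g j) ->
  gsq (glist N g v) s w = \sum_(j < N) (\sum_k v j k w ^+ 2) * \1_(`]g j, g j.+1]%classic) s.
Proof.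
move=> gh.
have ind (j : 'I_N) : (s <= g j.+1)%R%:R - (s <= g j)%R%:R = \1_(`]g j, g j.+1]%classic) s :> R.
  rewrite indicE mem_setE in_itv/=; have [gs|sg] := ltP (g j) s => /=; first by rewrite subr0.
  have gg : g j <= g j.+1 by apply: gh; rewrite leqnSn ltn_ord.
  by rewrite (le_trans sg gg) subrr.
have gv k : gval (glist N g v) k s w = \sum_(j < N) v j k w * \1_(`]g j, g j.+1]%classic) s.
  rewrite /gval pairing_glist; apply: eq_bigr => j _.
  rewrite (bigD1 k)//= eqxx big1 ?addr0 ?ind// => l /negPf ->.
  by rewrite subrr mulr0.
rewrite /gsq; under eq_bigr do rewrite gv.
have [[j sj]|nj] := pselect (exists j : 'I_N, s \in `]g j, g j.+1]).
  have uniq (i : 'I_N) : i != j -> \1_(`]g i, g i.+1]%classic) s = 0 :> R.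
    move=> ij; rewrite indicE mem_setE; case: (boolP (s \in _)) => // si.
    exfalso; move: si sj; rewrite !in_itv/= => /andP[a1 a2] /andP[b1 b2].
    move: ij; rewrite neq_ltn => /orP[ij|ji].
      have : g i.+1 <= g j by apply: gh; rewrite ij ltnW.
      by rewrite leNgt (lt_le_trans b1 a2).
    have : g j.+1 <= g i by apply: gh; rewrite ji ltnW.
    by rewrite leNgt (lt_le_trans a1 b2).
  have one : \1_(`]g j, g j.+1]%classic) s = 1 :> R by rewrite indicE mem_setE sj.
  transitivity (\sum_k v j k w ^+ 2); last first.
    by rewrite (bigD1 j)//= one mulr1 [X in _ + X]big1 ?addr0// => i ij; rewrite (uniq _ ij) mulr0.
  apply: eq_bigr => k _; rewrite (bigD1 j)//= one mulr1 big1 ?addr0//.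
  by move=> i ij; rewrite (uniq _ ij) mulr0.
have zero (i : 'I_N) : \1_(`]g i, g i.+1]%classic) s = 0 :> R.
  by rewrite indicE mem_setE; case: (boolP (s \in _)) => // si; case: nj; exists i.
rewrite big1 ?big1// => [j _|k _]; first by rewrite zero mulr0.
by rewrite big1 ?expr0n// => j _; rewrite zero mulr0.
Qed.

Lemma integral_gsq_glist lo hi N g v w : adapted_grid lo hi N g v ->
  (\int[mu]_(s in `[lo, hi]) (gsq (glist N g v) s w)%:E = (qf N g v w)%:E)%E.
Proof.
move=> [gb gh hv].
have v0 j : 0 <= \sum_k v j k w ^+ 2 by apply: sumr_ge0 => k _; exact: sqr_ge0.
under eq_integral do rewrite gsq_glist// -sumEFin.
rewrite ge0_integral_sum//.
- rewrite /qf -sumEFin; apply: eq_bigr => j _.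
  under eq_integral do rewrite EFinM.
  rewrite ge0_integralZl_EFin//.
  + rewrite integral_indic//.
    have gg : g j <= g j.+1 by apply: gh; rewrite leqnSn ltn_ord.
    rewrite (_ : `]g j, g j.+1]%classic `&` `[lo, hi]%classic = `]g j, g j.+1]%classic).
      rewrite EFinM; congr (_ * _)%E.
      have := @lebesgue_measure_itv R `]g j, g j.+1]; rewrite /= lte_fin => E.
      apply: (etrans E).
      by move: gg; rewrite le_eqVlt => /orP[/eqP ->|->//]; rewrite ltxx subrr.
    apply/seteqP; split=> x /=; first by case.
    rewrite !in_itv/= => /andP[a1 a2]; split; first by rewrite a1.
    have /andP[l1 _] := gb j (ltnW (ltn_ord j)).
    have /andP[_ h2] := gb j.+1 (ltn_ord j).
    by rewrite (le_trans l1 (ltW a1)) (le_trans a2 h2).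
  + by apply/measurable_EFinP/measurable_indic; exact: measurable_itv.
- move=> j; apply/measurable_EFinP; apply: measurable_funM => //.
- by move=> j x _; rewrite lee_fin mulr_ge0.
Qed.

End simple.

(** * Ito's isometry on subintervals and truncation of the energy *)

Section isometry.
Context {R : realType} {dO : measure_display} {Omega : measurableType dO}.
Variable P : probability Omega R.
Hypothesis cP : measure_is_complete P.
Variables (d : nat) (W : R -> Omega -> 'cV[R]_d).
Hypothesis BM : brownian_motion P W.
Notation Fm := (Fm P W).
Notation L2 := (L2 P).
Notation Ex := (Ex P).
Notation mu := (@lebesgue_measure R).
Notation elementary := (@elementary R dO Omega d).
Notation adapted_list := (adapted_list P W).
Notation gint := (gint W).
Implicit Types (L : seq elementary).

Lemma gsq_ge0 L s w : 0 <= gsq L s w.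
Proof. by apply: sumr_ge0 => k _; exact: sqr_ge0. Qed.

Lemma gsq_ext L L' : (forall y w, pairing L y w = pairing L' y w) ->
  forall s w, gsq L s w = gsq L' s w.
Proof. by move=> h s w; apply: eq_bigr => k _; rewrite /gval h. Qed.

Lemma gval_glist N g (v : nat -> 'I_d -> Omega -> R) k s w :
  (forall i j, (i <= j <= N)%N -> g i <= g j) ->
  gval (glist N g v) k s w = \sum_(j < N) v j k w * \1_(`]g j, g j.+1]%classic) s.
Proof.
move=> gh; rewrite /gval pairing_glist; apply: eq_bigr => j _.
rewrite (bigD1 k)//= eqxx big1 ?addr0 => [|l /negPf ->]; last by rewrite subrr mulr0.
congr (_ * _); rewrite indicE mem_setE in_itv/=; have [gs|sg] := ltP (g j) s => /=.
  by rewrite subr0.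
have gg : g j <= g j.+1 by apply: gh; rewrite leqnSn ltn_ord.
by rewrite (le_trans sg gg) subrr.
Qed.

Lemma gsq_res u v L s w :
  gsq (res u v L) s w = if (u < s) && (s <= v) then gsq L s w else 0.
Proof.
rewrite /gsq; under eq_bigr do rewrite gval_res.
by case: ifP => // _; rewrite big1// => k _; rewrite expr0n.
Qed.

Lemma gval_joint lo hi L k : adapted_list lo hi L ->
  measurable_fun setT (fun u : R * Omega => gval L k u.1 u.2).
Proof.
move=> hL; rewrite /gval /pairing.
rewrite (_ : (fun _ => _) = fun u : R * Omega => \sum_(e <- L) (if e \in L then ex e u.2 * (((ek e == k) && (u.1 <= eb e))%:R -
  ((ek e == k) && (u.1 <= ea e))%:R) else 0)); last first.
  by apply/funext => u; rewrite [LHS]big_seq [RHS]big_seq; apply: eq_bigr => e ->.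
apply: measurable_sum => e; case: (boolP (e \in L)) => [/hL [_ _ _ [m _] _]|_]; last exact: measurable_cst.
have mind c : measurable_fun setT (fun u : R * Omega => ((ek e == k) && (u.1 <= c))%:R : R).
  rewrite (_ : (fun _ => _) = fun u : R * Omega => (if ek e == k then 1 else 0) * \1_(`]-oo, c]%classic) u.1).
    apply: measurable_funM => //; apply: measurableT_comp => //.
  by apply/funext => u; rewrite indicE mem_setE in_itv/=; case: eqP => _ /=; rewrite ?mul0r ?mul1r.
apply: measurable_funM; first by apply: measurableT_comp.
by apply: measurable_funB; exact: mind.
Qed.

Lemma gsq_joint lo hi L : adapted_list lo hi L ->
  measurable_fun setT (fun u : R * Omega => gsq L u.1 u.2).
Proof.
move=> hL; rewrite /gsq; apply: measurable_sum => k.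
by apply: measurable_funX; exact: gval_joint hL.
Qed.

(** Restricting L to (u, v] and passing to a sorted grid reduces everything to [isometry_grid]. The
    closed interval of integration differs from (u, v] by a point. *)
Lemma gint_isometry lo hi L u v : 0 <= lo -> lo <= u -> u <= v -> v <= hi -> adapted_list lo hi L ->
  [/\ Fm v (gint L u v), L2 (gint L u v),
    (forall f, Fm u f -> L2 f -> Ex (fun w => f w * gint L u v w) = 0) &
    (\int[P]_w \int[mu]_(s in `[u, v]) (gsq L s w)%:E = (Ex (fun w => gint L u v w ^+ 2))%:E)%E].
Proof.
move=> lo0 lu uv vh hL.
have hR := adapted_list_res uv hL.
have [N [g [x [G E]]]] := sorted_grid_form uv hR.
have u0 := le_trans lo0 lu.
have [F Lx o I] := isometry_grid cP BM u0 G.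
have Eg : gint L u v = fun w => pairing (glist N g x) (fun l x => W x w l 0) w.
  by apply/funext => w; rewrite -E -gint_res.
rewrite Eg; split => //.
rewrite I.
have Q w : (\int[mu]_(s in `[u, v]) (gsq L s w)%:E = (qf N g x w)%:E)%E.
  rewrite -(integral_gsq_glist w G).
  rewrite -integral_itv_obnd_cbnd; last first.
    apply/measurable_EFinP; apply: measurable_funTS.
    exact: (measurable_fun_pair1 w (gsq_joint hL)).
  rewrite -[RHS]integral_itv_obnd_cbnd; last first.
    apply/measurable_EFinP; apply: measurable_funTS.
    exact: (measurable_fun_pair1 w (gsq_joint (adapted_list_glist cP BM G))).
  apply: eq_integral => s; rewrite inE/= in_itv/= => suv.
  by rewrite -(gsq_ext E) gsq_res suv.
under eq_integral do rewrite Q.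
rewrite ExE//.
rewrite /L1; apply: (@eq_integrable _ _ _ _ _ measurableT (fun w => (\sum_(j < N) (\sum_k x j k w ^+ 2) * (g j.+1 - g j))%:E)) => //.
apply: L1_sum => j _; under eq_fun do rewrite mulrC.
apply: L1Z; apply: L1_sum => k _.
have [_ _ hx] := G; have [Fv bv] := hx j k (ltn_ord j).
by have [] := L2_bdd P (Fm_meas cP BM Fv) bv.
Qed.

(** Partial sums are nondecreasing, so the terms kept form an initial segment whose sum respects the
    threshold. The induction also carries that the truncated sum is at most the full one, which is
    what the case of a kept last term uses. *)
Lemma trunc_sum_le (N : nat) (x : nat -> R) (M : R) : 0 <= M -> (forall j, 0 <= x j) ->
  \sum_(j < N) (if \sum_(i < j.+1) x i <= M then x j else 0) <= M.
Proof.
move=> M0 x0.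
suff [] : \sum_(j < N) (if \sum_(i < j.+1) x i <= M then x j else 0) <= M /\
  \sum_(j < N) (if \sum_(i < j.+1) x i <= M then x j else 0) <= \sum_(j < N) x j by [].
elim: N => [|N [IH1 IH2]]; first by rewrite !big_ord0.
rewrite [X in X <= _ /\ _]big_ord_recr/= [X in _ /\ X <= _]big_ord_recr/=.
rewrite [X in _ /\ _ <= X]big_ord_recr/=.
case: ifP => h; last by rewrite addr0; split => //; rewrite (le_trans IH2)// lerDl.
split; last by rewrite lerD2r.
by apply: le_trans h; rewrite big_ord_recr/= lerD2r.
Qed.

(* Replaces stopping: the coefficient of a step is set to 0 as soon as the energy
   up to the end of that step exceeds M, which is decided at its beginning. *)
Lemma bounded_energy_truncation lo hi L M : 0 <= lo -> lo <= hi -> 0 <= M -> adapted_list lo hi L ->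
  exists L', [/\ adapted_list lo hi L',
    (forall w, (\int[mu]_(s in `[lo, hi]) (gsq L' s w)%:E <= M%:E)%E) &
    (forall w, (\int[mu]_(s in `[lo, hi]) (gsq L s w)%:E <= M%:E)%E ->
       forall y, pairing L' y w = pairing L y w)].
Proof.
move=> lo0 lohi M0 hL.
have [N [g [x [G E]]]] := sorted_grid_form lohi hL.
have [gb gh hx] := G.
(* The maximum with 0 makes [q] nonnegative at every index, including those beyond the grid; on the
   grid it is the energy of step j. *)
pose q j w := (\sum_k x j k w ^+ 2) * Num.max (g j.+1 - g j) 0.
have q0 j w : 0 <= q j w.
  by rewrite mulr_ge0 ?le_max ?lexx ?orbT// sumr_ge0// => k _; exact: sqr_ge0.
have qE j w : (j < N)%N -> q j w = (\sum_k x j k w ^+ 2) * (g j.+1 - g j).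
  by move=> jN; rewrite /q max_l// subr_ge0; apply: gh; rewrite leqnSn.
pose c j w := \sum_(i < j.+1) q i w.
pose x' j k w := if c j w <= M then x j k w else 0.
have G' : adapted_grid P W lo hi N g x'.
  split => // j k jN; have [Fx [C bx]] := hx j k jN; split; last first.
    exists C => w; rewrite /x'; case: ifP => // _.
    by rewrite normr0 (le_trans _ (bx w)).
  have Fc : Fm (g j) (c j).
    rewrite /c [X in Fm _ X](_ : _ = fun w => \sum_(i < j.+1) (if (i < N)%N then q i w else 0)); last first.
      apply/funext => w; apply: eq_bigr => i _.
      by rewrite (leq_trans (ltn_ord i) jN).
    apply: (@measurable_sum _ (g_sigma_algebraType (Gt P W (g j)))) => i.
    have [iN|_] := boolP (i < N)%N; last exact: measurable_cst.
    apply: measurable_funM; last exact: measurable_cst.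
    apply: (@measurable_sum _ (g_sigma_algebraType (Gt P W (g j)))) => l.
    apply: measurable_funX; have [Fi _] := hx i l iN.
    by apply: (Fm_mono _ Fi); apply: gh; rewrite -ltnS ltn_ord ltnW.
  apply: (@measurable_fun_ifT _ _ (g_sigma_algebraType (Gt P W (g j)))) => //.
  by apply: measurable_fun_ler => //; exact: measurable_cst.
have qf' w : qf N g x' w = \sum_(j < N) (if c j w <= M then q j w else 0).
  apply: eq_bigr => j _; rewrite /x'; case: ifP => _; first by rewrite qE.
  by rewrite big1 ?mul0r// => k _; rewrite expr0n.
exists (glist N g x'); split.
- exact: (adapted_list_glist cP BM G').
- move=> w; rewrite (integral_gsq_glist w G') qf' lee_fin.
  exact: (@trunc_sum_le N (q ^~ w) M M0 (fun j => q0 j w)).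
- move=> w hw y; rewrite E.
  have : qf N g x w <= M.
    rewrite -lee_fin -(integral_gsq_glist w G); apply: le_trans hw.
    by under eq_integral do rewrite -(gsq_ext E).
  rewrite /qf => hM.
  rewrite !pairing_glist; apply: eq_bigr => j _; apply: eq_bigr => k _.
  congr (_ * _); rewrite /x' ifT//; apply: le_trans hM.
  rewrite /c [leRHS](_ : _ = \sum_(i < N) q i w); last first.
    by apply: eq_bigr => i _; rewrite qE.
  rewrite -(big_mkord xpredT (fun i => q i w)) -(big_mkord xpredT (fun i => q i w)).
  rewrite [leRHS](big_cat_nat _ (n := j.+1))//=.
  by rewrite lerDl sumr_ge0.
Qed.

End isometry.

(** * Ito integrals in probability *)

Section measure_tools.
Context {R : realType} {dO : measure_display} {Omega : measurableType dO}.
Variable P : probability Omega R.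
Hypothesis cP : measure_is_complete P.
Notation mu := (@lebesgue_measure R).

Lemma measurable_set_ae (A B : set Omega) : measurable A ->
  {ae P, forall w, A w <-> B w} -> measurable B.
Proof.
move=> mA [N [mN N0 sN]].
have -> : B = (A `\` N) `|` (B `&` N).
  apply/seteqP; split=> w.
    move=> Bw; have [Nw|Nw] := pselect (N w); [by right|left; split=> //].
    have [_ h] : A w <-> B w by apply: contrapT => h; apply/Nw/sN.
    exact: h.
  move=> [[Aw Nw]|[]//].
  have [h _] : A w <-> B w by apply: contrapT => h; apply/Nw/sN.
  exact: h.
apply: measurableU; first exact: measurableD.
by apply: cP; exists N; split => //; exact: subIsetr.
Qed.

(** U is only equal almost surely to a measurable function; completeness makes its super-level sets
    measurable, so they can serve as the exceptional sets of [hp]. *)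
Lemma cvg0_hp (U : nat -> Omega -> \bar R) (U' : nat -> Omega -> \bar R) e :
  cvg0_in_probability P U -> (forall k, measurable_fun setT (U' k)) ->
  (forall k, {ae P, forall w, U k w = U' k w}) -> 0 < e ->
  \forall k \near \oo, hp P e (fun w => (U k w < e%:E)%E).
Proof.
move=> cU mU UU e0.
have h : \forall k \near \oo, (P [set w | (e%:E <= U k w)%E] < e%:E)%E.
  have := cU e e0; move=> /(_ [set x | (x < e%:E)%E]); apply.
  by apply: open_ereal_lt'; rewrite lte_fin.
near=> k; exists [set w | (e%:E <= U k w)%E]; split.
- apply: (@measurable_set_ae [set w | (e%:E <= U' k w)%E]); last first.
    by apply: filterS (UU k) => w /= ->.
  have := mU k measurableT `[e%:E, +oo[%classic (emeasurable_itv _).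
  rewrite setTI; congr measurable.
  by apply/seteqP; split=> w /=; rewrite in_itv/= andbT.
- by apply: ltW; near: k.
- by move=> w /= /negP; rewrite -ltNge.
Unshelve. all: by end_near. Qed.

(** Dominated convergence along integer levels. The level is at least 1, so that the tail integral
    also bounds the probability of the tail event. *)
Lemma tail_integral (f : Omega -> \bar R) : measurable_fun setT f ->
  (forall w, 0 <= f w)%E -> (\int[P]_w f w < +oo)%E ->
  forall e : R, 0 < e -> exists2 M : R, 1 <= M &
    (\int[P]_(w in [set w | (M%:E < f w)%E]) f w <= e%:E)%E.
Proof.
move=> mf f0 fi e e0.
pose A (n : nat) := [set w | ((n%:R : R)%:E < f w)%E].
have mA n : measurable (A n).
  have := mf measurableT `](n%:R : R)%:E, +oo[%classic (emeasurable_itv _).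
  rewrite setTI; congr measurable.
  by apply/seteqP; split=> w /=; rewrite /A in_itv/= andbT.
have ifi : P.-integrable setT f.
  apply/integrableP; split => //.
  by under eq_integral do rewrite gee0_abs//.
have c : (\int[P]_w (f \_ (A n)) w)%E @[n --> \oo] --> (\int[P]_w (cst 0%E w))%E.
  have h1 n : measurable_fun setT (f \_ (A n)).
    by apply/(measurable_restrictT _ _).1 => //; exact: measurable_funTS.
  have h2 : measurable_fun setT (cst 0%E : Omega -> \bar R) by exact: measurable_cst.
  have h3 : {ae P, forall w, setT w -> (f \_ (A n)) w @[n --> \oo] --> cst 0%E w}.
    have := integrable_ae measurableT ifi; apply: filterS => w /(_ I) fw _.
    apply: cvg_near_cst; near=> n; rewrite patchE ifF//; apply/negP; rewrite inE /A/=.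
    apply/negP; rewrite -leNgt -(fineK fw) lee_fin; near: n; exact: nbhs_infty_ger.
  have h4 : {ae P, forall w n, setT w -> (`|(f \_ (A n)) w| <= f w)%E}.
    apply: aeW => w n _; rewrite patchE; case: ifP => _; last by rewrite abse0.
    by rewrite gee0_abs.
  by have [_ _ h] := dominated_convergence measurableT h1 h2 h3 ifi h4; exact: h.
move: c; rewrite [X in _ --> X]integral0_eq// => c.
have : \forall n \near \oo, ((\int[P]_w (f \_ (A n)) w)%E < e%:E)%E.
  move: c => /(_ [set x | (x < e%:E)%E]); apply.
  by apply: open_ereal_lt'; rewrite lte_fin.
move=> [n0 _ hn].
exists (maxn n0 1)%:R; first by rewrite ler1n leq_max orbT.
rewrite integral_mkcond; apply: ltW; apply: (hn (maxn n0 1)%N) => /=.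
by rewrite leq_max leqnn.
Unshelve. all: by end_near. Qed.

(** Monotone convergence of the truncations. It bounds a square whose integrability is not known
    beforehand. *)
Lemma integral_min_le (f : Omega -> R) (K : R) : measurable_fun setT f ->
  (forall w, 0 <= f w) ->
  (forall C, 0 <= C -> (\int[P]_w (Num.min (f w) C)%:E <= K%:E)%E) ->
  (\int[P]_w (f w)%:E <= K%:E)%E.
Proof.
move=> mf f0 h.
have mm n : measurable_fun setT (fun w => (Num.min (f w) n%:R)%:E).
  by apply/measurable_EFinP; apply: measurable_minr.
have c := @cvg_monotone_convergence _ _ _ P setT measurableT (fun n w => (Num.min (f w) n%:R)%:E) mm.
have {}c : (\int[P]_w (Num.min (f w) n%:R)%:E)%E @[n --> \oo] --> (\int[P]_w (f w)%:E)%E.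
  rewrite [X in _ --> X](_ : _ = \int[P]_(x in setT) limn (fun n => (Num.min (f x) n%:R)%:E))%E.
    apply: c.
    - by move=> n w _; rewrite lee_fin le_min f0/=.
    - move=> w _ a b ab; rewrite lee_fin; apply: le_min2 => //.
      by rewrite ler_nat.
  apply: eq_integral => w _; apply/esym/cvg_lim => //.
  apply: cvg_near_cst; near=> n; rewrite min_l//; near: n; exact: nbhs_infty_ger.
rewrite -(cvg_lim _ c)//; apply: lime_le; first by apply/cvg_ex; eexists; exact: c.
by near=> n; apply: h.
Unshelve. all: by end_near. Qed.

Lemma Ex_min_le (f g : Omega -> R) : measurable_fun setT f -> measurable_fun setT g ->
  (forall w, 0 <= f w <= g w) -> (\int[P]_w (f w)%:E <= \int[P]_w (g w)%:E)%E.
Proof.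
move=> mf mg fg; apply: ge0_le_integral => //=.
- by move=> w _; have /andP[] := fg w; rewrite lee_fin.
- exact/measurable_EFinP.
- exact/measurable_EFinP.
- by move=> w _; rewrite lee_fin; have /andP[] := fg w.
Qed.

End measure_tools.

Section ito.
Context {R : realType} {dO : measure_display} {Omega : measurableType dO}.
Variable P : probability Omega R.
Hypothesis cP : measure_is_complete P.
Variables (d : nat) (W : R -> Omega -> 'cV[R]_d).
Hypothesis BM : brownian_motion P W.
Notation Fm := (Fm P W).
Notation L2 := (L2 P).
Notation Ex := (Ex P).
Notation mu := (@lebesgue_measure R).
Notation elementary := (@elementary R dO Omega d).
Notation adapted_list := (adapted_list P W).
Notation gint := (gint W).
Notation hp := (hp P).
Implicit Types (L : seq elementary) (H : 'I_d -> R -> Omega -> R) (I : Omega -> R)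
  (f g : R -> Omega -> R) (a b c e : R) (w : Omega).

Definition jmf f := measurable_fun setT (fun u : R * Omega => f u.1 u.2).
Definition jm H := forall k, measurable_fun setT (fun u : R * Omega => H k u.1 u.2).
Definition sqd L H s w := \sum_k (gval L k s w - H k s w) ^+ 2.
Definition sqn H s w := \sum_k H k s w ^+ 2.
Definition tint a b (f : R -> Omega -> R) w := (\int[mu]_(s in `[a, b]) (f s w)%:E)%E.

(** Scalar form of [is_ito_integral] for one row H of the integrand. A single tolerance bounds the
    exceptional probability, the energy of the error over [a, b] and the error of the integral, so
    approximations combine by union bounds. *)
Definition ItoP a b H I := forall e, 0 < e -> exists2 L, adapted_list a b L &
  hp e (fun w => (tint a b (sqd L H) w <= e%:E)%E /\ `|gint L a b w - I w| <= e).

Lemma sqd_ge0 L H s w : 0 <= sqd L H s w.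
Proof. by apply: sumr_ge0 => k _; exact: sqr_ge0. Qed.

Lemma sqn_ge0 H s w : 0 <= sqn H s w.
Proof. by apply: sumr_ge0 => k _; exact: sqr_ge0. Qed.

Lemma jm_sqd lo hi L H : adapted_list lo hi L -> jm H ->
  measurable_fun setT (fun u : R * Omega => sqd L H u.1 u.2).
Proof.
move=> hL hH; apply: measurable_sum => k; apply: measurable_funX.
by apply: measurable_funB => //; exact: gval_joint hL.
Qed.

Lemma jm_sqn H : jm H -> measurable_fun setT (fun u : R * Omega => sqn H u.1 u.2).
Proof. by move=> hH; apply: measurable_sum => k; exact: measurable_funX. Qed.

Lemma joint_section f : jmf f ->
  forall D w, measurable_fun D (fun s => (f s w)%:E).
Proof.
move=> mf D w; apply: measurable_funTS; apply/measurable_EFinP.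
exact: (measurable_fun_pair1 w mf).
Qed.

Lemma tint_meas a b f : (forall s w, 0 <= f s w) ->
  jmf f -> measurable_fun setT (tint a b f).
Proof.
move=> f0 mf; rewrite /tint.
pose g (u : R * Omega) := ((\1_(`[a, b]%classic) u.1 : R) * f u.1 u.2)%:E.
have mg : measurable_fun setT g.
  apply/measurable_EFinP; apply: measurable_funM => //.
  by apply: measurableT_comp => //; apply: measurable_indic; exact: measurable_itv.
have := @measurable_fun_fubini_tonelli_G _ _ _ _ _ mu g mg.
rewrite [X in _ -> X](_ : _ = measurable_fun setT (fubini_G mu g)).
  by apply; move=> [s w]; rewrite lee_fin mulr_ge0.
congr measurable_fun; apply/funext => w; rewrite /fubini_G [LHS]integral_mkcond.
apply: eq_integral => s _; rewrite patchE /g indicE /=.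
by case: ifP => _; rewrite ?mul1r ?mul0r.
Qed.

Lemma tint_ge0 a b f w : (forall s w, 0 <= f s w) -> (0 <= tint a b f w)%E.
Proof. by move=> f0; apply: integral_ge0 => s _; rewrite lee_fin. Qed.

Lemma tint_le a b f g w : (forall s w, 0 <= f s w) ->
  jmf f ->
  jmf g ->
  (forall s, a <= s <= b -> f s w <= g s w) -> (tint a b f w <= tint a b g w)%E.
Proof.
move=> f0 mf mg fg; apply: ge0_le_integral => //=.
- by move=> s _; rewrite lee_fin.
- exact: joint_section.
- exact: joint_section.
Qed.

Lemma tintD a b f g w (c c' : R) : (forall s w, 0 <= f s w) -> (forall s w, 0 <= g s w) ->
  0 <= c -> 0 <= c' ->
  jmf f ->
  jmf g ->
  (tint a b (fun s w => (c * f s w + c' * g s w)%R) w = c%:E * tint a b f w + c'%:E * tint a b g w)%E.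
Proof.
move=> f0 g0 c0 c'0 mf mg; rewrite /tint.
have mI : measurable (`[a, b]%classic : set R) by exact: measurable_itv.
rewrite -!ge0_integralZl_EFin//; last 4 first.
- by move=> s _; rewrite lee_fin.
- exact: joint_section.
- by move=> s _; rewrite lee_fin.
- exact: joint_section.
rewrite -ge0_integralD//.
- by move=> s _; rewrite -EFinM lee_fin mulr_ge0.
- by apply: measurable_funeM; exact: joint_section.
- by move=> s _; rewrite -EFinM lee_fin mulr_ge0.
- by apply: measurable_funeM; exact: joint_section.
Qed.

Lemma tint_split a b c f w : a <= b -> b <= c -> (forall s w, 0 <= f s w) ->
  jmf f ->
  (tint a c f w = tint a b f w + tint b c f w)%E.
Proof.
move=> ab bc f0 mf; rewrite /tint.
rewrite -[X in (_ + X)%E]integral_itv_obnd_cbnd; last exact: joint_section.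
rewrite -ge0_integral_setU//=.
- congr integral; apply/seteqP; split=> s /=; rewrite !in_itv/=.
    by case: (leP s b) => sb /andP[as_ sc]; [left; rewrite as_|right; rewrite sc].
  by move=> [/andP[-> sb]|/andP[bs ->]] /=; [exact: le_trans bc|rewrite andbT (le_trans ab)// ltW].
- exact: joint_section.
- by move=> s _; rewrite lee_fin.
- apply/disj_setPS => s /= []; rewrite !in_itv/= => /andP[_ sb] /andP[+ _].
  by rewrite ltNge sb.
Qed.

Lemma tint_sub a b a' b' f w : a <= a' -> a' <= b' -> b' <= b -> (forall s w, 0 <= f s w) ->
  jmf f ->
  (tint a' b' f w <= tint a b f w)%E.
Proof.
move=> aa ab bb f0 mf; apply: ge0_subset_integral => //=.
- exact: joint_section.
- by move=> s _; rewrite lee_fin.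
- by move=> s /=; rewrite !in_itv/= => /andP[h1 h2]; rewrite (le_trans aa h1) (le_trans h2 bb).
Qed.

End ito.

(** * From approximation in probability to approximation in mean square *)

Section ito_lemmas.
Context {R : realType} {dO : measure_display} {Omega : measurableType dO}.
Variable P : probability Omega R.
Hypothesis cP : measure_is_complete P.
Variables (d : nat) (W : R -> Omega -> 'cV[R]_d).
Hypothesis BM : brownian_motion P W.
Notation Fm := (Fm P W).
Notation L2 := (L2 P).
Notation Ex := (Ex P).
Notation mu := (@lebesgue_measure R).
Notation elementary := (@elementary R dO Omega d).
Notation adapted_list := (adapted_list P W).
Notation gint := (gint W).
Notation hp := (hp P).
Notation ItoP := (ItoP P W).
Implicit Types (L : seq elementary) (H : 'I_d -> R -> Omega -> R) (I : Omega -> R)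
  (f g : R -> Omega -> R) (a b c e : R) (w : Omega).

Definition lsub L L' := L ++ lneg L'.

Lemma pairing_sub L L' y w : pairing (lsub L L') y w = pairing L y w - pairing L' y w.
Proof. by rewrite pairing_cat pairing_neg. Qed.

Lemma adapted_list_lsub lo hi L L' : adapted_list lo hi L -> adapted_list lo hi L' -> adapted_list lo hi (lsub L L').
Proof. by move=> h h'; apply: adapted_list_cat => //; exact: adapted_list_neg. Qed.

Lemma sqr_sub_le (x y : R) : (x - y) ^+ 2 <= 2 * x ^+ 2 + 2 * y ^+ 2.
Proof. have := sqr_ge0 (x + y); nra. Qed.

Lemma sqd_sub_le L L' H H' s w :
  sqd (lsub L L') (fun k s w => H k s w - H' k s w) s w <= 2 * sqd L H s w + 2 * sqd L' H' s w.
Proof.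
rewrite /sqd !mulr_sumr -big_split/=; apply: ler_sum => k _.
have := sqr_sub_le (gval L k s w - H k s w) (gval L' k s w - H' k s w).
apply: le_trans; rewrite le_eqVlt; apply/orP; left; apply/eqP.
by rewrite /gval pairing_sub; congr (_ ^+ 2); ring.
Qed.

Lemma gsq_sub_le L L' H s w : gsq (lsub L L') s w <= 2 * sqd L H s w + 2 * sqd L' H s w.
Proof.
have := sqd_sub_le L L' H H s w; apply: le_trans; rewrite le_eqVlt; apply/orP; left; apply/eqP.
by apply: eq_bigr => k _; rewrite subrr subr0.
Qed.

Lemma gsq_le L H s w : gsq L s w <= 2 * sqd L H s w + 2 * sqn H s w.
Proof.
rewrite /gsq /sqd /sqn !mulr_sumr -big_split/=; apply: ler_sum => k _.
have := sqr_sub_le (gval L k s w - H k s w) (- H k s w).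
by rewrite opprK subrK sqrrN.
Qed.

Lemma sqd_le L H s w : sqd L H s w <= 2 * gsq L s w + 2 * sqn H s w.
Proof.
rewrite /gsq /sqd /sqn !mulr_sumr -big_split/=; apply: ler_sum => k _.
exact: sqr_sub_le.
Qed.

Lemma sqn_le L H s w : sqn H s w <= 2 * gsq L s w + 2 * sqd L H s w.
Proof.
rewrite /gsq /sqd /sqn !mulr_sumr -big_split/=; apply: ler_sum => k _.
have := sqr_sub_le (gval L k s w) (gval L k s w - H k s w).
by rewrite subKr.
Qed.

Lemma ItoP_sub a b H H' I I' : jm H -> jm H' -> ItoP a b H I -> ItoP a b H' I' ->
  ItoP a b (fun k s w => H k s w - H' k s w) (fun w => I w - I' w).
Proof.
move=> mH mH' h h' e e0.
have e4 : 0 < e / 4 by rewrite divr_gt0.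
have [L hL pL] := h _ e4; have [L' hL' pL'] := h' _ e4.
exists (lsub L L'); first exact: adapted_list_lsub.
have := hpI pL pL'; apply: hpS; first by lra.
move=> w [[d1 g1] [d2 g2]]; split; last first.
  rewrite /gint pairing_sub.
  rewrite (_ : _ - _ - _ = (gint L a b w - I w) - (gint L' a b w - I' w)); last first.
    by rewrite /gint; ring.
  apply: (le_trans (ler_normB _ _)); lra.
apply: (@le_trans _ _ (tint a b (fun s w => (2 * sqd L H s w + 2 * sqd L' H' s w)%R) w)).
  apply: tint_le => //.
  - by move=> *; exact: sqd_ge0.
  - apply: (jm_sqd (adapted_list_lsub hL hL')) => k.
    by apply: measurable_funB; [exact: mH|exact: mH'].
  - apply: measurable_funD; apply: measurable_funM => //.
      exact: (jm_sqd hL).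
    exact: (jm_sqd hL').
  - by move=> s _; exact: sqd_sub_le.
rewrite tintD//; try by [move=> *; exact: sqd_ge0]; try exact: (jm_sqd hL); try exact: (jm_sqd hL').
apply: (@le_trans _ _ (2%:E * (e / 4)%:E + 2%:E * (e / 4)%:E)%E).
  by apply: leeD; rewrite lee_pmul2l.
by rewrite -!EFinM -EFinD lee_fin; lra.
Qed.

(** Lenglart's domination inequality. Where the energy is at most c e', the list agrees with its
    truncation at that level; the truncation satisfies E J <= c e', and Markov's inequality gives J
    <= c off an event of probability e'. The functional J is left general to cover the square of one
    integral as well as sums of squared increments. *)
Lemma lenglart lo hi L c e e' (J : Omega -> seq elementary -> R) : 0 <= lo -> lo <= hi -> 0 < c -> 0 < e' -> adapted_list lo hi L ->
  (forall L L' w, (forall y, pairing L y w = pairing L' y w) -> J w L = J w L') ->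
  (forall L, adapted_list lo hi L -> measurable_fun setT (J ^~ L) /\ (forall w, 0 <= J w L) /\
     (\int[P]_w (J w L)%:E <= \int[P]_w (tint lo hi (gsq L) w))%E) ->
  hp e (fun w => (tint lo hi (gsq L) w <= (c * e')%:E)%E) ->
  hp (e + e') (fun w => J w L <= c).
Proof.
move=> lo0 lohi c0 e'0 hL ext hJ hq.
have ce0 : 0 <= c * e' by rewrite mulr_ge0// ltW.
have [L' [hL' qL' EL']] := bounded_energy_truncation cP BM lo0 lohi ce0 hL.
have [mJ [J0 IJ]] := hJ _ hL'.
have h1 : hp e' (fun w => J w L' <= c).
  apply: hp_markov => //; apply: (le_trans IJ).
  apply: (@le_trans _ _ (\int[P]_w (cst (c * e')%:E w))%E).
    apply: ge0_le_integral => //=.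
    - by move=> w _; apply: tint_ge0 => *; exact: gsq_ge0.
    - by apply: tint_meas => [s w|]; [exact: gsq_ge0|exact: gsq_joint hL'].
    - by move=> w _; exact: qL'.
  by rewrite integral_cst//= probability_setT mule1.
have := hpI hq h1; apply: hpS => // w [q1 j1].
by rewrite (ext L L')// => y; rewrite EL'.
Qed.

Lemma gint_small lo hi L c e e' : 0 <= lo -> lo <= hi -> 0 < c -> 0 < e' -> adapted_list lo hi L ->
  hp e (fun w => (tint lo hi (gsq L) w <= (c ^+ 2 * e')%:E)%E) ->
  hp (e + e') (fun w => `|gint L lo hi w| <= c).
Proof.
move=> lo0 lohi c0 e'0 hL hq.
have := @lenglart lo hi L (c ^+ 2) e e' (fun w L => gint L lo hi w ^+ 2) lo0 lohi _ e'0 hL _ _ hq.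
move=> h; apply: (hpS (lexx _) _ (h _ _ _)).
- move=> w hw; rewrite -(@ler_pXn2r _ 2)// ?nnegrE ?(ltW c0)//.
  by rewrite real_normK ?num_real.
- by rewrite exprn_gt0.
- by move=> L1 L2 w E; rewrite /gint E.
- move=> L1 hL1; have [F LL _ I] := gint_isometry cP BM lo0 (lexx _) lohi (lexx _) hL1.
  split; first by apply: measurable_funX; exact: (L2_meas LL).
  split; first by move=> w; exact: sqr_ge0.
  by rewrite /tint I ExE//; exact: LL.2.
Qed.

(** Finite expected energy of H makes the errors of truncated approximants uniformly integrable, so
    the energy error tends to 0 in mean. To compare I with the integral of a chosen L, a much finer
    L' is used: the isometry controls the difference of the two elementary integrals, L' is close to
    I off a small event, and on that event the square is first cut at an arbitrary level C. *)
Lemma ItoP_L2 a b H I : 0 <= a -> a <= b -> jm H -> measurable_fun setT I ->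
  ItoP a b H I -> (\int[P]_w tint a b (sqn H) w < +oo)%E ->
  forall e, 0 < e -> exists2 L, adapted_list a b L &
    (\int[P]_w tint a b (sqd L H) w <= e%:E)%E /\
    (\int[P]_w ((gint L a b w - I w) ^+ 2)%:E <= e%:E)%E.
Proof.
move=> a0 ab mH mI ItoH finH.
have mh : measurable_fun setT (tint a b (sqn H)).
  by apply: tint_meas => [s w|]; [exact: sqn_ge0|exact: jm_sqn].
have h0 w : (0 <= tint a b (sqn H) w)%E by apply: tint_ge0 => *; exact: sqn_ge0.
(* truncation at a large level gives an approximation in mean square *)
have stepA e : 0 < e -> exists2 L, adapted_list a b L &
    (\int[P]_w tint a b (sqd L H) w <= e%:E)%E /\ hp e (fun w => `|gint L a b w - I w| <= e).
  move=> e0.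
  have e1 : 0 < e / 40 by rewrite divr_gt0.
  have [M M1 hM] := tail_integral mh h0 finH e1.
  have M0 : 0 < M by rewrite (lt_le_trans ltr01).
  (* Off [A] and [B] the energy of L is at most 2 tau + 2 M <= M2, so truncation at M2 changes
     nothing there. *)
  pose M2 := 2 + 2 * M.
  have M20 : 0 <= M2 by rewrite /M2; lra.
  pose tau := Num.min (Num.min (e / 4) 1) (e / (4 * (2 * M2 + 2 * M))).
  have K0 : 0 < 2 * M2 + 2 * M by rewrite /M2; lra.
  have t0 : 0 < tau by rewrite !lt_min ltr01 !divr_gt0// mulr_gt0.
  have t1 : tau <= 1 by rewrite !ge_min lexx orbT.
  have te : tau <= e / 4 by rewrite !ge_min lexx.
  have tK : (2 * M2 + 2 * M) * tau <= e / 4.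
    apply: (@le_trans _ _ ((2 * M2 + 2 * M) * (e / (4 * (2 * M2 + 2 * M))))).
      by apply: ler_wpM2l; rewrite ?(ltW K0)// /tau !ge_min lexx orbT.
    rewrite le_eqVlt; apply/orP; left; apply/eqP; field.
    by rewrite gt_eqF.
  have [L hL [A [mA PA hA]]] := ItoH _ t0.
  have [L' [hL' qL' EL']] := bounded_energy_truncation cP BM a0 ab M20 hL.
  pose B := [set w | (M%:E < tint a b (sqn H) w)%E].
  have mB : measurable B.
    have := mh measurableT `]M%:E, +oo[%classic (emeasurable_itv _).
    rewrite setTI; congr measurable.
    by apply/seteqP; split=> w /=; rewrite /B in_itv/= andbT.
  have PB : (P B <= (e / 40)%:E)%E.
    apply: le_trans hM.
    apply: (@le_trans _ _ (\int[P]_(w in B) cst 1%E w)%E); first by rewrite integral_cst// mul1e.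
    apply: ge0_le_integral => //=.
    - exact: measurable_funTS.
    - by move=> w Bw; apply: le_trans (ltW Bw); rewrite lee_fin.
  have mS L0 : adapted_list a b L0 -> jmf (sqd L0 H) by move=> h; exact: (jm_sqd h).
  have mG L0 : adapted_list a b L0 -> jmf (gsq L0) by move=> h; exact: (gsq_joint h).
  have mN : jmf (sqn H) := jm_sqn mH.
  have same w : ~ A w -> ~ B w -> forall y, pairing L' y w = pairing L y w.
    move=> nA nB; apply: EL'.
    have [d1 _] := hA _ nA; move/negP: nB; rewrite -leNgt => nB.
    apply: (@le_trans _ _ (tint a b (fun s w => (2 * sqd L H s w + 2 * sqn H s w)%R) w)).
      apply: tint_le => //.
      + by move=> *; exact: gsq_ge0.
      + exact: mG.
      + by apply: measurable_funD; apply: measurable_funM => //; exact: mS.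
      + by move=> s _; exact: gsq_le.
    rewrite tintD//; try by [move=> *; exact: sqd_ge0]; try by [move=> *; exact: sqn_ge0]; try exact: mS.
    apply: (@le_trans _ _ (2%:E * tau%:E + 2%:E * M%:E)%E).
      by apply: leeD; rewrite lee_pmul2l.
    by rewrite -!EFinM -EFinD lee_fin /M2; lra.
  exists L' => //; split; last first.
    exists (A `|` B); split; first exact: measurableU.
      apply: (@le_trans _ _ (P A + P B)%E); first exact: measureU2.
      apply: (@le_trans _ _ (tau%:E + (e / 40)%:E)%E); first exact: leeD.
      by rewrite -EFinD lee_fin; lra.
    move=> w /not_orP[nA nB]; have [_ g1] := hA _ nA.
    by rewrite /gint (same w nA nB); apply: (le_trans g1); lra.
  (* Three regimes: outside [A] and [B] the error is at most tau; on [A] minus [B] it is at most 2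
     M2 + 2 M; on [B] it is at most 2 M2 plus twice the energy of H, and 2 M2 = 4 + 4 M <= 8 M is at
     most 8 times that energy, because M >= 1. Hence the factor 10. *)
  have bnd w : (tint a b (sqd L' H) w <=
     tau%:E + (2 * M2 + 2 * M)%:E * (\1_A w)%:E + 10%:E * ((tint a b (sqn H)) \_ B) w)%E.
    have gen : (tint a b (sqd L' H) w <= (2 * M2)%:E + 2%:E * tint a b (sqn H) w)%E.
      apply: (@le_trans _ _ (tint a b (fun s w => (2 * gsq L' s w + 2 * sqn H s w)%R) w)).
        apply: tint_le => //.
        + by move=> *; exact: sqd_ge0.
        + exact: mS.
        + by apply: measurable_funD; apply: measurable_funM => //; exact: mG.
        + by move=> s _; exact: sqd_le.
      rewrite tintD//; try by [move=> *; exact: gsq_ge0]; try by [move=> *; exact: sqn_ge0]; try exact: mG.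
      by apply: leeD => //; rewrite EFinM lee_pmul2l//; exact: qL'.
    have [Bw|nB] := pselect (B w).
      rewrite patchE mem_set//.
      apply: (le_trans gen).
      apply: (@le_trans _ _ (10%:E * tint a b (sqn H) w)%E); last first.
        rewrite leeDr// adde_ge0// ?lee_fin ?(ltW t0)//.
        by rewrite mulr_ge0 ?(ltW K0).
      have Mw : (M%:E <= tint a b (sqn H) w)%E := ltW Bw.
      rewrite (_ : 10%:E = 8%:E + 2%:E)%E; last by rewrite -EFinD; congr EFin; lra.
      rewrite ge0_muleDl ?lee_fin//; apply: leeD => //.
      apply: (@le_trans _ _ (8%:E * M%:E)%E); last by rewrite lee_pmul2l.
      by rewrite -EFinM lee_fin /M2; lra.
    rewrite patchE memNset// mule0 adde0.
    have [Aw|nA] := pselect (A w).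
      rewrite indicE mem_set// mule1.
      apply: (le_trans gen).
      apply: (@le_trans _ _ ((2 * M2)%:E + (2 * M)%:E)%E).
        apply: leeD => //; rewrite EFinM lee_pmul2l//.
        by move/negP: nB; rewrite -leNgt.
      by rewrite -!EFinD lee_fin; lra.
    rewrite indicE memNset// mule0 adde0.
    have [d1 _] := hA _ nA; apply: le_trans d1.
    rewrite le_eqVlt; apply/orP; left; apply/eqP.
    apply: eq_integral => s _; congr EFin; apply: eq_bigr => k _.
    by rewrite /gval (same w nA nB).
  have mpB : measurable_fun setT ((tint a b (sqn H)) \_ B).
    by apply/(measurable_restrictT _ _).1 => //; exact: measurable_funTS.
  have pB0 w : (0 <= ((tint a b (sqn H)) \_ B) w)%E by rewrite patchE; case: ifP.
  have mA1 : measurable_fun setT (fun w => (\1_A w)%:E : \bar R).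
    by apply/measurable_EFinP; exact: measurable_indic.
  apply: (@le_trans _ _ (\int[P]_w (tau%:E + (2 * M2 + 2 * M)%:E * (\1_A w)%:E + 10%:E * ((tint a b (sqn H)) \_ B) w))%E).
    apply: ge0_le_integral => //=.
    - by move=> w _; apply: tint_ge0 => *; exact: sqd_ge0.
    - by apply: tint_meas => [*|]; [exact: sqd_ge0|exact: mS].
    - apply: emeasurable_funD; first apply: emeasurable_funD => //; exact: measurable_funeM.
  rewrite ge0_integralD//=.
  - rewrite ge0_integralD//=.
    + rewrite integral_cst//= probability_setT mule1.
      rewrite !ge0_integralZl_EFin//; last exact: ltW.
      rewrite integral_indic// setIT -integral_mkcond.
      apply: (@le_trans _ _ (tau%:E + (2 * M2 + 2 * M)%:E * tau%:E + 10%:E * (e / 40)%:E)%E).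
        apply: leeD; last by rewrite lee_pmul2l.
        by apply: leeD => //; rewrite lee_pmul2l// lte_fin.
      by rewrite -!EFinM -!EFinD lee_fin; lra.
    + by move=> w _; rewrite lee_fin ltW.
    + by move=> w _; rewrite mule_ge0// lee_fin ltW.
    + exact: measurable_funeM.
  - by move=> w _; rewrite adde_ge0// lee_fin ?(ltW t0)// mulr_ge0 ?(ltW K0).
  - by apply: emeasurable_funD => //; exact: measurable_funeM.
  - by move=> w _; rewrite mule_ge0.
  - exact: measurable_funeM.
move=> e e0.
have e5 : 0 < e / 5 by rewrite divr_gt0.
have [L hL [dL _]] := stepA _ e5.
exists L => //; split; first by apply: (le_trans dL); rewrite lee_fin; lra.
have [_ LL _ _] := gint_isometry cP BM a0 (lexx _) ab (lexx _) hL.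
have mD : measurable_fun setT (fun w => (gint L a b w - I w) ^+ 2).
  by apply: measurable_funX; apply: measurable_funB => //; exact: (L2_meas LL).
apply: integral_min_le => //; first by move=> w; exact: sqr_ge0.
move=> C C0.
(* The final sum is 2 (2 e/5 + 2 e2) + 2 e2^2 + C e2. The bounds e2 <= 1, e2 <= e/40 and C e2 <=
   e/40 keep it below e. *)
pose e2 := Num.min (Num.min 1 (e / 40)) (e / (40 * (C + 1))).
have C1 : 0 < 40 * (C + 1) by lra.
have e20 : 0 < e2 by rewrite !lt_min ltr01 !divr_gt0.
have e21 : e2 <= 1 by rewrite !ge_min lexx.
have e22 : e2 <= e / 40 by rewrite !ge_min lexx orbT.
have e2C : C * e2 <= e / 40.
  apply: (@le_trans _ _ ((C + 1) * (e / (40 * (C + 1))))).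
    by apply: ler_pM => //; [exact: ltW|lra|rewrite !ge_min lexx orbT].
  rewrite le_eqVlt; apply/orP; left; apply/eqP; field.
  by rewrite gt_eqF//; lra.
have [L' hL' [dL' [A [mA PA hA]]]] := stepA _ e20.
have hS := adapted_list_lsub hL hL'.
have [_ LS _ IS] := gint_isometry cP BM a0 (lexx _) ab (lexx _) hS.
have bnd w : Num.min ((gint L a b w - I w) ^+ 2) C <=
    2 * gint (lsub L L') a b w ^+ 2 + (2 * e2 ^+ 2 + C * \1_A w).
  have s0 := sqr_ge0 (gint (lsub L L') a b w).
  have [Aw|nA] := pselect (A w).
    rewrite indicE mem_set// mulr1 ge_min; apply/orP; right.
    have := sqr_ge0 e2; lra.
  rewrite indicE memNset// mulr0 addr0 ge_min; apply/orP; left.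
  have g1 := hA _ nA.
  have -> : gint L a b w - I w = gint (lsub L L') a b w - (I w - gint L' a b w).
    by rewrite /gint pairing_sub; ring.
  apply: (le_trans (sqr_sub_le _ _)); rewrite lerD2l ler_pM2l//.
  rewrite -(real_normK (num_real (I w - _))) distrC.
  by rewrite ler_pXn2r// nnegrE// ltW.
have mA1 : measurable_fun setT (\1_A : Omega -> R) by exact: measurable_indic.
apply: (@le_trans _ _ (\int[P]_w (2 * gint (lsub L L') a b w ^+ 2 + (2 * e2 ^+ 2 + C * \1_A w))%:E)%E).
  apply: Ex_min_le.
  - exact: measurable_minr.
  - apply: measurable_funD.
      by apply: measurable_funM => //; apply: measurable_funX; exact: (L2_meas LS).
    by apply: measurable_funD => //; exact: measurable_funM.
  - by move=> w; rewrite bnd andbT le_min sqr_ge0.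
have L1S := LS.2.
have L1A : L1 P (fun w => C * \1_A w).
  apply: L2_L1; apply: L2_bdd; first exact: measurable_funM.
  by exists C => w; rewrite indicE; case: (_ \in _); rewrite ?mulr1 ?mulr0 ?normr0 ?ger0_norm.
rewrite ExE; last by apply: L1D; [exact: L1Z|apply: L1D => //; exact: L1_cst].
rewrite ExD; [|exact: L1Z|by apply: L1D => //; exact: L1_cst].
rewrite ExD//; last exact: L1_cst.
rewrite ExZ// Ex_cst.
have EA : Ex (fun w => C * \1_A w) <= C * e2.
  rewrite ExZ; last first.
    apply: L2_L1; apply: L2_bdd => //.
    by exists 1 => w; rewrite indicE; case: (_ \in _); rewrite ?normr0 ?normr1.
  rewrite ler_wpM2l//.
  rewrite -lee_fin -ExE; last first.
    apply: L2_L1; apply: L2_bdd => //.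
    by exists 1 => w; rewrite indicE; case: (_ \in _); rewrite ?normr0 ?normr1.
  by rewrite integral_indic// setIT.
have ES : Ex (fun w => gint (lsub L L') a b w ^+ 2) <= 2 * (e / 5) + 2 * e2.
  rewrite -lee_fin -IS.
  apply: (@le_trans _ _ (\int[P]_w (tint a b (fun s w => (2 * sqd L H s w + 2 * sqd L' H s w)%R) w))%E).
    apply: ge0_le_integral => //=.
    - by move=> w _; apply: tint_ge0 => *; exact: gsq_ge0.
    - by apply: tint_meas => [*|]; [exact: gsq_ge0|exact: gsq_joint hS].
    - apply: tint_meas => [*|].
        by rewrite addr_ge0// mulr_ge0// sqd_ge0.
      by apply: measurable_funD; apply: measurable_funM => //; [exact: (jm_sqd hL)|exact: (jm_sqd hL')].
    - move=> w _; apply: tint_le => //.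
      + by move=> *; exact: gsq_ge0.
      + exact: gsq_joint hS.
      + by apply: measurable_funD; apply: measurable_funM => //; [exact: (jm_sqd hL)|exact: (jm_sqd hL')].
      + by move=> s _; exact: gsq_sub_le.
  rewrite (eq_integral (fun w => 2%:E * tint a b (sqd L H) w + 2%:E * tint a b (sqd L' H) w)%E); last first.
    move=> w _; rewrite tintD//.
    + by move=> *; exact: sqd_ge0.
    + by move=> *; exact: sqd_ge0.
    + exact: (jm_sqd hL).
    + exact: (jm_sqd hL').
  have m1 : measurable_fun setT (tint a b (sqd L H)).
    by apply: tint_meas => [*|]; [exact: sqd_ge0|exact: (jm_sqd hL)].
  have m2 : measurable_fun setT (tint a b (sqd L' H)).
    by apply: tint_meas => [*|]; [exact: sqd_ge0|exact: (jm_sqd hL')].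
  have p1 w : (0 <= tint a b (sqd L H) w)%E by apply: tint_ge0 => *; exact: sqd_ge0.
  have p2 w : (0 <= tint a b (sqd L' H) w)%E by apply: tint_ge0 => *; exact: sqd_ge0.
  rewrite ge0_integralD//=; try (by move=> w _; rewrite mule_ge0); try exact: measurable_funeM.
  rewrite !ge0_integralZl_EFin//.
  apply: (@le_trans _ _ (2%:E * (e / 5)%:E + 2%:E * e2%:E)%E); last by rewrite -!EFinM -EFinD.
  by apply: leeD; rewrite lee_pmul2l.
rewrite lee_fin.
have : e2 ^+ 2 <= e2 by rewrite expr2 ler_piMl// ltW.
lra.
Qed.

End ito_lemmas.

Section enorm.
Context {R : realType}.

Lemma enorm_sqr p q (A : 'M[R]_(p, q)) : enorm A ^+ 2 = \sum_i \sum_j A i j ^+ 2.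
Proof. by rewrite sqr_sqrtr// sumr_ge0// => i _; apply: sumr_ge0 => j _; exact: sqr_ge0. Qed.

Lemma enorm_ge0 p q (A : 'M[R]_(p, q)) : 0 <= enorm A.
Proof. exact: sqrtr_ge0. Qed.

Lemma row_sqr_le_enorm p q (A : 'M[R]_(p, q)) i : \sum_j A i j ^+ 2 <= enorm A ^+ 2.
Proof.
rewrite enorm_sqr (bigD1 i)//= lerDl sumr_ge0// => j _.
by apply: sumr_ge0 => k _; exact: sqr_ge0.
Qed.

Lemma entry_le_enorm p q (A : 'M[R]_(p, q)) i j : `|A i j| <= enorm A.
Proof.
rewrite -(@ler_pXn2r _ 2)// ?nnegrE ?enorm_ge0// real_normK ?num_real//.
apply: le_trans (row_sqr_le_enorm A i).
by rewrite (bigD1 j)//= lerDl sumr_ge0// => k _; exact: sqr_ge0.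
Qed.

Lemma measurable_enorm_sqr d (S : measurableType d) (D : set S) p q (f : S -> 'M[R]_(p, q)) :
  measurable_mx D f -> measurable_fun D (fun s => enorm (f s) ^+ 2).
Proof.
move=> mf; rewrite (_ : (fun _ => _) = fun s => \sum_i \sum_j f s i j ^+ 2).
  apply: measurable_sum => i; apply: measurable_sum => j.
  exact: measurable_funX.
by apply/funext => s; rewrite enorm_sqr.
Qed.

Lemma measurable_enorm d (S : measurableType d) (D : set S) p q (f : S -> 'M[R]_(p, q)) :
  measurable D -> measurable_mx D f -> measurable_fun D (fun s => enorm (f s)).
Proof.
move=> mD mf; rewrite (_ : (fun _ => _) = Num.sqrt \o (fun s => enorm (f s) ^+ 2)).
  apply: (measurable_comp (F := setT)) => //.
    by apply: continuous_measurable_fun; exact: sqrt_continuous.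
  exact: measurable_enorm_sqr.
by apply/funext => s /=; rewrite sqrtr_sqr ger0_norm// enorm_ge0.
Qed.

End enorm.

(** * Simultaneous approximation at several times and the link with [is_ito_integral] *)

Section ito_simple.
Context {R : realType} {dO : measure_display} {Omega : measurableType dO}.
Variable P : probability Omega R.
Hypothesis cP : measure_is_complete P.
Variables (d : nat) (W : R -> Omega -> 'cV[R]_d).
Hypothesis BM : brownian_motion P W.
Notation Fm := (Fm P W).
Notation L2 := (L2 P).
Notation Ex := (Ex P).
Notation mu := (@lebesgue_measure R).
Notation elementary := (@elementary R dO Omega d).
Notation adapted_list := (adapted_list P W).
Notation gint := (gint W).
Notation hp := (hp P).
Notation ItoP := (ItoP P W).
Implicit Types (L : seq elementary) (H : 'I_d -> R -> Omega -> R) (I : Omega -> R)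
  (f g : R -> Omega -> R) (a b c e : R) (w : Omega).

Lemma gint_small_sub lo hi u v L c e e' : 0 <= lo -> lo <= u -> u <= v -> v <= hi ->
  0 < c -> 0 < e' -> adapted_list lo hi L ->
  hp e (fun w => (tint u v (gsq L) w <= (c ^+ 2 * e')%:E)%E) ->
  hp (e + e') (fun w => `|gint L u v w| <= c).
Proof.
move=> lo0 lu uv vh c0 e'0 hL hq.
have u0 := le_trans lo0 lu.
have hR : adapted_list u v (res u v L) by exact: adapted_list_res hL.
have := @gint_small _ _ _ P cP d W BM u v (res u v L) c e e' u0 uv c0 e'0 hR.
have E w : gint (res u v L) u v w = gint L u v w.
  rewrite /gint pairing_res.
  congr pairing; apply/funext => k; apply/funext => x.
  by rewrite clamp_id// clamp_ge clamp_le.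
move=> h; apply: (hpS (lexx _) _ (h _)) => [w|]; first by rewrite E.
apply: (hpS (lexx _) _ hq) => w; apply: le_trans.
apply: tint_le => //.
- by move=> *; exact: gsq_ge0.
- exact: (gsq_joint hR).
- exact: (gsq_joint hL).
- by move=> s _; rewrite gsq_res; case: ifP => // _; exact: gsq_ge0.
Qed.

(** The integrals I j come with unrelated approximating lists. On [0, t j] the list for [0, T] and
    the one for I j are both close to H in energy, so their integrals up to t j are close by
    [gint_small_sub]; one list thus approximates all the integrals. *)
Lemma ItoP_grid T H (N : nat) (t : nat -> R) (I : nat -> Omega -> R) J : 0 <= T ->
  jm H -> (forall j, (j < N)%N -> 0 <= t j <= T /\ ItoP 0 (t j) H (I j)) ->
  ItoP 0 T H J ->
  forall e, 0 < e -> exists2 L, adapted_list 0 T L &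
    hp e (fun w => (tint 0 T (sqd L H) w <= e%:E)%E /\
       forall j, (j < N)%N -> `|gint L 0 (t j) w - I j w| <= e).
Proof.
move=> T0 mH hI hJ e e0.
pose K := 8 * (N.+1%:R : R).
have K0 : 0 < K by rewrite mulr_gt0.
pose e' := e / K.
have e'0 : 0 < e' by rewrite divr_gt0.
pose e1 := Num.min e' ((e / 2) ^+ 2 * e' / 4).
have e10 : 0 < e1 by rewrite lt_min e'0 divr_gt0// mulr_gt0// exprn_gt0// divr_gt0.
have e11 : e1 <= e' by rewrite ge_min lexx.
have e12 : 4 * e1 <= (e / 2) ^+ 2 * e'.
  have : e1 <= (e / 2) ^+ 2 * e' / 4 by rewrite ge_min lexx orbT.
  lra.
have e'e : e' <= e / 8.
  rewrite /e' /K ler_pM2l// lef_pV2 ?posrE//.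
  by rewrite ler_peMr// ler1n.
have [L hL pL] := hJ _ e10.
exists L => //.
have hj (j : 'I_N) : hp (4 * e') (fun w => `|gint L 0 (t j) w - I j w| <= e).
  have [/andP[t0 tT] It] := hI j (ltn_ord j).
  have [Lj hLj pLj] := It _ e10.
  have hLj' : adapted_list 0 T Lj by exact: adapted_list_sub hLj.
  have hD := adapted_list_lsub hL hLj'.
  have sm : hp (e1 + e1 + e') (fun w => `|gint (lsub L Lj) 0 (t j) w| <= e / 2).
    apply: (gint_small_sub _ _ _ _ _ _ hD) => //; first by rewrite divr_gt0.
    have := hpI pL pLj; apply: (hpS (lexx _)) => w [[d1 _] [d2 _]].
    apply: (@le_trans _ _ (tint 0 (t j) (fun s w => (2 * sqd L H s w + 2 * sqd Lj H s w)%R) w)).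
      apply: tint_le => //.
      - by move=> *; exact: gsq_ge0.
      - exact: (gsq_joint hD).
      - by apply: measurable_funD; apply: measurable_funM => //; [exact: (jm_sqd hL)|exact: (jm_sqd hLj)].
      - by move=> s _; exact: gsq_sub_le.
    rewrite tintD//; try by [move=> *; exact: sqd_ge0]; try exact: (jm_sqd hL); try exact: (jm_sqd hLj).
    apply: (@le_trans _ _ (2%:E * e1%:E + 2%:E * e1%:E)%E); last first.
      by rewrite -!EFinM -EFinD lee_fin; lra.
    apply: leeD; rewrite lee_pmul2l//; apply: le_trans d1.
    apply: tint_sub => //; first by move=> *; exact: sqd_ge0.
    exact: (jm_sqd hL).
  have := hpI sm pLj; apply: hpS; first by lra.
  move=> w [g1 [_ g2]].
  have -> : gint L 0 (t j) w - I j w = gint (lsub L Lj) 0 (t j) w + (gint Lj 0 (t j) w - I j w).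
    by rewrite /gint pairing_sub; ring.
  apply: (le_trans (ler_normD _ _)); lra.
have := hpI pL (hp_all hj); apply: hpS.
  have -> : e1 + N%:R * (4 * e') = e1 + N%:R * (4 * e / K) by rewrite /e'; ring.
  have : N%:R * (4 * e / K) <= e / 2.
    rewrite mulrA ler_pdivrMr// /K -natr1.
    have : (0 : R) <= N%:R by []. nra.
  lra.
move=> w [[q1 _] q2]; split; first by apply: (le_trans q1); rewrite lee_fin; lra.
by move=> j jN; exact: (q2 (Ordinal jN)).
Qed.

(** [H'] is a jointly measurable process that agrees with H on [a, b] almost surely. It makes the
    energy errors random variables, so convergence in probability yields measurable exceptional
    sets; the i-th rows of the simple processes then form adapted grids. *)
Lemma ItoP_of_is_ito a b p (H : R -> Omega -> 'M[R]_(p, d)) (H' : R -> Omega -> 'M[R]_(p, d))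
    (I : Omega -> 'cV[R]_p) (i : 'I_p) : 0 <= a -> a <= b ->
  (forall i, jm (fun k s w => H' s w i k)) ->
  {ae P, forall w, forall s, a <= s <= b -> H s w = H' s w} ->
  is_ito_integral P (augmented_filtration P W) W a b H I ->
  ItoP a b (fun k s w => H' s w i k) (fun w => I w i 0).
Proof.
move=> a0 ab mH' HH' [mI [S [hS c1 c2]]] e e0.
have e2 : 0 < Num.min (e ^+ 2) e / 2 by rewrite divr_gt0// lt_min e0 exprn_gt0.
set e3 := Num.min (e ^+ 2) e / 2 in e2.
have e3e : e3 <= e / 2 by rewrite /e3 ler_pM2r// ge_min lexx orbT.
have mval k j : (j < sp_size (S k))%N -> forall i l, Fm (sp_time (S k) j) (fun w => sp_val (S k) j w i l).
  by move=> jk; have [_ _ h _] := hS k; have := h j jk; rewrite Fm_wrt.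
have mono k : forall i j, (i <= j <= sp_size (S k))%N -> sp_time (S k) i <= sp_time (S k) j.
  have [_ h _ _] := hS k => i0 j0 /andP[ij jN].
  elim: j0 ij jN => [|j0 IH]; first by rewrite leqn0 => /eqP ->.
  rewrite leq_eqVlt => /orP[/eqP->//|ij] jN.
  by apply: le_trans (h _ jN); apply: IH => //; exact: ltnW.
have mS k : measurable_mx setT (fun u : R * Omega => simple_value (S k) u.1 u.2).
  move=> i0 j0; rewrite (_ : (fun _ => _) = fun u : R * Omega =>
      \sum_(j < sp_size (S k)) \1_(`]sp_time (S k) j, sp_time (S k) j.+1]%classic) u.1 * sp_val (S k) j u.2 i0 j0).
    apply: measurable_sum => j; apply: measurable_funM.
      apply: measurableT_comp => //; apply: measurable_indic; exact: measurable_itv.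
    apply: (measurableT_comp (f := fun w => sp_val (S k) j w i0 j0)) => //.
    exact: (Fm_meas cP BM (mval k j (ltn_ord j) i0 j0)).
  by apply/funext => u; rewrite /simple_value summxE; apply: eq_bigr => j _; rewrite mxE.
have mI' k : measurable_mx setT (fun w => simple_integral W (S k) w - I w).
  move=> i0 j0; rewrite (_ : (fun _ => _) = fun w =>
     \sum_(j < sp_size (S k)) (\sum_l sp_val (S k) j w i0 l * dW W (sp_time (S k) j) (sp_time (S k) j.+1) l w) - I w i0 j0).
    apply: measurable_funB; last exact: mI.
    apply: measurable_sum => j; apply: measurable_sum => l.
    apply: measurable_funM.
      exact: (Fm_meas cP BM (mval k j (ltn_ord j) i0 l)).
    have [h _ _ _] := hS k.
    apply: (dW_meas BM).
      by have /andP[+ _] := h j (ltnW (ltn_ord j)); exact: le_trans.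
    by have /andP[+ _] := h j.+1 (ltn_ord j); exact: le_trans.
  apply/funext => w; rewrite !mxE /simple_integral summxE; congr (_ - _).
  apply: eq_bigr => j _; rewrite !mxE; apply: eq_bigr => l _.
  by rewrite /dW !mxE (ord1 j0).
have jd k : jmf (fun s w => enorm (simple_value (S k) s w - H' s w) ^+ 2).
  apply: measurable_enorm_sqr => i0 j0.
  rewrite (_ : (fun _ => _) = fun u : R * Omega => simple_value (S k) u.1 u.2 i0 j0 - H' u.1 u.2 i0 j0).
    by apply: measurable_funB; [exact: mS|exact: (mH' i0 j0)].
  by apply/funext => u; rewrite !mxE.
have p1 := cvg0_hp cP c1 (U' := fun k => tint a b (fun s w => enorm (simple_value (S k) s w - H' s w) ^+ 2)) _ _ e2.
have p2 := cvg0_hp cP c2 (U' := fun k w => (enorm (simple_integral W (S k) w - I w))%:E) _ _ e2.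
have {}p1 : \forall k \near \oo, hp e3 (fun w => (\int[mu]_(s in `[a, b]) (enorm (simple_value (S k) s w - H s w) ^+ 2)%:E < e3%:E)%E).
  apply: p1 => k; first by apply: tint_meas => // s w; exact: sqr_ge0.
  apply: filterS HH' => w hw; apply: eq_integral => s; rewrite inE/= in_itv/= => sab.
  by rewrite hw.
have {}p2 : \forall k \near \oo, hp e3 (fun w => (enorm (simple_integral W (S k) w - I w))%:E < e3%:E)%E.
  apply: p2 => k; last by apply: aeW.
  by apply/measurable_EFinP; apply: measurable_enorm => //; exact: mI'.
have [k [q1 q2]] : exists k, hp e3 (fun w => (\int[mu]_(s in `[a, b]) (enorm (simple_value (S k) s w - H s w) ^+ 2)%:E < e3%:E)%E)
    /\ hp e3 (fun w => (enorm (simple_integral W (S k) w - I w))%:E < e3%:E)%E.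
  near \oo => k; exists k; split; near: k; [exact: p1|exact: p2].
have [h1 h2 h3 [C h4]] := hS k.
pose v (j : nat) (l : 'I_d) (w : Omega) : R := sp_val (S k) j w i l.
have hG : adapted_grid P W a b (sp_size (S k)) (sp_time (S k)) v.
  split => //; first exact: mono.
  move=> j l jN; split; first exact: mval.
  by exists C => w; apply: le_trans (h4 j w jN); exact: entry_le_enorm.
have hL := adapted_list_glist cP BM hG.
exists (glist (sp_size (S k)) (sp_time (S k)) v) => //.
have := hpI (hp_ae HH') (hpI q1 q2); apply: hpS; first by lra.
move=> w [hw [d1 d2]]; split.
  apply: (@le_trans _ _ e3%:E); last by rewrite lee_fin; lra.
  apply: le_trans (ltW d1).
  rewrite [leRHS](_ : _ = tint a b (fun s w => enorm (simple_value (S k) s w - H' s w) ^+ 2) w); last first.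
    by apply: eq_integral => s; rewrite inE/= in_itv/= => sab; rewrite hw.
  apply: tint_le => //.
  - by move=> *; exact: sqd_ge0.
  - by apply: (jm_sqd hL); exact: mH'.
  - move=> s _; apply: le_trans (row_sqr_le_enorm _ i).
    rewrite le_eqVlt; apply/orP; left; apply/eqP.
    apply: eq_bigr => l _; rewrite gval_glist; last exact: mono.
    rewrite !mxE /simple_value summxE; congr ((_ - _) ^+ 2).
    by apply: eq_bigr => j _; rewrite mxE mulrC.
apply: (@le_trans _ _ e3); last by lra.
move: d2; rewrite lte_fin => /ltW; apply: le_trans.
apply: le_trans (entry_le_enorm _ i 0).
rewrite le_eqVlt; apply/orP; left; apply/eqP; congr `|_|.
rewrite !mxE /simple_integral summxE; congr (_ - _).
rewrite /gint pairing_glist; apply: eq_bigr => j _; rewrite !mxE; apply: eq_bigr => l _.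
have /andP[u1 u2] := h1 j (ltnW (ltn_ord j)).
have /andP[u3 u4] := h1 j.+1 (ltn_ord j).
by rewrite !clamp_id ?u1 ?u2 ?u3 ?u4// !mxE.
Unshelve. all: by end_near. Qed.

End ito_simple.

(** * Convergence in probability and tightness *)

Section compactness.
Context {R : realType}.

Lemma clamp_lip (u v x y : R) : `|clamp u v x - clamp u v y| <= `|x - y|.
Proof.
wlog xy : x y / x <= y.
  by move=> h; have [/h//|/ltW/h] := leP x y; rewrite distrC [leRHS]distrC.
rewrite distrC ger0_norm ?subr_ge0 ?clamp_homo// distrC ger0_norm ?subr_ge0//.
rewrite /clamp !/Order.max !/Order.min.
by do ! case: ifP => //; move=> *; lra.
Qed.

(** Uniform continuity near a compact set: x lies in K, but y may leave it. Continuity at each point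
    of K gives a local radius, and the near-covering form of compactness makes it uniform. *)
Lemma heine_ball (E : pseudoMetricType R) (F : E -> R) (K : set E) (eta : R) :
  continuous F -> compact K -> 0 < eta ->
  \forall r \near 0^'+, forall x y, K x -> ball x r y -> `|F x - F y| <= eta.
Proof.
move=> cF /compact_near_coveringP cK eta0.
have := @cK _ (0^'+ : set_system R) (fun r x => forall y, ball x r y -> `|F x - F y| <= eta) _.
move=> h.
have {}h : \forall r \near 0^'+, K `<=` (fun x => forall y, ball x r y -> `|F x - F y| <= eta).
  apply: h => x Kx.
  have e2 : 0 < eta / 2 by rewrite divr_gt0.
  have := cF x; move=> /cvgrPdist_le /(_ _ e2) /nbhs_ballP[rho /= rho0 hrho].
  have r2 : 0 < rho / 2 by rewrite divr_gt0.
  exists (ball x (rho / 2), [set r : R | r <= rho / 2]).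
    split => /=; first exact: nbhsx_ballx.
    exact: nbhs_right_le.
  move=> [x' r] /= [bx rr] y by_.
  have h1 : `|F x - F x'| <= eta / 2.
    by apply: hrho; apply: le_ball bx; lra.
  have h2 : `|F x - F y| <= eta / 2.
    apply: hrho; rewrite [rho]splitr; apply: ball_triangle bx _.
    exact: le_ball rr _ by_.
  rewrite (_ : F x' - F y = (F x - F y) - (F x - F x')); last by ring.
  apply: (le_trans (ler_normB _ _)); lra.
by apply: filterS h => r hr x y Kx; exact: hr.
Qed.

Lemma bounded_on_compact (E : pseudoMetricType R) (F : E -> R) (K : set E) :
  continuous F -> compact K -> exists C, forall x, K x -> `|F x| <= C.
Proof.
move=> cF cK.
have : compact (F @` K).
  by apply: continuous_compact => //; exact: continuous_subspaceT.
move=> /compact_bounded [M [_ hM]].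
exists (M + 1) => x Kx; apply: (hM (M + 1)); first by rewrite ltrDl.
by exists x.
Qed.

Lemma box_compact n (M : R) : compact [set v : 'cV[R]_n | forall i, `|v i 0| <= M].
Proof.
have c := @rV_compact R n (fun=> `[- M, M]%classic) (fun=> @segment_compact R (- M) M).
have := @continuous_compact _ _ (fun v : 'rV[R]_n => v^T) _ _ c.
rewrite (_ : [set v : 'cV[R]_n | _] = trmx @` [set v : 'rV[R]_n | forall i, `[- M, M]%classic (v ord0 i)]).
  apply; apply: continuous_subspaceT => v U [Q hQ hU].
  exists (fun i j => Q j i); first by move=> i j; have := hQ j i; rewrite mxE.
  by move=> u hu; apply: hU => i j; rewrite mxE; exact: hu.
apply/seteqP; split=> [v /= hv|v /= [u hu <-] i].
  exists v^T; last by rewrite trmxK.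
  by move=> i; rewrite mxE /= in_itv/= -ler_norml.
by rewrite mxE ler_norml; have := hu i; rewrite /= in_itv/=.
Qed.

End compactness.

(** * Calculus of convergence and boundedness in probability *)

Section in_probability.
Context {R : realType} {dO : measure_display} {Omega : measurableType dO}.
Variable P : probability Omega R.
Notation hp := (hp P).
Implicit Types (e : R) (U V : nat -> Omega -> R).

(** Continuity of the probability along an increasing sequence that exhausts the space. The
    tightness of path norms and of moduli of continuity rests on it. *)
Lemma hp_increasing (B : nat -> set Omega) e : (forall k, measurable (B k)) ->
  (forall k, B k `<=` B k.+1) -> (forall w, exists k, B k w) -> 0 < e ->
  exists k, hp e (B k).
Proof.
move=> mB incB full e0.
have U : \bigcup_n B n = setT by apply/seteqP; split => // w _; have [k Bk] := full w; exists k.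
have : P (B k) @[k --> \oo] --> P (\bigcup_n B n).
  apply: nondecreasing_cvg_mu => //; first by rewrite U.
  by apply/nondecreasing_seqP => n; apply/subsetPset; exact: incB.
rewrite U probability_setT => c.
have : \forall k \near \oo, ((1 - e)%:E < P (B k))%E.
  move: c => /(_ [set x | ((1 - e)%:E < x)%E]); apply.
  by apply: open_ereal_gt'; rewrite lte_fin ltrBlDr ltrDl.
move=> [k _ hk]; exists k; exists (~` B k); split.
- exact: measurableC.
- rewrite probability_setC//.
  have := hk k (leqnn k); rewrite -(fineK (fin_num_measure P _ (mB k))) -EFinB lee_fin lte_fin /=; lra.
- by move=> w /contrapT.
Qed.

(* U_N tends to 0 in probability, respectively is bounded in probability. *)
Definition cvP U := forall e, 0 < e -> \forall N \near \oo, hp e (fun w => `|U N w| <= e).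
Definition OP U := forall e, 0 < e -> exists2 K, 0 <= K & \forall N \near \oo, hp e (fun w => `|U N w| <= K).

Lemma cvP_OP U : cvP U -> OP U.
Proof. by move=> h e e0; exists e; [exact: ltW|exact: h]. Qed.

Lemma cvPD U V : cvP U -> cvP V -> cvP (fun N w => U N w + V N w).
Proof.
move=> hU hV e e0; have e2 : 0 < e / 2 by rewrite divr_gt0.
near=> N.
have h1 : hp (e / 2) (fun w => `|U N w| <= e / 2) by near: N; exact: hU.
have h2 : hp (e / 2) (fun w => `|V N w| <= e / 2) by near: N; exact: hV.
have := hpI h1 h2; apply: hpS; first by lra.
move=> w [u v]; apply: (le_trans (ler_normD _ _)); lra.
Unshelve. all: by end_near. Qed.

Lemma OPD U V : OP U -> OP V -> OP (fun N w => U N w + V N w).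
Proof.
move=> hU hV e e0; have e2 : 0 < e / 2 by rewrite divr_gt0.
have [K K0 hK] := hU _ e2; have [K' K'0 hK'] := hV _ e2.
exists (K + K'); first exact: addr_ge0.
near=> N.
have h1 : hp (e / 2) (fun w => `|U N w| <= K) by near: N.
have h2 : hp (e / 2) (fun w => `|V N w| <= K') by near: N.
have := hpI h1 h2; apply: hpS; first by lra.
move=> w [u v]; apply: (le_trans (ler_normD _ _)); lra.
Unshelve. all: by end_near. Qed.

Lemma OPM U V : OP U -> OP V -> OP (fun N w => U N w * V N w).
Proof.
move=> hU hV e e0; have e2 : 0 < e / 2 by rewrite divr_gt0.
have [K K0 hK] := hU _ e2; have [K' K'0 hK'] := hV _ e2.
exists (K * K'); first exact: mulr_ge0.
near=> N.
have h1 : hp (e / 2) (fun w => `|U N w| <= K) by near: N.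
have h2 : hp (e / 2) (fun w => `|V N w| <= K') by near: N.
have := hpI h1 h2; apply: hpS; first by lra.
by move=> w [u v]; rewrite normrM; exact: ler_pM.
Unshelve. all: by end_near. Qed.

Lemma cvPM_OP U V : cvP U -> OP V -> cvP (fun N w => U N w * V N w).
Proof.
move=> hU hV e e0; have e2 : 0 < e / 2 by rewrite divr_gt0.
have [K K0 hK] := hV _ e2.
have e3 : 0 < Num.min (e / 2) (e / (K + 1)).
  by rewrite lt_min e2 divr_gt0// ltr_wpDl.
near=> N.
have h1 : hp (Num.min (e / 2) (e / (K + 1))) (fun w => `|U N w| <= Num.min (e / 2) (e / (K + 1))).
  by near: N; exact: hU.
have h2 : hp (e / 2) (fun w => `|V N w| <= K) by near: N.
have := hpI h1 h2; apply: hpS; first by rewrite [leRHS]splitr lerD2r ge_min lexx.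
move=> w [u v]; rewrite normrM.
apply: (@le_trans _ _ (e / (K + 1) * K)).
  by apply: ler_pM => //; apply: le_trans u _; rewrite ge_min lexx orbT.
by rewrite mulrAC ler_pdivrMr ?ltr_wpDl// ler_pM2l// lerDl.
Unshelve. all: by end_near. Qed.

Lemma OP_cst (c : R) : OP (fun=> fun=> c).
Proof.
move=> e e0; exists `|c| => //; apply: nearW => N.
by exists set0; rewrite measure0 lee_fin ltW.
Qed.

Lemma cvP_cst (u : R ^nat) : u n @[n --> \oo] --> (0 : R) -> cvP (fun N _ => u N).
Proof.
move=> c e e0; near=> N; exists set0; split => //.
  by rewrite measure0 lee_fin ltW.
move=> w _; near: N.
by have := c; move/cvgrPdist_le => /(_ e e0); apply: filterS => N; rewrite sub0r normrN.
Unshelve. all: by end_near. Qed.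

Lemma cvP_le U V : (forall N, {ae P, forall w, `|U N w| <= `|V N w|}) -> cvP V -> cvP U.
Proof.
move=> UV hV e e0; near=> N.
have h1 : hp e (fun w => `|V N w| <= e) by near: N; exact: hV.
have := hpI (hp_ae (UV N)) h1; apply: hpS; first by rewrite add0r.
by move=> w [h]; exact: le_trans.
Unshelve. all: by end_near. Qed.

Lemma cvPZ (c : R) U : cvP U -> cvP (fun N w => c * U N w).
Proof.
move=> hU; by have := cvPM_OP hU (OP_cst c); apply: cvP_le => N; apply: aeW => w; rewrite mulrC.
Qed.

Lemma OP_le U V : (forall N, {ae P, forall w, `|U N w| <= `|V N w|}) -> OP V -> OP U.
Proof.
move=> UV hV e e0; have [K K0 hK] := hV e e0; exists K => //; near=> N.
have h1 : hp e (fun w => `|V N w| <= K) by near: N.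
have := hpI (hp_ae (UV N)) h1; apply: hpS; first by rewrite add0r.
by move=> w [h]; exact: le_trans.
Unshelve. all: by end_near. Qed.

Lemma cvP_sum (I : finType) (U : I -> nat -> Omega -> R) :
  (forall i, cvP (U i)) -> cvP (fun N w => \sum_i U i N w).
Proof.
move=> h; elim: (index_enum I) => [|i s IH].
  have h0 : cvP (fun _ _ => 0) by apply: cvP_cst; exact: cvg_cst.
  by apply: (cvP_le _ h0) => N; apply: aeW => w; rewrite big_nil.
by have := cvPD (h i) IH; apply: cvP_le => N; apply: aeW => w; rewrite big_cons.
Qed.

Lemma OP_sum (I : finType) (U : I -> nat -> Omega -> R) :
  (forall i, OP (U i)) -> OP (fun N w => \sum_i U i N w).
Proof.
move=> h; elim: (index_enum I) => [|i s IH].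
  by have := OP_cst 0; apply: OP_le => N; apply: aeW => w; rewrite big_nil.
by have := OPD (h i) IH; apply: OP_le => N; apply: aeW => w; rewrite big_cons.
Qed.

(** The constant c is fixed first, so small that c V is negligible by tightness of V, and N is then
    taken large for this c. It is meant for bounds of the form 2xy <= c x^2 + y^2 / c, where the
    x-part is only tight. *)
Lemma cvP_interp U V (Wc : R -> nat -> Omega -> R) : OP V -> (forall c, 0 < c -> cvP (Wc c)) ->
  (forall c N w, 0 < c -> `|U N w| <= c * V N w + Wc c N w) -> cvP U.
Proof.
move=> hV hW UV e e0; have e2 : 0 < e / 2 by rewrite divr_gt0.
have [K K0 hK] := hV _ e2.
have c0 : 0 < e / 2 / (K + 1) by rewrite !divr_gt0// ltr_wpDl.
near=> N.
have h1 : hp (e / 2) (fun w => `|V N w| <= K) by near: N.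
have h2 : hp (e / 2) (fun w => `|Wc (e / 2 / (K + 1)) N w| <= e / 2) by near: N; exact: hW.
have := hpI h1 h2; apply: hpS; first by lra.
move=> w [v c]; apply: (le_trans (UV _ N w c0)).
rewrite [leRHS]splitr; apply: lerD; last exact: le_trans (ler_norm _) c.
apply: (@le_trans _ _ (e / 2 / (K + 1) * K)).
  by rewrite ler_pM2l//; exact: le_trans (ler_norm _) v.
by rewrite mulrAC ler_pdivrMr ?ltr_wpDl// ler_pM2l// lerDl.
Unshelve. all: by end_near. Qed.

(** Localisation without stopping times: U coincides with a bounded-coefficient version [UM M] off
    an event of small probability, at a level M independent of N. *)
Lemma cvP_local U (UM : R -> nat -> Omega -> R) :
  (forall e, 0 < e -> exists M, \forall N \near \oo, hp e (fun w => U N w = UM M N w)) ->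
  (forall M, cvP (UM M)) -> cvP U.
Proof.
move=> h hM e e0; have e2 : 0 < e / 2 by rewrite divr_gt0.
have [M h1] := h _ e2.
near=> N.
have p1 : hp (e / 2) (fun w => U N w = UM M N w) by near: N.
have p2 : hp (e / 2) (fun w => `|UM M N w| <= e / 2) by near: N; exact: hM.
have := hpI p1 p2; apply: hpS; first by lra.
by move=> w [-> u]; apply: (le_trans u); lra.
Unshelve. all: by end_near. Qed.

Lemma cvP_markov U : (forall N, measurable_fun setT (U N)) ->
  (forall N w, 0 <= U N w) ->
  (exists2 u : R ^nat, u n @[n --> \oo] --> (0 : R) &
    forall N, (\int[P]_w (U N w)%:E <= (u N)%:E)%E) -> cvP U.
Proof.
move=> mU U0 [u cu hu] e e0; have ee : 0 < e * e by rewrite mulr_gt0.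
near=> N.
have uN : u N <= e * e.
  near: N; move/cvgrPdist_le : cu => /(_ _ ee); apply: filterS => N.
  by rewrite sub0r normrN; exact: le_trans (ler_norm _).
have : hp e (fun w => U N w <= e).
  apply: hp_markov => //; apply: le_trans (hu N) _.
  by rewrite lee_fin.
by apply: (hpS (lexx _)) => w; rewrite ger0_norm.
Unshelve. all: by end_near. Qed.

Lemma OP_markov U K : (forall N, measurable_fun setT (U N)) ->
  (forall N w, 0 <= U N w) -> 0 <= K ->
  (forall N, (\int[P]_w (U N w)%:E <= K%:E)%E) -> OP U.
Proof.
move=> mU U0 K0 hu e e0; have K1 : 0 < (K + 1) / e by rewrite divr_gt0// ltr_wpDl.
exists ((K + 1) / e); first exact: ltW.
apply: nearW => N.
have : hp e (fun w => U N w <= (K + 1) / e).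
  apply: hp_markov => //; apply: le_trans (hu N) _.
  by rewrite lee_fin divfK ?gt_eqF// lerDl.
by apply: (hpS (lexx _)) => w; rewrite ger0_norm.
Qed.

End in_probability.

(** * Tightness of norms and of moduli of continuity *)

Section path_regularity.
Context {R : realType} {dO : measure_display} {Omega : measurableType dO}.
Variable P : probability Omega R.
Notation hp := (hp P).
Variable Phi : R -> Omega -> R.
Hypothesis mPhi : forall s, measurable_fun setT (Phi s).
Hypothesis cPhi : forall w, continuous (Phi ^~ w).

Lemma bigcap_rat_measurable (F : rat -> set Omega) : (forall q, measurable (F q)) ->
  measurable (\bigcap_q F q).
Proof.
move=> mF; rewrite (_ : \bigcap_q F q = \bigcap_n (if unpickle n is Some q then F q else setT)).
  by apply: bigcapT_measurable => n; case: unpickle.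
apply/seteqP; split=> w h; first by move=> n _; case: unpickle => // q; exact: h.
by move=> q _; have := h (pickle q) I; rewrite pickleK.
Qed.

Lemma rat_near (s r : R) : 0 < r -> exists q : rat, `|s - ratr q| < r.
Proof.
move=> r0; have /rat_in_itvoo[q] : s < s + r by rewrite ltrDl.
rewrite in_itv/= => /andP[q1 q2]; exists q.
by rewrite ltr_distl; apply/andP; split; lra.
Qed.

(* For continuous paths the suprema over rational times are measurable. *)
Lemma tight_bound (a b e : R) : a <= b -> 0 < e ->
  exists2 M, 0 <= M & hp e (fun w => forall s : R, a <= s <= b -> `|Phi s w| <= M).
Proof.
move=> ab e0.
(* Clamped rationals are dense in [a, b] even when the interval is a single irrational point, and
   clamping does not increase distances. *)
pose B (k : nat) := \bigcap_(q in [set: rat]) [set w | `|Phi (clamp a b (ratr q)) w| <= k%:R].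
have [||w|k hk] := @hp_increasing _ _ _ P B e _ _ _ e0.
- move=> k; apply: bigcap_rat_measurable => q.
  rewrite -[X in measurable X]setTI; apply: measurable_fun_le => //.
  by apply: measurableT_comp => //; exact: mPhi.
- by move=> k w h q _ /=; apply: (le_trans (h q I)); rewrite ler_nat.
- have [C hC] := bounded_on_compact (cPhi (w := w)) (@segment_compact R a b).
  have [k hk] : exists k : nat, C <= k%:R.
    by exists (Num.bound `|C|); rewrite (le_trans (ler_norm _))// ltW// archi_boundP.
  exists k => q _ /=; apply: le_trans hk; apply: hC.
  by rewrite /= in_itv/= clamp_ge clamp_le.
exists k%:R => //; apply: (hpS (lexx _) _ hk) => w hw s sab.
rewrite leNgt; apply/negP => h.
have := cPhi (w := w) (x := s); move/cvgrPdist_lt.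
have h0 : 0 < `|Phi s w| - k%:R by rewrite subr_gt0.
move=> /(_ _ h0) /nbhs_ballP[r /= r0 hr].
have [q hq] := rat_near s r0.
have := hr (clamp a b (ratr q)); rewrite /ball/= => /(_ _) h2.
have {}h2 : `|Phi s w - Phi (clamp a b (ratr q)) w| < `|Phi s w| - k%:R.
  apply: h2; apply: le_lt_trans hq; rewrite -{1}(clamp_id sab); exact: clamp_lip.
have := hw q I => /= h3.
have := ler_normD (Phi s w - Phi (clamp a b (ratr q)) w) (Phi (clamp a b (ratr q)) w).
rewrite subrK; lra.
Qed.

(** The events are conditions on countably many pairs of rational times closer than 1/(k+1); by
    uniform continuity every path satisfies one of them, so some k captures probability 1 - e. Any r
    < 1/(k+1) then works for real times. *)
Lemma tight_modulus (a b e eta : R) : a <= b -> 0 < e -> 0 < eta ->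
  \forall r \near 0^'+, hp e (fun w => forall s s' : R, a <= s <= b -> a <= s' <= b ->
     `|s - s'| <= r -> `|Phi s w - Phi s' w| <= eta).
Proof.
move=> ab e0 eta0.
pose B (k : nat) := \bigcap_(q in [set: rat]) \bigcap_(q' in [set: rat])
  [set w | `|ratr q - ratr q'| < k.+1%:R^-1 :> R -> `|Phi (clamp a b (ratr q)) w - Phi (clamp a b (ratr q')) w| <= eta].
have [||w|k hk] := @hp_increasing _ _ _ P B e _ _ _ e0.
- move=> k; apply: bigcap_rat_measurable => q; apply: bigcap_rat_measurable => q'.
  have [h|h] := pselect (`|ratr q - ratr q'| < k.+1%:R^-1 :> R); last first.
    by rewrite (_ : [set _ | _] = setT)//; apply/seteqP; split => // w _ /= /h.
  rewrite (_ : [set _ | _] = [set w | `|Phi (clamp a b (ratr q)) w - Phi (clamp a b (ratr q')) w| <= eta]).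
    rewrite -[X in measurable X]setTI; apply: measurable_fun_le => //.
    apply: measurableT_comp => //; apply: measurable_funB; exact: mPhi.
  by apply/seteqP; split => w /=; [exact|move=> ? ?].
- move=> k w h q _ q' _ /= qq; apply: h => //=.
  by apply: (lt_le_trans qq); rewrite lef_pV2 ?posrE// ler_nat.
- have := heine_ball (cPhi (w := w)) (@segment_compact R a b) eta0.
  move=> h; have [k hk] : exists k : nat, forall x y, `[a, b]%classic x -> ball x k.+1%:R^-1 y -> `|Phi x w - Phi y w| <= eta.
    case: h => r /= r0 hr.
    have [k hk] : exists k : nat, k.+1%:R^-1 < r.
      exists (Num.bound r^-1); rewrite invf_plt ?posrE//.
      apply: (@lt_trans _ _ (Num.bound r^-1)%:R); last by rewrite ltr_nat.
      by apply: archi_boundP; rewrite invr_ge0 ltW.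
    by exists k; apply: (hr k.+1%:R^-1) => //; rewrite /ball/= sub0r normrN gtr0_norm.
  exists k => q _ q' _ /= qq; apply: hk; first by rewrite /= in_itv/= clamp_ge clamp_le.
  by rewrite /ball/=; apply: le_lt_trans qq; exact: clamp_lip.
near=> r.
apply: (hpS (lexx _) _ hk) => w hw s s' sab sab' ss.
apply/ler_addgt0Pr => ep ep0.
have ep2 : 0 < ep / 2 by rewrite divr_gt0.
have rk : r < k.+1%:R^-1 by near: r; exact: nbhs_right_lt.
(* Moving both times to rationals by less than half of the slack [k.+1%:R^-1 - r] keeps the
   rationals closer than [k.+1%:R^-1]; the two moves cost [ep] in total. *)
have app u : a <= u <= b -> exists q : rat, `|u - ratr q| < (k.+1%:R^-1 - r) / 2 /\
   `|Phi u w - Phi (clamp a b (ratr q)) w| <= ep / 2.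
  move=> uab.
  have := cPhi (w := w) (x := u); move/cvgrPdist_le => /(_ _ ep2) /nbhs_ballP[r1 /= r10 hr].
  have r2 : 0 < Num.min r1 ((k.+1%:R^-1 - r) / 2) by rewrite lt_min r10 divr_gt0// subr_gt0.
  have [q hq] := rat_near u r2; exists q; move: hq; rewrite lt_min => /andP[q1 q2]; split => //.
  apply: hr; rewrite /ball/=; apply: le_lt_trans q1; rewrite -{1}(clamp_id uab); exact: clamp_lip.
have [q [q1 q2]] := app s sab; have [q' [q1' q2']] := app s' sab'.
have := hw q I q' I => /= h3.
have {}h3 : `|Phi (clamp a b (ratr q)) w - Phi (clamp a b (ratr q')) w| <= eta.
  apply: h3.
  rewrite (_ : ratr q - ratr q' = (s - s') - (s - ratr q) + (s' - ratr q')); last by ring.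
  apply: (le_lt_trans (ler_normD _ _)).
  have := ler_normB (s - s') (s - ratr q).
  by move: (k.+1%:R^-1 : R) q1 q1' => kk; lra.
rewrite (_ : Phi s w - Phi s' w = (Phi s w - Phi (clamp a b (ratr q)) w) - (Phi s' w - Phi (clamp a b (ratr q')) w) + (Phi (clamp a b (ratr q)) w - Phi (clamp a b (ratr q')) w)); last by ring.
apply: (le_trans (ler_normD _ _)).
have := ler_normB (Phi s w - Phi (clamp a b (ratr q)) w) (Phi s' w - Phi (clamp a b (ratr q')) w); lra.
Unshelve. all: by end_near. Qed.

End path_regularity.

(** * Uniform grids *)

Section grid.
Context {R : realType}.
Variables (t T : R).
Hypothesis tT : t < T.

(** There are [N.+1] steps: no grid is empty, and the steps are indexed by j <= N. *)
Definition dt (N : nat) : R := (T - t) / N.+1%:R.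
Definition gr (N j : nat) : R := t + j%:R * dt N.

Lemma dt_gt0 N : 0 < dt N.
Proof. by rewrite divr_gt0// subr_gt0. Qed.

Lemma gr0 N : gr N 0 = t.
Proof. by rewrite /gr mul0r addr0. Qed.

Lemma grN N : gr N N.+1 = T.
Proof. by rewrite /gr /dt mulrC divfK ?pnatr_eq0// addrC subrK. Qed.

Lemma grS N j : gr N j.+1 - gr N j = dt N.
Proof. by rewrite /gr -natr1; ring. Qed.

Lemma gr_homo N i j : (i <= j)%N -> gr N i <= gr N j.
Proof. by move=> ij; rewrite /gr lerD2l ler_wpM2r ?ler_nat// ltW// dt_gt0. Qed.

Lemma gr_lt N j : gr N j < gr N j.+1.
Proof. by rewrite -subr_gt0 grS dt_gt0. Qed.

Lemma gr_in N j : (j <= N.+1)%N -> t <= gr N j <= T.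
Proof. by move=> jN; rewrite -{1}(gr0 N) -(grN N) !gr_homo. Qed.

Lemma sum_dt N : \sum_(j < N.+1) dt N = T - t.
Proof. by rewrite sumr_const card_ord -mulr_natl /dt mulrC divfK ?pnatr_eq0. Qed.

Lemma dt_near (Q : R -> Prop) : (\forall r \near 0^'+, Q r) -> \forall N \near \oo, Q (dt N).
Proof.
move=> [r /= r0 hr]; near=> N; apply: hr; last exact: dt_gt0.
rewrite /ball/= sub0r normrN gtr0_norm ?dt_gt0// /dt ltr_pdivrMr//.
rewrite mulrC -ltr_pdivrMr//.
have : (T - t) / r < N%:R by near: N; exact: nbhs_infty_gtr.
by move=> h; apply: (lt_trans h); rewrite ltr_nat.
Unshelve. all: by end_near. Qed.

Lemma dt_cvg0 : dt N @[N --> \oo] --> (0 : R).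
Proof.
apply/cvgrPdist_le => e e0.
have := @dt_near (fun r => r <= e) (nbhs_right_le e0).
by apply: filterS => N; rewrite sub0r normrN gtr0_norm// dt_gt0.
Qed.

End grid.

(** * Path suprema and oscillations along a grid *)

Section paths.
Context {R : realType} {dO : measure_display} {Omega : measurableType dO}.
Variable P : probability Omega R.
Notation hp := (hp P).
Notation cvP := (cvP P).
Notation OP := (OP P).
Variables (t T : R).
Hypothesis tT : t < T.
Notation gr := (gr t T).
Notation dt := (dt t T).

Section real_process.
Variable Phi : R -> Omega -> R.
Hypothesis mPhi : forall s, measurable_fun setT (Phi s).
Hypothesis cPhi : forall w, continuous (Phi ^~ w).

Definition nrm (w : Omega) : R := sup [set `|Phi s w| | s in `[t, T]].
Definition osc N w : R := sup [set x | exists j s, [/\ (j <= N)%N, gr N j <= s <= gr N j.+1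
   & x = `|Phi s w - Phi (gr N j) w|]].

Lemma nrm_has_ub w : has_ubound [set `|Phi s w| | s in `[t, T]].
Proof.
have [C hC] := bounded_on_compact (cPhi (w := w)) (@segment_compact R t T).
by exists C => _ [s st <-]; exact: hC.
Qed.

Lemma le_nrm s w : t <= s <= T -> `|Phi s w| <= nrm w.
Proof.
move=> st; apply: (ub_le_sup (nrm_has_ub w)).
by exists s => //=; rewrite in_itv/=.
Qed.

Lemma nrm_ge0 w : 0 <= nrm w.
Proof. by apply: le_trans (le_nrm (s := t) w _) => //; rewrite lexx ltW. Qed.

Lemma nrm_le w M : (forall s, t <= s <= T -> `|Phi s w| <= M) -> nrm w <= M.
Proof.
move=> h; apply: ge_sup.
  by exists `|Phi t w|; exists t => //=; rewrite in_itv/= lexx ltW.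
by move=> _ [s /= st <-]; apply: h; move: st; rewrite in_itv.
Qed.

Lemma nrm_tight e : 0 < e -> exists2 M, 0 <= M & hp e (fun w => nrm w <= M).
Proof.
move=> e0; have [M M0 h] := tight_bound P mPhi cPhi (ltW tT) e0.
by exists M => //; apply: (hpS (lexx _) _ h) => w hw; exact: nrm_le.
Qed.

Lemma OP_nrm : OP (fun=> nrm).
Proof.
move=> e e0; have [M M0 h] := nrm_tight e0; exists M => //; apply: nearW => _.
by apply: (hpS (lexx _) _ h) => w; rewrite ger0_norm// nrm_ge0.
Qed.

Lemma le_osc N j s w : (j <= N)%N -> gr N j <= s <= gr N j.+1 ->
  `|Phi s w - Phi (gr N j) w| <= osc N w.
Proof.
move=> jN sj; apply: ub_le_sup; last by exists j, s.
exists (nrm w + nrm w) => _ [j' [s' [jN' /andP[s1 s2] ->]]].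
apply: (le_trans (ler_normB _ _)); apply: lerD; apply: le_nrm.
  have /andP[h1 _] := gr_in tT (leqW jN').
  have /andP[_ h2] := @gr_in _ t T tT N j'.+1 jN'.
  by rewrite (le_trans h1 s1) (le_trans s2 h2).
exact: (gr_in tT (leqW jN')).
Qed.

Lemma osc_ge0 N w : 0 <= osc N w.
Proof.
have h : gr N 0 <= gr N 0 <= gr N 1 by rewrite lexx ltW// gr_lt.
by apply: le_trans (le_osc w (leq0n N) h).
Qed.

Lemma cvP_osc : cvP osc.
Proof.
move=> e e0.
have := dt_near tT (tight_modulus P mPhi cPhi (ltW tT) e0 e0).
apply: filterS => N; apply: (hpS (lexx _)) => w hw.
rewrite ger0_norm ?osc_ge0//; apply: ge_sup.
  by exists `|Phi (gr N 0) w - Phi (gr N 0) w|; exists 0%N, (gr N 0); rewrite lexx ltW// gr_lt.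
move=> _ [j [s [jN /andP[s1 s2] ->]]].
have /andP[h1 h1'] := gr_in tT (leqW jN).
have /andP[h2' h2] := @gr_in _ t T tT N j.+1 jN.
apply: hw.
- by rewrite (le_trans h1 s1) (le_trans s2 h2).
- by rewrite h1.
- by rewrite ger0_norm ?subr_ge0// -(@grS _ t T N j) lerD2r.
Qed.

End real_process.

Section vector_process.
Variables (n : nat) (X : R -> Omega -> 'cV[R]_n).
Hypothesis mX : forall s p, measurable_fun setT (fun w => X s w p 0).
Hypothesis cX : forall w p, continuous (fun s => X s w p 0).
Variable F : R * 'cV[R]_n * 'cV[R]_n -> R.
Hypothesis cF : continuous F.

Let pt N j (c tau : R) w := (c, X t w, X (gr N j) w + tau *: (X (gr N j.+1) w - X (gr N j) w)).

(** The two intermediate points of Taylor's formula are covered at once: a time c inside the step,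
    and a point of the segment joining the positions at its ends. The segment may leave the path, so
    the oscillation of the process alone would not suffice. *)
Definition oscF N w : R := sup [set x | exists j c tau, [/\ (j <= N)%N, gr N j <= c <= gr N j.+1,
  0 <= tau <= 1 & x = `|F (pt N j c tau w) - F (gr N j, X t w, X (gr N j) w)|]].

Let box (M : R) := (`[t, T] `*` [set v : 'cV[R]_n | forall i, `|v i 0| <= M]) `*`
  [set v : 'cV[R]_n | forall i, `|v i 0| <= M].

Let box_cpt M : compact (box M).
Proof. by apply: compact_setX; [apply: compact_setX; [exact: segment_compact|]|]; exact: box_compact. Qed.

Let pt_box N j c tau w (M : R) : (j <= N)%N -> gr N j <= c <= gr N j.+1 -> 0 <= tau <= 1 ->
  (forall s p, t <= s <= T -> `|X s w p 0| <= M) -> box M (pt N j c tau w).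
Proof.
move=> jN /andP[c1 c2] /andP[t0 t1] h.
have h1 := gr_in tT (leqW jN).
have h2 := @gr_in _ t T tT N j.+1 jN.
have /andP[h1a h1b] := h1; have /andP[h2a h2b] := h2.
split; first split => /=.
- by rewrite in_itv/= (le_trans h1a c1) (le_trans c2 h2b).
- by move=> i; apply: h; rewrite lexx ltW.
- move=> i /=; rewrite !mxE.
  rewrite (_ : _ + _ = (1 - tau) * X (gr N j) w i 0 + tau * X (gr N j.+1) w i 0); last by ring.
  apply: (le_trans (ler_normD _ _)); rewrite !normrM.
  have := h _ i h1; have := h _ i h2.
  rewrite (ger0_norm t0) (@ger0_norm _ (1 - tau)) ?subr_ge0//.
  move: (`|X (gr N j.+1) w i 0|) (`|X (gr N j) w i 0|) => u v hu hv.
  nra.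
Qed.

Let bounded_path w : exists M, forall s p, t <= s <= T -> `|X s w p 0| <= M.
Proof.
have h p : exists M, forall s, t <= s <= T -> `|X s w p 0| <= M.
  have [C hC] := bounded_on_compact (cX (w := w) (p := p)) (@segment_compact R t T).
  by exists C => s st; apply: hC; rewrite /= in_itv.
have [M hM] := choice h; exists (\big[Num.max/0]_p M p) => s p st.
by apply: (le_trans (hM p s st)); exact: le_bigmax.
Qed.

Lemma le_oscF N j c tau w : (j <= N)%N -> gr N j <= c <= gr N j.+1 -> 0 <= tau <= 1 ->
  `|F (c, X t w, X (gr N j) w + tau *: (X (gr N j.+1) w - X (gr N j) w)) - F (gr N j, X t w, X (gr N j) w)| <= oscF N w.
Proof.
move=> jN cj t01; apply: ub_le_sup; last by exists j, c, tau.
have [M hM] := bounded_path w.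
have [C hC] := bounded_on_compact cF (@box_cpt M).
exists (C + C) => _ [j' [c' [tau' [jN' cj' tau01' ->]]]].
apply: (le_trans (ler_normB _ _)); apply: lerD; apply: hC; first exact: pt_box.
have := @pt_box N j' (gr N j') 0 w M jN' _ _ hM; rewrite /pt scale0r addr0; apply.
  by rewrite lexx ltW// gr_lt.
by rewrite lexx ler01.
Qed.

Lemma oscF_ge0 N w : 0 <= oscF N w.
Proof.
have h : gr N 0 <= gr N 0 <= gr N 1 by rewrite lexx ltW// gr_lt.
apply: le_trans (@le_oscF N 0%N _ 0 w (leq0n N) h _) => //.
by rewrite lexx ler01.
Qed.

(** Tight norms confine the path, hence also the segments between its points, to a compact box with
    high probability. There F is uniformly continuous, and the modulus of continuity of X brings the
    arguments within the required radius. *)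
Lemma cvP_oscF : cvP oscF.
Proof.
move=> e e0.
pose K : R := n.+1%:R.
have K0 : 0 < K by [].
have e1 : 0 < e / 2 / K by rewrite !divr_gt0.
have hb p : exists M : R, hp (e / 2 / K) (fun w => forall s : R, t <= s <= T -> `|X s w p 0| <= M).
  have [M _ h] := (tight_bound P (mX ^~ p) (fun w => cX (w := w) (p := p)) (ltW tT) e1); by exists M.
have [M0 hM0] := choice hb.
pose M := \big[Num.max/0]_p M0 p.
have hM := hp_all hM0.
have hh := heine_ball cF (@box_cpt M) e0.
have [r [r0 hr]] : exists r : R, 0 < r /\ forall x y, box M x -> ball x r y -> `|F x - F y| <= e.
  case: hh => r /= r0 h; exists (r / 2); split; first by rewrite divr_gt0.
  apply: (h (r / 2)); last by rewrite divr_gt0.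
  by rewrite /ball/= sub0r normrN gtr0_norm ?divr_gt0//; lra.
have r2 : 0 < r / 2 by rewrite divr_gt0.
have hm : \forall N \near \oo, forall p, hp (e / 2 / K) (fun w => forall s s' : R, t <= s <= T -> t <= s' <= T ->
     `|s - s'| <= dt N -> `|X s w p 0 - X s' w p 0| <= r / 2).
  apply: filter_forall => p.
  exact: (dt_near tT (tight_modulus P (mX ^~ p) (fun w => cX (w := w) (p := p)) (ltW tT) e1 r2)).
near=> N.
have m p : hp (e / 2 / K) (fun w => forall s s' : R, t <= s <= T -> t <= s' <= T ->
     `|s - s'| <= dt N -> `|X s w p 0 - X s' w p 0| <= r / 2).
  by move: p; near: N.
have dr : dt N < r.
  near: N; exact: (dt_near tT (nbhs_right_lt r0)).
have := hpI hM (hp_all m); apply: hpS.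
  have : (n%:R : R) * (e / 2 / K) <= e / 2.
    by rewrite mulrA ler_pdivrMr// mulrC ler_pM2l ?divr_gt0// ler_nat.
  by move=> h; rewrite [leRHS]splitr; exact: lerD.
move=> w [bw mw]; rewrite ger0_norm ?oscF_ge0//; apply: ge_sup.
  eexists; exists 0%N, (gr N 0), 0; split => //; first by rewrite lexx ltW// gr_lt.
  by rewrite lexx ler01.
move=> _ [j [c [tau [jN cj t01 ->]]]].
have hX s p : t <= s <= T -> `|X s w p 0| <= M.
  by move=> st; apply: (le_trans (bw p s st)); exact: le_bigmax.
rewrite distrC; apply: hr.
  have := @pt_box N j (gr N j) 0 w M jN _ _ hX; rewrite /pt scale0r addr0; apply.
    by rewrite lexx ltW// gr_lt.
  by rewrite lexx ler01.
have /andP[c1 c2] := cj.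
have h1 := gr_in tT (leqW jN); have h2 := @gr_in _ t T tT N j.+1 jN.
split; first split => /=.
- rewrite /ball/= distrC ger0_norm ?subr_ge0//; apply: le_lt_trans dr.
  by rewrite -(@grS _ t T N j) lerD2r.
- exact: ballxx.
- split => //= p k; rewrite (ord1 k) /ball/= !mxE.
  rewrite opprD addrA subrr sub0r normrN normrM.
  have /andP[t0 t1] := t01; rewrite (ger0_norm t0).
  have h := mw p (gr N j.+1) (gr N j) h2 h1.
  rewrite grS gtr0_norm ?dt_gt0// lexx in h; have {}h := h isT.
  have : 0 <= `|X (gr N j.+1) w p 0 - X (gr N j) w p 0| by [].
  move: h; move: (`|_|) => z; nra.
Unshelve. all: by end_near. Qed.

End vector_process.

End paths.

(** * Errors made by freezing the integrand on each step *)

Section euler.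
Context {R : realType} {dO : measure_display} {Omega : measurableType dO}.
Variable P : probability Omega R.
Hypothesis cP : measure_is_complete P.
Variables (d : nat) (W : R -> Omega -> 'cV[R]_d).
Hypothesis BM : brownian_motion P W.
Notation Fm := (Fm P W).
Notation L2 := (L2 P).
Notation Ex := (Ex P).
Notation mu := (@lebesgue_measure R).
Notation elementary := (@elementary R dO Omega d).
Notation adapted_list := (adapted_list P W).
Notation gint := (gint W).
Notation hp := (hp P).
Notation cvP := (cvP P).
Notation OP := (OP P).
Notation ItoP := (ItoP P W).
Implicit Types (L : seq elementary).

Lemma tint_le_oc a b (f g : R -> Omega -> R) w : (forall s w, 0 <= f s w) -> jmf f -> jmf g ->
  (forall s, a < s <= b -> f s w <= g s w) -> (tint a b f w <= tint a b g w)%E.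
Proof.
move=> f0 mf mg fg; rewrite /tint.
rewrite -[leLHS]integral_itv_obnd_cbnd; last exact: joint_section.
rewrite -[leRHS]integral_itv_obnd_cbnd; last exact: joint_section.
apply: ge0_le_integral => //=.
- by move=> s _; rewrite lee_fin.
- exact: joint_section.
- exact: joint_section.
Qed.

Lemma gint_res_sub u v u' v' L w : u <= u' -> v' <= v -> u' <= v' ->
  gint (res u v L) u' v' w = gint L u' v' w.
Proof.
move=> uu vv uv; rewrite /gint pairing_res; congr pairing.
apply/funext => k; apply/funext => x; congr (W _ w k 0).
have [xu|ux] := leP x u'.
  by rewrite !(@clampl _ u' v')//; rewrite /clamp ge_max uu/= ge_min xu.
have [xv|vx] := leP v' x.
  by rewrite !(@clampr _ u' v')//; rewrite /clamp le_max le_min xv vv orbT.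
by rewrite (@clamp_id _ u v)// (le_trans uu (ltW ux)) (le_trans (ltW vx) vv).
Qed.

Definition scl (c : Omega -> R) L := [seq Elt (ea e) (eb e) (ek e) (fun w => c w * ex e w) | e <- L].

Lemma pairing_scl c L y w : pairing (scl c L) y w = c w * pairing L y w.
Proof.
rewrite /pairing big_map mulr_sumr; apply: eq_bigr => e _ /=.
by rewrite mulrA.
Qed.

Lemma adapted_list_scl u v c L : Fm u c -> bddf c -> adapted_list u v L -> adapted_list u v (scl c L).
Proof.
move=> Fc bc hL e /mapP[e' /hL[h1 h2 h3 [m b] F] ->]; split => //=.
- split; last exact: bddfM.
  by apply: measurable_funM => //; exact: (Fm_meas cP BM Fc).
- move=> lt; apply: measurable_funM; last exact: F.
  exact: (Fm_mono h1 Fc).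
Qed.

Definition wlist (N : nat) (g : nat -> R) (c : nat -> Omega -> R) L :=
  flatten [seq scl (c j) (res (g j) (g j.+1) L) | j <- iota 0 N].

Lemma pairing_flatten (s : seq (seq elementary)) y w :
  pairing (flatten s) y w = \sum_(L <- s) pairing L y w.
Proof.
elim: s => [|L s IH]; first by rewrite big_nil /pairing big_nil.
by rewrite /= pairing_cat big_cons IH.
Qed.

Lemma pairing_wlist N g c L y w : pairing (wlist N g c L) y w =
  \sum_(j < N) c j w * pairing (res (g j) (g j.+1) L) y w.
Proof.
rewrite pairing_flatten big_map -(big_mkord xpredT (fun j => c j w * pairing (res (g j) (g j.+1) L) y w)).
by rewrite /index_iota subn0; apply: eq_bigr => j _; rewrite pairing_scl.
Qed.

Lemma adapted_list_wlist lo hi N g c L : (forall j, (j <= N)%N -> lo <= g j <= hi) ->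
  (forall j, (j < N)%N -> g j <= g j.+1) ->
  (forall j, (j < N)%N -> Fm (g j) (c j) /\ bddf (c j)) ->
  adapted_list lo hi L -> adapted_list lo hi (wlist N g c L).
Proof.
move=> g1 g2 hc hL e /flattenP[s /mapP[j]]; rewrite mem_iota add0n => /= jN -> he.
have [F b] := hc j jN; have /andP[h1 _] := g1 j (ltnW jN); have /andP[_ h2] := g1 _ jN.
have := adapted_list_scl F b (adapted_list_res (g2 j jN) hL) he.
by move=> [k1 k2 k3 k4 k5]; split => //; [exact: le_trans k1|exact: le_trans k3 h2].
Qed.

(** At each time at most one weight is active: the indicators of the steps are increments of s <= g
    j, so they sum to at most 1 by telescoping. *)
Lemma gsq_wlist_le N g c L C s w : 0 <= C ->
  (forall i j, (i <= j <= N)%N -> g i <= g j) ->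
  (forall j, (j < N)%N -> `|c j w| <= C) -> gsq (wlist N g c L) s w <= C ^+ 2 * gsq L s w.
Proof.
move=> C0 gh hc; rewrite /gsq mulr_sumr; apply: ler_sum => k _.
have -> : gval (wlist N g c L) k s w =
    (\sum_(j < N) c j w * ((g j < s) && (s <= g j.+1))%:R) * gval L k s w.
  rewrite /gval pairing_wlist mulr_suml; apply: eq_bigr => j _.
  rewrite -[pairing (res _ _ _) _ _]/(gval (res (g j) (g j.+1) L) k s w) gval_res.
  by case: ifP => _; rewrite ?mulr1 ?mulr0 ?mul0r.
rewrite exprMn ler_wpM2r ?sqr_ge0//.
rewrite -[leLHS](real_normK (num_real _)) ler_pXn2r ?nnegrE//.
apply: (@le_trans _ _ (\sum_(j < N) C * ((s <= g j.+1)%R%:R - (s <= g j)%R%:R))).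
  apply: (le_trans (ler_norm_sum _ _ _)); apply: ler_sum => j _.
  have -> : ((s <= g j.+1)%R%:R - (s <= g j)%R%:R : R) = ((g j < s) && (s <= g j.+1))%R%:R.
    have gg : g j <= g j.+1 by apply: gh; rewrite leqnSn ltn_ord.
    have [sg|gs] := leP s (g j); first by rewrite (le_trans sg gg) subrr.
    by rewrite subr0.
  by rewrite normrM (@ger0_norm _ (_%:R))// ler_wpM2r// hc.
rewrite -mulr_sumr -(big_mkord xpredT (fun j => (s <= g j.+1)%R%:R - (s <= g j)%R%:R)).
rewrite telescope_sumr// -[leRHS]mulr1 ler_wpM2l//.
by case: (s <= g N)%R; case: (s <= g 0)%R => /=; lra.
Qed.

Variables (t T : R).
Hypothesis t0 : 0 <= t.
Hypothesis tT : t < T.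
Notation gr := (gr t T).
Notation dt := (dt t T).

Variables (Phi : 'I_d -> R -> Omega -> R) (I : R -> Omega -> R).
Hypothesis FPhi : forall k s, t <= s <= T -> Fm s (Phi k s).
Hypothesis mPhi : forall k s, measurable_fun setT (Phi k s).
Hypothesis cPhi : forall k w, continuous (Phi k ^~ w).
Hypothesis IPhi : forall s, 0 <= s <= T -> ItoP 0 s Phi (I s).

Definition eps N j w := I (gr N j.+1) w - I (gr N j) w - \sum_k Phi k (gr N j) w * dW W (gr N j) (gr N j.+1) k w.

Let jmPhi : jm Phi.
Proof. by move=> k; apply: measurable_fun_joint => [s|w]; [exact: mPhi|exact: cPhi]. Qed.

(** The integrand frozen at left end points. Coefficients of elementary processes must be bounded,
    hence the clamping; for M above the norms of the paths it has no effect. *)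
Definition clist M N := glist N.+1 (gr N) (fun j k w => clamp (- M) M (Phi k (gr N j) w)).

Lemma clist_grid M N : 0 <= M ->
  adapted_grid P W t T N.+1 (gr N) (fun j k w => clamp (- M) M (Phi k (gr N j) w)).
Proof.
move=> M0; split.
- by move=> j jN; exact: gr_in.
- by move=> i j /andP[ij _]; exact: gr_homo.
- move=> j k jN; split.
    apply: measurable_maxr => //; apply: measurable_minr => //.
    by apply: FPhi; apply: gr_in => //; exact: ltnW.
  exists M => w; rewrite ler_norml clamp_ge clamp_le//.
  by rewrite (@le_trans _ _ 0)// oppr_le0.
Qed.

Lemma adapted_list_clist M N : 0 <= M -> adapted_list t T (clist M N).
Proof. by move=> M0; apply: (adapted_list_glist cP BM); exact: clist_grid. Qed.

Lemma gval_clist M N k j s w : (j <= N)%N -> gr N j < s <= gr N j.+1 ->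
  gval (clist M N) k s w = clamp (- M) M (Phi k (gr N j) w).
Proof.
move=> jN /andP[s1 s2].
rewrite gval_glist; last by move=> i i' /andP[ii _]; exact: gr_homo.
have jN' : (j < N.+1)%N by [].
rewrite (bigD1 (Ordinal jN'))//= indicE mem_set/= ?in_itv/= ?s1 ?s2//.
rewrite mulr1 big1 ?addr0// => i ij.
rewrite indicE memNset ?mulr0//= in_itv/= => /andP[h1 h2].
have [ltij|ltji|] := ltngtP i j; last by move=> E; move/eqP: ij; apply; apply: val_inj.
- have := gr_homo tT N ltij; rewrite leNgt => /negP; apply.
  exact: lt_le_trans s1 h2.
- have := gr_homo tT N ltji; rewrite leNgt => /negP; apply.
  exact: lt_le_trans h1 s2.
Qed.

Lemma gr_locate N s : t < s <= T -> exists2 j, (j <= N)%N & gr N j < s <= gr N j.+1.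
Proof.
move=> /andP[ts sT].
have ex : exists j, s <= gr N j by exists N.+1; rewrite grN.
have := ex_minnP ex => -[[|j] hj hmin].
  by move: hj; rewrite gr0 leNgt ts.
exists j.
  by have := hmin N.+1; rewrite grN => /(_ sT); rewrite ltnS.
rewrite hj andbT ltNge; apply/negP => h.
by have := hmin _ h; rewrite ltnn.
Qed.

Lemma gint_clist M N j w : (j <= N)%N ->
  gint (clist M N) (gr N j) (gr N j.+1) w =
  \sum_k clamp (- M) M (Phi k (gr N j) w) * dW W (gr N j) (gr N j.+1) k w.
Proof.
move=> jN; rewrite /gint pairing_glist.
have jN' : (j < N.+1)%N by [].
rewrite (bigD1 (Ordinal jN'))//= [X in _ + X]big1 ?addr0; last first.
  move=> i ij; apply: big1 => k _.
  have gh a b : (a <= b)%N -> gr N a <= gr N b := fun h => gr_homo tT N h.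
  have [ltij|ltji|] := ltngtP i j; last by move=> E; move/eqP: ij => []; apply: val_inj.
    by rewrite !(@clampl _ (gr N j) (gr N j.+1)) ?subrr ?mulr0//; apply: gh => //; exact: ltnW.
  by rewrite !(@clampr _ (gr N j) (gr N j.+1)) ?subrr ?mulr0//; apply: gh => //; exact: ltnW.
by apply: eq_bigr => k _; rewrite !(@clamp_id _ (gr N j) (gr N j.+1))// ?lexx ?(ltW (gr_lt tT _ _))//.
Qed.

Lemma gint_clist_total M N w : gint (clist M N) t T w =
  \sum_(j < N.+1) \sum_k clamp (- M) M (Phi k (gr N j) w) * dW W (gr N j) (gr N j.+1) k w.
Proof.
rewrite /gint pairing_glist; apply: eq_bigr => j _; apply: eq_bigr => k _.
by rewrite !(@clamp_id _ t T)// gr_in//; exact: ltnW.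
Qed.

Lemma clist_sqd M N w : 0 <= M -> (forall k, nrm t T (Phi k) w <= M) ->
  (tint t T (sqd (clist M N) Phi) w <= ((\sum_k osc t T (Phi k) N w ^+ 2) * (T - t))%:E)%E.
Proof.
move=> M0 hM; have hL := @adapted_list_clist M N M0.
apply: (@le_trans _ _ (tint t T (fun _ _ => \sum_k osc t T (Phi k) N w ^+ 2) w)).
  apply: tint_le_oc.
  - by move=> *; exact: sqd_ge0.
  - exact: (jm_sqd hL).
  - exact: measurable_cst.
  move=> s sT; have [j jN sj] := gr_locate N sT.
  apply: ler_sum => k _; rewrite (gval_clist _ _ _ jN sj).
  rewrite clamp_id; last first.
    by rewrite -ler_norml; apply: le_trans (hM k); apply: le_nrm => //; apply: gr_in => //; exact: leqW.
  rewrite -[leLHS](real_normK (num_real _)) ler_pXn2r ?nnegrE ?osc_ge0// distrC.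
  by apply: le_osc => //; have /andP[/ltW -> ->] := sj.
rewrite /tint integral_cst//= EFinM lee_wpmul2l//.
  by rewrite lee_fin sumr_ge0// => k _; exact: sqr_ge0.
have := @lebesgue_measure_itv R `[t, T]; rewrite /= lte_fin tT => E.
by rewrite le_eqVlt; apply/orP; left; apply/eqP; apply: (etrans E); rewrite EFinB.
Qed.

Lemma euler_list kap : 0 < kap -> \forall N \near \oo, exists2 D, adapted_list t T D &
  hp kap (fun w => (tint t T (gsq D) w <= kap%:E)%E /\
    forall j, (j <= N)%N -> `|eps N j w + gint D (gr N j) (gr N j.+1) w| <= kap / N.+1%:R).
Proof.
move=> kap0.
have T0 : 0 <= T by exact: le_trans (ltW tT).
have Tt0 : 0 < T - t by rewrite subr_gt0.
have k3 : 0 < kap / 3 / d.+1%:R by rewrite !divr_gt0.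
have hb k : exists M : R, hp (kap / 3 / d.+1%:R) (fun w => nrm t T (Phi k) w <= M).
  by have [M _ h] := nrm_tight P tT (mPhi k) (@cPhi k) k3; exists M.
have [M0 hM0] := choice hb.
pose M := \big[Num.max/0]_k M0 k.
have M00 : 0 <= M by exact: bigmax_ge_id.
have hM := hp_all hM0.
(* Squared oscillations below c2 bound the energy error of freezing by c2 (T - t) = kap / 8,
   matching the bound eta <= kap / 8 for the elementary approximation. *)
pose c2 := kap / (8 * (T - t)).
have c20 : 0 < c2 by rewrite divr_gt0// mulr_gt0.
have co : cvP (fun N w => \sum_k osc t T (Phi k) N w ^+ 2).
  apply: cvP_sum => k; have h := cvP_osc P tT (mPhi k) (@cPhi k).
  by have := cvPM_OP h (cvP_OP h); apply: cvP_le => N; apply: aeW => w; rewrite expr2.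
have e1 : 0 < Num.min (kap / 3) c2 by rewrite lt_min c20 divr_gt0.
near=> N.
have ho : hp (Num.min (kap / 3) c2) (fun w => `|\sum_k osc t T (Phi k) N w ^+ 2| <= Num.min (kap / 3) c2).
  near: N; exact: co.
(* Each increment involves the integrals at two grid times, hence 2 eta <= kap / (N+1). Here eta
   depends on N, and the approximation is chosen after the grid. *)
pose eta := Num.min (kap / 8) (kap / (2 * N.+1%:R)).
have eta0 : 0 < eta by rewrite lt_min !divr_gt0// mulr_gt0.
have eta1 : eta <= kap / 8 by rewrite ge_min lexx.
have eta2 : 2 * eta <= kap / N.+1%:R.
  apply: (@le_trans _ _ (2 * (kap / (2 * N.+1%:R)))); first by rewrite ler_pM2l// ge_min lexx orbT.
  have x0 : (N.+1%:R : R) != 0 by [].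
  by move: x0; move: (N.+1%:R : R) => x x0; rewrite le_eqVlt; apply/orP; left; apply/eqP; field.
have gT j : (j < N.+2)%N -> 0 <= gr N j <= T.
  move=> jN; have /andP[h1 ->] := @gr_in _ t T tT N j jN.
  by rewrite (le_trans t0 h1).
have [Q hQ pQ] := @ItoP_grid _ _ _ P cP d W BM T Phi N.+2 (gr N) (fun j => I (gr N j)) (I T) T0 jmPhi
  (fun j jN => conj (gT j jN) (IPhi (gT j jN))) (IPhi (s := T) (introT andP (conj T0 (lexx _)))) eta eta0.
have hC := @adapted_list_clist M N M00.
have hC' : adapted_list 0 T (clist M N) by exact: adapted_list_sub hC.
have hD := adapted_list_lsub hC' hQ.
have hR := adapted_list_res (ltW tT) hD.
exists (res t T (lsub (clist M N) Q)) => //.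
have := hpI (hpI hM ho) pQ; apply: hpS.
  have : (d%:R : R) * (kap / 3 / d.+1%:R) <= kap / 3.
    by rewrite mulrA ler_pdivrMr// mulrC ler_pM2l ?divr_gt0// ler_nat.
  have : Num.min (kap / 3) c2 <= kap / 3 by rewrite ge_min lexx.
  move: (Num.min _ _) (_ * (kap / 3 / _)) => u v; lra.
move=> w [[bM oN] [q1 q2]].
have bM' k : nrm t T (Phi k) w <= M by apply: le_trans (bM k) _; exact: le_bigmax.
split.
  apply: (@le_trans _ _ (tint t T (fun s w => (2 * sqd (clist M N) Phi s w + 2 * sqd Q Phi s w)%R) w)).
    apply: tint_le.
    - by move=> *; exact: gsq_ge0.
    - exact: (gsq_joint hR).
    - by apply: measurable_funD; apply: measurable_funM => //; [exact: (jm_sqd hC)|exact: (jm_sqd hQ)].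
    - move=> s _; rewrite gsq_res; case: ifP => _; first exact: gsq_sub_le.
      by rewrite addr_ge0// mulr_ge0// sqd_ge0.
  rewrite tintD//; [|by move=> *; exact: sqd_ge0|by move=> *; exact: sqd_ge0|exact: (jm_sqd hC)|exact: (jm_sqd hQ)].
  apply: (@le_trans _ _ (2%:E * (kap / 8)%:E + 2%:E * (kap / 8)%:E)%E); last first.
    by rewrite -!EFinM -EFinD lee_fin; lra.
  apply: leeD; rewrite lee_pmul2l//.
    apply: (le_trans (clist_sqd N M00 bM')).
    rewrite lee_fin.
    apply: (@le_trans _ _ (c2 * (T - t))).
      rewrite ler_pM2r//; apply: le_trans (ler_norm _) _; apply: le_trans oN _.
      by rewrite ge_min lexx orbT.
    rewrite /c2 le_eqVlt; apply/orP; left; apply/eqP; field.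
    by rewrite gt_eqF.
  apply: (@le_trans _ _ (tint 0 T (sqd Q Phi) w)).
    apply: tint_sub => //; [exact: ltW|by move=> *; exact: sqd_ge0|exact: (jm_sqd hQ)].
  by apply: (le_trans q1); rewrite lee_fin.
move=> j jN.
have h1 := q2 j.+1 jN; have h2 := q2 j (leqW jN).
have tj := @gr_in _ t T tT N j (leqW jN).
have tj1 := @gr_in _ t T tT N j.+1 jN.
have jj := ltW (gr_lt tT N j).
have {}tj : t <= gr N j by case/andP: tj.
have {}tj1 : gr N j.+1 <= T by case/andP: tj1.
rewrite gint_res_sub//.
have -> : gint (lsub (clist M N) Q) (gr N j) (gr N j.+1) w =
    \sum_k Phi k (gr N j) w * dW W (gr N j) (gr N j.+1) k w
    - (gint Q 0 (gr N j.+1) w - gint Q 0 (gr N j) w).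
  rewrite (@gintD _ _ _ d W Q 0 (gr N j)) ?(le_trans t0 tj)//.
  rewrite [X in _ - X](_ : _ = gint Q (gr N j) (gr N j.+1) w); last by ring.
  rewrite {1}/gint pairing_sub; congr (_ - _); rewrite -/(gint _ _ _ _) gint_clist//.
  apply: eq_bigr => k _; congr (_ * _); rewrite clamp_id//.
  rewrite -ler_norml; apply: le_trans (bM' k); apply: le_nrm => //.
  by rewrite tj (le_trans jj).
rewrite /eps.
rewrite [X in `|X|](_ : _ = (gint Q 0 (gr N j) w - I (gr N j) w) - (gint Q 0 (gr N j.+1) w - I (gr N j.+1) w)); last by ring.
apply: le_trans eta2; apply: (le_trans (ler_normB _ _)); lra.
Unshelve. all: by end_near. Qed.

Lemma tint_grid N (f : R -> Omega -> R) w : (forall s w, 0 <= f s w) -> jmf f ->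
  (\sum_(j < N.+1) tint (gr N j) (gr N j.+1) f w = tint t T f w)%E.
Proof.
move=> f0 mf.
have h k : (\sum_(j < k) tint (gr N j) (gr N j.+1) f w = tint t (gr N k) f w)%E.
  elim: k => [|k IH]; first by rewrite big_ord0 gr0 /tint set_itv1 integral_set1.
  rewrite big_ord_recr/= IH -tint_split//; last exact: ltW (gr_lt tT _ _).
  by rewrite -{1}(gr0 t T N) gr_homo.
by rewrite h grN.
Qed.

(** The sum of the squared increments of an elementary integral has expectation equal to its energy,
    by the isometry on each step. Lenglart's inequality with this functional makes it small as soon
    as the energy of D is. *)
Lemma euler_sqr : cvP (fun N w => \sum_(j < N.+1) eps N j w ^+ 2).
Proof.
move=> e e0.
pose kap := Num.min (Num.min 1 (e / 8)) (e / 8 * (e / 4)).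
have e4 : 0 < e / 4 by rewrite divr_gt0.
have e8 : 0 < e / 8 by rewrite divr_gt0.
have kap0 : 0 < kap by rewrite !lt_min ltr01 e8 mulr_gt0.
have k1 : kap <= 1 by rewrite !ge_min lexx.
have k8 : kap <= e / 8 by rewrite !ge_min lexx orbT.
have k16 : kap <= e / 8 * (e / 4) by rewrite !ge_min lexx orbT.
have := euler_list kap0; apply: filterS => N [D hD pD].
pose J w L := \sum_(j < N.+1) gint L (gr N j) (gr N j.+1) w ^+ 2.
have iso L (j : 'I_N.+1) : adapted_list t T L -> _ := fun hL => gint_isometry cP BM t0
  (proj1 (andP (gr_in tT (ltnW (ltn_ord j))))) (ltW (gr_lt tT N j)) (proj2 (andP (@gr_in _ t T tT N j.+1 (ltn_ord j)))) hL.
have := @lenglart _ _ _ P cP d W BM t T D (e / 8) kap (e / 4) J t0 (ltW tT) e8 e4 hD.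
have h1 : forall (L L' : seq elementary) w, (forall y, pairing L y w = pairing L' y w) -> J w L = J w L'.
  by move=> L L' w E; apply: eq_bigr => j _; rewrite /gint E.
move=> /(_ h1).
have h2 : forall L, adapted_list t T L -> measurable_fun setT (J ^~ L) /\ (forall w, 0 <= J w L) /\
     (\int[P]_w (J w L)%:E <= \int[P]_w (tint t T (gsq L) w))%E.
  move=> L hL; split.
    apply: measurable_sum => j; apply: measurable_funX.
    by have [_ h _ _] := iso L j hL; exact: (L2_meas h).
  split; first by move=> w; apply: sumr_ge0 => j _; exact: sqr_ge0.
  rewrite (eq_integral (fun w => \sum_(j < N.+1) (gint L (gr N j) (gr N j.+1) w ^+ 2)%:E)%E); last first.
    by move=> w _; rewrite sumEFin.
  rewrite ge0_integral_sum//; last 2 first.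
  - move=> j; apply/measurable_EFinP; apply: measurable_funX.
    by have [_ h _ _] := iso L j hL; exact: (L2_meas h).
  - by move=> j w _; rewrite lee_fin sqr_ge0.
  rewrite (eq_integral (fun w => \sum_(j < N.+1) tint (gr N j) (gr N j.+1) (gsq L) w)%E); last first.
    by move=> w _; rewrite tint_grid//; [move=> *; exact: gsq_ge0|exact: (gsq_joint hL)].
  rewrite ge0_integral_sum//; last 2 first.
  - by move=> j; apply: tint_meas; [move=> *; exact: gsq_ge0|exact: (gsq_joint hL)].
  - by move=> j w _; apply: tint_ge0 => *; exact: gsq_ge0.
  apply: lee_sum => j _; have [_ h _ E] := iso L j hL.
  by rewrite /tint E ExE//; exact: h.2.
move=> /(_ h2).
have h3 : hp kap (fun w => (tint t T (gsq D) w <= (e / 8 * (e / 4))%:E)%E).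
  by apply: (hpS (lexx _) _ pD) => w [q _]; apply: (le_trans q); rewrite lee_fin.
move=> /(_ h3) h4; have := hpI h4 pD; apply: hpS; first by lra.
move=> w [j1 [_ j2]].
rewrite ger0_norm; last by apply: sumr_ge0 => j _; exact: sqr_ge0.
apply: (@le_trans _ _ (\sum_(j < N.+1) (2 * gint D (gr N j) (gr N j.+1) w ^+ 2 + 2 * (kap / N.+1%:R)))).
  apply: ler_sum => j _.
  have hj := j2 j (ltn_ord j).
  have N1 : (1 : R) <= N.+1%:R by rewrite ler1n.
  have kN : kap / N.+1%:R <= 1.
    by rewrite ler_pdivrMr ?mul1r ?(lt_le_trans ltr01)// (le_trans k1).
  have := sqr_sub_le (eps N j w + gint D (gr N j) (gr N j.+1) w) (gint D (gr N j) (gr N j.+1) w).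
  rewrite addrK => h; apply: (le_trans h); rewrite addrC lerD2l ler_pM2l//.
  rewrite -[leLHS](real_normK (num_real _)) expr2.
  move: hj kN; move: (`|_|) (normr_ge0 (eps N j w + gint D (gr N j) (gr N j.+1) w)) (kap / _) => x x0 y xy y1.
  nra.
rewrite big_split/= -mulr_sumr sumr_const card_ord -[_ *+ N.+1]mulr_natr -[2 * _ * _]mulrA divfK ?pnatr_eq0//.
by move: j1; rewrite /J; lra.
Qed.

(** Weights known at the beginning of each step can be moved into the list: the weighted sum is
    itself an elementary integral, with energy at most C^2 times that of D. Summing absolute errors
    instead would lose the cancellation between steps. *)
Lemma euler_lin (c : nat -> nat -> Omega -> R) (C : R) :
  (forall N j, (j <= N)%N -> Fm (gr N j) (c N j)) -> (forall N j w, `|c N j w| <= C) ->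
  cvP (fun N w => \sum_(j < N.+1) c N j w * eps N j w).
Proof.
move=> Fc bc e e0.
have C0 : 0 <= C by apply: le_trans (bc 0%N 0%N point); exact: normr_ge0.
have C1 : 0 < C + 1 by rewrite ltr_wpDl.
have C2 : 0 < C ^+ 2 + 1 by rewrite ltr_wpDl// sqr_ge0.
pose kap := Num.min (Num.min (e / 4) (e / 2 / (C + 1))) ((e / 2) ^+ 2 * (e / 4) / (C ^+ 2 + 1)).
have e4 : 0 < e / 4 by rewrite divr_gt0.
have e2 : 0 < e / 2 by rewrite divr_gt0.
have kap0 : 0 < kap by rewrite !lt_min e4 !divr_gt0// mulr_gt0// exprn_gt0.
have k4 : kap <= e / 4 by rewrite !ge_min lexx.
have kC : C * kap <= e / 2.
  apply: (@le_trans _ _ ((C + 1) * (e / 2 / (C + 1)))).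
    by apply: ler_pM => //; [exact: ltW|lra|rewrite !ge_min lexx orbT].
  by rewrite mulrC divfK ?gt_eqF.
have kC2 : C ^+ 2 * kap <= (e / 2) ^+ 2 * (e / 4).
  apply: (@le_trans _ _ ((C ^+ 2 + 1) * ((e / 2) ^+ 2 * (e / 4) / (C ^+ 2 + 1)))).
    by apply: ler_pM => //; [exact: sqr_ge0|exact: ltW|lra|rewrite !ge_min lexx orbT].
  by rewrite mulrC divfK ?gt_eqF.
have := euler_list kap0; apply: filterS => N [D hD pD].
pose D' := wlist N.+1 (gr N) (c N) D.
have hD' : adapted_list t T D'.
  apply: adapted_list_wlist => //.
  - by move=> j jN; exact: gr_in.
  - by move=> j jN; exact: ltW (gr_lt tT _ _).
  - by move=> j jN; split; [exact: Fc|exists C].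
have mono : forall i j, (i <= j <= N.+1)%N -> gr N i <= gr N j.
  by move=> i j /andP[ij _]; exact: gr_homo.
have E w : gint D' t T w = \sum_(j < N.+1) c N j w * gint D (gr N j) (gr N j.+1) w.
  rewrite /gint pairing_wlist; apply: eq_bigr => j _; congr (_ * _).
  rewrite pairing_res; congr pairing; apply/funext => k; apply/funext => x.
  have jj := ltW (gr_lt tT N j).
  have /andP[h1 _] := gr_in tT (ltnW (ltn_ord j)).
  have /andP[_ h2] := @gr_in _ t T tT N j.+1 (ltn_ord j).
  rewrite (@clamp_id _ t T)// (le_trans h1 (clamp_ge _ _ _))/=.
  exact: le_trans (clamp_le _ jj) h2.
have h3 : hp (kap + e / 4) (fun w => `|gint D' t T w| <= e / 2).
  apply: gint_small => //; first exact: ltW.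
  apply: (hpS (lexx _) _ pD) => w [q _].
  apply: (@le_trans _ _ (tint t T (fun s w => (C ^+ 2 * gsq D s w + 0 * gsq D s w)%R) w)).
    apply: tint_le.
    - by move=> *; exact: gsq_ge0.
    - exact: (gsq_joint hD').
    - by apply: measurable_funD; apply: measurable_funM => //; exact: (gsq_joint hD).
    - by move=> s _; rewrite mul0r addr0; apply: gsq_wlist_le.
  rewrite tintD//; [|by move=> *; exact: gsq_ge0|by move=> *; exact: gsq_ge0|exact: sqr_ge0|exact: (gsq_joint hD)|exact: (gsq_joint hD)].
  rewrite mul0e adde0; apply: (@le_trans _ _ ((C ^+ 2)%:E * kap%:E)%E).
    by rewrite lee_wpmul2l// lee_fin sqr_ge0.
  by rewrite -EFinM lee_fin.
have := hpI h3 pD; apply: hpS; first by lra.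
move=> w [g1 [_ g2]].
have -> : \sum_(j < N.+1) c N j w * eps N j w =
    \sum_(j < N.+1) c N j w * (eps N j w + gint D (gr N j) (gr N j.+1) w) - gint D' t T w.
  by rewrite E -sumrB; apply: eq_bigr => j _; ring.
apply: (le_trans (ler_normB _ _)); rewrite [leRHS]splitr; apply: lerD => //.
apply: le_trans kC; apply: (le_trans (ler_norm_sum _ _ _)).
apply: (@le_trans _ _ (\sum_(j < N.+1) C * (kap / N.+1%:R))).
  apply: ler_sum => j _; rewrite normrM; apply: ler_pM => //; apply: g2; exact: ltn_ord j.
by rewrite sumr_const card_ord -[_ *+ N.+1]mulr_natr -mulrA divfK ?pnatr_eq0.
Qed.

End euler.

(** * Quadratic variation of Brownian motion *)

Section quadratic_variation.
Context {R : realType} {dO : measure_display} {Omega : measurableType dO}.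
Variable P : probability Omega R.
Hypothesis cP : measure_is_complete P.
Variables (d : nat) (W : R -> Omega -> 'cV[R]_d).
Hypothesis BM : brownian_motion P W.
Notation Fm := (Fm P W).
Notation L2 := (L2 P).
Notation L1 := (L1 P).
Notation Ex := (Ex P).
Notation hp := (hp P).
Notation cvP := (cvP P).
Notation OP := (OP P).
Variables (t T : R).
Hypothesis t0 : 0 <= t.
Hypothesis tT : t < T.
Notation gr := (gr t T).
Notation dt := (dt t T).

Lemma cvP_sqr (U : nat -> Omega -> R) : cvP (fun N w => U N w ^+ 2) -> cvP U.
Proof.
move=> h e e0; have m0 : 0 < Num.min e (e ^+ 2) by rewrite lt_min e0 exprn_gt0.
have := h _ m0; apply: filterS => N; apply: hpS; first by rewrite ge_min lexx.
move=> w; rewrite ger0_norm ?sqr_ge0// le_min => /andP[_].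
by rewrite -(real_normK (num_real (U N w))) ler_pXn2r// nnegrE// ltW.
Qed.

Lemma quad_orth (a : Omega -> R) (C s r : R) k l : 0 <= s -> s < r -> Fm s a ->
  (forall w, `|a w| <= C) ->
  let G w := a w * (dW W s r k w * dW W s r l w - (if k == l then r - s else 0)) in
  [/\ Fm r G, L2 G, (forall f, Fm s f -> L2 f -> Ex (fun w => f w * G w) = 0) &
    Ex (fun w => G w ^+ 2) <= C ^+ 2 * (200 * (r - s) ^+ 2)].
Proof.
move=> s0 sr Fa ba G.
pose q w := dW W s r k w * dW W s r l w - (if k == l then r - s else 0).
have qL2 : L2 q by apply: L2B; [exact: (dWdW_L2 BM)|exact: L2_cst].
have ma : measurable_fun setT a := Fm_meas cP BM Fa.
have bda : bddf a by exists C.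
have GL2 : L2 G by exact: L2_bddM.
have Eq : Ex q = 0.
  rewrite ExB; last exact: L1_cst.
    by rewrite (Ex_dWdW BM)// Ex_cst subrr.
  by apply: L2_L1; exact: (dWdW_L2 BM).
split => //.
- apply: measurable_funM; first exact: Fm_mono (ltW sr) Fa.
  have FdW k' : Fm r (dW W s r k').
    by apply: measurable_funB; apply: Fm_W; rewrite ?s0 ?(ltW sr) ?lexx ?(le_trans s0 (ltW sr)).
  by apply: measurable_funB; [apply: measurable_funM; exact: FdW|exact: measurable_cst].
- move=> f Ff fL2.
  rewrite (_ : (fun w => f w * G w) = fun w => (f w * a w) * q w); last first.
    by apply/funext => w; rewrite /G -/(q w) mulrA.
  have faL2 : L2 (fun w => f w * a w).
    rewrite (_ : (fun _ => _) = fun w => a w * f w); first exact: L2_bddM.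
    by apply/funext => w; rewrite mulrC.
  rewrite (Fm_Ex cP BM s0 sr (f := fun w => f w * a w) (h := q)) ?Eq ?mulr0//.
  + exact: measurable_funM.
  + exact: Vm_quad.
  + exact: L2_L1.
  + exact: L2_L1.
  + exact: L2M.
apply: (@le_trans _ _ (Ex (fun w => C ^+ 2 * q w ^+ 2))).
  apply: Ex_le.
  - exact: GL2.2.
  - by apply: L1Z; exact: qL2.2.
  - move=> w; rewrite /G -/(q w) exprMn ler_wpM2r ?sqr_ge0//.
    rewrite -(real_normK (num_real (a w))) ler_pXn2r// nnegrE//.
    by apply: le_trans (ba w).
rewrite ExZ; last exact: qL2.2.
by rewrite ler_wpM2l ?sqr_ge0//; exact: (Ex_quad_sqr BM).
Qed.

(** The compensated products have mean 0 given the past, so the terms are orthogonal; each has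
    second moment at most 200 C^2 dt^2, and the second moment of the sum is of order dt. *)
Lemma quad_cvg (a : nat -> nat -> Omega -> R) (C : R) k l :
  (forall N j, (j <= N)%N -> Fm (gr N j) (a N j)) -> (forall N j w, `|a N j w| <= C) ->
  cvP (fun N w => \sum_(j < N.+1) a N j w *
    (dW W (gr N j) (gr N j.+1) k w * dW W (gr N j) (gr N j.+1) l w - (if k == l then dt N else 0))).
Proof.
move=> Fa ba; apply: cvP_sqr.
have gp N (j : nat) : (j < N.+1)%N -> _ := fun jN => quad_orth k l
  (le_trans t0 (proj1 (andP (gr_in tT (ltnW jN))))) (gr_lt tT N j) (Fa N j jN) (ba N j).
have L2S N : L2 (fun w => \sum_(j < N.+1) a N j w *
    (dW W (gr N j) (gr N j.+1) k w * dW W (gr N j) (gr N j.+1) l w - (if k == l then dt N else 0))).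
  apply: L2_sum => j; have [_ h _ _] := gp N j (ltn_ord j).
  by move: h; rewrite grS.
apply: cvP_markov.
- by move=> N; apply: measurable_funX; exact: (L2_meas (L2S N)).
- by move=> N w; exact: sqr_ge0.
exists (fun N => C ^+ 2 * 200 * (T - t) * dt N).
  rewrite -[X in _ --> X](mulr0 (C ^+ 2 * 200 * (T - t))).
  by apply: cvgMl_tmp; exact: dt_cvg0.
move=> N; rewrite ExE; last exact: (L2S N).2.
rewrite lee_fin.
rewrite (@orth_sum _ _ _ P d W N.+1 (gr N) (fun j w => a N j w *
    (dW W (gr N j) (gr N j.+1) k w * dW W (gr N j) (gr N j.+1) l w - (if k == l then dt N else 0)))).
- apply: (@le_trans _ _ (\sum_(j < N.+1) C ^+ 2 * (200 * dt N ^+ 2))).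
    apply: ler_sum => j _; have [_ _ _ h] := gp N j (ltn_ord j).
    by move: h; rewrite grS.
  rewrite sumr_const card_ord -[_ *+ N.+1]mulr_natr.
  rewrite le_eqVlt; apply/orP; left; apply/eqP.
  by rewrite /dt; field; rewrite nat1r pnatr_eq0.
- by move=> i j /andP[ij _]; exact: gr_homo.
- move=> j jN; have [h1 h2 _ _] := gp N j jN.
  by move: h1 h2; rewrite grS.
- move=> j f jN Ff f2; have [_ _ h _] := gp N j jN.
  by move: h; rewrite grS => h; exact: h.
Qed.

Lemma OP_dW_sqr k : OP (fun N w => \sum_(j < N.+1) dW W (gr N j) (gr N j.+1) k w ^+ 2).
Proof.
have g0 N j : (j <= N)%N -> 0 <= gr N j.
  by move=> jN; apply: le_trans t0 _; have /andP[] := gr_in tT (leqW jN).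
have L1s N j : (j <= N)%N -> L1 (fun w => dW W (gr N j) (gr N j.+1) k w ^+ 2).
  by move=> jN; have [_] := dW_L2 BM k (g0 N j jN) (gr_lt tT N j).
apply: (@OP_markov _ _ _ _ _ (T - t)).
- move=> N; apply: measurable_sum => j; apply: measurable_funX.
  exact: (L2_meas (dW_L2 BM k (g0 N j (ltn_ord j)) (gr_lt tT N j))).
- by move=> N w; apply: sumr_ge0 => j _; exact: sqr_ge0.
- by rewrite subr_ge0 ltW.
move=> N; rewrite ExE; last by apply: L1_sum => j _; apply: L1s; exact: ltn_ord j.
rewrite lee_fin Ex_sum; last by move=> j _; apply: L1s; exact: ltn_ord j.
rewrite -(sum_dt t T N) ler_sum// => j _.
by rewrite (Ex_dW2 BM)// ?grS ?gr_lt// g0// -ltnS.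
Qed.

End quadratic_variation.

(** * Ito's formula *)

Section riemann.
Context {R : realType}.
Notation mu := (@lebesgue_measure R).
Implicit Types (phi : R -> R) (a b c v o : R).

Lemma integrable_cont phi a b : continuous phi -> mu.-integrable `[a, b] (EFin \o phi).
Proof.
move=> cphi; apply: continuous_compact_integrable; first exact: segment_compact.
exact: continuous_subspaceT.
Qed.

Lemma Rint_split phi a b c : a <= b -> b <= c -> continuous phi ->
  (\int[mu]_(s in `[a, c]) phi s = \int[mu]_(s in `[a, b]) phi s + \int[mu]_(s in `[b, c]) phi s)%R.
Proof.
move=> ab bc cphi; have := @Rintegral_itvB _ phi (BLeft a) (BRight c) b.
move=> /(_ (integrable_cont _ _ cphi)); rewrite !bnd_simp => /(_ ab bc).
move=> h; rewrite -[X in _ + X]Rintegral_itv_obnd_cbnd; last first.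
  apply: integrableS (integrable_cont b c cphi) => //.
  by apply: subset_itvr; rewrite bnd_simp.
by rewrite -h addrC subrK.
Qed.

Lemma mu_itvcc a b : a <= b -> fine (mu `[a, b]) = b - a.
Proof.
move=> ab; have := @lebesgue_measure_itv R `[a, b]; rewrite /= lte_fin.
move: ab; rewrite le_eqVlt => /predU1P[->|->] E.
  by rewrite (_ : mu _ = 0%E) ?subrr//; apply: (etrans E); rewrite ltxx.
by rewrite (_ : mu _ = (b - a)%:E)//; apply: (etrans E).
Qed.

Lemma Rint_dev phi a b v o : a <= b -> continuous phi ->
  (forall s, a <= s <= b -> `|phi s - v| <= o) ->
  `|(\int[mu]_(s in `[a, b]) phi s)%R - v * (b - a)| <= o * (b - a).
Proof.
move=> ab cphi h.
have ic x : mu.-integrable `[a, b] (EFin \o cst x) := integrable_cont a b (@cst_continuous _ _ x).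
rewrite -(mu_itvcc ab) -!Rintegral_cst//.
rewrite -(RintegralB _ (integrable_cont a b cphi) (ic v))//.
have id : mu.-integrable `[a, b] (EFin \o (fun x => phi x - cst v x)).
  by apply: integrable_cont => x; apply: cvgB; [exact: cphi|exact: cvg_cst].
apply: (le_trans (le_normr_Rintegral _ _)) => //.
apply: le_Rintegral => //.
- exact: integrable_norm.
- exact: ic.
Qed.

Lemma Rint_bound phi a b o : a <= b -> continuous phi ->
  (forall s, a <= s <= b -> `|phi s| <= o) ->
  `|(\int[mu]_(s in `[a, b]) phi s)%R| <= o * (b - a).
Proof.
move=> ab cphi h; have := @Rint_dev phi a b 0 o ab cphi.
by rewrite mul0r subr0; apply=> s sab; rewrite subr0 h.
Qed.

Lemma Rint_grid phi t T N : t < T -> continuous phi ->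
  \sum_(j < N.+1) (\int[mu]_(s in `[gr t T N j, gr t T N j.+1]) phi s)%R =
  (\int[mu]_(s in `[t, T]) phi s)%R.
Proof.
move=> tT cphi.
have h k : \sum_(j < k) (\int[mu]_(s in `[gr t T N j, gr t T N j.+1]) phi s)%R =
  (\int[mu]_(s in `[t, gr t T N k]) phi s)%R.
  elim: k => [|k IH].
    by rewrite big_ord0 gr0 set_itv1 /Rintegral integral_set1.
  rewrite big_ord_recr/= IH -Rint_split//; last exact: ltW (gr_lt tT _ _).
  by rewrite -{1}(gr0 t T N) gr_homo.
by rewrite h grN.
Qed.

End riemann.

Section algebra.
Context {R : realType}.

Lemma sqr_sum_le (n : nat) (a : 'I_n -> R) : (\sum_i a i) ^+ 2 <= n%:R * \sum_i a i ^+ 2.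
Proof.
elim: n a => [|n IH] a; first by rewrite !big_ord0 expr0n mulr0.
rewrite !big_ord_recl -natr1.
have := IH (fun i => a (lift ord0 i)).
set S := \sum_i a (lift ord0 i); set Q := \sum_i a (lift ord0 i) ^+ 2.
have Q0 : 0 <= Q by apply: sumr_ge0 => i _; exact: sqr_ge0.
case: n IH a @S @Q Q0 => [|n] IH a S Q Q0 h.
  rewrite /S /Q !big_ord0 !addr0 add0r mul1r.
  exact: lexx.
have n0 : (0 : R) < n.+1%:R by [].
have := sqr_ge0 (n.+1%:R * a ord0 - S).
move: h Q0; move: (S) (Q) => {}S {}Q h Q0 h2.
have h3 : n.+1%:R * (2 * a ord0 * S) <= n.+1%:R * (n.+1%:R * a ord0 ^+ 2 + Q).
  move: n0 h h2; move: (n.+1%:R : R) => x x0 h h2; nra.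
rewrite ler_pM2l// in h3; nra.
Qed.

Lemma mul_le_sqr (x y c : R) : 0 < c -> `|x * y| <= c * x ^+ 2 + c^-1 * y ^+ 2.
Proof.
move=> c0; have c1 : 0 < c^-1 by rewrite invr_gt0.
have cc : c * c^-1 = 1 by rewrite divff// gt_eqF.
rewrite normrM -(real_normK (num_real x)) -(real_normK (num_real y)).
move: (`|x|) (`|y|) (normr_ge0 x) (normr_ge0 y) => a b a0 b0.
have := sqr_ge0 (c * a - b); rewrite sqrrB exprMn => h.
have h1 : 0 <= c^-1 * ((c ^+ 2 * a ^+ 2) - c * a * b *+ 2 + b ^+ 2) by rewrite mulr_ge0// ltW.
have h2 : c^-1 * ((c ^+ 2 * a ^+ 2) - c * a * b *+ 2 + b ^+ 2) = c * a ^+ 2 - 2 * (a * b) + c^-1 * b ^+ 2.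
  rewrite (_ : c^-1 * _ = (c * c^-1) * (c * a ^+ 2) - 2 * ((c * c^-1) * (a * b)) + c^-1 * b ^+ 2); last by ring.
  by rewrite cc; ring.
have : 0 <= c * a ^+ 2 by rewrite mulr_ge0 ?(ltW c0) ?(ltW c1) ?sqr_ge0.
have : 0 <= c^-1 * b ^+ 2 by rewrite mulr_ge0 ?(ltW c0) ?(ltW c1) ?sqr_ge0.
have : 0 <= a * b by rewrite mulr_ge0.
lra.
Qed.

Lemma sqr_le_sum (n : nat) (a : 'I_n -> R) i : a i ^+ 2 <= \sum_j a j ^+ 2.
Proof. by rewrite (bigD1 i)//= lerDl sumr_ge0// => j _; exact: sqr_ge0. Qed.

Lemma mul_le_sum (n : nat) (a : 'I_n -> R) i j : `|a i * a j| <= \sum_k a k ^+ 2.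
Proof.
have h1 := sqr_le_sum a i; have h2 := sqr_le_sum a j.
rewrite normrM; rewrite -(real_normK (num_real (a i))) in h1.
rewrite -(real_normK (num_real (a j))) in h2.
have := sqr_ge0 (`|a i| - `|a j|); move: (`|a i|) (`|a j|) h1 h2 => x y; nra.
Qed.

End algebra.

Lemma cont_pair (T U V : topologicalType) (f : T -> U) (g : T -> V) :
  continuous f -> continuous g -> continuous (fun s => (f s, g s)).
Proof. by move=> cf cg s; exact: (cvg_pair (cf s) (cg s)). Qed.

Lemma cont_sum {R : realType} (T : topologicalType) (I : finType) (F : I -> T -> R) :
  (forall i, continuous (F i)) -> continuous (fun x => \sum_i F i x).
Proof.
move=> h; elim: (index_enum I) => [|i s IH].
  rewrite (_ : (fun _ => _) = fun=> 0) => [x|]; first exact: cvg_cst.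
  by apply/funext => x; rewrite big_nil.
rewrite (_ : (fun _ => _) = fun x => F i x + \sum_(j <- s) F j x) => [x|].
  by apply: cvgD; [exact: h|exact: IH].
by apply/funext => x; rewrite big_cons.
Qed.

(** * Expansion of f(s, X(t), X(s)) along the grid *)

Section ito_formula.
Context {R : realType} {dO : measure_display} {Omega : measurableType dO}.
Variable P : probability Omega R.
Hypothesis cP : measure_is_complete P.
Variables (d : nat) (W : R -> Omega -> 'cV[R]_d).
Hypothesis BM : brownian_motion P W.
Notation Fm := (Fm P W).
Notation mu := (@lebesgue_measure R).
Notation hp := (hp P).
Notation cvP := (cvP P).
Notation OP := (OP P).
Notation ItoP := (ItoP P W).
Variables (t T : R).
Hypothesis t0 : 0 <= t.
Hypothesis tT : t < T.
Notation gr := (gr t T).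
Notation dt := (dt t T).
Notation osc := (osc t T).
Notation nrm := (nrm t T).
Variables (n : nat).
Notation V := 'cV[R]_n.
Variable X : R -> Omega -> V.
Hypothesis FX : forall s p, 0 <= s <= T -> Fm s (fun w => X s w p 0).
Hypothesis mX : forall s p, measurable_fun setT (fun w => X s w p 0).
Hypothesis cX : forall w p, continuous (fun s => X s w p 0).
Variables (b : 'I_n -> R * V -> R) (sg : 'I_n -> 'I_d -> R * V -> R).
Hypothesis cb : forall p, continuous (b p).
Hypothesis csg : forall p k, continuous (sg p k).
Variable I : 'I_n -> R -> Omega -> R.
Hypothesis II : forall p s, 0 <= s <= T -> ItoP 0 s (fun k r w => sg p k (r, X r w)) (I p s).
Variable x0 : 'I_n -> R.
Hypothesis SDE : forall s, 0 <= s <= T -> {ae P, forall w, forall p,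
  X s w p 0 = x0 p + (\int[mu]_(r in `[0%R, s]) b p (r, X r w))%R + I p s w}.
Notation E3 := (R * V * V)%type.
Variables (f fs G : E3 -> R) (D : 'I_n -> E3 -> R) (H : 'I_n -> 'I_n -> E3 -> R).
Hypothesis cfs : continuous fs.
Hypothesis cG : continuous G.
Hypothesis cD : forall p, continuous (D p).
Hypothesis cH : forall p q, continuous (H p q).
(** Time and space regularity of f are stated as mean value forms, with the derivatives evaluated at
    an intermediate point; together with continuity of [fs] and [H], this lets [oscF] bound the
    remainders. *)
Hypothesis ftime : forall s s' xi x, t <= s -> s < s' -> s' <= T ->
  exists2 c, s <= c <= s' & f (s', xi, x) - f (s, xi, x) = fs (c, xi, x) * (s' - s).
Hypothesis ftaylor : forall s xi x h, t <= s <= T -> exists2 tau, 0 <= tau <= 1 &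
  f (s, xi, x + h) - f (s, xi, x) = \sum_p D p (s, xi, x) * h p 0 +
    2^-1 * \sum_p \sum_q H p q (s, xi, x + tau *: h) * (h p 0 * h q 0).
Hypothesis pde : forall s xi x, t <= s <= T ->
  fs (s, xi, x) + \sum_p D p (s, xi, x) * b p (s, x)
  + 2^-1 * (\sum_p \sum_q H p q (s, xi, x) * \sum_k (sg p k (s, x) * sg q k (s, x)))
  + G (s, xi, x) = 0.

Definition at3 s w : E3 := (s, X t w, X s w).
Definition at2 s w : R * V := (s, X s w).

Lemma cvg_process w (s : R) : X r w @[r --> s] --> X s w.
Proof.
move=> U [Q hQ hU].
have h p : \forall r \near s, Q p 0 (X r w p 0).
  have h : X r w p 0 @[r --> s] --> X s w p 0 := @cX w p s.
  exact: h (hQ p 0).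
have hh : \forall r \near s, forall p, Q p 0 (X r w p 0).
  exact: (@filter_forall _ _ (fun p r => Q p 0 (X r w p 0)) (nbhs s) _ h).
by apply: filterS hh => r hr; apply: hU => p j; rewrite (ord1 j).
Qed.

Lemma at2_cont w : continuous (at2 ^~ w).
Proof.
apply: (@cont_pair R R V id (fun s => X s w)) => s; first exact: cvg_id.
exact: cvg_process.
Qed.

Lemma at3_cont w : continuous (at3 ^~ w).
Proof.
apply: (@cont_pair R (R * V)%type V (fun s => (s, X t w)) (fun s => X s w)) => [|s]; last exact: cvg_process.
apply: (@cont_pair R R V id (fun=> X t w)) => s; first exact: cvg_id.
exact: cvg_cst.
Qed.

Section measurability.
Context {d' : measure_display} {S : measurableType d'}.
Variables (r : R) (u v : S -> V).
Hypothesis mu_ : forall p, measurable_fun setT (fun s => u s p 0).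
Hypothesis mv_ : forall p, measurable_fun setT (fun s => v s p 0).

Lemma comp3_meas (F : E3 -> R) : continuous F -> measurable_fun setT (fun s => F (r, u s, v s)).
Proof.
move=> cF; have sE : sep E3 by apply: sep_prod; [apply: sep_prod; [exact: sep_R|]|]; exact: sep_mx.
apply: (@bm_within R _ S setT measurableT E3 setT F (fun s => (r, u s, v s))) => //.
- apply: bm_pair => //; first apply: bm_pair => //.
  + by apply: bm_R => //; exact: measurable_cst.
  + by apply: bm_mx => // i j; rewrite (ord1 j).
  + by apply: bm_mx => // i j; rewrite (ord1 j).
- exact: continuous_subspaceT.
Qed.

Lemma comp2_meas (F : R * V -> R) : continuous F -> measurable_fun setT (fun s => F (r, v s)).
Proof.
move=> cF; have sE : sep (R * V)%type by apply: sep_prod; [exact: sep_R|exact: sep_mx].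
apply: (@bm_within R _ S setT measurableT _ setT F (fun s => (r, v s))) => //.
- apply: bm_pair => //; first by apply: bm_R => //; exact: measurable_cst.
  by apply: bm_mx => // i j; rewrite (ord1 j).
- exact: continuous_subspaceT.
Qed.

End measurability.

Section processes.
Variables (F3 : E3 -> R) (F2 : R * V -> R).
Hypothesis cF3 : continuous F3.
Hypothesis cF2 : continuous F2.
Definition pr3 s w := F3 (at3 s w).
Definition pr2 s w := F2 (at2 s w).

Lemma pr3_meas s : measurable_fun setT (pr3 s).
Proof. exact: comp3_meas. Qed.

Lemma pr2_meas s : measurable_fun setT (pr2 s).
Proof. exact: comp2_meas. Qed.

Lemma pr3_cont w : continuous (pr3 ^~ w).
Proof. by move=> s; apply: (@continuous_comp _ _ _ (at3 ^~ w) F3); [exact: at3_cont|exact: cF3]. Qed.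

Lemma pr2_cont w : continuous (pr2 ^~ w).
Proof. by move=> s; apply: (@continuous_comp _ _ _ (at2 ^~ w) F2); [exact: at2_cont|exact: cF2]. Qed.

Lemma pr3_Fm s : t <= s <= T -> Fm s (pr3 s).
Proof.
move=> /andP[ts sT]; apply: comp3_meas => // p; last by apply: FX; rewrite (le_trans t0 ts).
by apply: (Fm_mono ts); apply: FX; rewrite t0 (le_trans ts).
Qed.

Lemma pr2_Fm s : t <= s <= T -> Fm s (pr2 s).
Proof. by move=> /andP[ts sT]; apply: comp2_meas => // p; apply: FX; rewrite (le_trans t0 ts). Qed.

End processes.

(* The increment h_ of X over a step is the sum of the drift B_, the diffusion
   term u_ with frozen coefficient, and the Euler error e_. *)
Let h_ p N j w := X (gr N j.+1) w p 0 - X (gr N j) w p 0.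
Let dW_ k N j w := dW W (gr N j) (gr N j.+1) k w.
Let u_ p N j w := \sum_k sg p k (at2 (gr N j) w) * dW_ k N j w.
Let B_ p N j w := (\int[mu]_(r in `[gr N j, gr N j.+1]) b p (at2 r w))%R.
Let e_ p N j w := I p (gr N j.+1) w - I p (gr N j) w - u_ p N j w.

Lemma h_decomp N : {ae P, forall w, forall p j, (j <= N)%N -> h_ p N j w = B_ p N j w + u_ p N j w + e_ p N j w}.
Proof.
have gT j : (j <= N.+1)%N -> 0 <= gr N j <= T.
  by move=> jN; have /andP[h1 ->] := @gr_in _ t T tT N j jN; rewrite (le_trans t0 h1).
have : {ae P, forall w, forall j : 'I_N.+2, forall p,
    X (gr N j) w p 0 = x0 p + (\int[mu]_(r in `[0%R, gr N j]) b p (r, X r w))%R + I p (gr N j) w}.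
  by apply: filter_forall => j; apply: SDE; apply: gT; exact: ltn_ord j.
apply: filterS => w hw p j jN.
have jN1 : (j < N.+2)%N by apply: ltnW.
have jN2 : (j.+1 < N.+2)%N by [].
rewrite /h_ (hw (Ordinal jN1)) (hw (Ordinal jN2)) /=.
rewrite (@Rint_split _ (fun r => b p (r, X r w)) 0 (gr N j) (gr N j.+1)); last 3 first.
- by have /andP[] := gT j (ltnW jN2).
- exact: ltW (gr_lt tT N j).
- exact: (pr2_cont (cb (p := p))).
rewrite /e_ /B_ /at2; ring.
Qed.


(** The part of an increment of X whose squares sum to 0 in the limit; the other part [u_] has
    squares that are only bounded in probability. *)
Let rr_ p N j w := B_ p N j w + e_ p N j w.
Let Zf k (v : E3) := \sum_p D p v * sg p k (v.1.1, v.2).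
(** The coefficient of dW_k dW_l in the second order term. *)
Let Af k l (v : E3) := \sum_p \sum_q H p q v * (sg p k (v.1.1, v.2) * sg q l (v.1.1, v.2)).

Let csg3 p k : continuous (fun v : E3 => sg p k (v.1.1, v.2)).
Proof.
move=> v; apply: (@continuous_comp _ _ _ (fun v : E3 => (v.1.1, v.2)) (sg p k)); last exact: csg.
apply: (@cont_pair E3 R V (fun v => v.1.1) snd) => {}v; last exact: cvg_snd.
by apply: (@continuous_comp E3 (R * V)%type R fst fst); exact: cvg_fst.
Qed.

Let cZf k : continuous (Zf k).
Proof.
by apply: cont_sum => p v; apply: cvgM; [exact: cD|exact: csg3].
Qed.

Let cAf k l : continuous (Af k l).
Proof.
apply: cont_sum => p; apply: cont_sum => q v.
by apply: cvgM; [exact: cH|apply: cvgM; exact: csg3].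
Qed.

Let B_dev p N j w : (j <= N)%N ->
  `|B_ p N j w - b p (at2 (gr N j) w) * dt N| <= osc (pr2 (b p)) N w * dt N.
Proof.
move=> jN; have := @Rint_dev _ (pr2 (b p) ^~ w) (gr N j) (gr N j.+1) (b p (at2 (gr N j) w)) (osc (pr2 (b p)) N w)
  (ltW (gr_lt tT N j)) (pr2_cont (cb (p := p)) (w := w)).
rewrite grS; apply => s sj.
exact: (le_osc tT (pr2_cont (cb (p := p))) w jN sj).
Qed.

Let B_bound p N j w : (j <= N)%N -> `|B_ p N j w| <= nrm (pr2 (b p)) w * dt N.
Proof.
move=> jN; have := @Rint_bound _ (pr2 (b p) ^~ w) (gr N j) (gr N j.+1) (nrm (pr2 (b p)) w)
  (ltW (gr_lt tT N j)) (pr2_cont (cb (p := p)) (w := w)).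
rewrite grS; apply => s /andP[s1 s2].
apply: (le_nrm (pr2_cont (cb (p := p)))).
have /andP[h1 _] := gr_in tT (leqW jN); have /andP[_ h2] := @gr_in _ t T tT N j.+1 jN.
by rewrite (le_trans h1 s1) (le_trans s2 h2).
Qed.

(** Drift increments are of order dt, so their squares sum to a tight factor times dt (T - t); for
    the Euler errors this is [euler_sqr]. *)
Let cvP_RR : cvP (fun N w => \sum_(j < N.+1) \sum_p rr_ p N j w ^+ 2).
Proof.
have hB p : cvP (fun N w => \sum_(j < N.+1) B_ p N j w ^+ 2).
  have h1 : cvP (fun N _ => dt N) by apply: cvP_cst; exact: dt_cvg0.
  have oN := OP_nrm P tT (pr2_meas (cb (p := p))) (pr2_cont (cb (p := p))).
  have h2 := cvPM_OP (cvPM_OP h1 (OPM oN oN)) (OP_cst P (T - t)).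
  apply: (cvP_le _ h2) => N; apply: aeW => w.
  rewrite ger0_norm; last by apply: sumr_ge0 => j _; exact: sqr_ge0.
  apply: le_trans (ler_norm _).
  apply: (@le_trans _ _ (\sum_(j < N.+1) (nrm (pr2 (b p)) w * dt N) ^+ 2)).
    apply: ler_sum => j _; rewrite -(real_normK (num_real (B_ _ _ _ _))).
    have h := B_bound p w (ltn_ord j : (j <= N)%N).
    by rewrite ler_pXn2r ?nnegrE// (le_trans _ h).
  rewrite -mulr_suml sumr_const card_ord -[_ *+ N.+1]mulr_natr.
  have E : dt N * N.+1%:R = T - t by rewrite /dt divfK ?pnatr_eq0.
  by rewrite -E le_eqVlt; apply/orP; left; apply/eqP; ring.
have hE p : cvP (fun N w => \sum_(j < N.+1) e_ p N j w ^+ 2).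
  apply: (euler_sqr cP BM t0 tT (Phi := fun k => pr2 (sg p k)) (I := I p)).
  - by move=> k s; apply: pr2_Fm; exact: csg.
  - by move=> k s; apply: pr2_meas; exact: csg.
  - by move=> k; apply: pr2_cont; exact: csg.
  - by move=> s sT; exact: II.
have h : cvP (fun N w => \sum_p (2 * (\sum_(j < N.+1) B_ p N j w ^+ 2) + 2 * (\sum_(j < N.+1) e_ p N j w ^+ 2))).
  by apply: cvP_sum => p; apply: cvPD; exact: cvPZ.
apply: (cvP_le _ h) => N; apply: aeW => w.
rewrite ger0_norm; last by apply: sumr_ge0 => j _; apply: sumr_ge0 => p _; exact: sqr_ge0.
apply: le_trans (ler_norm _); rewrite exchange_big/=; apply: ler_sum => p _.
rewrite !mulr_sumr -big_split/=; apply: ler_sum => j _.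
by have := sqr_sub_le (B_ p N j w) (- e_ p N j w); rewrite opprK sqrrN.
Qed.

Let OP_UU : OP (fun N w => \sum_(j < N.+1) \sum_p u_ p N j w ^+ 2).
Proof.
have h : OP (fun N w => \sum_p \sum_k d%:R * (nrm (pr2 (sg p k)) w * nrm (pr2 (sg p k)) w) * (\sum_(j < N.+1) dW_ k N j w ^+ 2)).
  apply: OP_sum => p; apply: OP_sum => k; apply: OPM; last exact: (OP_dW_sqr BM t0 tT).
  apply: OPM; first exact: OP_cst.
  by apply: OPM; apply: (OP_nrm P tT (pr2_meas (@csg p k)) (pr2_cont (@csg p k))).
apply: (OP_le _ h) => N; apply: aeW => w.
rewrite ger0_norm; last by apply: sumr_ge0 => j _; apply: sumr_ge0 => p _; exact: sqr_ge0.
apply: le_trans (ler_norm _); rewrite exchange_big/=; apply: ler_sum => p _.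
apply: (@le_trans _ _ (\sum_(j < N.+1) \sum_k d%:R * (nrm (pr2 (sg p k)) w * nrm (pr2 (sg p k)) w) * dW_ k N j w ^+ 2)); last first.
  by rewrite exchange_big/=; apply: ler_sum => k _; rewrite mulr_sumr.
apply: ler_sum => j _; apply: (le_trans (sqr_sum_le _)).
rewrite mulr_sumr; apply: ler_sum => k _; rewrite -mulrA ler_wpM2l//.
rewrite exprMn ler_wpM2r ?sqr_ge0// -(real_normK (num_real (sg _ _ _))) expr2.
have hn := le_nrm (pr2_cont (@csg p k)) w (gr_in tT (ltnW (ltn_ord j))).
by apply: ler_pM.
Qed.

Let h_ur N : {ae P, forall w, forall p j, (j <= N)%N -> h_ p N j w = u_ p N j w + rr_ p N j w}.
Proof. by apply: filterS (h_decomp N) => w h p j jN; rewrite h// /rr_; ring. Qed.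

Let OP_HH : OP (fun N w => \sum_(j < N.+1) \sum_p h_ p N j w ^+ 2).
Proof.
have h := OPD (OPM (OP_cst P 2) OP_UU) (OPM (OP_cst P 2) (cvP_OP cvP_RR)).
apply: (OP_le _ h) => N; apply: filterS (h_ur N) => w hw.
rewrite ger0_norm; last by apply: sumr_ge0 => j _; apply: sumr_ge0 => p _; exact: sqr_ge0.
apply: le_trans (ler_norm _); rewrite !mulr_sumr -big_split/=; apply: ler_sum => j _.
rewrite !mulr_sumr -big_split/=; apply: ler_sum => p _; rewrite hw; last exact: ltn_ord j.
by have := sqr_sub_le (u_ p N j w) (- rr_ p N j w); rewrite opprK sqrrN.
Qed.

Let Q_ N j w := \sum_p \sum_q H p q (at3 (gr N j) w) * (h_ p N j w * h_ q N j w).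
Let taylor_remainder N j w := f (at3 (gr N j.+1) w) - f (at3 (gr N j) w)
  - (fs (at3 (gr N j) w) * dt N + \sum_p D p (at3 (gr N j) w) * h_ p N j w + 2^-1 * Q_ N j w).

(** The increment of f is split at (gr j, X at gr j.+1): first in time with the new position, which
    is the case tau = 1 of [oscF], then in space at the old time, where the Hessian is taken at an
    unknown tau. *)
Let taylor_remainder_le N j w : (j <= N)%N -> `|taylor_remainder N j w| <= oscF t T X fs N w * dt N
   + (\sum_p \sum_q oscF t T X (H p q) N w) * \sum_p h_ p N j w ^+ 2.
Proof.
move=> jN; have sj := gr_in tT (leqW jN); have sj1 := @gr_in _ t T tT N j.+1 jN.
have /andP[tj _] := sj; have /andP[_ j1T] := sj1.
have dt0 := dt_gt0 tT N.
pose dx := X (gr N j.+1) w - X (gr N j) w.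
have xE : X (gr N j.+1) w = X (gr N j) w + dx by rewrite addrC subrK.
have hE p : dx p 0 = h_ p N j w by rewrite !mxE.
have [c cj fE] := ftime (X t w) (X (gr N j.+1) w) tj (gr_lt tT N j) j1T.
have [tau t01 fE2] := ftaylor (X t w) (X (gr N j) w) dx sj.
rewrite -xE in fE2; rewrite grS in fE.
have -> : taylor_remainder N j w = (fs (c, X t w, X (gr N j) w + 1 *: dx) - fs (at3 (gr N j) w)) * dt N
   + 2^-1 * \sum_p \sum_q (H p q (gr N j, X t w, X (gr N j) w + tau *: dx) - H p q (at3 (gr N j) w)) * (h_ p N j w * h_ q N j w).
  rewrite scale1r -xE /taylor_remainder /Q_ /at3.
  have -> : f (gr N j.+1, X t w, X (gr N j.+1) w) - f (gr N j, X t w, X (gr N j) w) =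
     (f (gr N j.+1, X t w, X (gr N j.+1) w) - f (gr N j, X t w, X (gr N j.+1) w)) +
     (f (gr N j, X t w, X (gr N j.+1) w) - f (gr N j, X t w, X (gr N j) w)) by ring.
  rewrite fE fE2.
  under [in RHS]eq_bigr do (under eq_bigr do rewrite mulrBl; rewrite sumrB).
  rewrite sumrB.
  under eq_bigr do rewrite hE.
  under [X in 2^-1 * X]eq_bigr do under eq_bigr do rewrite !hE.
  move: (\sum_p _) (\sum_p _) (\sum_p _) => s1 s2 s3; ring.
apply: (le_trans (ler_normD _ _)); apply: lerD.
  rewrite normrM (gtr0_norm dt0) ler_pM2r//.
  by apply: (le_oscF tT cX cfs) => //; rewrite ler01 lexx.
rewrite normrM gtr0_norm ?invr_gt0//.
apply: (@le_trans _ _ (1 * \sum_p \sum_q oscF t T X (H p q) N w * \sum_p h_ p N j w ^+ 2)); last first.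
  rewrite mul1r mulr_suml; apply: ler_sum => p _; by rewrite mulr_suml.
apply: ler_pM => //; first by rewrite invf_le1// ler1n.
apply: (le_trans (ler_norm_sum _ _ _)); apply: ler_sum => p _.
apply: (le_trans (ler_norm_sum _ _ _)); apply: ler_sum => q _.
rewrite normrM; apply: ler_pM => //; last exact: (mul_le_sum (fun p => h_ p N j w)).
apply: (le_oscF tT cX (@cH p q)) => //.
by rewrite lexx ltW// gr_lt.
Qed.

Let cvP_taylor_remainder : cvP (fun N w => \sum_(j < N.+1) taylor_remainder N j w).
Proof.
have h1 := cvPM_OP (cvP_oscF P tT mX cX cfs) (OP_cst P (T - t)).
have h2 : cvP (fun N w => \sum_p \sum_q oscF t T X (H p q) N w).
  by apply: cvP_sum => p; apply: cvP_sum => q; exact: (cvP_oscF P tT mX cX (@cH p q)).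
have h := cvPD h1 (cvPM_OP h2 OP_HH).
apply: (cvP_le _ h) => N; apply: aeW => w.
apply: le_trans (ler_norm _); apply: (le_trans (ler_norm_sum _ _ _)).
apply: (@le_trans _ _ (\sum_(j < N.+1) (oscF t T X fs N w * dt N
   + (\sum_p \sum_q oscF t T X (H p q) N w) * \sum_p h_ p N j w ^+ 2))).
  by apply: ler_sum => j _; apply: taylor_remainder_le; exact: ltn_ord j.
by rewrite big_split/= -mulr_sumr sum_dt -mulr_sumr.
Qed.

Let cvP_drift_error : cvP (fun N w => \sum_(j < N.+1) \sum_p D p (at3 (gr N j) w) * (B_ p N j w - b p (at2 (gr N j) w) * dt N)).
Proof.
have h : cvP (fun N w => \sum_p osc (pr2 (b p)) N w * (nrm (pr3 (D p)) w * (T - t))).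
  apply: cvP_sum => p; apply: cvPM_OP.
    exact: (cvP_osc P tT (pr2_meas (cb (p := p))) (pr2_cont (cb (p := p)))).
  apply: OPM; last exact: OP_cst.
  exact: (OP_nrm P tT (pr3_meas (@cD p)) (pr3_cont (@cD p))).
apply: (cvP_le _ h) => N; apply: aeW => w.
apply: le_trans (ler_norm _); apply: (le_trans (ler_norm_sum _ _ _)).
rewrite -(sum_dt t T N).
apply: (@le_trans _ _ (\sum_(j < N.+1) \sum_p osc (pr2 (b p)) N w * (nrm (pr3 (D p)) w * dt N))).
  apply: ler_sum => j _; apply: (le_trans (ler_norm_sum _ _ _)); apply: ler_sum => p _.
  rewrite [leRHS]mulrCA normrM; apply: ler_pM => //; last by apply: B_dev; exact: ltn_ord j.
  apply: (le_nrm (pr3_cont (@cD p))); apply: gr_in => //; exact: ltnW.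
by rewrite exchange_big/=; apply: ler_sum => p _; rewrite -!mulr_sumr.
Qed.

(** The absolute value makes the bound valid for every real M, as [cvP_local] quantifies over all of
    them. *)
Let clampM (M x : R) := clamp (- `|M|) `|M| x.

Let clampM_id M x : `|x| <= M -> clampM M x = x.
Proof. by move=> xM; rewrite /clampM clamp_id// -ler_norml (le_trans xM)// ler_norm. Qed.

Let clampM_le M x : `|clampM M x| <= `|M|.
Proof. by rewrite ler_norml clamp_ge clamp_le// -subr_ge0 opprK addr_ge0. Qed.

Let clampM_Fm M s (phi : Omega -> R) : Fm s phi -> Fm s (fun w => clampM M (phi w)).
Proof. by move=> F; apply: measurable_maxr => //; exact: measurable_minr. Qed.

Let cvP_euler_error p : cvP (fun N w => \sum_(j < N.+1) D p (at3 (gr N j) w) * e_ p N j w).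
Proof.
apply: (@cvP_local _ _ _ _ _ (fun M N w => \sum_(j < N.+1) clampM M (D p (at3 (gr N j) w)) * e_ p N j w)).
  move=> e e0; have [M _ hM] := nrm_tight P tT (pr3_meas (@cD p)) (pr3_cont (@cD p)) e0.
  exists M; apply: nearW => N; apply: (hpS (lexx _) _ hM) => w hw.
  apply: eq_bigr => j _; rewrite clampM_id//; apply: le_trans hw.
  by apply: (le_nrm (pr3_cont (@cD p))); apply: gr_in => //; exact: ltnW.
move=> M.
apply: (@euler_lin R dO Omega P cP d W BM t T t0 tT (fun k => pr2 (sg p k)) (I p) _ _ _ _
   (fun N j w => clampM M (D p (at3 (gr N j) w))) `|M|).
- by move=> k s; apply: pr2_Fm; exact: csg.
- by move=> k s; apply: pr2_meas; exact: csg.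
- by move=> k; apply: pr2_cont; exact: csg.
- by move=> s sT; exact: II.
- move=> N j jN; apply: clampM_Fm; apply: (pr3_Fm (@cD p)); apply: gr_in => //; exact: leqW.
- by move=> N j w; exact: clampM_le.
Qed.

(** With h = u + r the difference is u_p r_q + r_p u_q + r_p r_q. The squares of u are merely tight
    and those of r vanish, so Young's inequality with a small weight on u is combined with
    [cvP_interp]. *)
Let cvP_cross_terms : cvP (fun N w => \sum_(j < N.+1) \sum_p \sum_q H p q (at3 (gr N j) w) *
   (h_ p N j w * h_ q N j w - u_ p N j w * u_ q N j w)).
Proof.
pose Hn w := \sum_p \sum_q nrm (pr3 (H p q)) w.
have oH : OP (fun=> Hn).
  apply: OP_sum => p; apply: OP_sum => q.
  exact: (OP_nrm P tT (pr3_meas (@cH p q)) (pr3_cont (@cH p q))).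
pose UU N w := \sum_(j < N.+1) \sum_p u_ p N j w ^+ 2.
pose RR N w := \sum_(j < N.+1) \sum_p rr_ p N j w ^+ 2.
pose U N w := \sum_(j < N.+1) \sum_p \sum_q H p q (at3 (gr N j) w) *
   ((u_ p N j w + rr_ p N j w) * (u_ q N j w + rr_ q N j w) - u_ p N j w * u_ q N j w).
suff h : cvP U.
  apply: (cvP_le _ h) => N; apply: filterS (h_ur N) => w hw.
  rewrite le_eqVlt; apply/orP; left; apply/eqP; congr `|_|.
  apply: eq_bigr => j _; apply: eq_bigr => p _; apply: eq_bigr => q _.
  by rewrite !hw//; exact: ltn_ord j.
apply: (@cvP_interp _ _ _ _ U (fun N w => 2 * Hn w * UU N w)
   (fun c N w => RR N w * ((2 * c^-1 + 1) * Hn w))).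
- by apply: OPM OP_UU; apply: OPM oH; exact: OP_cst.
- by move=> c c0; apply: cvPM_OP; [exact: cvP_RR|apply: OPM oH; exact: OP_cst].
move=> c N w c0.
have key j p q : `|(u_ p N j w + rr_ p N j w) * (u_ q N j w + rr_ q N j w) - u_ p N j w * u_ q N j w|
   <= c * 2 * (\sum_p u_ p N j w ^+ 2) + (2 * c^-1 + 1) * (\sum_p rr_ p N j w ^+ 2).
  have -> : (u_ p N j w + rr_ p N j w) * (u_ q N j w + rr_ q N j w) - u_ p N j w * u_ q N j w
    = u_ p N j w * rr_ q N j w + u_ q N j w * rr_ p N j w + rr_ p N j w * rr_ q N j w by ring.
  apply: (le_trans (ler_normD _ _)).
  apply: (@le_trans _ _ ((c * (\sum_p u_ p N j w ^+ 2) + c^-1 * (\sum_p rr_ p N j w ^+ 2)) * 2 + \sum_p rr_ p N j w ^+ 2)); last first.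
    by rewrite le_eqVlt; apply/orP; left; apply/eqP; ring.
  apply: lerD; last exact: (mul_le_sum (fun p => rr_ p N j w)).
  apply: (le_trans (ler_normD _ _)); rewrite mulr_natr mulr2n; apply: lerD.
  + apply: (le_trans (mul_le_sqr _ _ c0)); apply: lerD.
      by rewrite ler_pM2l//; exact: (sqr_le_sum (fun p => u_ p N j w)).
    by rewrite ler_pM2l ?invr_gt0//; exact: (sqr_le_sum (fun p => rr_ p N j w)).
  + apply: (le_trans (mul_le_sqr _ _ c0)); apply: lerD.
      by rewrite ler_pM2l//; exact: (sqr_le_sum (fun p => u_ p N j w)).
    by rewrite ler_pM2l ?invr_gt0//; exact: (sqr_le_sum (fun p => rr_ p N j w)).
apply: (@le_trans _ _ (\sum_(j < N.+1) Hn w * (c * 2 * (\sum_p u_ p N j w ^+ 2) + (2 * c^-1 + 1) * (\sum_p rr_ p N j w ^+ 2)))); last first.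
  rewrite -mulr_sumr big_split/= -!mulr_sumr le_eqVlt; apply/orP; left; apply/eqP.
  by rewrite -/(UU N w) -/(RR N w); ring.
apply: (le_trans (ler_norm_sum _ _ _)); apply: ler_sum => j _.
apply: (le_trans (ler_norm_sum _ _ _)); rewrite /Hn mulr_suml; apply: ler_sum => p _.
apply: (le_trans (ler_norm_sum _ _ _)); rewrite mulr_suml; apply: ler_sum => q _.
rewrite normrM; apply: ler_pM => //.
by apply: (le_nrm (pr3_cont (@cH p q))); apply: gr_in => //; exact: ltnW.
Qed.

Let cvP_quadratic_variation k l : cvP (fun N w => \sum_(j < N.+1) Af k l (at3 (gr N j) w) *
  (dW_ k N j w * dW_ l N j w - (if k == l then dt N else 0))).
Proof.
apply: (@cvP_local _ _ _ _ _ (fun M N w => \sum_(j < N.+1) clampM M (Af k l (at3 (gr N j) w)) *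
  (dW_ k N j w * dW_ l N j w - (if k == l then dt N else 0)))).
  move=> e e0; have [M _ hM] := nrm_tight P tT (pr3_meas (@cAf k l)) (pr3_cont (@cAf k l)) e0.
  exists M; apply: nearW => N; apply: (hpS (lexx _) _ hM) => w hw.
  apply: eq_bigr => j _; rewrite clampM_id//; apply: le_trans hw.
  by apply: (le_nrm (pr3_cont (@cAf k l))); apply: gr_in => //; exact: ltnW.
move=> M; apply: (@quad_cvg R dO Omega P cP d W BM t T t0 tT (fun N j w => clampM M (Af k l (at3 (gr N j) w))) `|M| k l).
- move=> N j jN; apply: clampM_Fm; apply: (pr3_Fm (@cAf k l)); apply: gr_in => //; exact: leqW.
- by move=> N j w; exact: clampM_le.
Qed.

Let cvP_riemann_sum : cvP (fun N w => (\int[mu]_(s in `[t, T]) G (at3 s w))%R - \sum_(j < N.+1) G (at3 (gr N j) w) * dt N).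
Proof.
have h := cvPM_OP (cvP_osc P tT (pr3_meas cG) (pr3_cont cG)) (OP_cst P (T - t)).
apply: (cvP_le _ h) => N; apply: aeW => w.
apply: le_trans (ler_norm _); rewrite -(Rint_grid N tT (@pr3_cont _ cG w)) -sumrB.
apply: (le_trans (ler_norm_sum _ _ _)); rewrite -(sum_dt t T N) mulr_sumr.
apply: ler_sum => j _.
have := @Rint_dev _ (pr3 G ^~ w) (gr N j) (gr N j.+1) (G (at3 (gr N j) w)) (osc (pr3 G) N w)
  (ltW (gr_lt tT N j)) (pr3_cont cG (w := w)).
rewrite grS; apply => s sj.
exact: (le_osc tT (pr3_cont cG) w (ltn_ord j : (j <= N)%N) sj).
Qed.


(** The equation at the left end point expresses G as minus the other terms. The time and drift
    terms then cancel in Taylor's expansion, and the second order coefficient of dt is exactly the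
    compensator of the products dW_k dW_l; only error terms remain. *)
Let step N j w : (j <= N)%N -> (forall p, h_ p N j w = B_ p N j w + u_ p N j w + e_ p N j w) ->
  f (at3 (gr N j.+1) w) - f (at3 (gr N j) w) - \sum_k Zf k (at3 (gr N j) w) * dW_ k N j w
    + G (at3 (gr N j) w) * dt N =
  taylor_remainder N j w + \sum_p D p (at3 (gr N j) w) * (B_ p N j w - b p (at2 (gr N j) w) * dt N)
  + \sum_p D p (at3 (gr N j) w) * e_ p N j w
  + 2^-1 * (\sum_p \sum_q H p q (at3 (gr N j) w) * (h_ p N j w * h_ q N j w - u_ p N j w * u_ q N j w))
  + 2^-1 * (\sum_k \sum_l Af k l (at3 (gr N j) w) *
      (dW_ k N j w * dW_ l N j w - (if k == l then dt N else 0))).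
Proof.
move=> jN hw; set a := at3 (gr N j) w; set c := at2 (gr N j) w.
have E1 : \sum_p D p a * h_ p N j w = \sum_p D p a * (B_ p N j w - b p c * dt N)
   + (\sum_p D p a * b p c) * dt N + \sum_k Zf k a * dW_ k N j w + \sum_p D p a * e_ p N j w.
  have -> : \sum_k Zf k a * dW_ k N j w = \sum_p D p a * u_ p N j w.
    rewrite /Zf /u_; under eq_bigr do rewrite mulr_suml.
    rewrite exchange_big/=; apply: eq_bigr => p _; rewrite mulr_sumr.
    by apply: eq_bigr => k _; rewrite mulrA.
  rewrite mulr_suml -!big_split/=; apply: eq_bigr => p _; rewrite hw; ring.
have E2 : Q_ N j w = (\sum_p \sum_q H p q a * (h_ p N j w * h_ q N j w - u_ p N j w * u_ q N j w))
   + \sum_k \sum_l Af k l a * (dW_ k N j w * dW_ l N j w).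
  have -> : \sum_k \sum_l Af k l a * (dW_ k N j w * dW_ l N j w) = \sum_p \sum_q H p q a * (u_ p N j w * u_ q N j w).
    rewrite /Af /u_.
    under eq_bigr do under eq_bigr do rewrite mulr_suml.
    under eq_bigr do rewrite exchange_big/=.
    rewrite exchange_big/=; apply: eq_bigr => p _.
    under eq_bigr do under eq_bigr do rewrite mulr_suml.
    under eq_bigr do rewrite exchange_big/=.
    rewrite exchange_big/=; apply: eq_bigr => q _.
    rewrite mulr_suml mulr_sumr; apply: eq_bigr => k _.
    rewrite mulr_sumr mulr_sumr; apply: eq_bigr => l _.
    by rewrite /a /at3 /at2 /=; ring.
  rewrite /Q_ -big_split/=; apply: eq_bigr => p _; rewrite -big_split/=; apply: eq_bigr => q _.
  by rewrite -/a; ring.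
have E3 : \sum_k \sum_l Af k l a * (dW_ k N j w * dW_ l N j w - (if k == l then dt N else 0)) =
   \sum_k \sum_l Af k l a * (dW_ k N j w * dW_ l N j w)
   - (\sum_p \sum_q H p q a * \sum_k (sg p k c * sg q k c)) * dt N.
  have -> : (\sum_p \sum_q H p q a * \sum_k (sg p k c * sg q k c)) = \sum_k Af k k a.
    rewrite /Af [RHS]exchange_big/=; apply: eq_bigr => p _; rewrite [RHS]exchange_big/=; apply: eq_bigr => q _.
    by rewrite mulr_sumr.
  rewrite mulr_suml -sumrB; apply: eq_bigr => k _.
  rewrite (_ : Af k k a * dt N = \sum_l Af k l a * (if k == l then dt N else 0)); last first.
    rewrite (bigD1 k)//= eqxx big1 ?addr0// => l lk.
    by rewrite eq_sym (negbTE lk) mulr0.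
  by rewrite -sumrB; apply: eq_bigr => l _; rewrite mulrBr.
have pd : fs a + \sum_p D p a * b p c + 2^-1 * (\sum_p \sum_q H p q a * \sum_k (sg p k c * sg q k c)) + G a = 0.
  exact: pde (X t w) (X (gr N j) w) (gr_in tT (leqW jN)).
have -> : G a = - (fs a + \sum_p D p a * b p c + 2^-1 * (\sum_p \sum_q H p q a * \sum_k (sg p k c * sg q k c))).
  by apply/eqP; rewrite -addr_eq0 addrC; apply/eqP.
rewrite E3 /taylor_remainder -/a E1 E2; ring.
Qed.

Let ito_remainder N w := f (at3 T w) - f (at3 t w) + (\int[mu]_(s in `[t, T]) G (at3 s w))%R
  - \sum_(j < N.+1) \sum_k Zf k (at3 (gr N j) w) * dW_ k N j w.

Let cvP_ito_remainder : cvP ito_remainder.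
Proof.
have h4 := cvPZ 2^-1 cvP_cross_terms.
have h5 : cvP (fun N w => 2^-1 * \sum_k \sum_l \sum_(j < N.+1) Af k l (at3 (gr N j) w) *
  (dW_ k N j w * dW_ l N j w - (if k == l then dt N else 0))).
  by apply: cvPZ; apply: cvP_sum => k; apply: cvP_sum => l; exact: cvP_quadratic_variation.
have h3 : cvP (fun N w => \sum_p \sum_(j < N.+1) D p (at3 (gr N j) w) * e_ p N j w).
  by apply: cvP_sum => p; exact: cvP_euler_error.
have h := cvPD (cvPD (cvPD (cvPD (cvPD cvP_taylor_remainder cvP_drift_error) h3) h4) h5) cvP_riemann_sum.
apply: (cvP_le _ h) => N; apply: filterS (h_decomp N) => w hw.
rewrite le_eqVlt; apply/orP; left; apply/eqP; congr `|_|.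
rewrite /ito_remainder; have -> : f (at3 T w) - f (at3 t w) = \sum_(j < N.+1) (f (at3 (gr N j.+1) w) - f (at3 (gr N j) w)).
  rewrite -(big_mkord xpredT (fun j => f (at3 (gr N j.+1) w) - f (at3 (gr N j) w))).
  by rewrite telescope_sumr// grN gr0.
have -> : \sum_p \sum_(j < N.+1) D p (at3 (gr N j) w) * e_ p N j w =
    \sum_(j < N.+1) \sum_p D p (at3 (gr N j) w) * e_ p N j w by rewrite exchange_big.
have -> : \sum_k \sum_l \sum_(j < N.+1) Af k l (at3 (gr N j) w) *
      (dW_ k N j w * dW_ l N j w - (if k == l then dt N else 0)) =
    \sum_(j < N.+1) \sum_k \sum_l Af k l (at3 (gr N j) w) *
      (dW_ k N j w * dW_ l N j w - (if k == l then dt N else 0)).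
  by under eq_bigr do rewrite exchange_big/=; rewrite exchange_big.
rewrite [2^-1 * \sum_(j < N.+1) _]mulr_sumr [2^-1 * \sum_(j < N.+1) _]mulr_sumr.
have hs : \sum_(j < N.+1) (f (at3 (gr N j.+1) w) - f (at3 (gr N j) w) - \sum_k Zf k (at3 (gr N j) w) * dW_ k N j w
    + G (at3 (gr N j) w) * dt N) = \sum_(j < N.+1) (
  taylor_remainder N j w + \sum_p D p (at3 (gr N j) w) * (B_ p N j w - b p (at2 (gr N j) w) * dt N)
  + \sum_p D p (at3 (gr N j) w) * e_ p N j w
  + 2^-1 * (\sum_p \sum_q H p q (at3 (gr N j) w) * (h_ p N j w * h_ q N j w - u_ p N j w * u_ q N j w))
  + 2^-1 * (\sum_k \sum_l Af k l (at3 (gr N j) w) *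
      (dW_ k N j w * dW_ l N j w - (if k == l then dt N else 0)))).
  by apply: eq_bigr => j _; apply: step => [|p]; [exact: ltn_ord j|apply: hw; exact: ltn_ord j].
rewrite -!big_split/= addrA -hs.
rewrite [X in _ = X + _ - _]big_split/= [X in _ = X + _ + _ - _]sumrB; ring.
Qed.

(** The left-point sums of [Zf] against dW are integrals of the lists [clist], with a clamping level
    M that is inactive off a small event. The lists approach [Zf] in energy by continuity of paths,
    and [ito_remainder] identifies the limit of the sums as an explicit random variable. *)
Theorem ito_formula : ItoP t T (fun k s w => \sum_p D p (at3 s w) * sg p k (at2 s w))
  (fun w => f (at3 T w) - f (at3 t w) + (\int[mu]_(s in `[t, T]) G (at3 s w))%R).
Proof.
move=> e e0.
have Tt : 0 < T - t by rewrite subr_gt0.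
pose Phi k := pr3 (Zf k).
have FP k s : t <= s <= T -> Fm s (Phi k s) by exact: (pr3_Fm (@cZf k)).
have mP k s : measurable_fun setT (Phi k s) := pr3_meas (@cZf k) s.
have cPh k w : continuous (Phi k ^~ w) := pr3_cont (@cZf k) (w := w).
have e1 : 0 < e / 4 / d.+1%:R by rewrite !divr_gt0.
have hb k : exists M : R, hp (e / 4 / d.+1%:R) (fun w => nrm (Phi k) w <= M).
  by have [M _ h] := nrm_tight P tT (mP k) (cPh k) e1; exists M.
have [M0 hM0] := choice hb.
pose M := \big[Num.max/0]_k M0 k.
have M00 : 0 <= M by exact: bigmax_ge_id.
have hM := hp_all hM0.
have co : cvP (fun N w => \sum_k osc (Phi k) N w ^+ 2 * (T - t)).
  apply: cvP_sum => k; apply: cvPM_OP; last exact: OP_cst.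
  have h := cvP_osc P tT (mP k) (cPh k).
  by have := cvPM_OP h (cvP_OP h); apply: cvP_le => N; apply: aeW => w; rewrite expr2.
have e4 : 0 < e / 4 by rewrite divr_gt0.
near \oo => N.
have p1 : hp (e / 4) (fun w => `|ito_remainder N w| <= e / 4) by near: N; exact: cvP_ito_remainder.
have p2 : hp (e / 4) (fun w => `|\sum_k osc (Phi k) N w ^+ 2 * (T - t)| <= e / 4) by near: N; exact: co.
exists (clist t T Phi M N); first exact: (adapted_list_clist cP BM tT FP).
have := hpI hM (hpI p1 p2); apply: hpS.
  have : (d%:R : R) * (e / 4 / d.+1%:R) <= e / 4.
    by rewrite mulrA ler_pdivrMr// mulrC ler_pM2l// ler_nat.
  move: (_ * (e / 4 / _)) => u; lra.
move=> w [bM [r1 r2]].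
have bM' k : nrm (Phi k) w <= M by apply: le_trans (bM k) _; exact: le_bigmax.
split.
  have := clist_sqd cP BM tT FP mP cPh N M00 bM'.
  move=> h; apply: le_trans (le_trans h _).
    by rewrite le_eqVlt; apply/orP; left; apply/eqP.
  rewrite lee_fin mulr_suml; apply: le_trans (ler_norm _) _; apply: (le_trans r2); lra.
rewrite (gint_clist_total W tT).
have -> : \sum_(j < N.+1) \sum_k clamp (- M) M (Phi k (gr N j) w) * dW W (gr N j) (gr N j.+1) k w =
   \sum_(j < N.+1) \sum_k Zf k (at3 (gr N j) w) * dW_ k N j w.
  apply: eq_bigr => j _; apply: eq_bigr => k _; congr (_ * _); rewrite clamp_id//.
  rewrite -ler_norml; apply: le_trans (bM' k).
  by apply: (le_nrm (cPh k)); apply: gr_in => //; exact: ltnW.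
rewrite distrC; apply: (le_trans r1); lra.
Unshelve. all: by end_near. Qed.

End ito_formula.

(** * The energy estimate *)

Section time_integrals.
Context {R : realType} {dO : measure_display} {Omega : measurableType dO}.
Variable P : probability Omega R.
Notation L2 := (L2 P).
Notation L1 := (L1 P).
Notation Ex := (Ex P).
Notation mu := (@lebesgue_measure R).
Implicit Types (f : R -> Omega -> R) (a b : R) (w : Omega).

Definition Rint a b f w : R := (\int[mu]_(s in `[a, b]) f s w)%R.

Lemma tintE a b f w : tint a b f w = (\int[mu]_s ((\1_(`[a, b]%classic) s : R) * f s w)%:E)%E.
Proof.
rewrite /tint integral_mkcond; apply: eq_integral => s _.
by rewrite patchE indicE; case: ifP => _; rewrite ?mul1r ?mul0r.
Qed.

Lemma jmf_indic a b f : jmf f ->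
  measurable_fun setT (fun u : R * Omega => ((\1_(`[a, b]%classic) u.1 : R) * f u.1 u.2)%:E).
Proof.
move=> mf; apply/measurable_EFinP; apply: measurable_funM => //.
by apply: measurableT_comp => //; apply: measurable_indic; exact: measurable_itv.
Qed.

Lemma jmf_norm f : jmf f -> jmf (fun s w => `|f s w|).
Proof. by move=> mf; exact: (measurableT_comp (@normr_measurable R setT) mf). Qed.

Lemma jmf_1 a b : jmf (fun s (_ : Omega) => \1_(`[a, b]%classic) s : R).
Proof. by apply: measurableT_comp => //; apply: measurable_indic; exact: measurable_itv. Qed.

Lemma mu_itv_lty a b : (mu `[a, b] < +oo)%E.
Proof. exact: (compact_finite_measure (@segment_compact R a b)). Qed.

Lemma tint_swap a b f : (forall s w, 0 <= f s w) -> jmf f ->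
  (\int[P]_w tint a b f w = \int[mu]_(s in `[a, b]) \int[P]_w (f s w)%:E)%E.
Proof.
move=> f0 mf.
have := @fubini_tonelli _ _ _ _ _ mu P _ (jmf_indic a b mf).
move=> h; rewrite (eq_integral _ _ (fun w _ => tintE a b f w)).
rewrite -[LHS]h; last by move=> [s w]; rewrite lee_fin mulr_ge0.
rewrite [RHS]integral_mkcond; apply: eq_integral => s _; rewrite patchE /fubini_F.
case: ifP => sab; last first.
  by rewrite integral0_eq// => w _ /=; rewrite indicE sab mul0r.
by apply: eq_integral => w _ /=; rewrite indicE sab mul1r.
Qed.

Lemma Rint_meas a b f : jmf f -> measurable_fun setT (Rint a b f).
Proof.
move=> mf.
rewrite (_ : Rint a b f = fun w => fine (tint a b (fun s w => Num.max (f s w) 0)%R w -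
   tint a b (fun s w => Num.max (- f s w) 0)%R w)%E).
  apply: measurableT_comp => //; apply: emeasurable_funB.
    apply: tint_meas => [s w|]; first by rewrite le_max lexx orbT.
    exact: measurable_maxr.
  apply: tint_meas => [s w|]; first by rewrite le_max lexx orbT.
  by apply: measurable_maxr => //; exact: measurable_funN.
apply/funext => w; rewrite /Rint /Rintegral integralE; congr (fine (_ - _)%E).
  by apply: eq_integral => s _; rewrite funeposE -EFin_max.
by apply: eq_integral => s _; rewrite funenegE -EFinN -EFin_max.
Qed.

Lemma section_integrable a b f w : jmf f -> (tint a b (fun s w => (f s w ^+ 2)%R) w < +oo)%E ->
  mu.-integrable `[a, b] (EFin \o (f ^~ w)).
Proof.
move=> mf fin; apply/integrableP; split; first exact: joint_section.
apply: (@le_lt_trans _ _ (tint a b (fun s w => (1 * 1 + 1 * f s w ^+ 2)%R) w)).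
  apply: ge0_le_integral => //=.
  - exact: (joint_section (jmf_norm mf)).
  - apply: (joint_section (f := fun s w => 1 * 1 + 1 * f s w ^+ 2)).
    by apply: measurable_funD => //; apply: measurable_funM => //; exact: measurable_funX.
  - move=> s _; rewrite lee_fin !mul1r -(real_normK (num_real (f s w))).
    by have := sqr_ge0 (`|f s w| - 1); move: (`|f s w|) => x; nra.
rewrite (@tintD _ _ _ a b (fun _ _ => 1) (fun s w => f s w ^+ 2))//.
- by rewrite !mul1e lte_add_pinfty// /tint integral_cst//= mul1e; exact: mu_itv_lty.
- by move=> *; exact: sqr_ge0.
- exact: measurable_cst.
- exact: measurable_funX.
Qed.

(** Cauchy-Schwarz in time, obtained by integrating f^2 >= 2 m f - m^2 with m the mean of f over
    [a, b]. If the energy is infinite, so is the right side. *)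
Lemma Rint_sqr_le a b f w : a <= b -> jmf f ->
  (((Rint a b f w) ^+ 2)%:E <= (b - a)%:E * tint a b (fun s w => (f s w ^+ 2)%R) w)%E.
Proof.
rewrite le_eqVlt => /predU1P[->|ab] mf.
  by rewrite /Rint set_itv1 /Rintegral integral_set1 /= expr0n subrr mul0e.
have ba : 0 < b - a by rewrite subr_gt0.
have [fin|] := boolP (tint a b (fun s w => (f s w ^+ 2)%R) w < +oo)%E; last first.
  by rewrite ltey negbK => /eqP ->; rewrite gt0_muley ?lte_fin// leey.
have if1 := section_integrable mf fin.
have if2 : mu.-integrable `[a, b] (EFin \o (fun s => f s w ^+ 2)).
  apply/integrableP; split.
    by apply: (joint_section (f := fun s w => f s w ^+ 2)); exact: measurable_funX.
  rewrite [X in (X < _)%E](_ : _ = tint a b (fun s w => (f s w ^+ 2)%R) w)//.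
  by apply: eq_integral => s _ /=; rewrite ger0_norm// sqr_ge0.
rewrite (_ : tint a b _ w = (\int[mu]_(s in `[a, b]) (f s w ^+ 2))%R%:E); last first.
  by rewrite /Rintegral fineK//; exact: integrable_fin_num.
rewrite -EFinM lee_fin.
pose F := Rint a b f w; pose m := F / (b - a).
have icst c : mu.-integrable `[a, b] (EFin \o cst c).
  by apply: integrable_cont => x; exact: cvg_cst.
have h : (\int[mu]_(s in `[a, b]) (2 * m * f s w - m ^+ 2) <= \int[mu]_(s in `[a, b]) (f s w ^+ 2))%R.
  apply: le_Rintegral => //.
  - have i1 : mu.-integrable `[a, b] (fun s => (2 * m)%:E * (f s w)%:E)%E by apply: integrableZl.
    by have := integrableB _ i1 (icst (m ^+ 2)); apply.
  - by move=> s _; have := sqr_ge0 (f s w - m); nra.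
have i1 : mu.-integrable `[a, b] (EFin \o (fun s => 2 * m * f s w)).
  have i1 : mu.-integrable `[a, b] (fun s => (2 * m)%:E * (f s w)%:E)%E by apply: integrableZl.
  exact: i1.
rewrite (RintegralB _ i1 (icst (m ^+ 2)))// in h.
rewrite RintegralZl// Rintegral_cst// mu_itvcc ?(ltW ab)// in h.
rewrite -/(Rint a b f w) -/F in h *.
have mE : m * (b - a) = F by rewrite /m divfK// gt_eqF.
have : (b - a) * (2 * m * F - m ^+ 2 * (b - a)) <= (b - a) * (\int[mu]_(s in `[a, b]) (f s w ^+ 2))%R.
  by rewrite ler_pM2l.
apply: le_trans; rewrite le_eqVlt; apply/orP; left; apply/eqP.
by rewrite -mE; ring.
Qed.

Lemma Rint_L2 a b f : a <= b -> jmf f -> (\int[P]_w tint a b (fun s w => (f s w ^+ 2)%R) w < +oo)%E ->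
  L2 (Rint a b f) /\
  ((Ex (fun w => Rint a b f w ^+ 2))%:E <= (b - a)%:E * \int[P]_w tint a b (fun s w => (f s w ^+ 2)%R) w)%E.
Proof.
move=> ab mf fin.
have mf2 : jmf (fun s w => f s w ^+ 2) by exact: measurable_funX.
have ba : 0 <= b - a by rewrite subr_ge0.
have t0 w : (0 <= tint a b (fun s w => (f s w ^+ 2)%R) w)%E by apply: tint_ge0 => *; exact: sqr_ge0.
have mt : measurable_fun setT (tint a b (fun s w => (f s w ^+ 2)%R)).
  by apply: tint_meas => [*|//]; exact: sqr_ge0.
have mR := Rint_meas a b mf.
have h : (\int[P]_w (Rint a b f w ^+ 2)%:E <= (b - a)%:E * \int[P]_w tint a b (fun s w => (f s w ^+ 2)%R) w)%E.
  rewrite -ge0_integralZl_EFin//; apply: ge0_le_integral => //=.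
  - by move=> w _; rewrite lee_fin sqr_ge0.
  - by apply/measurable_EFinP; exact: measurable_funX.
  - exact: measurable_funeM.
  - by move=> w _; exact: Rint_sqr_le.
have L : L1 (fun w => Rint a b f w ^+ 2).
  apply/integrableP; split; first by apply/measurable_EFinP; exact: measurable_funX.
  rewrite (eq_integral (fun w => (Rint a b f w ^+ 2)%:E)); last first.
    by move=> w _ /=; rewrite ger0_norm// sqr_ge0.
  apply: (le_lt_trans h).
  by apply: lte_mul_pinfty.
split; first by split.
by rewrite -ExE.
Qed.

(** Finite expected energy makes the paths integrable only almost surely, hence the null set. *)
Lemma Rint_split_ae a b c f : a <= b -> b <= c -> jmf f ->
  (\int[P]_w tint a c (fun s w => (f s w ^+ 2)%R) w < +oo)%E ->
  {ae P, forall w, Rint a c f w = Rint a b f w + Rint b c f w}.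
Proof.
move=> ab bc mf fin.
have mf2 : jmf (fun s w => f s w ^+ 2) by exact: measurable_funX.
have t0 w : (0 <= tint a c (fun s w => (f s w ^+ 2)%R) w)%E by apply: tint_ge0 => *; exact: sqr_ge0.
have mt : measurable_fun setT (tint a c (fun s w => (f s w ^+ 2)%R)).
  by apply: tint_meas => [*|//]; exact: sqr_ge0.
have : P.-integrable setT (tint a c (fun s w => (f s w ^+ 2)%R)).
  apply/integrableP; split => //.
  by under eq_integral do rewrite gee0_abs//.
move=> /integrable_ae => /(_ measurableT); apply: filterS => w /(_ I) /fin_numPlt/andP[_ fw].
have if1 := section_integrable mf fw.
have := @Rintegral_itvB _ (f ^~ w) (BLeft a) (BRight c) b if1.
rewrite !bnd_simp => /(_ ab bc) h.
rewrite /Rint -[X in _ = _ + X]Rintegral_itv_obnd_cbnd; last first.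
  by apply: integrableS if1 => //; apply: subset_itvr; rewrite bnd_simp.
by rewrite -h addrC subrK.
Qed.

(** Fubini moves the expectation inside the time integral. Square integrability of f s is available
    for almost every s, so the orthogonality hypothesis may presuppose it. *)
Lemma Rint_orth a b f g : a <= b -> jmf f -> (\int[P]_w tint a b (fun s w => (f s w ^+ 2)%R) w < +oo)%E ->
  L2 g -> (forall s, a <= s <= b -> L2 (f s) -> Ex (fun w => f s w * g w) = 0) ->
  Ex (fun w => Rint a b f w * g w) = 0.
Proof.
move=> ab mf fin gL orth.
have mg := L2_meas gL.
have mf2 : jmf (fun s w => f s w ^+ 2) by exact: measurable_funX.
have [RL _] := Rint_L2 ab mf fin.
pose k (u : R * Omega) : \bar R := ((\1_(`[a, b]%classic) u.1 : R) * (f u.1 u.2 * g u.2))%:E.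
have mfg : jmf (fun s w => f s w * g w).
  by apply: measurable_funM => //; exact: (measurableT_comp mg).
have mk : measurable_fun setT k by exact: (jmf_indic a b mfg).
have mfg1 : jmf (fun s w => (\1_(`[a, b]%classic) s : R) * (f s w * g w)).
  by apply: measurable_funM => //; exact: jmf_1.
have mg2 : jmf (fun (_ : R) w => g w ^+ 2).
  by apply: (measurableT_comp (f := fun w => g w ^+ 2)) => //; exact: measurable_funX.
have mfgs : jmf (fun s w => 1 * f s w ^+ 2 + 1 * g w ^+ 2).
  by apply: measurable_funD; apply: measurable_funM.
have mfg2 : jmf (fun s w => (\1_(`[a, b]%classic) s : R) * (1 * f s w ^+ 2 + 1 * g w ^+ 2)).
  by apply: measurable_funM => //; exact: jmf_1.
have t0 w : (0 <= tint a b (fun s w => (f s w ^+ 2)%R) w)%E by apply: tint_ge0 => *; exact: sqr_ge0.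
have mt : measurable_fun setT (tint a b (fun s w => (f s w ^+ 2)%R)).
  by apply: tint_meas => [*|//]; exact: sqr_ge0.
have ik : (mu \x P)%E.-integrable setT k.
  apply/integrable21ltyP => //.
  apply: (@le_lt_trans _ _ (\int[P]_w tint a b (fun s w => (1 * f s w ^+ 2 + 1 * g w ^+ 2)%R) w)%E).
    apply: ge0_le_integral => //=.
    - by move=> w _; exact: integral_ge0.
    - apply: (@measurable_fun_fubini_tonelli_G _ _ _ _ _ mu (abse \o k)) => [|u].
        exact: measurableT_comp.
      exact: abse_ge0.
    - apply: tint_meas => [s w|]; last exact: mfgs.
      by rewrite addr_ge0// mul1r sqr_ge0.
    - move=> w _; rewrite tintE; apply: ge0_le_integral => //=.
      + exact: (joint_section (jmf_norm mfg1)).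
      + exact: (joint_section mfg2).
      + move=> s _; rewrite lee_fin normrM ger0_norm// ler_wpM2l// !mul1r.
        have := @mul_le_sqr _ (f s w) (g w) 1 ltr01.
        by rewrite mul1r invr1 mul1r.
  rewrite (eq_integral (fun w => 1%:E * tint a b (fun s w => (f s w ^+ 2)%R) w + 1%:E * tint a b (fun _ w => (g w ^+ 2)%R) w)%E); last first.
    by move=> w _; rewrite tintD// => *; exact: sqr_ge0.
  rewrite ge0_integralD//=.
  - under eq_integral do rewrite mul1e.
    under [X in (_ + X)%E]eq_integral do rewrite mul1e.
    apply: lte_add_pinfty => //.
    rewrite (tint_swap a b (fun _ w => sqr_ge0 (g w)) mg2).
    rewrite (eq_integral (cst (Ex (fun w => g w ^+ 2))%:E)); last by move=> s _; rewrite ExE//; exact: gL.2.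
    rewrite integral_cst//=; apply: lte_mul_pinfty => //; first by rewrite lee_fin Ex_ge0// => w; exact: sqr_ge0.
    exact: mu_itv_lty.
  - by move=> w _; rewrite mul1e.
  - by apply: measurable_funeM.
  - by move=> w _; rewrite mul1e; apply: tint_ge0 => *; exact: sqr_ge0.
  - by apply: measurable_funeM; apply: tint_meas => // *; exact: sqr_ge0.
have fub := Fubini ik.
have finae : {ae P, forall w, (tint a b (fun s w => (f s w ^+ 2)%R) w < +oo)%E}.
  have : P.-integrable setT (tint a b (fun s w => (f s w ^+ 2)%R)).
    apply/integrableP; split => //.
    by under eq_integral do rewrite gee0_abs//.
  move=> /integrable_ae => /(_ measurableT); apply: filterS => w /(_ I).
  by move=> /fin_numPlt/andP[].
have GE : (\int[P]_w (Rint a b f w * g w)%:E = \int[P]_w fubini_G mu k w)%E.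
  apply: ae_eq_integral => //.
  - apply/measurable_EFinP; apply: measurable_funM => //; exact: Rint_meas.
  - exact: (measurable_fubini_G ik).
  apply: filterS finae => w fw _; rewrite /fubini_G.
  have if1 := section_integrable mf fw.
  rewrite [RHS](_ : _ = \int[mu]_s ((g w)%:E * ((\1_(`[a, b]%classic) s : R) * f s w)%:E))%E; last first.
    by apply: eq_integral => s _; rewrite /k -EFinM /= mulrA mulrC.
  have E : (\int[mu]_s ((\1_(`[a, b]%classic) s : R) * f s w)%:E = \int[mu]_(s in `[a, b]) (f s w)%:E)%E.
    rewrite [RHS]integral_mkcond; apply: eq_integral => s _.
    by rewrite patchE indicE; case: ifP => _; rewrite ?mul1r ?mul0r.
  have if3 : mu.-integrable setT (fun s => ((\1_(`[a, b]%classic) s : R) * f s w)%:E).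
    apply/integrableP; split.
      by apply: (joint_section (f := fun s w => (\1_(`[a, b]%classic) s : R) * f s w)); apply: measurable_funM => //; exact: jmf_1.
    have /integrableP[_] := if1; congr (_ < _)%E.
    rewrite [LHS]integral_mkcond; apply: eq_integral => s _.
    by rewrite patchE indicE /=; case: ifP => _; rewrite ?mul1r// mul0r normr0.
  rewrite integralZl// E /Rint /Rintegral mulrC EFinM fineK//.
  exact: integrable_fin_num.
rewrite /Ex /Rintegral GE -fub (_ : (\int[mu]_x fubini_F P k x)%E = 0%E)//.
have sw : (\int[mu]_(s in `[a, b]) (\int[P]_w (f s w ^+ 2)%:E) < +oo)%E.
  by rewrite -tint_swap// => *; exact: sqr_ge0.
have mF2 : measurable_fun (`[a, b]%classic : set R) (fun s => \int[P]_w (f s w ^+ 2)%:E)%E.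
  apply: measurable_funTS.
  apply: (@measurable_fun_fubini_tonelli_F _ _ _ _ _ P (fun u : R * Omega => (f u.1 u.2 ^+ 2)%:E)) => [|u].
    exact/measurable_EFinP.
  by rewrite lee_fin sqr_ge0.
have aeL : {ae mu, forall s, `[a, b]%classic s -> (\int[P]_w (f s w ^+ 2)%:E)%E \is a fin_num}.
  apply: integrable_ae => //; apply/integrableP; split => //.
  move: sw; congr (_ < _)%E; apply: eq_integral => s _; rewrite gee0_abs//.
  by apply: integral_ge0 => w _; rewrite lee_fin sqr_ge0.
rewrite (ae_eq_integral (cst 0%E))//.
- by rewrite integral0.
- exact: (measurable_fubini_F ik).
case: aeL => A [mA A0 sA]; exists A; split => // s /= ns; apply: sA => /= hs; apply: ns => _.
rewrite /fubini_F /k /=.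
have [sab|nsab] := boolP (s \in `[a, b]%classic); last first.
  by rewrite integral0_eq// => w _; rewrite indicE (negbTE nsab) mul0r.
have sI : `[a, b]%classic s by rewrite inE in sab.
have fsL : L2 (f s).
  have mfs : measurable_fun setT (f s) by exact: (measurable_fun_pair2 s mf).
  split => //; apply/integrableP; split; first by apply/measurable_EFinP; exact: measurable_funX.
  rewrite (eq_integral (fun w => (f s w ^+ 2)%:E)); last by move=> w _ /=; rewrite ger0_norm// sqr_ge0.
  by have /fin_numPlt/andP[] := hs sI.
have := orth s _ fsL; rewrite /= in_itv/= in sI => /(_ sI) h.
rewrite (eq_integral (fun w => (f s w * g w)%:E)); last by move=> w _; rewrite indicE sab mul1r.
by rewrite ExE ?h//; exact: L2M.
Qed.

End time_integrals.

Section expected_time_integral.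
Context {R : realType} {dO : measure_display} {Omega : measurableType dO}.
Variable P : probability Omega R.
Implicit Types (f g : R -> Omega -> R) (a b c : R).

Definition IT a b f := (\int[P]_w tint a b f w)%E.

Lemma IT_ge0 a b f : (forall s w, 0 <= f s w) -> (0 <= IT a b f)%E.
Proof. by move=> f0; apply: integral_ge0 => w _; exact: tint_ge0. Qed.

Lemma IT_le a b f g : (forall s w, 0 <= f s w) -> (forall s w, 0 <= g s w) -> jmf f -> jmf g ->
  (forall s w, a <= s <= b -> f s w <= g s w) -> (IT a b f <= IT a b g)%E.
Proof.
move=> f0 g0 mf mg fg; apply: ge0_le_integral => //=.
- by move=> w _; exact: tint_ge0.
- exact: tint_meas.
- exact: tint_meas.
- by move=> w _; apply: tint_le => // s sab; exact: fg.
Qed.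

Lemma ITD a b f g c c' : (forall s w, 0 <= f s w) -> (forall s w, 0 <= g s w) -> jmf f -> jmf g ->
  0 <= c -> 0 <= c' ->
  (IT a b (fun s w => (c * f s w + c' * g s w)%R) = c%:E * IT a b f + c'%:E * IT a b g)%E.
Proof.
move=> f0 g0 mf mg c0 c'0.
have mtf := tint_meas a b f0 mf; have mtg := tint_meas a b g0 mg.
rewrite /IT (eq_integral (fun w => c%:E * tint a b f w + c'%:E * tint a b g w)%E); last first.
  by move=> w _; rewrite tintD.
rewrite ge0_integralD//=.
- rewrite !ge0_integralZl_EFin//.
  + by move=> w _; exact: tint_ge0.
  + by move=> w _; exact: tint_ge0.
- by move=> w _; rewrite mule_ge0 ?lee_fin ?tint_ge0.
- exact: measurable_funeM.
- by move=> w _; rewrite mule_ge0 ?lee_fin ?tint_ge0.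
- exact: measurable_funeM.
Qed.

Lemma IT_sum a b n (f : 'I_n -> R -> Omega -> R) : (forall i s w, 0 <= f i s w) -> (forall i, jmf (f i)) ->
  (IT a b (fun s w => (\sum_i f i s w)%R) = \sum_i IT a b (f i))%E.
Proof.
move=> f0 mf; rewrite -ge0_integral_sum//.
- apply: eq_integral => w _; rewrite -ge0_integral_sum//.
  + by apply: eq_integral => s _; rewrite sumEFin.
  + by move=> i; exact: joint_section.
  + by move=> i s _; rewrite lee_fin.
- by move=> i; exact: tint_meas.
- by move=> i w _; exact: tint_ge0.
Qed.

Lemma IT_sub a b a' b' f : a <= a' -> a' <= b' -> b' <= b -> (forall s w, 0 <= f s w) -> jmf f ->
  (IT a' b' f <= IT a b f)%E.
Proof.
move=> aa ab bb f0 mf; apply: ge0_le_integral => //=.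
- by move=> w _; exact: tint_ge0.
- exact: tint_meas.
- exact: tint_meas.
- by move=> w _; exact: tint_sub.
Qed.

Lemma IT_grid t T N f : t < T -> (forall s w, 0 <= f s w) -> jmf f ->
  (\sum_(j < N.+1) IT (gr t T N j) (gr t T N j.+1) f = IT t T f)%E.
Proof.
move=> tT f0 mf; rewrite -ge0_integral_sum//.
- by apply: eq_integral => w _; rewrite tint_grid.
- by move=> i; exact: tint_meas.
- by move=> i w _; exact: tint_ge0.
Qed.

Lemma IT_fine a b f : (forall s w, 0 <= f s w) -> (IT a b f < +oo)%E -> ((fine (IT a b f))%:E = IT a b f)%E.
Proof. by move=> f0 fin; rewrite fineK// ge0_fin_numE// IT_ge0. Qed.

End expected_time_integral.

(** * The estimate for a fixed initial time *)

Section a_priori.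
Context {R : realType} {dO : measure_display} {Omega : measurableType dO}.
Variable P : probability Omega R.
Hypothesis cP : measure_is_complete P.
Variables (d : nat) (W : R -> Omega -> 'cV[R]_d).
Hypothesis BM : brownian_motion P W.
Notation Fm := (Fm P W).
Notation L2 := (L2 P).
Notation Ex := (Ex P).
Notation IT := (IT P).
Notation adapted_list := (adapted_list P W).
Notation gint := (gint W).
Notation ItoP := (ItoP P W).
Variables (t T : R).
Hypothesis t0 : 0 <= t.
Hypothesis tT : t < T.
Variable m : nat.
Variables (y : 'I_m -> Omega -> R) (z : 'I_m -> 'I_d -> R -> Omega -> R) (I : 'I_m -> Omega -> R)
  (phi : 'I_m -> R -> Omega -> R) (q : R -> Omega -> R) (C0 : R).
Hypothesis Fy : forall i, Fm t (y i).
Hypothesis yL : forall i, L2 (y i).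
Hypothesis jz : forall i, jm (z i).
Hypothesis fz : forall i, (IT t T (sqn (z i)) < +oo)%E.
Hypothesis mI : forall i, measurable_fun setT (I i).
Hypothesis zI : forall i, ItoP t T (z i) (I i).
Hypothesis jphi : forall i, jmf (phi i).
Hypothesis Fphi : forall i s, t <= s <= T -> Fm s (phi i s).
Hypothesis q0 : forall s w, 0 <= q s w.
Hypothesis jq : jmf q.
Hypothesis fq : (IT t T q < +oo)%E.
Hypothesis C00 : 0 <= C0.
Hypothesis phi_le : forall i s w, t <= s <= T -> phi i s w ^+ 2 <= C0 * (q s w + \sum_j sqn (z j) s w).
Hypothesis eqn : {ae P, forall w, forall i, y i w = Rint t T (phi i) w - I i w}.
Variable N : nat.
Notation gr := (gr t T N).
Notation dt := (dt t T N).
Hypothesis small : 8 * m%:R * C0 * dt <= 1.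

Let sq i s w := phi i s w ^+ 2.
Let jsq i : jmf (sq i).
Proof. by apply: measurable_funX; exact: jphi. Qed.

Let jsqn i : jmf (sqn (z i)).
Proof. exact: jm_sqn. Qed.

Let fphi i : (IT t T (sq i) < +oo)%E.
Proof.
apply: (@le_lt_trans _ _ (IT t T (fun s w => C0 * q s w + C0 * \sum_j sqn (z j) s w))).
  apply: IT_le.
  - by move=> *; exact: sqr_ge0.
  - move=> s w; rewrite addr_ge0// mulr_ge0// sumr_ge0// => j _; exact: sqn_ge0.
  - exact: jsq.
  - by apply: measurable_funD; apply: measurable_funM => //; apply: measurable_sum => j; exact: jsqn.
  - by move=> s w st; rewrite -mulrDr phi_le.
rewrite ITD//; last 2 first.
- by move=> s w; apply: sumr_ge0 => j _; exact: sqn_ge0.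
- by apply: measurable_sum => j; exact: jsqn.
rewrite IT_sum; [|by move=> *; exact: sqn_ge0|exact: jsqn].
apply: lte_add_pinfty; apply: lte_mul_pinfty; rewrite ?lee_fin//.
by apply: lte_sum_pinfty => j _; exact: fz.
Qed.

Section approximation.
Variable e : R.
Hypothesis e0 : 0 < e.
Variable L : 'I_m -> seq (@elementary R dO Omega d).
Hypothesis hL : forall i, adapted_list t T (L i).
Hypothesis dL : forall i, (IT t T (sqd (L i) (z i)) <= e%:E)%E.
Hypothesis gL : forall i, (\int[P]_w ((gint (L i) t T w - I i w) ^+ 2)%:E <= e%:E)%E.

(* [lam i j] is orthogonal to the increment of the elementary integral over the
   next step and is small at the last grid point, so that [u] is bounded by
   backward induction on j. *)
Let lam i j w := y i w - Rint t (gr j) (phi i) w + gint (L i) t (gr j) w.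
Let u j := \sum_i Ex (fun w => lam i j w ^+ 2).
Let g j := \sum_i Ex (fun w => gint (L i) (gr j) (gr j.+1) w ^+ 2).
Let Q := fine (IT t T q).

Let Fphi_fin a b i : t <= a -> a <= b -> b <= T -> (IT a b (sq i) < +oo)%E.
Proof.
move=> ta ab bT; apply: le_lt_trans (fphi i); apply: IT_sub => //.
by move=> *; exact: sqr_ge0.
Qed.

Let gj j : (j <= N.+1)%N -> t <= gr j /\ gr j <= T.
Proof. by move=> jN; apply/andP; exact: gr_in. Qed.

Let iso i j : (j <= N)%N -> _ := fun jN => gint_isometry cP BM t0 (proj1 (gj (leqW jN))) (ltW (gr_lt tT N j))
  (proj2 (@gj j.+1 jN)) (@hL i).

Let iso0 i j : (j <= N.+1)%N -> _ := fun jN => gint_isometry cP BM t0 (lexx t) (proj1 (gj jN))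
  (proj2 (gj jN)) (@hL i).

Let lamL i j : (j <= N.+1)%N -> L2 (lam i j).
Proof.
move=> jN; have [h1 h2] := gj jN.
apply: L2D; last by have [_ h _ _] := iso0 i jN.
apply: L2B => //.
by have [h _] := Rint_L2 h1 (jphi i) (Fphi_fin i (lexx t) h1 h2).
Qed.

Let lam_orth i j : (j <= N)%N -> Ex (fun w => lam i j w * gint (L i) (gr j) (gr j.+1) w) = 0.
Proof.
move=> jN; have [h1 h2] := gj (leqW jN).
have [_ gL2 orth _] := iso i jN.
have [Fg0 g0L _ _] := iso0 i (leqW jN).
have [RL _] := Rint_L2 h1 (jphi i) (Fphi_fin i (lexx t) h1 h2).
have E1 : Ex (fun w => y i w * gint (L i) (gr j) (gr j.+1) w) = 0.
  by apply: orth => //; exact: (Fm_mono h1 (Fy i)).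
have E2 : Ex (fun w => gint (L i) t (gr j) w * gint (L i) (gr j) (gr j.+1) w) = 0 by exact: orth.
have E3 : Ex (fun w => Rint t (gr j) (phi i) w * gint (L i) (gr j) (gr j.+1) w) = 0.
  apply: Rint_orth => //; first exact: Fphi_fin.
  move=> s /andP[s1 s2] sL; apply: orth => //; apply: (Fm_mono s2); apply: Fphi.
  by rewrite s1 (le_trans s2).
rewrite (_ : (fun w => lam i j w * _) = fun w => (y i w * gint (L i) (gr j) (gr j.+1) w
  - Rint t (gr j) (phi i) w * gint (L i) (gr j) (gr j.+1) w) + gint (L i) t (gr j) w * gint (L i) (gr j) (gr j.+1) w); last first.
  by apply/funext => w; rewrite /lam; ring.
rewrite ExD; [|by apply: L1B; exact: L2M|exact: L2M].
by rewrite ExB; [rewrite E1 E2 E3 subrr addr0|exact: L2M|exact: L2M].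
Qed.

(** By definition, lam at j plus the increment of the elementary integral equals lam at j.+1 plus
    the integral of phi over the step. Orthogonality splits the square on the left exactly; the
    right is bounded by twice the sum of squares, with the factor dt coming from Cauchy-Schwarz. *)
Let lam_step i j : (j <= N)%N ->
  Ex (fun w => lam i j w ^+ 2) + Ex (fun w => gint (L i) (gr j) (gr j.+1) w ^+ 2) <=
  2 * Ex (fun w => lam i j.+1 w ^+ 2) + 2 * (dt * fine (IT (gr j) (gr j.+1) (sq i))).
Proof.
move=> jN; have [h1 h2] := gj (leqW jN); have [h1' h2'] := @gj j.+1 jN.
have jj := ltW (gr_lt tT N j).
have [_ gL2 _ _] := iso i jN.
have l1 := lamL i (leqW jN); have l2 := @lamL i j.+1 jN.
have ff := Fphi_fin i h1 jj h2'.
have [FL FE] := Rint_L2 jj (jphi i) ff.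
have sp : {ae P, forall w, Rint t (gr j.+1) (phi i) w = Rint t (gr j) (phi i) w + Rint (gr j) (gr j.+1) (phi i) w}.
  exact: (Rint_split_ae h1 jj (jphi i) (Fphi_fin i (lexx t) (le_trans h1 jj) h2')).
have E1 : Ex (fun w => lam i j w ^+ 2) + Ex (fun w => gint (L i) (gr j) (gr j.+1) w ^+ 2) =
    Ex (fun w => (lam i j w + gint (L i) (gr j) (gr j.+1) w) ^+ 2).
  rewrite (_ : (fun w => (lam i j w + _) ^+ 2) = fun w => (lam i j w ^+ 2 + gint (L i) (gr j) (gr j.+1) w ^+ 2)
     + 2 * (lam i j w * gint (L i) (gr j) (gr j.+1) w)); last by apply/funext => w; ring.
  rewrite ExD; [|by apply: L1D; [exact: l1.2|exact: gL2.2]|by apply: L1Z; exact: L2M].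
  by rewrite ExD; [|exact: l1.2|exact: gL2.2]; rewrite ExZ ?lam_orth ?mulr0 ?addr0//; exact: L2M.
rewrite E1 (Ex_ae (g := fun w => (lam i j.+1 w + Rint (gr j) (gr j.+1) (phi i) w) ^+ 2)); last 3 first.
- by have := L2D l1 gL2; case.
- by have := L2D l2 FL; case.
- apply: filterS sp => w sw; congr (_ ^+ 2); rewrite /lam sw (gintD _ _ _ h1 jj); ring.
apply: (@le_trans _ _ (Ex (fun w => 2 * lam i j.+1 w ^+ 2 + 2 * Rint (gr j) (gr j.+1) (phi i) w ^+ 2))).
  apply: Ex_le.
  - by have := L2D l2 FL; case.
  - by apply: L1D; apply: L1Z; [exact: l2.2|exact: FL.2].
  - by move=> w; have := sqr_sub_le (lam i j.+1 w) (- Rint (gr j) (gr j.+1) (phi i) w); rewrite opprK sqrrN.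
rewrite ExD; [|by apply: L1Z; exact: l2.2|by apply: L1Z; exact: FL.2].
rewrite ExZ; last exact: l2.2.
rewrite ExZ; last exact: FL.2.
rewrite lerD2l ler_pM2l// -lee_fin EFinM IT_fine//; last by move=> *; exact: sqr_ge0.
by rewrite -(grS t T N j).
Qed.

Let gfin i j : (j <= N)%N -> IT (gr j) (gr j.+1) (gsq (L i)) = (Ex (fun w => gint (L i) (gr j) (gr j.+1) w ^+ 2))%:E.
Proof. by move=> jN; have [_ _ _ h] := iso i jN. Qed.

(** On the step, z is replaced by its elementary approximation, whose energy there is the isometry
    term [g j]. Forcing and approximation error are bounded by their totals over [t, T]. *)
Let phi_step i j : (j <= N)%N -> fine (IT (gr j) (gr j.+1) (sq i)) <= C0 * (Q + 2 * g j + 2 * (m%:R * e)).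
Proof.
move=> jN; have [h1 h2] := gj (leqW jN); have [h1' h2'] := @gj j.+1 jN.
have jj := ltW (gr_lt tT N j).
have jgs i' : jmf (gsq (L i')) := gsq_joint (@hL i').
have jsd i' : jmf (sqd (L i') (z i')) := jm_sqd (@hL i') (jz i').
have gs0 i' s w : 0 <= gsq (L i') s w by exact: gsq_ge0.
have sd0 i' s w : 0 <= sqd (L i') (z i') s w by exact: sqd_ge0.
rewrite -lee_fin IT_fine//; [|by move=> *; exact: sqr_ge0|exact: Fphi_fin].
pose A s w := \sum_i' gsq (L i') s w; pose B s w := \sum_i' sqd (L i') (z i') s w.
have jA : jmf A by exact: measurable_sum.
have jB : jmf B by exact: measurable_sum.
have A0 s w : 0 <= A s w by apply: sumr_ge0.
have B0 s w : 0 <= B s w by apply: sumr_ge0.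
pose D s w := 2 * A s w + 2 * B s w.
have jD : jmf D by apply: measurable_funD; exact: measurable_funM.
have D0 s w : 0 <= D s w by rewrite addr_ge0// mulr_ge0.
apply: (@le_trans _ _ (IT (gr j) (gr j.+1) (fun s w => C0 * q s w + C0 * D s w))).
  apply: IT_le => //.
  - by move=> *; exact: sqr_ge0.
  - by move=> s w; rewrite addr_ge0// mulr_ge0.
  - by apply: measurable_funD; exact: measurable_funM.
  - move=> s w /andP[s1 s2].
    apply: (le_trans (phi_le i w _)); first by rewrite (le_trans h1) ?(le_trans s2).
    rewrite -mulrDr ler_wpM2l// lerD2l /D /A /B !mulr_sumr -big_split/=.
    by apply: ler_sum => i' _; exact: sqn_le.
rewrite ITD// ITD// IT_sum// IT_sum//.
have sA : (\sum_i' IT (gr j) (gr j.+1) (gsq (L i')) = (g j)%:E)%E.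
  by rewrite /g -sumEFin; apply: eq_bigr => i' _; exact: gfin.
have sB : (\sum_i' IT (gr j) (gr j.+1) (sqd (L i') (z i')) <= (m%:R * e)%:E)%E.
  apply: (@le_trans _ _ (\sum_(i' < m) e%:E)%E).
    by apply: lee_sum => i' _; apply: le_trans (dL i'); exact: IT_sub.
  by rewrite sumEFin sumr_const card_ord mulr_natl.
rewrite sA.
have qQ : (IT (gr j) (gr j.+1) q <= Q%:E)%E by rewrite /Q (IT_fine q0 fq); exact: (IT_sub _ h1 jj h2' q0 jq).
apply: (@le_trans _ _ (C0%:E * Q%:E + C0%:E * (2%:E * (g j)%:E + 2%:E * (m%:R * e)%:E))%E).
  apply: leeD; first by rewrite lee_wpmul2l.
  by rewrite lee_wpmul2l//; apply: leeD => //; rewrite lee_pmul2l.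
rewrite (_ : (C0%:E * Q%:E + _)%E = (C0 * Q + C0 * (2 * g j + 2 * (m%:R * e)))%:E); last by rewrite !EFinD !EFinM.
by rewrite lee_fin le_eqVlt; apply/orP; left; apply/eqP; ring.
Qed.

Let Q0 : 0 <= Q.
Proof. by rewrite /Q fine_ge0// IT_ge0. Qed.

Let A := Q + m%:R * e.

Let me0 : 0 <= m%:R * e.
Proof. by rewrite mulr_ge0// ltW. Qed.

Let u0 j : 0 <= u j.
Proof. by apply: sumr_ge0 => i _; apply: Ex_ge0 => w; exact: sqr_ge0. Qed.

Let g0 j : 0 <= g j.
Proof. by apply: sumr_ge0 => i _; apply: Ex_ge0 => w; exact: sqr_ge0. Qed.

(** This is where [small] acts: after summation over i the terms coming from phi are at most (Q + 2
    g j + 2 m e) / 4, so half of [g j] survives on the left. *)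
Let step j : (j <= N)%N -> u j + g j / 2 <= 2 * u j.+1 + A.
Proof.
move=> jN.
have h : u j + g j <= \sum_i (2 * Ex (fun w => lam i j.+1 w ^+ 2) + 2 * (dt * (C0 * (Q + 2 * g j + 2 * (m%:R * e))))).
  rewrite /u {1}/g -big_split/=; apply: ler_sum => i _.
  apply: (le_trans (lam_step i jN)); rewrite lerD2l ler_pM2l// ler_pM2l ?dt_gt0//.
  exact: phi_step.
rewrite big_split/= -mulr_sumr -/(u j.+1) sumr_const card_ord -[_ *+ m]mulr_natr in h.
have g0j := g0 j.
have h2 : 8 * m%:R * C0 * dt * (Q + 2 * g j + 2 * (m%:R * e)) <= 1 * (Q + 2 * g j + 2 * (m%:R * e)).
  by apply: ler_wpM2r => //; rewrite !addr_ge0// mulr_ge0.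
have E : 2 * (dt * (C0 * (Q + 2 * g j + 2 * (m%:R * e)))) * m%:R = 8 * m%:R * C0 * dt * (Q + 2 * g j + 2 * (m%:R * e)) / 4.
  by field.
rewrite E in h.
set a := 8 * m%:R * C0 * dt * _ in h h2.
have := me0; have := Q0; rewrite /A; move: (m%:R * e) h h2 => x h h2; lra.
Qed.

(** At time T the equation reduces lam to the difference between the elementary integral and I. *)
Let u_last : u N.+1 <= A.
Proof.
apply: (@le_trans _ _ (\sum_(i < m) e)); last first.
  by rewrite sumr_const card_ord -mulr_natl /A lerDr.
apply: ler_sum => i _; rewrite -lee_fin.
have l := lamL i (leqnn N.+1).
rewrite -ExE; last exact: l.2.
apply: le_trans (gL i); rewrite le_eqVlt; apply/orP; left; apply/eqP.
have [_ gi _ _] := iso0 i (leqnn N.+1); rewrite grN in gi.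
apply: ae_eq_integral => //.
- by apply/measurable_EFinP; apply: measurable_funX; exact: (L2_meas l).
- by apply/measurable_EFinP; apply: measurable_funX; apply: measurable_funB => //; exact: (L2_meas gi).
- apply: filterS eqn => w hw _; rewrite /lam grN hw; congr (_%:E); ring.
Qed.

(** Backward iteration of u_j <= 2 u_{j+1} + A from u_{N+1} <= A gives (2^(k+1) - 1) A after k
    steps. *)
Let u_bound j : (j <= N.+1)%N -> u j <= 2 ^+ N.+2 * A.
Proof.
have A0 : 0 <= A by rewrite addr_ge0.
have h k : (k <= N.+1)%N -> u (N.+1 - k) <= (2 ^+ k.+1 - 1) * A.
  elim: k => [|k IH] kN; first by rewrite subn0 expr1; apply: (le_trans u_last); lra.
  have E : (N.+1 - k = (N.+1 - k.+1).+1)%N by rewrite subnSK.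
  have := IH (ltnW kN); rewrite E => h.
  have jN : (N.+1 - k.+1 <= N)%N by rewrite subSS leq_subr.
  have := step jN; have := g0 (N.+1 - k.+1).
  rewrite exprS; move: h; move: (2 ^+ k.+1 : R) => x; nra.
move=> jN; have := h (N.+1 - j)%N (leq_subr _ _); rewrite subKn//.
move=> h2; apply: (le_trans h2); rewrite ler_wpM2r//.
apply: (@le_trans _ _ (2 ^+ (N.+1 - j).+1)); first by rewrite gerBl.
by rewrite ler_weXn2l// ?ler1n// ltnS leq_subr.
Qed.

(** At j = 0 the integrals in lam are void, so [u 0] is the energy of y. For z, put B = 2^(N+2) A:
    [step] gives g j <= 2 (2 u_{j+1} + A) <= 6 B, hence 6 (N+1) B after summation; doubling it and
    adding the approximation error 2 m e <= 2 B yields the constant 14. *)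
Lemma approx_bound : \sum_i Ex (fun w => y i w ^+ 2) <= 14 * N.+1%:R * 2 ^+ N.+2 * A /\
  (\sum_i IT t T (sqn (z i)) <= (14 * N.+1%:R * 2 ^+ N.+2 * A)%:E)%E.
Proof.
have A0 : 0 <= A by rewrite addr_ge0.
have N1 : (1 : R) <= N.+1%:R by rewrite ler1n.
have M1 : (1 : R) <= 2 ^+ N.+2 by rewrite exprn_ege1// ler1n.
have MA : 0 <= 2 ^+ N.+2 * A by rewrite mulr_ge0// (le_trans ler01).
have MA' : A <= 2 ^+ N.+2 * A by rewrite -[leLHS]mul1r ler_wpM2r.
have NM : 2 ^+ N.+2 * A <= N.+1%:R * (2 ^+ N.+2 * A) by rewrite -[leLHS]mul1r ler_wpM2r.
have E14 : 14 * N.+1%:R * 2 ^+ N.+2 * A = 14 * (N.+1%:R * (2 ^+ N.+2 * A)) by rewrite !mulrA.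
split.
  have := u_bound (leq0n _); rewrite /u.
  have -> : \sum_i Ex (fun w => lam i 0 w ^+ 2) = \sum_i Ex (fun w => y i w ^+ 2).
    apply: eq_bigr => i _; congr (Ex _); apply/funext => w.
    rewrite /lam gr0 /Rint set_itv1 /Rintegral integral_set1 /= subr0.
    suff -> : gint (L i) t t w = 0 by rewrite addr0.
    have := @gintD _ _ _ d W (L i) t t t w (lexx t) (lexx t); lra.
  move=> h; rewrite E14; apply: (le_trans h); lra.
have gb j : (j <= N)%N -> g j <= 6 * (2 ^+ N.+2 * A).
  move=> jN; have := step jN; have := @u_bound j.+1 jN; have := u0 j; lra.
have sg : \sum_(j < N.+1) g j <= 6 * (N.+1%:R * (2 ^+ N.+2 * A)).
  apply: (@le_trans _ _ (\sum_(j < N.+1) 6 * (2 ^+ N.+2 * A))).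
    by apply: ler_sum => j _; apply: gb; exact: ltn_ord j.
  by rewrite sumr_const card_ord -[_ *+ N.+1]mulr_natl le_eqVlt; apply/orP; left; apply/eqP; ring.
apply: (@le_trans _ _ (\sum_i (2%:E * IT t T (gsq (L i)) + 2%:E * IT t T (sqd (L i) (z i))))%E).
  apply: lee_sum => i _; rewrite -ITD//; first (apply: IT_le => //).
  - by move=> *; exact: sqn_ge0.
  - by move=> s w; rewrite addr_ge0// mulr_ge0// ?gsq_ge0// sqd_ge0.
  - by apply: measurable_funD; apply: measurable_funM => //; [exact: (gsq_joint (@hL i))|exact: (jm_sqd (@hL i))].
  - by move=> s w _; exact: sqn_le.
  - by move=> *; exact: gsq_ge0.
  - by move=> *; exact: sqd_ge0.
  - exact: (gsq_joint (@hL i)).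
  - exact: (jm_sqd (@hL i)).
rewrite big_split/=.
have s1 : (\sum_i 2%:E * IT t T (gsq (L i)) = (2 * \sum_(j < N.+1) g j)%:E)%E.
  rewrite -ge0_sume_distrr; last by move=> i _; apply: IT_ge0 => *; exact: gsq_ge0.
  rewrite EFinM; congr (_ * _)%E; rewrite /g exchange_big/= -sumEFin; apply: eq_bigr => i _.
  rewrite -(IT_grid P N tT) -?sumEFin; [|by move=> *; exact: gsq_ge0|exact: (gsq_joint (@hL i))].
  by apply: eq_bigr => j _; apply: gfin; exact: ltn_ord j.
have s2 : (\sum_i 2%:E * IT t T (sqd (L i) (z i)) <= (2 * (m%:R * e))%:E)%E.
  apply: (@le_trans _ _ (\sum_(i < m) (2 * e)%:E)%E).
    by apply: lee_sum => i _; rewrite EFinM lee_pmul2l.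
  by rewrite sumEFin sumr_const card_ord -mulr_natl lee_fin le_eqVlt; apply/orP; left; apply/eqP; ring.
rewrite s1; apply: (@le_trans _ _ ((2 * \sum_(j < N.+1) g j)%:E + (2 * (m%:R * e))%:E)%E).
  exact: leeD.
rewrite -EFinD lee_fin E14; have : m%:R * e <= A by rewrite /A lerDr.
lra.
Qed.

End approximation.

(** The approximation error is sent to 0 while N, and with it the constant, stays fixed. *)
Lemma a_priori : let K := 14 * N.+1%:R * 2 ^+ N.+2 in
  \sum_i Ex (fun w => y i w ^+ 2) <= K * fine (IT t T q) /\
  (\sum_i IT t T (sqn (z i)) <= (K * fine (IT t T q))%:E)%E.
Proof.
move=> K.
have K0 : 0 <= K by apply: mulr_ge0; [exact: mulr_ge0|exact: exprn_ge0].
have bound e : 0 < e -> \sum_i Ex (fun w => y i w ^+ 2) <= K * fine (IT t T q) + e /\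
  (\sum_i IT t T (sqn (z i)) <= (K * fine (IT t T q) + e)%:E)%E.
  (* Chosen so that K m r <= e; the added 1 avoids a division by zero when m = 0. *)
  move=> e0; pose r := e / (K * m%:R + 1).
  have Km : 0 < K * m%:R + 1 by rewrite ltr_pwDr// mulr_ge0.
  have r0 : 0 < r by rewrite divr_gt0.
  have [L hL] : exists L : 'I_m -> seq (@elementary R dO Omega d), forall i, adapted_list t T (L i) /\
      ((IT t T (sqd (L i) (z i)) <= r%:E)%E /\ (\int[P]_w ((gint (L i) t T w - I i w) ^+ 2)%:E <= r%:E)%E).
    suff /choice[L h] : forall i, exists l : seq (@elementary R dO Omega d), adapted_list t T l /\
      ((IT t T (sqd l (z i)) <= r%:E)%E /\ (\int[P]_w ((gint l t T w - I i w) ^+ 2)%:E <= r%:E)%E) by exists L.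
    move=> i; by have [L] := ItoP_L2 cP BM t0 (ltW tT) (jz i) (mI i) (zI i) (fz i) r0; exists L.
  have [b1 b2] := approx_bound r0 (fun i => proj1 (hL i)) (fun i => proj1 (proj2 (hL i))) (fun i => proj2 (proj2 (hL i))).
  have le : K * (fine (IT t T q) + m%:R * r) <= K * fine (IT t T q) + e.
    rewrite mulrDr lerD2l /r [K * _]mulrA [leLHS]mulrA ler_pdivrMr// [leLHS]mulrC ler_pM2l//.
    by rewrite lerDl.
  by split; [exact: (le_trans b1 le)|apply: (le_trans b2); rewrite lee_fin].
split.
- by apply/ler_addgt0Pr => e /bound[].
- by apply/lee_addgt0Pr => e /bound[_]; rewrite EFinD.
Qed.

End a_priori.

Section lebesgue_ae.
Context {R : realType}.
Notation mu := (@lebesgue_measure R).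
Implicit Types p q r : R -> Prop.

Lemma lebesgue_ae_imp2 p q r : (forall s, p s -> q s -> r s) ->
  {ae mu, forall s, p s} -> {ae mu, forall s, q s} -> {ae mu, forall s, r s}.
Proof.
move=> h [A [mA A0 pA]] [B [mB B0 qB]]; exists (A `|` B); split.
- exact: measurableU.
- by apply: null_set_setU.
- move=> s /= nr; have [ps|/pA] := pselect (p s); last by left.
  by right; apply: qB => /= qs; apply: nr; exact: h.
Qed.

Lemma lebesgue_ae_imp p q : (forall s, p s -> q s) ->
  {ae mu, forall s, p s} -> {ae mu, forall s, q s}.
Proof. by move=> h h1; exact: (lebesgue_ae_imp2 (fun s ps _ => h s ps) h1 h1). Qed.

Lemma lebesgue_ae_neq a : {ae mu, forall s, s != a}.
Proof.
exists [set a]; split=> //; first exact: lebesgue_measure_set1.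
by move=> s /= /negP; rewrite negbK => /eqP.
Qed.

End lebesgue_ae.

(** * Gronwall's lemma for inequalities holding almost everywhere *)

Section gronwall.
Context {R : realType}.
Notation mu := (@lebesgue_measure R).
Variables (A : R -> \bar R) (K T : R).
Hypothesis A0 : forall s, (0 <= A s)%E.
Hypothesis mA : measurable_fun setT A.
Hypothesis T0 : 0 < T.
Hypothesis K0 : 0 <= K.
Hypothesis Afin : (\int[mu]_(s in `[0%R, T]) A s < +oo)%E.
Hypothesis Ale : {ae mu, forall t, 0 <= t < T -> (A t <= K%:E * \int[mu]_(s in `[t, T]) A s)%E}.

Let G c : \bar R := (\int[mu]_(s in `[c, T]) A s)%E.

Let G_le c c' : c <= c' -> (G c' <= G c)%E.
Proof.
move=> cc; apply: ge0_subset_integral => //.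
- exact: measurable_funTS.
- by apply: subset_itvr; rewrite bnd_simp.
Qed.

(** On a window with K (c' - c) <= 1/2 beyond which A has integral 0, the inequality integrates to G
    c <= G c / 2; since G c is finite, it vanishes. No continuity or pointwise finiteness of A is
    involved. *)
Let step c c' : 0 <= c -> c <= c' -> c' <= T -> K * (c' - c) <= 2^-1 -> G c' = 0%E -> G c = 0%E.
Proof.
move=> c0 cc cT Kc Gc'.
have Gfin : (G c < +oo)%E by apply: le_lt_trans Afin; exact: G_le.
have Gge : (0 <= G c)%E by apply: integral_ge0.
have l1 : (G c <= \int[mu]_(s in `[c, c']) A s)%E.
  rewrite /G (@itv_bndbnd_setU _ _ (BLeft c) (BRight c') (BRight T)) ?bnd_simp// ge0_integral_setU//=.
  - rewrite -[leRHS]adde0; apply: leeD => //; rewrite -Gc'; apply: ge0_subset_integral => //.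
    + exact: measurable_funTS.
    + by apply: subset_itvr; rewrite bnd_simp.
  - exact: measurable_funTS.
  - apply/disj_setPS => s /= []; rewrite !in_itv/= => /andP[_ h] /andP[h' _].
    by move: (lt_le_trans h' h); rewrite ltxx.
have l2 : (\int[mu]_(s in `[c, c']) A s <= \int[mu]_(s in `[c, c']) (K%:E * G c))%E.
  apply: ae_ge0_le_integral => //.
  - exact: measurable_funTS.
  - by move=> s _; rewrite mule_ge0.
  - apply: lebesgue_ae_imp2 Ale (lebesgue_ae_neq T) => s h sT; rewrite /= in_itv/= => /andP[cs sc'].
    apply: le_trans (h _) _.
      by rewrite (le_trans c0 cs) /= lt_neqAle sT (le_trans sc').
    by rewrite lee_wpmul2l//; exact: G_le.
have := le_trans l1 l2.
rewrite integral_cst//= lebesgue_measure_itv/= lte_fin.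
case: ifPn => [_|_]; last by rewrite mule0 => h; apply/eqP; rewrite eq_le h.
have gf : G c \is a fin_num by rewrite ge0_fin_numE.
rewrite -(fineK gf) -EFinD -!EFinM lee_fin => h; congr (_%:E); apply/eqP.
have g0 : 0 <= fine (G c) by exact: fine_ge0.
rewrite eq_le g0 andbT.
have : K * fine (G c) * (c' - c) <= 2^-1 * fine (G c) by rewrite mulrAC ler_wpM2r.
move: h; move: (_ * (c' - c)) => x; lra.
Qed.

Lemma gronwall : (\int[mu]_(s in `[0%R, T]) A s = 0)%E.
Proof.
have GT : G T = 0%E by rewrite /G set_itv1 integral_set1.
(* With M + 1 > 2 K T windows of equal length h one has K h <= 1/2; the induction runs backwards
   from T. *)
pose M := Num.Def.truncn (2 * K * T); pose h := T / M.+1%:R.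
have h0 : 0 < h by rewrite divr_gt0.
have Kh : K * h <= 2^-1.
  have : 2 * K * T < M.+1%:R by exact: truncnS_gt.
  rewrite /h mulrA ler_pdivrMr//; lra.
have hM : M.+1%:R * h = T by rewrite /h mulrCA divff ?mulr1// pnatr_eq0.
have E j : (j <= M.+1)%N -> G (T - j%:R * h) = 0%E.
  elim: j => [|j IH] jM; first by rewrite mul0r subr0.
  have jh : j.+1%:R * h <= T by rewrite -hM ler_pM2r// ler_nat.
  have j0 : 0 <= j%:R * h by rewrite mulr_ge0// ltW.
  have jS : j.+1%:R * h = j%:R * h + h by rewrite -natr1 mulrDl mul1r.
  apply: (@step _ (T - j%:R * h)); last exact: (IH (ltnW jM)).
  - by rewrite subr_ge0.
  - by rewrite jS; lra.
  - by lra.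
  - by rewrite (_ : _ - _ = h) // jS; lra.
by have := E M.+1 (leqnn _); rewrite hM subrr.
Qed.

End gronwall.

(** * Classical solutions *)

Section taylor.
Context {R : realType}.

Lemma is_derive_eps (f : R -> R) (x a : R) :
  (forall e, 0 < e -> exists2 r, 0 < r & forall h, h != 0 -> `|h| < r ->
     `|h^-1 * (f (x + h) - f x) - a| <= e) -> is_derive x 1 f a.
Proof.
move=> h.
have c : (fun r => r^-1 *: ((f \o shift x) (r *: (1 : R)) - f x)) @ 0^' --> a.
  apply/cvgrPdist_le => e /h[r r0 hr].
  near=> u; rewrite distrC /= [u *: 1]mulr1 [u + x]addrC.
  apply: hr; first by near: u; exact: nbhs_dnbhs_neq.
  by near: u; apply: dnbhs0_lt.
by split; [exact: cvgP c|exact: cvg_lim c].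
Unshelve. all: by end_near. Qed.

Lemma is_derive_elim (f : R -> R) (x a : R) : is_derive x 1 f a ->
  forall e, 0 < e -> exists2 r, 0 < r & forall h, h != 0 -> `|h| < r ->
     `|h^-1 * (f (x + h) - f x) - a| <= e.
Proof.
move=> [df <-] e e0.
have /cvgrPdist_le/(_ e e0) : (fun r => r^-1 *: ((f \o shift x) (r *: (1 : R)) - f x)) @ 0^' --> 'D_1 f x by [].
rewrite near_withinE => /nbhs_ballP[r /= r0 hr]; exists r => // h h0 hlt.
have := hr h; rewrite /ball/= sub0r normrN => /(_ hlt h0).
by rewrite distrC [h *: 1]mulr1 [h + x]addrC.
Qed.

Lemma is_derive_continuous (f : R -> R) (x a : R) : is_derive x 1 f a -> {for x, continuous f}.
Proof. by move=> [df _]; apply/differentiable_continuous; rewrite -derivable1_diffP. Qed.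

Lemma mvt_sym (f df : R -> R) (c : R) : (forall x : R, is_derive x 1 f (df x)) ->
  exists2 u, `|u| <= `|c| & f c - f 0 = df u * c.
Proof.
move=> d.
have cf (a b : R) : {within `[a, b], continuous f}.
  by apply: continuous_subspaceT => x; exact: is_derive_continuous (d x).
have [c0|c0] := leP 0 c.
  have [u] := MVT_segment c0 (fun x _ => d x) (cf 0 c).
  rewrite in_itv/= => /andP[u0 uc] E; exists u; first by rewrite !ger0_norm.
  by rewrite E subr0.
have [u] := MVT_segment (ltW c0) (fun x _ => d x) (cf c 0).
rewrite in_itv/= => /andP[u0 uc] E; exists u; first by rewrite !ler0_norm ?lerN2// ltW.
by apply: oppr_inj; rewrite opprB E sub0r mulrN.
Qed.

Section multivariate.
Variable n : nat.
Notation V := 'cV[R]_n.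
Notation ee j := (delta_mx j 0 : V).

Lemma line_derive (F : V -> R) (z v : V) (r : R) : derivable F (z + r *: v) v ->
  is_derive r 1 (fun r => F (z + r *: v)) ('D_v F (z + r *: v)).
Proof.
move=> dF; apply: is_derive_eps => e e0.
have /cvgrPdist_le/(_ e e0) : (fun h => h^-1 *: ((F \o shift (z + r *: v)) (h *: v) - F (z + r *: v))) @ 0^'
   --> 'D_v F (z + r *: v) by [].
rewrite near_withinE => /nbhs_ballP[d /= d0 hd]; exists d => // h h0 hlt.
have := hd h; rewrite /ball/= sub0r normrN => /(_ hlt h0); rewrite distrC.
by rewrite (_ : z + (r + h) *: v = h *: v + (z + r *: v)) // scalerDl [RHS]addrC addrA.
Qed.

Lemma line_mvt (F : V -> R) (z v : V) (c : R) : (forall x, derivable F x v) ->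
  exists2 u, `|u| <= `|c| & F (z + c *: v) - F z = 'D_v F (z + u *: v) * c.
Proof.
move=> dF; have [u uc] := @mvt_sym (fun r => F (z + r *: v)) _ c (fun r => line_derive (dF (z + r *: v))).
by rewrite scale0r addr0; exists u.
Qed.

Let part (h : V) (k : nat) : V := \col_i (if (i < k)%N then h i 0 else 0).

(** The increment along h is telescoped over the vectors [part h k], which keep the first k
    coordinates. Each link changes one coordinate, the one-dimensional mean value theorem applies to
    it, and continuity of the partial derivatives makes the intermediate points harmless. *)
Lemma directional_derive (F : V -> R) : (forall x j, derivable F x (ee j)) ->
  (forall j, continuous ('D_(ee j) F)) -> forall (x h : V) (r : R),
  is_derive r 1 (fun r => F (x + r *: h)) (\sum_j 'D_(ee j) F (x + r *: h) * h j 0).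
Proof.
move=> dF cF x h r; apply: is_derive_eps => e e0.
set y := x + r *: h.
(* The added 1 keeps M positive when h = 0. For |c| < d / M all intermediate points stay within d of
   y. *)
pose M := 1 + \sum_j `|h j 0|.
have M0 : 0 < M by rewrite ltr_pwDl// sumr_ge0.
have hM j : `|h j 0| <= M.
  by rewrite /M (bigD1 j)//= addrA [1 + _]addrC -addrA lerDl addr_ge0// sumr_ge0.
have [d d0 hd] : exists2 d : R, 0 < d & forall j z, `|z - y| < d ->
    `|'D_(ee j) F z - 'D_(ee j) F y| <= e / M.
  have /nbhs_ballP[d /= d0 hd] : \forall z \near y, forall j, `|'D_(ee j) F z - 'D_(ee j) F y| <= e / M.
    apply: (@filter_forall _ _ (fun j z => `|'D_(ee j) F z - 'D_(ee j) F y| <= e / M) (nbhs y) _) => j.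
    have /cvgrPdist_le/(_ (e / M)) := @cF j y.
    by rewrite divr_gt0// => /(_ isT); apply: filterS => z; rewrite distrC.
  by exists d => // j z zy; apply: hd; rewrite -ball_normE /ball_/= distrC.
exists (d / M); first exact: divr_gt0.
move=> c c0 cd.
have tel : F (x + (r + c) *: h) - F y = \sum_(j < n) (F (y + c *: part h j.+1) - F (y + c *: part h j)).
  rewrite -(big_mkord xpredT (fun j => F (y + c *: part h j.+1) - F (y + c *: part h j))).
  rewrite telescope_sumr//; congr (F _ - F _).
    by rewrite /y (_ : part h n = h) ?scalerDl ?addrA//; apply/colP => i; rewrite mxE ltn_ord.
  by rewrite (_ : part h 0 = 0) ?scaler0 ?addr0//; apply/colP => i; rewrite !mxE.
have st (j : 'I_n) : exists2 u, `|u| <= `|c * h j 0| &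
    F (y + c *: part h j.+1) - F (y + c *: part h j) = 'D_(ee j) F (y + c *: part h j + u *: ee j) * (c * h j 0).
  have [u uc E] := @line_mvt F (y + c *: part h j) (ee j) (c * h j 0) (fun x => dF x j).
  exists u => //; rewrite -E; congr (F _ - _); rewrite -[RHS]addrA; congr (y + _).
  apply/colP => i; rewrite !mxE eqxx andbT ltnS leq_eqVlt; have [->|ij] := eqVneq i j.
    by rewrite eqxx ltnn /= mulr1 mulr0 add0r.
  by rewrite (negbTE (_ : (i != j :> nat))) //= mulr0 addr0.
pose u j := s2val (cid2 (st j)).
have hu j : `|u j| <= `|c * h j 0| by rewrite /u; case: cid2.
have Eu (j : 'I_n) : F (y + c *: part h j.+1) - F (y + c *: part h j) = 'D_(ee j) F (y + c *: part h j + u j *: ee j) * (c * h j 0).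
  by rewrite /u; case: cid2.
rewrite tel mulr_sumr -sumrB.
have bd (j : 'I_n) : `|c^-1 * (F (y + c *: part h j.+1) - F (y + c *: part h j)) - 'D_(ee j) F y * h j 0| <=
    e / M * `|h j 0|.
  rewrite Eu (_ : _ - _ = ('D_(ee j) F (y + c *: part h j + u j *: ee j) - 'D_(ee j) F y) * h j 0); last by field.
  rewrite normrM ler_wpM2r//; apply: hd.
  rewrite -[y + _ + _]addrA addrAC subrr add0r.
  apply: (@le_lt_trans _ _ (`|c| * M)); last by rewrite -ltr_pdivlMr.
  rewrite -[X in X <= _]/(mx_norm _) mx_normrE.
  apply/bigmax_leP; split; first by rewrite mulr_ge0// ltW.
  move=> [i k] _ /=; rewrite (ord1 k) !mxE andbT.
  have [->|ij] := eqVneq i j.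
    by rewrite ltnn mulr0 add0r mulr1 (le_trans (hu j))// normrM ler_wpM2l.
  by rewrite mulr0 addr0 normrM ler_wpM2l//; case: ifP => // _; rewrite normr0 ltW.
apply: (le_trans (ler_norm_sum _ _ _)).
apply: (@le_trans _ _ (\sum_j e / M * `|h j 0|)); first by apply: ler_sum => j _; exact: bd.
by rewrite -mulr_sumr mulrAC ler_pdivrMr// ler_pM2l// /M lerDr.
Qed.

(** Second order Taylor formula with Lagrange remainder for F along the segment from x to x + h,
    obtained from Rolle's theorem. *)
Lemma taylor2 (F : V -> R) : twice_derivable F -> (forall j, continuous ('D_(ee j) F)) ->
  (forall j k, continuous ('D_(ee k) ('D_(ee j) F))) -> forall x h, exists2 tau, 0 <= tau <= 1 &
  F (x + h) - F x = \sum_p 'D_(ee p) F x * h p 0 +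
    2^-1 * \sum_p \sum_q 'D_(ee q) ('D_(ee p) F) (x + tau *: h) * (h p 0 * h q 0).
Proof.
move=> [dF ddF] cF ccF x h.
pose f r := F (x + r *: h).
pose f1 r := \sum_j 'D_(ee j) F (x + r *: h) * h j 0.
pose f2 r := \sum_j (\sum_k 'D_(ee k) ('D_(ee j) F) (x + r *: h) * h k 0) * h j 0.
have d1 (r : R) : is_derive r 1 f (f1 r) by exact: directional_derive.
have d2 (r : R) : is_derive r 1 f1 (f2 r).
  rewrite /f1 (_ : (fun r => _) = \sum_j (fun r => 'D_(ee j) F (x + r *: h) * h j 0)); last first.
    by apply/funext => s; rewrite fct_sumE.
  apply: is_derive_sum => j.
  have dj : is_derive r 1 (fun r => 'D_(ee j) F (x + r *: h)) (\sum_k 'D_(ee k) ('D_(ee j) F) (x + r *: h) * h k 0).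
    by apply: directional_derive.
  apply: (is_derive_eq (is_deriveM dj (is_derive_cst (h j 0) r 1))).
  by rewrite scaler0 add0r /GRing.scale/= mulrC.
pose A := f 1 - f 0 - f1 0.
(* [A] is the remainder, chosen so that K 0 = K 1. The derivative of K is (f2 - 2 A)(1 - r), so a
   zero of it inside (0, 1) gives A = f2 / 2. *)
pose K r := f r + f1 r * (1 - r) + A * ((1 - r) * (1 - r)).
have dl (r : R) : is_derive r 1 (fun r : R => 1 - r) (- 1).
  have := is_deriveB (is_derive_cst (1 : R) r 1) (is_derive_id r (1 : R)); rewrite sub0r; exact.
have dK (r : R) : is_derive r 1 K (f2 r * (1 - r) - 2 * A * (1 - r)).
  apply: (is_derive_eq (is_deriveD (is_deriveD (d1 r) (is_deriveM (d2 r) (dl r)))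
    (is_deriveM (is_derive_cst A r 1) (is_deriveM (dl r) (dl r))))).
  by rewrite /GRing.scale/=; ring.
have K01 : K 0 = K 1 by rewrite /K /A; ring.
have [tau] := Rolle ltr01 (fun r _ => ex_derive (is_derive := dK r))
  (continuous_subspaceT (fun r => is_derive_continuous (dK r))) K01.
rewrite in_itv/= => /andP[t0 t1] [_ E].
have E2 : f2 tau * (1 - tau) - 2 * A * (1 - tau) = 0 by rewrite -E -[LHS](derive_val (is_derive := dK tau)).
have t1' : 1 - tau != 0 by rewrite subr_eq0 gt_eqF.
have A2 : A = 2^-1 * f2 tau.
  have : (f2 tau - 2 * A) * (1 - tau) = 0 by rewrite -E2; ring.
  move/eqP; rewrite mulf_eq0 (negbTE t1') orbF subr_eq0 => /eqP ->; by field.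
exists tau; first by apply/andP; split; exact: ltW.
have -> : F (x + h) - F x = f1 0 + A by rewrite /A /f scale1r scale0r addr0; ring.
rewrite A2; congr (_ + _ * _).
- by apply: eq_bigr => p _; rewrite scale0r addr0.
- apply: eq_bigr => p _; rewrite mulr_suml; apply: eq_bigr => q _; ring.
Qed.

End multivariate.

(** Near an interior point the restriction to D is void, so the one-sided notion becomes an ordinary
    derivative, coordinate by coordinate. *)
Lemma derivative_within_entry p (D : set R) (f : R -> 'cV[R]_p) s l i (r : R) :
  0 < r -> (forall h, `|h| < r -> D (s + h)) -> derivative_within D f s l ->
  is_derive s 1 (fun u => f u i 0) (l i 0).
Proof.
move=> r0 hD df; apply: is_derive_eps => e e0.
have : (fun u => ((u - s)^-1 *: (f u - f s)) i 0) @ within D s^' --> l i 0.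
  exact: (cvg_comp _ _ df (@coord_continuous _ _ _ i 0 l)).
move=> /cvgrPdist_le/(_ e e0).
rewrite near_withinE near_withinE => /nbhs_ballP[d /= d0 hd].
exists (Num.min d r); first by rewrite lt_min d0.
move=> h h0; rewrite lt_min => /andP[hld hlr].
have := hd (s + h); rewrite /ball/= opprD addNKr normrN => /(_ hld).
rewrite [s + h]addrC addrK.
have sh : h + s != s by rewrite -subr_eq0 addrK.
move=> /(_ sh); rewrite -[h + s]addrC => /(_ (hD _ hlr)).
by rewrite distrC !mxE.
Qed.

End taylor.

(** Precomposition with a continuous map into D turns continuity relative to D into continuity
    everywhere; the map is typically a clamping of times. *)
Lemma within_comp (U V W : topologicalType) (D : set V) (F : V -> W) (h : U -> V) :
  {within D, continuous F} -> (forall u, D (h u)) -> continuous h -> continuous (fun u => F (h u)).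
Proof.
move=> cF Dh ch u; apply: cvg_trans (cF (h u)) => A hA.
have : within D (nbhs (h u)) (F @^-1` A) by rewrite nbhs_subspace_in//; exact: hA.
move=> hw; have h1 : nbhs u (h @^-1` (fun y => D y -> A (F y))) := ch u _ hw.
have h2 : h @^-1` (fun y => D y -> A (F y)) `<=` (fun x => A (F (h x))) by move=> v /= hv; exact: hv (Dh v).
exact: (@filterS _ (nbhs u) _ _ _ h2 h1).
Qed.

Lemma cont_comp (U V W : topologicalType) (f : U -> V) (g : V -> W) :
  continuous f -> continuous g -> continuous (fun x => g (f x)).
Proof. by move=> cf cg x; apply: continuous_comp; [exact: cf|exact: cg]. Qed.

Lemma cont_mx {R : realType} (T : topologicalType) p q (F : T -> 'M[R]_(p, q)) :
  (forall i j, continuous (fun x => F x i j)) -> continuous F.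
Proof.
move=> cF s U [Q hQ hU].
have h i j : \forall r \near s, Q i j (F r i j).
  have h : F r i j @[r --> s] --> F s i j := @cF i j s.
  exact: h (hQ i j).
have h2 i : \forall r \near s, forall j, Q i j (F r i j).
  exact: (@filter_forall _ _ (fun j r => Q i j (F r i j)) (nbhs s) _ (h i)).
have hh : \forall r \near s, forall i j, Q i j (F r i j).
  exact: (@filter_forall _ _ (fun i r => forall j, Q i j (F r i j)) (nbhs s) _ h2).
by apply: filterS hh => r hr; apply: hU => i j.
Qed.

Lemma cont_entry {R : realType} (T : topologicalType) p q (F : T -> 'M[R]_(p, q)) i j :
  continuous F -> continuous (fun x => F x i j).
Proof. by move=> cF x; exact: (cvg_comp _ _ (cF x) (@coord_continuous _ _ _ i j _)). Qed.

Lemma cont_mulmx {R : realType} (T : topologicalType) p q r (F : T -> 'M[R]_(p, q)) (G : T -> 'M[R]_(q, r)) :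
  continuous F -> continuous G -> continuous (fun x => F x *m G x).
Proof.
move=> cF cG; apply: cont_mx => i j x.
rewrite (_ : (fun x => _) = fun x => \sum_k F x i k * G x k j); last first.
  by apply/funext => y; rewrite mxE.
apply: cont_sum => k y; apply: cvgM.
  exact: (cvg_comp _ _ (cF y) (@coord_continuous _ _ _ _ _ _)).
exact: (cvg_comp _ _ (cG y) (@coord_continuous _ _ _ _ _ _)).
Qed.

Lemma cont_clamp {R : realType} (u v : R) : continuous (clamp u v).
Proof.
move=> x; apply/cvgrPdist_le => e e0; near=> y.
apply: le_trans (clamp_lip _ _ _ _) _.
by near: y; apply: cvgr_dist_le.
Unshelve. all: by end_near. Qed.

(** * Clamped coefficients and the hypotheses of Ito's formula *)

Section solution.
Context {R : realType}.
Variables (n d m : nat) (T : R).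
Notation V := 'cV[R]_n.
Variables (b : R -> V -> V) (sigma : R -> V -> 'M[R]_(n, d)) (psi : R -> V -> V -> 'cV[R]_m)
  (g : R -> R -> V -> V -> 'cV[R]_m -> 'M[R]_(m, d) -> 'cV[R]_m) (Theta : R -> R -> V -> V -> 'cV[R]_m).
Hypothesis T0 : 0 < T.

(** Clamping the time extends the coefficient to a globally continuous function, as [ito_formula]
    asks, without changing it on [0, T]. *)
Definition clb (p : 'I_n) (u : R * V) := b (clamp 0 T u.1) u.2 p 0.
Definition cls (p : 'I_n) (k : 'I_d) (u : R * V) := sigma (clamp 0 T u.1) u.2 p k.

Let clamp0 s : 0 <= clamp 0 T s <= T.
Proof. by rewrite clamp_ge clamp_le// ltW. Qed.

Let coef_cont q (a : R -> V -> 'M[R]_(n, q)) : continuous_coefficient T a ->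
  continuous (fun u : R * V => a (clamp 0 T u.1) u.2).
Proof.
move=> ca; apply: (@within_comp _ _ _ _ (fun u : R * V => a u.1 u.2) (fun u : R * V => (clamp 0 T u.1, u.2)) ca).
- by move=> u; split => //=; rewrite in_itv/=; exact: clamp0.
- apply: (@cont_pair (R * V)%type R V (fun u => clamp 0 T u.1) snd) => u; last exact: cvg_snd.
  by move: u; apply: (@cont_comp _ _ _ fst (clamp 0 T)) => [u|]; [exact: cvg_fst|exact: cont_clamp].
Qed.

Lemma clb_cont p : continuous_coefficient T b -> continuous (clb p).
Proof. by move=> /coef_cont cb u; exact: (cvg_comp _ _ (cb u) (@coord_continuous _ _ _ _ _ _)). Qed.

Lemma cls_cont p k : continuous_coefficient T sigma -> continuous (cls p k).
Proof. by move=> /coef_cont cb u; exact: (cvg_comp _ _ (cb u) (@coord_continuous _ _ _ _ _ _)). Qed.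

Variables (t : R) (i : 'I_m).
Hypothesis t0 : 0 <= t.
Hypothesis tT : t < T.
Notation E3 := (R * V * V)%type.
Notation ct := (clamp t T).

Definition solf (u : E3) := Theta t (ct u.1.1) u.1.2 u.2 i 0.
Definition solD (p : 'I_n) (u : E3) := jac (Theta t (ct u.1.1) u.1.2) u.2 i p.
Definition solz (u : E3) := jac (Theta t (ct u.1.1) u.1.2) u.2 *m sigma (ct u.1.1) u.2.
Definition soly (u : E3) := Theta (ct u.1.1) (ct u.1.1) u.2 u.2.
Definition solG (u : E3) := g t (ct u.1.1) u.1.2 u.2 (soly u) (solz u) i 0.

Let tct s : triangle T (t, ct s).
Proof. by rewrite /triangle/= t0 clamp_ge clamp_le// ltW. Qed.

Let ct_id s : t <= s <= T -> ct s = s.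
Proof. exact: clamp_id. Qed.

Let c11 : continuous (fun u : E3 => ct u.1.1).
Proof.
apply: (@cont_comp _ _ _ (fun u : E3 => u.1.1) ct); last exact: cont_clamp.
by apply: (@cont_comp _ _ _ fst fst) => u; exact: cvg_fst.
Qed.

Let c12 : continuous (fun u : E3 => u.1.2).
Proof. by move=> u; exact: (cvg_comp _ _ cvg_fst cvg_snd). Qed.

Let c2 : continuous (fun u : E3 => u.2).
Proof. by move=> u; exact: cvg_snd. Qed.

Let ctt : continuous (fun u : E3 => (t, ct u.1.1)).
Proof. by apply: (@cont_pair E3 R R (fun=> t)) => [u|]; [exact: cvg_cst|exact: c11]. Qed.

Let cdom : continuous (fun u : E3 => ((t, ct u.1.1), u.1.2, u.2)).
Proof. exact: (cont_pair (cont_pair ctt c12) c2). Qed.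

Let sol_cont (W : topologicalType) (F : R * R * V * V -> W) :
  {within triangle T `*` setT `*` setT, continuous F} ->
  continuous (fun u : E3 => F ((t, ct u.1.1), u.1.2, u.2)).
Proof. by move=> cF; apply: (within_comp cF) => // u; split => //; split => //=; exact: tct. Qed.

(** For frozen t and component i the space argument xi is a parameter, later the value X(t). The
    driver is evaluated at the diagonal value of Theta, which is just another continuous function of
    (s, x), so the nonlocal equation takes the form required by [ito_formula]. *)
Lemma classical_solution_ito (Lg : R) :
  continuous_coefficient T sigma -> g_assumption T g Lg ->
  classical_solution T b sigma psi g Theta ->
  exists (fs : E3 -> R) (H : 'I_n -> 'I_n -> E3 -> R),
  [/\ continuous fs /\ continuous solG, forall p, continuous (solD p), forall p q, continuous (H p q) &
  [/\ forall s s' xi x, t <= s -> s < s' -> s' <= T ->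
    exists2 c, s <= c <= s' & solf (s', xi, x) - solf (s, xi, x) = fs (c, xi, x) * (s' - s),
    forall s xi x h, t <= s <= T -> exists2 tau, 0 <= tau <= 1 &
    solf (s, xi, x + h) - solf (s, xi, x) = \sum_p solD p (s, xi, x) * h p 0 +
    2^-1 * \sum_p \sum_q H p q (s, xi, x + tau *: h) * (h p 0 * h q 0) &
    forall s xi x, t <= s <= T ->
    fs (s, xi, x) + \sum_p solD p (s, xi, x) * clb p (s, x)
    + 2^-1 * (\sum_p \sum_q H p q (s, xi, x) * \sum_k (cls p k (s, x) * cls q k (s, x)))
    + solG (s, xi, x) = 0]].
Proof.
move=> cs [cg _] [Ts [[dTs dT] [cT cTs] [cJ cH] pde _]].
exists (fun u => Ts t (ct u.1.1) u.1.2 u.2 i 0),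
  (fun p q u => hess (fun x => Theta t (ct u.1.1) u.1.2 x i 0) u.2 p q).
have cJt : continuous (fun u : E3 => jac (Theta t (ct u.1.1) u.1.2) u.2) := sol_cont cJ.
have cHt : continuous (fun u : E3 => hess (fun x => Theta t (ct u.1.1) u.1.2 x i 0) u.2) := sol_cont (cH i).
have cz : continuous solz.
  apply: cont_mulmx => //.
  have := coef_cont cs.
  move=> h u; have := @within_comp E3 _ _ _ _ (fun u : E3 => (ct u.1.1, u.2)) cs.
  apply => {u}.
  - move=> u; split => //=; rewrite in_itv/=; have /and3P[_ h1 h2] := tct u.1.1.
    by rewrite (le_trans t0 h1).
  - exact: (cont_pair c11 c2).
have cy : continuous soly.
  apply: (@within_comp E3 _ _ _ _ (fun u : E3 => ((ct u.1.1, ct u.1.1), u.2, u.2)) cT).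
  - move=> u; split => //; split => //=; have /and3P[_ h1 h2] := tct u.1.1.
    by rewrite /triangle/= lexx (le_trans t0 h1).
  - exact: (cont_pair (cont_pair (cont_pair c11 c11) c2) c2).
split.
- split.
  + exact: (@cont_entry _ _ _ _ (fun u : E3 => Ts t (ct u.1.1) u.1.2 u.2) i 0 (sol_cont cTs)).
  + have := @within_comp E3 _ _ _ _ (fun u : E3 => ((t, ct u.1.1), u.1.2, u.2, soly u, solz u)) cg.
    move=> h u; refine (cvg_comp _ _ (h _ _ u) (@coord_continuous _ _ _ i 0 _)).
    * by move=> {}u; do !split => //=; exact: tct.
    * exact: (cont_pair (cont_pair cdom cy) cz).
- by move=> p u; exact: (cvg_comp _ _ (cJt u) (@coord_continuous _ _ _ _ _ _)).
- by move=> p q u; exact: (cvg_comp _ _ (cHt u) (@coord_continuous _ _ _ _ _ _)).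
split.
- move=> s s' xi x ts ss sT; rewrite /solf /=.
  have cth : continuous (fun r => Theta t (ct r) xi x i 0).
    have h : continuous (fun r : R => ((t, ct r), xi, x)).
      have h1 : continuous (fun r : R => (t, ct r)).
        by apply: (@cont_pair R R R (fun=> t)) => [r|]; [exact: cvg_cst|exact: cont_clamp].
      apply: (@cont_pair R _ _ (fun r : R => ((t, ct r), xi)) (fun=> x)) => [|r]; last exact: cvg_cst.
      by apply: (@cont_pair R _ _ (fun r : R => (t, ct r)) (fun=> xi)) => // r; exact: cvg_cst.
    move=> r; refine (cvg_comp _ _ (@within_comp R _ _ _ _ _ cT _ h r) (@coord_continuous _ _ _ i 0 _)).
    by move=> r'; split => //; split => //=; exact: tct.
  (* The mean value theorem asks for a derivative inside (s, s') only, where the one-sided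
     derivative on [t, T] is two-sided; r keeps c + h in [t, T], where clamping is the identity. *)
  have dth c : c \in `]s, s'[%R -> is_derive c 1 (fun r => Theta t (ct r) xi x i 0) (Ts t (ct c) xi x i 0).
    rewrite in_itv/= => /andP[sc cs'].
    have tc : t < c by exact: le_lt_trans sc.
    have cT' : c < T by exact: lt_le_trans sT.
    pose r := Num.min (c - t) (T - c).
    have r0 : 0 < r by rewrite lt_min !subr_gt0 tc.
    have hr h : `|h| < r -> t <= c + h <= T.
      by rewrite lt_min => /andP[]; rewrite !ltr_norml => /andP[a1 a2] /andP[a3 a4]; apply/andP; split; lra.
    have tcT : triangle T (t, c) by rewrite /triangle/= t0 !ltW.
    have hrD (h : R) : `|h| < r -> `[t, T]%classic (c + h) by move=> hh; rewrite /= in_itv/=; exact: hr.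
    have dd := derivative_within_entry i r0 hrD (dTs t c xi x tcT).
    rewrite ct_id; last by rewrite (ltW tc) (ltW cT').
    apply: is_derive_eps => e e0; have [q q0 hq] := is_derive_elim dd e0.
    exists (Num.min q r); first by rewrite lt_min q0.
    move=> h h0; rewrite lt_min => /andP[hq' hr'].
    by rewrite !ct_id ?hr//; [exact: hq|rewrite !ltW].
  have [c] := MVT ss dth (continuous_subspaceT cth).
  rewrite in_itv/= => /andP[/ltW sc /ltW cs'] E; exists c; first by rewrite sc.
  exact: E.
- move=> s xi x h st; rewrite /solf /solD /=.
  have cin : continuous (fun y : V => ((s, xi), y)).
    have c1 : continuous (fun _ : V => (s, xi)) by exact: cst_continuous.
    have c3 : continuous (fun y : V => y) by move=> y; apply: cvg_id.
    exact: (cont_pair c1 c3).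
  have d2 : twice_derivable (fun y => Theta t (ct s) xi y i 0) by exact: dT.
  have cD1 j : continuous ('D_(delta_mx j 0) (fun y => Theta t (ct s) xi y i 0)).
    rewrite (_ : 'D_(delta_mx j 0) _ = fun y => jac (Theta t (ct s) xi) y i j).
      exact: (@cont_entry _ _ _ _ (fun y => jac (Theta t (ct s) xi) y) i j (cont_comp cin cJt)).
    by apply/funext => y; rewrite mxE.
  have cD2 j k : continuous ('D_(delta_mx k 0) ('D_(delta_mx j 0) (fun y => Theta t (ct s) xi y i 0))).
    rewrite (_ : 'D_(delta_mx k 0) _ = fun y => hess (fun x => Theta t (ct s) xi x i 0) y j k).
      exact: (@cont_entry _ _ _ _ (fun y => hess (fun x => Theta t (ct s) xi x i 0) y) j k (cont_comp cin cHt)).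
    by apply/funext => y; rewrite mxE.
  have [tau tau01 E] := taylor2 d2 cD1 cD2 x h.
  exists tau => //; rewrite E; congr (_ + _ * _).
  + by apply: eq_bigr => p _; rewrite mxE.
  + by apply: eq_bigr => p _; apply: eq_bigr => q _; rewrite mxE.
- move=> s xi x st; rewrite /solD /solG /soly /solz /clb /cls /= !ct_id// clamp_id; last first.
    by case/andP: st => h1 h2; rewrite (le_trans t0 h1).
  have tri : triangle T (t, s) by rewrite /triangle/= t0.
  have := congr1 (fun M : 'cV_m => M i 0) (pde t s xi x tri).
  move=> /=; rewrite !mxE => h; rewrite -[RHS]h [X in X + _ = _]addrAC; congr (_ + _ * _ + _ + _).
  transitivity (\sum_p \sum_q \sum_k sigma s x p k * hess (fun y => Theta t s xi y i 0) x p q * sigma s x q k).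
    apply: eq_bigr => p _; apply: eq_bigr => q _; rewrite mulr_sumr; apply: eq_bigr => k _; ring.
  transitivity (\sum_k \sum_p \sum_q sigma s x p k * hess (fun y => Theta t s xi y i 0) x p q * sigma s x q k).
    rewrite [RHS]exchange_big/=; apply: eq_bigr => p _; by rewrite [RHS]exchange_big.
  apply: eq_bigr => k _.
  rewrite [RHS]mxE exchange_big/=; apply: eq_bigr => q _; rewrite [in RHS]mxE mulr_suml; apply: eq_bigr => p _.
  by rewrite !mxE.
Qed.

End solution.

(** * Comparison of the two solutions *)

Section tonelli.
Context {R : realType} {dO : measure_display} {Omega : measurableType dO}.
Variable P : probability Omega R.
Notation mu := (@lebesgue_measure R).
Notation IT := (IT P).

Lemma ae_measurable_fun (f h : Omega -> \bar R) : measure_is_complete P -> measurable_fun setT f ->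
  {ae P, forall w, f w = h w} -> measurable_fun setT h.
Proof.
move=> cP mf fh _ B mB; rewrite setTI.
apply: (measurable_set_ae cP (A := f @^-1` B)); first by rewrite -[X in measurable X]setTI; exact: mf.
by apply: filterS fh => w /= ->.
Qed.

Lemma time_ae_fin (F : R -> \bar R) a b : measurable_fun setT F -> (forall s, 0 <= F s)%E ->
  (\int[mu]_(s in `[a, b]) F s < +oo)%E -> {ae mu, forall s, a <= s <= b -> (F s < +oo)%E}.
Proof.
move=> mF F0 fin.
have iF : mu.-integrable `[a, b] F.
  apply/integrableP; split; first exact: measurable_funTS.
  by under eq_integral do rewrite gee0_abs//.
have h1 : {ae mu, forall x, `[a, b]%classic x -> F x \is a fin_num}.
  by apply: integrable_ae iF; exact: measurable_itv.
move: h1.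
apply: lebesgue_ae_imp => s h sab.
have /h : `[a, b]%classic s by rewrite /= in_itv.
by rewrite fin_numE => /andP[_]; rewrite ltey.
Qed.

Lemma ae_integral (f h : Omega -> \bar R) : measure_is_complete P -> measurable_fun setT f ->
  {ae P, forall w, f w = h w} -> (\int[P]_w f w = \int[P]_w h w)%E.
Proof.
move=> cP mf fh; apply: ae_eq_integral => //; first exact: ae_measurable_fun fh.
by apply: filterS fh => w h1 _.
Qed.

Lemma ge0_time_meas (F : R * Omega -> \bar R) a b : measurable_fun setT F -> (forall u, 0 <= F u)%E ->
  measurable_fun setT (fun w => \int[mu]_(t in `[a, b]) F (t, w))%E.
Proof.
move=> mF F0.
pose F1 (u : R * Omega) := ((\1_(`[a, b]%classic) u.1 : R)%:E * F u)%E.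
have mF1 : measurable_fun setT F1.
  by apply: emeasurable_funM => //; apply/measurable_EFinP; exact: (jmf_1 a b).
have F10 u : (0 <= F1 u)%E by rewrite mule_ge0// lee_fin.
rewrite (_ : (fun w => _) = fubini_G mu F1).
  exact: (@measurable_fun_fubini_tonelli_G _ _ _ _ R mu F1).
apply/funext => w; rewrite integral_mkcond; apply: eq_integral => t _.
by rewrite patchE /F1 indicE /=; case: ifP => _; rewrite ?mul1e ?mul0e.
Qed.

Lemma ge0_time_swap (F : R * Omega -> \bar R) a b : measurable_fun setT F -> (forall u, 0 <= F u)%E ->
  (\int[P]_w \int[mu]_(t in `[a, b]) F (t, w) = \int[mu]_(t in `[a, b]) \int[P]_w F (t, w))%E.
Proof.
move=> mF F0.
pose F1 (u : R * Omega) := ((\1_(`[a, b]%classic) u.1 : R)%:E * F u)%E.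
have mF1 : measurable_fun setT F1.
  by apply: emeasurable_funM => //; apply/measurable_EFinP; exact: (jmf_1 a b).
have F10 u : (0 <= F1 u)%E by rewrite mule_ge0// lee_fin.
have E w : (\int[mu]_(t in `[a, b]) F (t, w) = \int[mu]_t F1 (t, w))%E.
  rewrite integral_mkcond; apply: eq_integral => t _.
  by rewrite patchE /F1 indicE /=; case: ifP => _; rewrite ?mul1e ?mul0e.
have E2 : (\int[mu]_(t in `[a, b]) \int[P]_w F (t, w) = \int[mu]_t \int[P]_w F1 (t, w))%E.
  rewrite integral_mkcond; apply: eq_integral => t _.
  rewrite patchE; case: ifP => sab.
    by apply: eq_integral => w _; rewrite /F1 indicE /= sab mul1e.
  by rewrite integral0_eq// => w _; rewrite /F1 indicE /= sab mul0e.
transitivity (\int[P]_w \int[mu]_t F1 (t, w))%E; first by apply: eq_integral => w _; exact: E.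
rewrite E2; transitivity (\int[mu \x P]_u F1 u)%E.
  by rewrite (@fubini_tonelli2 _ _ _ _ R mu P F1 mF1 F10).
exact: (@fubini_tonelli1 _ _ _ _ R mu P F1 mF1 F10).
Qed.

(** * Tonelli's theorem on the triangle of times *)

Section triangle.
Variables (T : R) (H : R -> R -> Omega -> R).
Hypothesis H0 : forall t s w, 0 <= H t s w.
Hypothesis mH : measurable_fun setT (fun u : R * R * Omega => H u.1.1 u.1.2 u.2).

Lemma triangle_measurable : measurable (triangle T).
Proof.
have -> : triangle T = ((fun u : R * R => u.1) @^-1` `[0, +oo[) `&`
    (((fun u : R * R => u.2 - u.1) @^-1` `[0, +oo[) `&` ((fun u : R * R => u.2) @^-1` `]-oo, T])).
  apply/seteqP; split=> -[t s]; rewrite /triangle/= !in_itv/= !andbT subr_ge0.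
    by move=> /and3P[].
  by move=> [-> [-> ->]].
apply: measurableI.
  by rewrite -[X in measurable X]setTI; exact: measurable_fst.
apply: measurableI; rewrite -[X in measurable X]setTI; last exact: measurable_snd.
have h : measurable_fun setT (fun u : R * R => u.2 - u.1) by exact: measurable_funB.
exact: h.
Qed.

Lemma section_jmf t : jmf (H t).
Proof.
have h : measurable_fun setT (fun u : R * Omega => ((t, u.1), u.2)).
  apply: measurable_fun_pair => //.
  by apply: measurable_fun_pair => //; exact: measurable_cst.
exact: (measurableT_comp mH h).
Qed.

(** The order (t, w, s) makes the inner time integral a section over the last variable, which leaves
    a jointly measurable function of (t, w). *)
Let K (v : R * Omega * R) := ((\1_(triangle T) (v.1.1, v.2) : R) * H v.1.1 v.2 v.1.2)%:E.

Let mK : measurable_fun setT K.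
Proof.
apply/measurable_EFinP; apply: measurable_funM.
  have h : measurable_fun setT (fun v : R * Omega * R => (v.1.1, v.2)).
    apply: measurable_fun_pair => //.
    exact: (@measurableT_comp _ _ _ _ _ _ fst _ fst).
  have h2 : measurable_fun setT (\1_(triangle T) : R * R -> R).
    by apply: measurable_indic; exact: triangle_measurable.
  exact: (measurableT_comp h2 h).
have h : measurable_fun setT (fun v : R * Omega * R => ((v.1.1, v.2), v.1.2)).
  apply: measurable_fun_pair; last exact: (@measurableT_comp _ _ _ _ _ _ snd _ fst).
  apply: measurable_fun_pair => //; exact: (@measurableT_comp _ _ _ _ _ _ fst _ fst).
exact: (measurableT_comp mH h).
Qed.

Let K0 v : (0 <= K v)%E.
Proof. by rewrite lee_fin mulr_ge0. Qed.

Let tintK t w : 0 <= t -> tint t T (H t) w = (\int[mu]_s K (t, w, s))%E.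
Proof.
move=> t0; rewrite tintE; apply: eq_integral => s _; rewrite /K/= !indicE.
have -> : (s \in `[t, T]%classic) = ((t, s) \in triangle T); last by [].
by apply/idP/idP; rewrite !inE /triangle/= in_itv/= t0.
Qed.

Let Fk := fubini_F mu K.

Let mFk : measurable_fun setT Fk.
Proof. exact: measurable_fun_fubini_tonelli_F. Qed.

Let Fk0 u : (0 <= Fk u)%E.
Proof. by apply: integral_ge0. Qed.

Lemma triangle_swap : 0 <= T -> (\int[P]_w \int[mu]_(t in `[0%R, T]) tint t T (H t) w =
  \int[mu]_(t in `[0%R, T]) IT t T (H t))%E.
Proof.
move=> T0; have h t w : t \in `[0, T]%classic -> tint t T (H t) w = Fk (t, w).
  by rewrite inE/= in_itv/= => /andP[t0 _]; exact: tintK.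
transitivity (\int[P]_w \int[mu]_(t in `[0%R, T]) Fk (t, w))%E.
  by apply: eq_integral => w _; apply: eq_integral => t tT; exact: h.
rewrite (ge0_time_swap _ _ mFk Fk0); apply: eq_integral => t tT; apply: eq_integral => w _.
by rewrite h.
Qed.

Lemma triangle_meas : measurable_fun setT (fun w => \int[mu]_(t in `[0%R, T]) tint t T (H t) w)%E.
Proof.
rewrite (_ : (fun w => _) = fun w => \int[mu]_(t in `[0%R, T]) Fk (t, w))%E.
  exact: (ge0_time_meas _ _ mFk Fk0).
apply/funext => w; apply: eq_integral => t; rewrite inE/= in_itv/= => /andP[t0 _]; exact: tintK.
Qed.

Let G t := (\int[P]_w Fk (t, w))%E.

Let mG : measurable_fun setT G.
Proof. exact: (@measurable_fun_fubini_tonelli_F _ _ _ _ R P Fk). Qed.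

Let GE t : 0 <= t <= T -> G t = IT t T (H t).
Proof. by move=> /andP[t0 _]; apply: eq_integral => w _; rewrite tintK. Qed.

Lemma triangle_ae_fin : 0 <= T -> (\int[P]_w \int[mu]_(t in `[0%R, T]) tint t T (H t) w < +oo)%E ->
  {ae mu, forall t, 0 <= t <= T -> (IT t T (H t) < +oo)%E}.
Proof.
move=> T0; rewrite (triangle_swap T0) => fin.
have G0 t : (0 <= G t)%E by apply: integral_ge0 => w _; exact: Fk0.
have GI : (\int[mu]_(t in `[0%R, T]) G t = \int[mu]_(t in `[0%R, T]) IT t T (H t))%E.
  by apply: eq_integral => t; rewrite inE/= in_itv/= => tT; exact: GE.
have Gfin : (\int[mu]_(t in `[0%R, T]) G t < +oo)%E by rewrite GI; exact: fin.
have h := time_ae_fin mG G0 Gfin.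
apply: lebesgue_ae_imp h => t ht tT; rewrite -(GE tT); exact: ht.
Qed.

(** The expectation of H, set to 0 outside the triangle, is a nonnegative function of (t, s) whose
    double integral vanishes by Tonelli. It is thus 0 for almost every pair, and for such a pair H
    vanishes almost surely. *)
Lemma triangle_ae0 : 0 <= T -> {ae mu, forall t, 0 <= t <= T -> IT t T (H t) = 0%E} ->
  {ae (mu \x mu)%E, forall u : R * R, triangle T u -> {ae P, forall w, H u.1 u.2 w = 0}}.
Proof.
move=> T0 h0.
pose K2 (v : R * R * Omega) := ((\1_(triangle T) v.1 : R) * H v.1.1 v.1.2 v.2)%:E.
have mK2 : measurable_fun setT K2.
  apply/measurable_EFinP; apply: measurable_funM => //; apply: measurableT_comp => //.
  by apply: measurable_indic; exact: triangle_measurable.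
have K20 v : (0 <= K2 v)%E by rewrite lee_fin mulr_ge0.
pose E2 := fubini_F P K2.
have mE2 : measurable_fun setT E2 by exact: measurable_fun_fubini_tonelli_F.
have E20 u : (0 <= E2 u)%E by exact: integral_ge0.
have sec t : 0 <= t <= T -> (\int[mu]_s E2 (t, s) = IT t T (H t))%E.
  move=> /andP[t0 tT].
  rewrite /IT (tint_swap P _ _ (H0 t) (section_jmf t)).
  rewrite [RHS]integral_mkcond; apply: eq_integral => s _; rewrite patchE /E2 /fubini_F /K2 /=.
  rewrite indicE.
  have -> : (s \in `[t, T]%classic) = ((t, s) \in triangle T).
    by apply/idP/idP; rewrite !inE /triangle/= in_itv/= t0.
  case: ifP => _; first by apply: eq_integral => w _; rewrite mul1r.
  by under eq_integral do rewrite mul0r; rewrite integral0.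
have z : (\int[mu \x mu]_u E2 u = 0)%E.
  rewrite (@fubini_tonelli1 _ _ _ _ R mu mu E2 mE2 E20).
  transitivity (\int[mu]_t (cst 0%E t))%E; last exact: integral0.
  apply: ge0_ae_eq_integral => //.
  - exact: (@measurable_fun_fubini_tonelli_F _ _ _ _ R mu E2).
  - by move=> t _; apply: integral_ge0.
  - case: h0 => A [mA A0 sA]; exists A; split => // t /= nt; apply: sA => /= ht; apply: nt => _.
    have [tT|tT] := boolP (0 <= t <= T); first by rewrite /fubini_F sec// ht.
    rewrite /fubini_F (eq_integral (cst 0%E)) ?integral0// => s _.
    rewrite /E2 /fubini_F (eq_integral (cst 0%E)) ?integral0// => w _.
    rewrite /K2/= indicE memNset ?mul0r// /triangle/= => /and3P[a1 a2 a3].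
    by move: tT; rewrite a1 (le_trans a2 a3).
have /ae_eq_integral_abs : (\int[mu \x mu]_u `|E2 u| = 0)%E.
  by rewrite -[RHS]z; apply: eq_integral => u _; rewrite gee0_abs.
move=> /(_ measurableT mE2); apply: filterS => u /(_ I) Eu tri.
have mH2 : measurable_fun setT (fun w => (H u.1 u.2 w)%:E).
  apply/measurable_EFinP; exact: (measurableT_comp mH (measurable_pair1 _)).
have : (\int[P]_w `|(H u.1 u.2 w)%:E| = 0)%E.
  rewrite -[RHS]Eu; apply: eq_integral => w _; rewrite gee0_abs ?lee_fin//.
  by rewrite /K2/= indicE mem_set// mul1r.
move/ae_eq_integral_abs => /(_ measurableT mH2); apply: filterS => w /(_ I) hw.
by have [] := hw.
Qed.

End triangle.

End tonelli.

(** * Measurability of the coefficients along processes *)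

Section composition_measurability.
Context {R : realType}.
Variables (n d m : nat) (T : R).
Notation V := 'cV[R]_n.
Variables (b : R -> V -> V) (sigma : R -> V -> 'M[R]_(n, d)) (psi : R -> V -> V -> 'cV[R]_m)
  (g : R -> R -> V -> V -> 'cV[R]_m -> 'M[R]_(m, d) -> 'cV[R]_m) (Theta : R -> R -> V -> V -> 'cV[R]_m).
Hypothesis csigma : continuous_coefficient T sigma.
Variable Lg : R.
Hypothesis gA : g_assumption T g Lg.
Hypothesis CS : classical_solution T b sigma psi g Theta.
Context {d' : measure_display} {S : measurableType d'}.
Variables (tt ss : S -> R) (xi x : S -> V).
Hypothesis mtt : measurable_fun setT tt.
Hypothesis mss : measurable_fun setT ss.
Hypothesis tri : forall u, triangle T (tt u, ss u).
Hypothesis mxi : forall p, measurable_fun setT (fun u => xi u p 0).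
Hypothesis mx : forall p, measurable_fun setT (fun u => x u p 0).

Let bt : bm setT tt := bm_R measurableT mtt.
Let bs : bm setT ss := bm_R measurableT mss.

Let bmV q (v : S -> 'cV[R]_q) : (forall p, measurable_fun setT (fun u => v u p 0)) -> bm setT v.
Proof. by move=> h; apply: bm_mx => // i j; rewrite (ord1 j). Qed.

Let sep2 : sep (R * R)%type. Proof. by apply: sep_prod; exact: sep_R. Qed.
Let sep3 : sep (R * R * V)%type. Proof. by apply: sep_prod => //; exact: sep_mx. Qed.
Let sep4 : sep (R * R * V * V)%type. Proof. by apply: sep_prod => //; exact: sep_mx. Qed.

Let b4 : bm setT (fun u => ((tt u, ss u), xi u, x u)).
Proof.
apply: bm_pair => //; last exact: bmV.
by apply: bm_pair => //; [exact: bm_pair|exact: bmV].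
Qed.

Let dom4 u : (triangle T `*` setT `*` setT) ((tt u, ss u), xi u, x u).
Proof. by split => //; split => //; exact: tri. Qed.

Lemma jac_comp_meas i p : measurable_fun setT (fun u => jac (Theta (tt u) (ss u) (xi u)) (x u) i p).
Proof.
case: CS => Ts [_ _ [cJ _] _ _].
have cj := cont_entry (F := (fun v : subspace (triangle T `*` [set: V] `*` [set: V]) =>
  jac (Theta v.1.1.1 v.1.1.2 v.1.2) v.2)) (i := i) (j := p) cJ.
exact: (bm_within measurableT sep4 b4 (fun u _ => dom4 u) cj).
Qed.

Lemma Theta_comp_meas i : measurable_fun setT (fun u => Theta (tt u) (ss u) (xi u) (x u) i 0).
Proof.
case: CS => Ts [_ [cT _] _ _ _].
have cj := cont_entry (F := (fun v : subspace (triangle T `*` [set: V] `*` [set: V]) =>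
  Theta v.1.1.1 v.1.1.2 v.1.2 v.2)) (i := i) (j := 0) cT.
exact: (bm_within measurableT sep4 b4 (fun u _ => dom4 u) cj).
Qed.

Lemma sigma_comp_meas p k : measurable_fun setT (fun u => sigma (ss u) (x u) p k).
Proof.
have cj := cont_entry (F := (fun v : subspace (`[0, T] `*` [set: V]) => sigma v.1 v.2)) (i := p) (j := k) csigma.
have bb : bm setT (fun u => (ss u, x u)) by apply: bm_pair => //; exact: bmV.
have sE : sep (R * V)%type by apply: sep_prod; [exact: sep_R|exact: sep_mx].
apply: (bm_within measurableT sE bb _ cj) => u _; split => //=.
by rewrite in_itv/=; have /and3P[h1 h2 ->] := tri u; rewrite (le_trans h1 h2).
Qed.

Lemma g_comp_meas (y : S -> 'cV[R]_m) (z : S -> 'M[R]_(m, d)) i :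
  (forall j, measurable_fun setT (fun u => y u j 0)) ->
  (forall j k, measurable_fun setT (fun u => z u j k)) ->
  measurable_fun setT (fun u => g (tt u) (ss u) (xi u) (x u) (y u) (z u) i 0).
Proof.
move=> my mz; case: gA => cg _.
have cj := cont_entry (F := (fun u : subspace (triangle T `*` setT `*` setT `*` setT `*` setT) =>
  g u.1.1.1.1.1 u.1.1.1.1.2 u.1.1.1.2 u.1.1.2 u.1.2 u.2)) (i := i) (j := 0) cg.
have sE : sep (R * R * V * V * 'cV[R]_m * 'M[R]_(m, d))%type.
  by apply: sep_prod; [apply: sep_prod => //|]; exact: sep_mx.
have bb : bm setT (fun u => ((tt u, ss u), xi u, x u, y u, z u)).
  by apply: bm_pair => //; [apply: bm_pair => //; exact: bmV|exact: bm_mx].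
apply: (bm_within measurableT sE bb _ cj) => u _.
by do 2! split => //; exact: dom4.
Qed.

End composition_measurability.

(** * Vanishing of the difference of the two solutions *)

Section verification.
Context {R : realType} {dO : measure_display} {Omega : measurableType dO}.
Variable P : probability Omega R.
Hypothesis cP : measure_is_complete P.
Variables (d : nat) (W : R -> Omega -> 'cV[R]_d).
Hypothesis BM : brownian_motion P W.
Notation Fm := (Fm P W).
Notation mu := (@lebesgue_measure R).
Notation L2 := (L2 P).
Notation Ex := (Ex P).
Notation IT := (IT P).
Notation ItoP := (ItoP P W).
Variables (n m : nat) (T : R).
Hypothesis T0 : 0 < T.
Notation V := 'cV[R]_n.
Variables (b : R -> V -> V) (sigma : R -> V -> 'M[R]_(n, d)) (psi : R -> V -> V -> 'cV[R]_m)
  (g : R -> R -> V -> V -> 'cV[R]_m -> 'M[R]_(m, d) -> 'cV[R]_m) (Theta : R -> R -> V -> V -> 'cV[R]_m).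
Hypothesis cb : continuous_coefficient T b.
Hypothesis cs : continuous_coefficient T sigma.
Variable Lg : R.
Hypothesis gA : g_assumption T g Lg.
Hypothesis CS : classical_solution T b sigma psi g Theta.
Variable X : R -> Omega -> V.
Hypothesis FX : forall s p, 0 <= s <= T -> Fm s (fun w => X s w p 0).
Hypothesis mX : forall s p, measurable_fun setT (fun w => X s w p 0).
Hypothesis cX : forall w p, continuous (fun s => X s w p 0).
Variable I : 'I_n -> R -> Omega -> R.
Hypothesis II : forall p s, 0 <= s <= T -> ItoP 0 s (fun k r w => cls T sigma p k (r, X r w)) (I p s).
Variable x0 : 'I_n -> R.
Hypothesis SDE : forall s, 0 <= s <= T -> {ae P, forall w, forall p,
  X s w p 0 = x0 p + (\int[mu]_(r in `[0%R, s]) clb T b p (r, X r w))%R + I p s w}.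
(** The given solution. X is a version of it with all paths continuous on the whole line, equal to
    it on [0, T] off one null set; hypotheses and conclusions are transferred between the two. *)
Variable X' : R -> Omega -> V.
Hypothesis X'E : {ae P, forall w, forall s, 0 <= s <= T -> X s w = X' s w}.
Variables (Y : R -> Omega -> 'cV[R]_m) (Z : R -> R -> Omega -> 'M[R]_(m, d)).
Hypothesis mY : measurable_mx (`[0, T] `*` setT) (fun u : R * Omega => Y u.1 u.2).
Hypothesis mZ : measurable_mx (triangle T `*` setT) (fun u : R * R * Omega => Z u.1.1 u.1.2 u.2).
Hypothesis FYZ : forall t s, 0 <= t < T -> t <= s <= T ->
  measurable_wrt (augmented_filtration P W s) (Y s) /\ measurable_wrt (augmented_filtration P W s) (Z t s).
Hypothesis YZ2 : square_integrable_pair P T Y Z.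
Hypothesis Th2 : square_integrable_pair P T (fun s w => Theta s s (X' s w) (X' s w))
  (fun t s w => jac (Theta t s (X' t w)) (X' s w) *m sigma s (X' s w)).
Hypothesis eqYZ : {ae mu, forall t, 0 <= t <= T ->
  exists2 IY, is_ito_integral P (augmented_filtration P W) W t T (Z t) IY &
  {ae P, forall w, Y t w = psi t (X' t w) (X' T w)
    + vintegral `[t, T] (fun s => g t s (X' t w) (X' s w) (Y s w) (Z t s w)) - IY w}}.

Let eqX : {ae mu, forall t, 0 <= t <= T ->
  exists2 IY, is_ito_integral P (augmented_filtration P W) W t T (Z t) IY &
  {ae P, forall w, Y t w = psi t (X t w) (X T w)
    + vintegral `[t, T] (fun s => g t s (X t w) (X s w) (Y s w) (Z t s w)) - IY w}}.
Proof.
apply: lebesgue_ae_imp eqYZ => t h t_in; have [IY hI hY] := h t_in; exists IY => //.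
apply: filterS2 hY X'E => w -> E; have T_in : 0 <= T <= T by rewrite lexx ltW.
rewrite !E//; congr (_ + _ - _); apply/colP => i; rewrite !mxE.
apply: eq_Rintegral => s; rewrite inE/= in_itv/= => /andP[ts sT].
by rewrite E//; case/andP: t_in => t0 _; rewrite (le_trans t0 ts).
Qed.

Let c0 (s : R) : R := clamp 0 T s.
Let ct (t s : R) : R := clamp (c0 t) T s.

(* Y and Z extended by 0 outside their domains, and their candidate values
   with clamped times, so that all processes are jointly measurable on the
   whole space. *)
Let Y0 s w : 'cV[R]_m := if 0 <= s <= T then Y s w else 0.
Let Z0 t s w : 'M[R]_(m, d) := if [&& 0 <= t, t <= s & s <= T] then Z t s w else 0.
Let Yt s w : 'cV[R]_m := Theta (c0 s) (c0 s) (X s w) (X s w).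
Let Zt t s w : 'M[R]_(m, d) := jac (Theta (c0 t) (ct t s) (X t w)) (X s w) *m sigma (c0 s) (X s w).

Let dY i s w := Y0 s w i 0 - Yt s w i 0.
Let dZ t i k s w := Z0 t s w i k - Zt t s w i k.
Let gY i t s w := g (c0 t) (ct t s) (X t w) (X s w) (Y0 s w) (Z0 t s w) i 0.
Let gT i t s w := g (c0 t) (ct t s) (X t w) (X s w) (Yt s w) (Zt t s w) i 0.
Let dG t i s w := gY i t s w - gT i t s w.
Let q s w := \sum_i dY i s w ^+ 2.

Let c0_in s : 0 <= c0 s <= T.
Proof. by rewrite /c0 clamp_ge clamp_le// ltW. Qed.

Let c0_id s : 0 <= s <= T -> c0 s = s.
Proof. exact: clamp_id. Qed.

Let ct_id t s : 0 <= t -> t <= s <= T -> ct t s = s.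
Proof.
move=> t0 /andP[ts sT]; rewrite /ct c0_id ?t0 ?(le_trans ts)//.
by apply: clamp_id; rewrite ts.
Qed.

Let tri_ct t s : triangle T (c0 t, ct t s).
Proof.
have /andP[h1 h2] := c0_in t.
by rewrite /triangle/= h1 /ct clamp_ge clamp_le.
Qed.

Let tri_c0 s : triangle T (c0 s, c0 s).
Proof. by have /andP[h1 h2] := c0_in s; rewrite /triangle/= h1 lexx. Qed.

Let tri_0 s : triangle T (0, c0 s).
Proof. by have /andP[h1 h2] := c0_in s; rewrite /triangle/= h1 lexx. Qed.

Section slices.
Context {d' : measure_display} {S : measurableType d'}.
Variables (tt ss : S -> R) (xi x : S -> V).
Hypothesis mtt : measurable_fun setT tt.
Hypothesis mss : measurable_fun setT ss.
Hypothesis mxi : forall p, measurable_fun setT (fun u => xi u p 0).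
Hypothesis mx : forall p, measurable_fun setT (fun u => x u p 0).

Let mc0 (f : S -> R) : measurable_fun setT f -> measurable_fun setT (fun u => c0 (f u)).
Proof.
move=> mf; apply: (@measurableT_comp _ _ _ _ _ _ c0) => //.
by apply: continuous_measurable_fun; exact: cont_clamp.
Qed.

Let mct : measurable_fun setT (fun u => ct (tt u) (ss u)).
Proof.
apply: measurable_maxr; first exact: mc0.
by apply: measurable_minr => //; exact: measurable_cst.
Qed.

(** The measurable space is left arbitrary because it is used twice: product spaces give joint
    measurability, and Omega with the sigma-algebra of a fixed time gives adaptedness. *)
Lemma slice_Y i : measurable_fun setT (fun u => Theta (c0 (ss u)) (c0 (ss u)) (x u) (x u) i 0).
Proof. by apply: (Theta_comp_meas CS) => //; exact: mc0. Qed.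

Lemma slice_Z i k : measurable_fun setT (fun u =>
  (jac (Theta (c0 (tt u)) (ct (tt u) (ss u)) (xi u)) (x u) *m sigma (c0 (ss u)) (x u)) i k).
Proof.
rewrite (_ : (fun u => _) = fun u => \sum_p jac (Theta (c0 (tt u)) (ct (tt u) (ss u)) (xi u)) (x u) i p *
   sigma (c0 (ss u)) (x u) p k); last by apply/funext => u; rewrite mxE.
apply: measurable_sum => p; apply: measurable_funM.
  by apply: (jac_comp_meas CS) => //; exact: mc0.
apply: (@sigma_comp_meas _ _ _ _ _ cs _ _ (fun=> 0) (fun u => c0 (ss u)) x) => //; exact: mc0.
Qed.

Lemma slice_g (y : S -> 'cV[R]_m) (z : S -> 'M[R]_(m, d)) i : (forall j, measurable_fun setT (fun u : S => y u j 0)) ->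
  (forall j k, measurable_fun setT (fun u : S => z u j k)) ->
  measurable_fun setT (fun u => g (c0 (tt u)) (ct (tt u) (ss u)) (xi u) (x u) (y u) (z u) i 0).
Proof. by move=> my mz; apply: (g_comp_meas gA) => //; exact: mc0. Qed.

End slices.

Let jX p : measurable_fun setT (fun u : R * Omega => X u.1 u.2 p 0).
Proof. exact: (measurable_fun_joint (X := fun s w => X s w p 0) (fun s => mX s p) (fun w => @cX w p)). Qed.

Let m11 : measurable_fun setT (fun u : R * R * Omega => u.1.1).
Proof. exact: (measurableT_comp (measurable_fst) measurable_fst). Qed.
Let m12 : measurable_fun setT (fun u : R * R * Omega => u.1.2).
Proof. exact: (measurableT_comp (measurable_snd) measurable_fst). Qed.

Let jX1 p : measurable_fun setT (fun u : R * R * Omega => X u.1.1 u.2 p 0).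
Proof.
have h : measurable_fun setT (fun u : R * R * Omega => (u.1.1, u.2)) by exact: measurable_fun_pair.
exact: (measurableT_comp (jX p) h).
Qed.

Let jX2 p : measurable_fun setT (fun u : R * R * Omega => X u.1.2 u.2 p 0).
Proof.
have h : measurable_fun setT (fun u : R * R * Omega => (u.1.2, u.2)) by exact: measurable_fun_pair.
exact: (measurableT_comp (jX p) h).
Qed.

Let jYt i : jmf (fun s w => Yt s w i 0).
Proof. exact: slice_Y. Qed.

Let jY0 i : jmf (fun s w => Y0 s w i 0).
Proof.
have mD : measurable (`[0, T]%classic `*` [set: Omega]) by apply: measurableX => //; exact: measurable_itv.
have := mY i 0; move/(measurable_restrictT _ mD); congr measurable_fun.
apply/funext => -[s w]; rewrite patchE /Y0 /=.
have -> : ((s, w) \in `[0, T]%classic `*` [set: Omega]) = (0 <= s <= T).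
  by apply/idP/idP; rewrite inE/= in_itv/=; [case|].
by case: ifP => // _; rewrite mxE.
Qed.

Let jZt i k : measurable_fun setT (fun u : R * R * Omega => Zt u.1.1 u.1.2 u.2 i k).
Proof. exact: slice_Z. Qed.

Let jZ0 i k : measurable_fun setT (fun u : R * R * Omega => Z0 u.1.1 u.1.2 u.2 i k).
Proof.
have mD : measurable (triangle T `*` [set: Omega]) by apply: measurableX => //; exact: triangle_measurable.
have := mZ i k; move/(measurable_restrictT _ mD); congr measurable_fun.
apply/funext => -[[t s] w]; rewrite patchE /Z0 /=.
have -> : ((t, s, w) \in triangle T `*` [set: Omega]) = [&& 0 <= t, t <= s & s <= T].
  by apply/idP/idP; rewrite inE/=; [case|].
by case: ifP => // _; rewrite mxE.
Qed.

Let jY2 i : measurable_fun setT (fun u : R * R * Omega => Y0 u.1.2 u.2 i 0).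
Proof.
have h : measurable_fun setT (fun u : R * R * Omega => (u.1.2, u.2)) by exact: measurable_fun_pair.
exact: (measurableT_comp (jY0 i) h).
Qed.

Let jYt2 i : measurable_fun setT (fun u : R * R * Omega => Yt u.1.2 u.2 i 0).
Proof.
have h : measurable_fun setT (fun u : R * R * Omega => (u.1.2, u.2)) by exact: measurable_fun_pair.
exact: (measurableT_comp (jYt i) h).
Qed.

Let jgT i : measurable_fun setT (fun u : R * R * Omega => gT i u.1.1 u.1.2 u.2).
Proof. exact: (slice_g m11 m12 jX1 jX2). Qed.

Let jdG i : measurable_fun setT (fun u : R * R * Omega => dG u.1.1 i u.1.2 u.2).
Proof. by apply: measurable_funB => //; exact: (slice_g m11 m12 jX1 jX2). Qed.

Let jdY i : jmf (dY i).
Proof. by apply: measurable_funB; [exact: jY0|exact: jYt]. Qed.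

Let jdZ i k : measurable_fun setT (fun u : R * R * Omega => dZ u.1.1 i k u.1.2 u.2).
Proof. exact: measurable_funB. Qed.

Let jq : jmf q.
Proof. by apply: measurable_sum => i; apply: measurable_funX; exact: jdY. Qed.

Let q0 s w : 0 <= q s w.
Proof. by apply: sumr_ge0 => i _; exact: sqr_ge0. Qed.

Let SY0 s w := \sum_i Y0 s w i 0 ^+ 2.
Let SYt s w := \sum_i Yt s w i 0 ^+ 2.
Let SZ0 t s w := \sum_i \sum_k Z0 t s w i k ^+ 2.
Let SZt t s w := \sum_i \sum_k Zt t s w i k ^+ 2.
Let H t s w := \sum_i sqn (dZ t i) s w.

Let SY0_ge0 s w : 0 <= SY0 s w. Proof. by apply: sumr_ge0 => i _; exact: sqr_ge0. Qed.
Let SYt_ge0 s w : 0 <= SYt s w. Proof. by apply: sumr_ge0 => i _; exact: sqr_ge0. Qed.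
Let SZ0_ge0 t s w : 0 <= SZ0 t s w.
Proof. by apply: sumr_ge0 => i _; apply: sumr_ge0 => k _; exact: sqr_ge0. Qed.
Let SZt_ge0 t s w : 0 <= SZt t s w.
Proof. by apply: sumr_ge0 => i _; apply: sumr_ge0 => k _; exact: sqr_ge0. Qed.
Let H_ge0 t s w : 0 <= H t s w.
Proof. by apply: sumr_ge0 => i _; exact: sqn_ge0. Qed.

Let jSY0 : jmf SY0.
Proof. by apply: measurable_sum => i; apply: measurable_funX; exact: jY0. Qed.
Let jSYt : jmf SYt.
Proof. by apply: measurable_sum => i; apply: measurable_funX; exact: jYt. Qed.
Let jSZ0 : measurable_fun setT (fun u : R * R * Omega => SZ0 u.1.1 u.1.2 u.2).
Proof. by apply: measurable_sum => i; apply: measurable_sum => k; apply: measurable_funX; exact: jZ0. Qed.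
Let jSZt : measurable_fun setT (fun u : R * R * Omega => SZt u.1.1 u.1.2 u.2).
Proof. by apply: measurable_sum => i; apply: measurable_sum => k; apply: measurable_funX; exact: jZt. Qed.
Let jH : measurable_fun setT (fun u : R * R * Omega => H u.1.1 u.1.2 u.2).
Proof. by apply: measurable_sum => i; apply: measurable_sum => k; apply: measurable_funX; exact: jdZ. Qed.

Let sq_split (A : R -> Omega -> 'cV[R]_m) (B : R -> R -> Omega -> 'M[R]_(m, d)) :
  square_integrable_pair P T A B ->
  (\int[P]_w \int[mu]_(t in `[0%R, T]) (enorm (A t w) ^+ 2)%:E < +oo)%E /\
  (\int[P]_w \int[mu]_(t in `[0%R, T]) \int[mu]_(s in `[t, T]) (enorm (B t s w) ^+ 2)%:E < +oo)%E.
Proof.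
move=> AB; split; apply: le_lt_trans AB.
  apply: leeDl; apply: integral_ge0 => w _; apply: integral_ge0 => t _; apply: integral_ge0 => s _.
  by rewrite lee_fin sqr_ge0.
apply: leeDr; apply: integral_ge0 => w _; apply: integral_ge0 => t _.
by rewrite lee_fin sqr_ge0.
Qed.

Let sq_Y (A : R -> Omega -> 'cV[R]_m) (S : R -> Omega -> R) :
  (forall s w, 0 <= s <= T -> S s w = \sum_i A s w i 0 ^+ 2) ->
  (\int[P]_w \int[mu]_(t in `[0%R, T]) (enorm (A t w) ^+ 2)%:E)%E = IT 0 T S.
Proof.
move=> hS; apply: eq_integral => w _; apply: eq_integral => s; rewrite inE/= in_itv/= => sT.
rewrite hS// enorm_sqr; congr (_%:E); apply: eq_bigr => i _.
by rewrite big_ord1.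
Qed.

Let sq_Z (A : R -> R -> Omega -> 'M[R]_(m, d)) (S : R -> R -> Omega -> R) :
  (forall t s w, 0 <= t -> t <= s <= T -> S t s w = \sum_i \sum_k A t s w i k ^+ 2) ->
  (\int[P]_w \int[mu]_(t in `[0%R, T]) \int[mu]_(s in `[t, T]) (enorm (A t s w) ^+ 2)%:E)%E =
  (\int[P]_w \int[mu]_(t in `[0%R, T]) tint t T (S t) w)%E.
Proof.
move=> hS; apply: eq_integral => w _; apply: eq_integral => t; rewrite inE/= in_itv/= => /andP[t0 _].
apply: eq_integral => s; rewrite inE/= in_itv/= => sT.
by rewrite hS// enorm_sqr.
Qed.

Let Y0E s w : 0 <= s <= T -> Y0 s w = Y s w.
Proof. by rewrite /Y0 => ->. Qed.

Let Z0E t s w : 0 <= t -> t <= s <= T -> Z0 t s w = Z t s w.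
Proof. by rewrite /Z0 => -> ->. Qed.

Let YtE s w : 0 <= s <= T -> Yt s w = Theta s s (X s w) (X s w).
Proof. by move=> sT; rewrite /Yt c0_id. Qed.

Let ZtE t s w : 0 <= t -> t <= s <= T ->
  Zt t s w = jac (Theta t s (X t w)) (X s w) *m sigma s (X s w).
Proof.
move=> t0 sT; have /andP[ts sT'] := sT.
by rewrite /Zt ct_id// !c0_id// ?t0 ?sT' ?(le_trans t0 ts) ?(le_trans ts sT').
Qed.

Let fSY0 : (IT 0 T SY0 < +oo)%E.
Proof.
have E s w : 0 <= s <= T -> SY0 s w = \sum_i Y s w i 0 ^+ 2 by move=> sT; rewrite /SY0 Y0E.
by rewrite -(sq_Y E); have [h _] := sq_split YZ2; exact: h.
Qed.

(** The integrability hypothesis concerns X', so the inner integrals agree only almost surely;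
    completeness makes both of them measurable. *)
Let fSYt : (IT 0 T SYt < +oo)%E.
Proof.
have [h _] := sq_split Th2; apply: le_lt_trans h; rewrite le_eqVlt; apply/orP; left; apply/eqP.
apply: (ae_integral cP); first exact: (tint_meas 0 T SYt_ge0 jSYt).
apply: filterS X'E => w E; apply: eq_integral => s; rewrite inE/= in_itv/= => sT.
rewrite enorm_sqr /SYt; congr (_%:E); apply: eq_bigr => i _.
by rewrite big_ord1 YtE// E.
Qed.

Let fSZ0 : {ae mu, forall t, 0 <= t <= T -> (IT t T (SZ0 t) < +oo)%E}.
Proof.
have E t s w : 0 <= t -> t <= s <= T -> SZ0 t s w = \sum_i \sum_k Z t s w i k ^+ 2.
  by move=> t0 sT; rewrite /SZ0 Z0E.
apply: (triangle_ae_fin SZ0_ge0 jSZ0 (ltW T0)); rewrite -(sq_Z E).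
by have [_ h] := sq_split YZ2; exact: h.
Qed.

Let fSZt : {ae mu, forall t, 0 <= t <= T -> (IT t T (SZt t) < +oo)%E}.
Proof.
apply: (triangle_ae_fin SZt_ge0 jSZt (ltW T0)).
have [_ h] := sq_split Th2; apply: le_lt_trans h; rewrite le_eqVlt; apply/orP; left; apply/eqP.
have mm := triangle_meas T SZt_ge0 jSZt.
apply: (ae_integral cP mm).
apply: filterS X'E => w E; apply: eq_integral => t; rewrite inE/= in_itv/= => t_in.
apply: eq_integral => s; rewrite inE/= in_itv/= => /andP[ts sT].
have /andP[t0 _] := t_in.
rewrite enorm_sqr /SZt ZtE ?ts// !E ?(le_trans t0 ts)//.
Qed.

Let IT_sub_fin a c (f f1 f2 : R -> Omega -> R) : (forall s w, 0 <= f s w) -> (forall s w, 0 <= f1 s w) ->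
  (forall s w, 0 <= f2 s w) -> jmf f -> jmf f1 -> jmf f2 ->
  (forall s w, f s w <= 2 * f1 s w + 2 * f2 s w) ->
  (IT a c f1 < +oo)%E -> (IT a c f2 < +oo)%E -> (IT a c f < +oo)%E.
Proof.
move=> f0 f10 f20 jf jf1 jf2 le fin1 fin2.
apply: (@le_lt_trans _ _ (IT a c (fun s w => 2 * f1 s w + 2 * f2 s w))).
  apply: IT_le => //.
  - by move=> s w; rewrite addr_ge0// mulr_ge0.
  - by apply: measurable_funD; exact: measurable_funM.
have z2 : 0 <= 2 :> R by [].
have e2 : (0%R <= (2 : R)%:E)%E by rewrite lee_fin.
have f2' : (2 : R)%:E \is a fin_num by [].
rewrite (ITD P a c f10 f20 jf1 jf2 z2 z2).
exact: (lte_add_pinfty (lte_mul_pinfty e2 f2' fin1) (lte_mul_pinfty e2 f2' fin2)).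
Qed.

Let fq : (IT 0 T q < +oo)%E.
Proof.
apply: (IT_sub_fin q0 SY0_ge0 SYt_ge0 jq jSY0 jSYt _ fSY0 fSYt) => s w.
rewrite /q /SY0 /SYt !mulr_sumr -big_split/=; apply: ler_sum => i _; exact: sqr_sub_le.
Qed.

Let fqt t : 0 <= t <= T -> (IT t T q < +oo)%E.
Proof. by move=> /andP[t0 tT]; apply: le_lt_trans fq; apply: IT_sub. Qed.

Let fH t : (IT t T (SZ0 t) < +oo)%E -> (IT t T (SZt t) < +oo)%E -> (IT t T (H t) < +oo)%E.
Proof.
move=> f1 f2; apply: (IT_sub_fin (H_ge0 t) (SZ0_ge0 t) (SZt_ge0 t) (section_jmf jH t) (section_jmf jSZ0 t)
   (section_jmf jSZt t) _ f1 f2) => s w.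
rewrite /H /SZ0 /SZt !mulr_sumr -big_split/=; apply: ler_sum => i _.
rewrite !mulr_sumr -big_split/=; apply: ler_sum => k _; exact: sqr_sub_le.
Qed.

(** The stochastic integral of the candidate Z(t, .) over [t, T], in the explicit form given by
    Ito's formula and the equation for Theta. *)
Let It t i w := solf T Theta t i (at3 t X T w) - solf T Theta t i (at3 t X t w)
  + (\int[mu]_(s in `[t, T]) solG T sigma g Theta t i (at3 t X s w))%R.

Section fixed_time.
Variable t : R.
Hypothesis t0 : 0 <= t.
Hypothesis tT : t < T.

Let t_in : 0 <= t <= T.
Proof. by rewrite t0 ltW. Qed.

Let Zt_ito i : ItoP t T (fun k s w => Zt t s w i k) (It t i).
Proof.
have [fs [H' [[cfs cG] cD cH [ft ftay pde]]]] := classical_solution_ito T0 i t0 tT cs gA CS.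
have := ito_formula cP BM t0 tT FX mX cX (fun p => clb_cont T0 (p := p) cb) (fun p k => cls_cont T0 (p := p) (k := k) cs) II SDE
  cfs cG cD cH ft ftay pde.
congr (ItoP _ _ _ _); apply/funext => k; apply/funext => s; apply/funext => w.
by rewrite /Zt mxE /ct c0_id.
Qed.

Let cG i : continuous (solG T sigma g Theta t i).
Proof. by have [fs [H' [[_ cG] _ _ _]]] := classical_solution_ito T0 i t0 tT cs gA CS. Qed.

Let cGX i w : continuous (fun s => solG T sigma g Theta t i (at3 t X s w)).
Proof. by apply: cont_comp; [exact: at3_cont|exact: cG]. Qed.

Let jG i : jmf (fun s w => solG T sigma g Theta t i (at3 t X s w)).
Proof.
apply: measurable_fun_joint => [s|w]; last exact: cGX.
by apply: comp3_meas; [exact: mX|exact: mX|exact: cG].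
Qed.

Let msolf i s : measurable_fun setT (fun w => solf T Theta t i (at3 t X s w)).
Proof.
apply: (@Theta_comp_meas _ _ _ _ _ _ _ _ _ _ CS _ _ (fun=> t) (fun=> clamp t T s)) => //.
- by move=> _; have := tri_ct t s; rewrite /ct c0_id.
- by move=> p; exact: mX.
- by move=> p; exact: mX.
Qed.

Let mIt i : measurable_fun setT (It t i).
Proof.
apply: measurable_funD; last exact: (Rint_meas t T (jG i)).
by apply: measurable_funB; exact: msolf.
Qed.

Let FdY i : Fm t (dY i t).
Proof.
apply: measurable_funB.
  have tt : t <= t <= T by rewrite lexx ltW.
  have tT' : 0 <= t < T by rewrite t0.
  have [/Fm_wrt FY _] := FYZ tT' tt.
  rewrite (_ : (fun w => Y0 t w i 0) = fun w => Y t w i 0); first exact: FY.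
  by apply/funext => w; rewrite Y0E.
apply: (@slice_Y _ (g_sigma_algebraType (Gt P W t)) (fun=> t) (X t)) => // p; exact: FX.
Qed.

Let FdG i s : t <= s <= T -> Fm s (dG t i s).
Proof.
move=> sT; have /andP[ts sT'] := sT.
have s_in : 0 <= s <= T by rewrite (le_trans t0).
have Ft p : Fm s (fun w => X t w p 0) by apply: (Fm_mono ts); exact: FX.
have Fs p : Fm s (fun w => X s w p 0) by exact: FX.
have tT' : 0 <= t < T by rewrite t0.
have [/Fm_wrt FY /Fm_wrt FZ] := FYZ tT' sT.
apply: measurable_funB.
- apply: (@slice_g _ (g_sigma_algebraType (Gt P W s)) (fun=> t) (fun=> s) (X t) (X s)) => //.
  + move=> j; rewrite (_ : (fun w => Y0 s w j 0) = fun w => Y s w j 0); first exact: FY.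
    by apply/funext => w; rewrite Y0E.
  + move=> j k; rewrite (_ : (fun w => Z0 t s w j k) = fun w => Z t s w j k); first exact: FZ.
    by apply/funext => w; rewrite Z0E.
- apply: (@slice_g _ (g_sigma_algebraType (Gt P W s)) (fun=> t) (fun=> s) (X t) (X s)) => //.
  + by move=> j; apply: (@slice_Y _ (g_sigma_algebraType (Gt P W s)) (fun=> s) (X s)).
  + by move=> j k; apply: (@slice_Z _ (g_sigma_algebraType (Gt P W s)) (fun=> t) (fun=> s) (X t) (X s)).
Qed.

(** From the Lipschitz bound and (u + v)^2 <= 2 u^2 + 2 v^2. *)
Let C0 := 2 * Lg ^+ 2.

Let C00 : 0 <= C0.
Proof. by rewrite mulr_ge0// sqr_ge0. Qed.

Let dG_le i s w : t <= s <= T -> dG t i s w ^+ 2 <= C0 * (q s w + \sum_j sqn (dZ t j) s w).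
Proof.
move=> sT; have [_ lip] := gA.
have := lip (c0 t) (c0 t) (ct t s) (X t w) (X t w) (X s w) (X s w) (Y0 s w) (Yt s w) (Z0 t s w) (Zt t s w)
  (tri_ct t s) (tri_ct t s).
have z0 (v : V) : enorm (v - v) = 0.
  by apply/eqP; rewrite -sqrf_eq0 enorm_sqr subrr big1// => j _; rewrite big1// => k _; rewrite mxE expr0n.
rewrite !z0 subrr normr0 !add0r => le.
have e1 : enorm (Y0 s w - Yt s w) ^+ 2 = q s w.
  by rewrite enorm_sqr; apply: eq_bigr => j _; rewrite big_ord1 !mxE.
have e2 : enorm (Z0 t s w - Zt t s w) ^+ 2 = \sum_j sqn (dZ t j) s w.
  by rewrite enorm_sqr; apply: eq_bigr => j _; apply: eq_bigr => k _; rewrite mxE [X in _ + X]mxE.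
rewrite -e1 -e2.
have := entry_le_enorm (g (c0 t) (ct t s) (X t w) (X s w) (Y0 s w) (Z0 t s w) -
  g (c0 t) (ct t s) (X t w) (X s w) (Yt s w) (Zt t s w)) i 0.
rewrite !mxE -/(gY i t s w) -/(gT i t s w) -/(dG t i s w) => le2.
have {le2}le := le_trans le2 le.
move: le; set u := enorm _; set v := enorm _ => le.
have uv : dG t i s w ^+ 2 <= (Lg * (u + v)) ^+ 2.
  by rewrite -real_normK ?num_real//; apply: lerXn2r => //; rewrite ?nnegrE ?(le_trans _ le).
apply: (le_trans uv); rewrite exprMn /C0 -[leRHS]mulrA [leRHS]mulrCA; apply: ler_wpM2l; first exact: sqr_ge0.
have := sqr_sub_le u (- v); rewrite opprK sqrrN; lra.
Qed.

(** T is used although the grid lives on [t, T]: dt <= T / (N+1), so [small] holds for every t with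
    the same N, hence with the same K. *)
Let N := Num.truncn (8 * m%:R * C0 * T).
Let K := 14 * N.+1%:R * 2 ^+ N.+2 : R.

Let small : 8 * m%:R * C0 * dt t T N <= 1.
Proof.
have a0 : 0 <= 8 * m%:R * C0 by apply: mulr_ge0; [exact: mulr_ge0|exact: C00].
apply: (@le_trans _ _ (8 * m%:R * C0 * (T / N.+1%:R))).
  by apply: ler_wpM2l => //; rewrite /dt ler_pM2r ?invr_gt0// lerBlDr lerDl.
rewrite mulrA ler_pdivrMr// mul1r; exact: (ltW (truncnS_gt _)).
Qed.

(** An instance of [a_priori] with y = dY(t), z = dZ(t, .), phi = dG(t, .) and forcing |dY(s)|^2.
    The integral attached to dZ is that of Z minus [It]. *)
Lemma fixed_time_estimate : (\int[P]_w (q t w)%:E < +oo)%E -> (IT t T (H t) < +oo)%E ->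
  (exists2 IY, is_ito_integral P (augmented_filtration P W) W t T (Z t) IY &
    {ae P, forall w, Y t w = psi t (X t w) (X T w)
    + vintegral `[t, T] (fun s => g t s (X t w) (X s w) (Y s w) (Z t s w)) - IY w}) ->
  (\int[P]_w (q t w)%:E <= K%:E * IT t T q)%E /\ (IT t T (H t) <= K%:E * IT t T q)%E.
Proof.
move=> fqt0 fHt [IY hIY eqY].
have mq : measurable_fun setT (fun w => (q t w)%:E).
  by apply/measurable_EFinP; exact: (measurable_fun_pair2 t jq).
have mdY i : measurable_fun setT (dY i t) := Fm_meas cP BM (FdY i).
have yL i : L2 (dY i t).
  split => //; apply/integrableP; split.
    by apply/measurable_EFinP; exact: measurable_funX.
  apply: le_lt_trans fqt0; apply: ge0_le_integral => //=.
  - apply/measurable_EFinP.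
    exact: (measurableT_comp (@normr_measurable R setT) (measurable_funX 2 (mdY i))).
  - move=> w _; rewrite ger0_norm ?sqr_ge0// lee_fin /q (bigD1 i)//= lerDl sumr_ge0// => j _.
    exact: sqr_ge0.
have jz i : jm (dZ t i).
  move=> k; exact: (section_jmf (H := fun t s w => dZ t i k s w) (jdZ i k) t).
have fz i : (IT t T (sqn (dZ t i)) < +oo)%E.
  apply: le_lt_trans fHt; apply: IT_le.
  - by move=> *; exact: sqn_ge0.
  - by move=> *; exact: H_ge0.
  - exact: jm_sqn.
  - exact: (section_jmf jH t).
  - by move=> s w _; rewrite /H (bigD1 i)//= lerDl sumr_ge0// => j _; exact: sqn_ge0.
have mIY i : measurable_fun setT (fun w => IY w i 0) by case: hIY => h _; exact: h.
have zI i : ItoP t T (dZ t i) (fun w => IY w i 0 - It t i w).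
  apply: ItoP_sub.
  - by move=> k; exact: (section_jmf (H := fun t s w => Z0 t s w i k) (jZ0 i k) t).
  - by move=> k; exact: (section_jmf (H := fun t s w => Zt t s w i k) (jZt i k) t).
  - apply: (ItoP_of_is_ito (H := Z t) (H' := Z0 t) cP BM i t0 (ltW tT) _ _ hIY).
      by move=> j k; exact: (section_jmf (H := fun t s w => Z0 t s w j k) (jZ0 j k) t).
    by apply: filterE => w s sT; rewrite Z0E.
  - exact: Zt_ito.
have jphi i : jmf (dG t i) := section_jmf (H := fun t s w => dG t i s w) (jdG i) t.
have IS : (\sum_i IT t T (sqn (dZ t i)) = IT t T (H t))%E.
  by rewrite -IT_sum// => [*|i]; [exact: sqn_ge0|exact: jm_sqn].
have fG i : (IT t T (fun s w => (dG t i s w ^+ 2)%R) < +oo)%E.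
  have jS : jmf (fun s w => \sum_j sqn (dZ t j) s w) := section_jmf jH t.
  apply: (@le_lt_trans _ _ (IT t T (fun s w => C0 * q s w + C0 * H t s w))).
    apply: IT_le.
    - by move=> *; exact: sqr_ge0.
    - by move=> s w; rewrite addr_ge0// mulr_ge0.
    - by apply: measurable_funX; exact: jphi.
    - by apply: measurable_funD; apply: measurable_funM.
    - by move=> s w sT; rewrite -mulrDr; exact: dG_le.
  rewrite (ITD P t T q0 (H_ge0 t) jq jS C00 C00).
  have c0e : (0%R <= C0%:E)%E by rewrite lee_fin.
  have c0f : C0%:E \is a fin_num by [].
  exact: (lte_add_pinfty (lte_mul_pinfty c0e c0f (fqt t_in)) (lte_mul_pinfty c0e c0f fHt)).
(* The terminal condition turns the value of Theta at T inside [It] into psi, which cancels, and the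
   integral of [solG] is the driver along the candidate. Almost sure finiteness of the energy of dG
   allows the time integral to be split. *)
have eqn : {ae P, forall w, forall i, dY i t w = Rint t T (dG t i) w - (IY w i 0 - It t i w)}.
  have tfin : {ae P, forall w, forall i, (tint t T (fun s w => (dG t i s w ^+ 2)%R) w < +oo)%E}.
    apply: (@filter_forall _ _ (fun i w => (tint t T (fun s w => (dG t i s w ^+ 2)%R) w < +oo)%E)) => i.
    have mt : measurable_fun setT (tint t T (fun s w => (dG t i s w ^+ 2)%R)).
      by apply: tint_meas => [*|]; [exact: sqr_ge0|apply: measurable_funX; exact: jphi].
    have t_ge0 w : (0 <= tint t T (fun s w => (dG t i s w ^+ 2)%R) w)%E.
      by apply: tint_ge0 => *; exact: sqr_ge0.
    have it : P.-integrable setT (tint t T (fun s w => (dG t i s w ^+ 2)%R)).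
      apply/integrableP; split => //.
      by under eq_integral do rewrite gee0_abs//; exact: fG.
    have := integrable_ae measurableT it; apply: filterS => w /(_ Logic.I).
    by rewrite fin_numE => /andP[_]; rewrite ltey.
  apply: filterS2 eqY tfin => w eq1 fin i.
  case: CS => Ts [_ _ _ _ term].
  have iG := section_integrable (jphi i) (fin i).
  have iT := integrable_cont t T (@cGX i w).
  have sG : (\int[mu]_(s in `[t, T]) g t s (X t w) (X s w) (Y s w) (Z t s w) i 0)%R =
      Rint t T (dG t i) w + (\int[mu]_(s in `[t, T]) solG T sigma g Theta t i (at3 t X s w))%R.
    rewrite /Rint -(RintegralD _ iG iT); last exact: measurable_itv.
    apply: eq_Rintegral => s; rewrite inE/= in_itv/= => sT.
    have /andP[ts sT'] := sT.
    have s_in : 0 <= s <= T by rewrite (le_trans t0).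
    rewrite /dG /gY /gT /solG /soly /solz /at3 /= Y0E// Z0E// /Yt /Zt !ct_id// !c0_id// clamp_id//.
    by rewrite subrK.
  rewrite /dY Y0E// eq1 !mxE sG /It /solf /at3 /= !clamp_id ?lexx ?ltW// term// YtE//.
  ring.
have [E1 E2] := a_priori cP BM t0 tT FdY yL jz fz (fun i => measurable_funB (mIY i) (mIt i)) zI jphi
  FdG q0 jq (fqt t_in) C00 dG_le eqn small.
have KE : (K%:E * IT t T q = (K * fine (IT t T q))%:E)%E.
  by rewrite -[in LHS](IT_fine q0 (fqt t_in)) EFinM.
split; last by rewrite -IS KE.
rewrite KE (_ : (\int[P]_w _)%E = (\sum_i Ex (fun w => dY i t w ^+ 2))%:E) ?lee_fin//.
rewrite -Ex_sum; last by move=> i _; exact: (yL i).2.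
by rewrite -ExE//; apply: L1_sum => i _; exact: (yL i).2.
Qed.

End fixed_time.

Let K := 14 * (Num.truncn (8 * m%:R * (2 * Lg ^+ 2) * T)).+1%:R * 2 ^+ (Num.truncn (8 * m%:R * (2 * Lg ^+ 2) * T)).+2 : R.

Let A s : \bar R := (\int[P]_w (q s w)%:E)%E.

Let A_ge0 s : (0 <= A s)%E.
Proof. by apply: integral_ge0 => w _; rewrite lee_fin. Qed.

Let mA : measurable_fun setT A.
Proof.
apply: (@measurable_fun_fubini_tonelli_F _ _ _ _ R P (fun u : R * Omega => (q u.1 u.2)%:E)).
- by apply/measurable_EFinP; exact: jq.
- by move=> u; rewrite lee_fin.
Qed.

Let ITq a c : IT a c q = (\int[mu]_(s in `[a, c]) A s)%E.
Proof. exact: (tint_swap P a c q0 jq). Qed.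

Let estimate : {ae mu, forall t, 0 <= t < T ->
  (A t <= K%:E * IT t T q)%E /\ (IT t T (H t) <= K%:E * IT t T q)%E}.
Proof.
have fA : (\int[mu]_(s in `[0%R, T]) A s < +oo)%E by rewrite -ITq; exact: fq.
have h1 := lebesgue_ae_imp2 (fun t a c => conj a c) (time_ae_fin mA A_ge0 fA) eqX.
have h2 := lebesgue_ae_imp2 (fun t a c => conj a c) fSZ0 fSZt.
apply: lebesgue_ae_imp2 h1 h2 => t [a1 a2] [a3 a4] /andP[t0 tT].
have t_in : 0 <= t <= T by rewrite t0 ltW.
exact: (fixed_time_estimate t0 tT (a1 t_in) (fH (a3 t_in) (a4 t_in)) (a2 t_in)).
Qed.

Let ITq0 : IT 0 T q = 0%E.
Proof.
have K0 : 0 <= K by apply: mulr_ge0; [exact: mulr_ge0|exact: exprn_ge0].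
have fA : (\int[mu]_(s in `[0%R, T]) A s < +oo)%E by rewrite -ITq; exact: fq.
rewrite ITq; apply: (gronwall A_ge0 mA T0 K0 fA).
by apply: lebesgue_ae_imp estimate => t h /h[]; rewrite ITq.
Qed.

Let ITq0t t : 0 <= t -> t <= T -> IT t T q = 0%E.
Proof.
move=> t0 tT; apply/eqP; rewrite eq_le; apply/andP; split; last exact: (IT_ge0 P _ _ q0).
by rewrite -ITq0; exact: (IT_sub P t0 tT (lexx T) q0 jq).
Qed.

(** Once the forcing is known to vanish, the same estimate annihilates E|dY(t)|^2 and the energy of
    dZ(t, .). The final time T, excluded there, is a null set. *)
Let estimate0 : {ae mu, forall t, 0 <= t <= T -> A t = 0%E /\ IT t T (H t) = 0%E}.
Proof.
apply: lebesgue_ae_imp2 estimate (lebesgue_ae_neq T) => t h tT /andP[t0 tT'].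
have tlt : 0 <= t < T by rewrite t0 lt_neqAle tT.
have := h tlt; rewrite (ITq0t t0 tT') mule0 => -[h1 h2]; split; apply/eqP; rewrite eq_le.
  by rewrite h1 A_ge0.
by rewrite h2 (IT_ge0 P _ _ (H_ge0 t)).
Qed.

Lemma verification_Y : {ae mu, forall s, 0 <= s <= T ->
  {ae P, forall w, Y s w = Theta s s (X' s w) (X' s w)}}.
Proof.
apply: lebesgue_ae_imp estimate0 => s h sT; have [As _] := h sT.
have mq : measurable_fun setT (fun w => (q s w)%:E).
  by apply/measurable_EFinP; exact: (measurable_fun_pair2 s jq).
have : (\int[P]_w `|(q s w)%:E| = 0)%E.
  by rewrite -[RHS]As; apply: eq_integral => w _; rewrite gee0_abs ?lee_fin.
move/ae_eq_integral_abs => /(_ measurableT mq) aq; apply: filterS2 aq X'E => w /(_ Logic.I) [] + E; rewrite -E//.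
move/eqP; rewrite psumr_eq0 => [/allP h0|i _]; last exact: sqr_ge0.
rewrite -YtE// -Y0E//; apply/colP => i; apply/eqP; rewrite -subr_eq0.
by have := h0 i (mem_index_enum _); rewrite sqrf_eq0.
Qed.

(** The energy of dZ(t, .) vanishes for almost every t; [triangle_ae0] turns this into a statement
    for almost every pair of times. *)
Lemma verification_Z : {ae (mu \x mu)%E, forall u : R * R, triangle T u ->
  {ae P, forall w, Z u.1 u.2 w = jac (Theta u.1 u.2 (X' u.1 w)) (X' u.2 w) *m sigma u.2 (X' u.2 w)}}.
Proof.
have HH : {ae mu, forall t, 0 <= t <= T -> IT t T (H t) = 0%E}.
  by apply: lebesgue_ae_imp estimate0 => t h /h[].
have [B [mB B0 sB]] := triangle_ae0 H_ge0 jH (ltW T0) HH.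
exists B; split => // -[t s] nu; apply: sB => /= h; apply: nu => tri.
apply: filterS2 (h tri) X'E => w /= /eqP Hw E; move: Hw.
have /and3P[t0 ts sT] := tri.
have st : t <= s <= T by rewrite ts.
rewrite -!E ?t0 ?sT ?(le_trans t0 ts) ?(le_trans ts sT)// -ZtE// -Z0E// psumr_eq0 => [/allP h0|i _]; last exact: sqn_ge0.
apply/matrixP => i k; have := h0 i (mem_index_enum _); rewrite /= psumr_eq0 => [/allP h1|j _]; last exact: sqr_ge0.
by have := h1 k (mem_index_enum _); rewrite sqrf_eq0 subr_eq0 => /eqP.
Qed.

End verification.

(** * A version of the diffusion with continuous paths *)

Section continuous_version.
Context {R : realType} {dO : measure_display} {Omega : measurableType dO}.
Variable P : probability Omega R.
Hypothesis cP : measure_is_complete P.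
Variables (d : nat) (W : R -> Omega -> 'cV[R]_d).
Hypothesis BM : brownian_motion P W.
Variables (n : nat) (T : R).
Hypothesis T0 : 0 < T.
Notation V := 'cV[R]_n.
Variables (b : R -> V -> V) (sigma : R -> V -> 'M[R]_(n, d)) (x0 : V).
Hypothesis cs : continuous_coefficient T sigma.
Variable X : R -> Omega -> V.
Hypothesis SX : sde_solution P (augmented_filtration P W) W T x0 b sigma X.

(** Paths are clamped in time to [0, T], and set to 0 on the null set where continuity may fail.
    Adaptedness survives since the augmented filtration contains the null sets, and the equation is
    transferred path by path. *)
Lemma sde_continuous_version : exists (Xc : R -> Omega -> V) (I : 'I_n -> R -> Omega -> R),
  [/\ {ae P, forall w, forall s, 0 <= s <= T -> Xc s w = X s w},
      forall s p, 0 <= s <= T -> Fm P W s (fun w => Xc s w p 0),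
      forall s p, measurable_fun setT (fun w => Xc s w p 0),
      forall w p, continuous (fun s => Xc s w p 0) &
      (forall p s, 0 <= s <= T -> ItoP P W 0 s (fun k r w => cls T sigma p k (r, Xc r w)) (I p s)) /\
      (forall s, 0 <= s <= T -> {ae P, forall w, forall p, Xc s w p 0 =
         x0 p 0 + (\int[lebesgue_measure]_(r in `[0%R, s]) clb T b p (r, Xc r w))%R + I p s w})].
Proof.
case: SX => FX [N [mN N0 sN]] _ eqX.
have cl s : 0 <= clamp 0 T s <= T by rewrite clamp_ge clamp_le// ltW.
pose Xc s w := if `[< N w >] then 0 else X (clamp 0 T s) w.
have XcE w s : ~ N w -> 0 <= s <= T -> Xc s w = X s w.
  by move=> Nw sT; rewrite /Xc asboolF// clamp_id.
have aeE : {ae P, forall w, forall s, 0 <= s <= T -> Xc s w = X s w}.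
  exists N; split => // w /= h; apply: contrapT => Nw; apply: h => s; exact: XcE.
have FXc s p : 0 <= s <= T -> Fm P W s (fun w => Xc s w p 0).
  move=> sT; have /Fm_wrt/(_ p 0) h := FX s sT.
  by apply: (Fm_ae h); apply: filterS aeE => w ->.
have Xc_cl s w : Xc s w = Xc (clamp 0 T s) w.
  by rewrite /Xc (clamp_id (cl s)).
have mXc s p : measurable_fun setT (fun w => Xc s w p 0).
  rewrite (_ : (fun w => _) = fun w => Xc (clamp 0 T s) w p 0); last by apply/funext => w; rewrite Xc_cl.
  exact: (Fm_meas cP BM (FXc _ p (cl s))).
have cXc w p : continuous (fun s => Xc s w p 0).
  have [Nw|Nw] := pselect (N w).
    rewrite (_ : (fun s => _) = fun=> 0); first exact: cst_continuous.
    by apply/funext => s; rewrite /Xc asboolT// mxE.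
  rewrite (_ : (fun s => _) = fun s => X (clamp 0 T s) w p 0); last first.
    by apply/funext => s; rewrite /Xc asboolF.
  have cw : {within `[0, T], continuous (fun t => X t w)} by apply: contrapT => h; exact/Nw/sN.
  apply: (@cont_entry _ _ _ _ (fun s => X (clamp 0 T s) w)).
  apply: (within_comp cw); last exact: cont_clamp.
  by move=> s; rewrite /= in_itv/=.
have jm_sigma p : jm (fun k s w => cls T sigma p k (s, Xc s w)).
  move=> k; apply: (@measurable_fun_joint _ _ _ (fun s w => cls T sigma p k (s, Xc s w))) => [s|w].
    by apply: comp2_meas; [exact: mXc|exact: cls_cont].
  by apply: (cont_comp (@at2_cont _ _ _ _ _ cXc w)); exact: cls_cont.
(* The equation supplies one Ito integral for each time separately; they are collected into a
   process by choice, with value 0 at times outside [0, T]. *)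
have [J hJ] : exists J : R -> Omega -> V, forall s, 0 <= s <= T ->
    is_ito_integral P (augmented_filtration P W) W 0 s (fun s w => sigma s (X s w)) (J s) /\
    {ae P, forall w, X s w = x0 + vintegral `[0, s] (fun s => b s (X s w)) + J s w}.
  suff /choice[J h] : forall s, exists j : Omega -> V, 0 <= s <= T ->
    is_ito_integral P (augmented_filtration P W) W 0 s (fun s w => sigma s (X s w)) j /\
    {ae P, forall w, X s w = x0 + vintegral `[0, s] (fun s => b s (X s w)) + j w} by exists J.
  move=> s; have [sT|_] := boolP (0 <= s <= T); last by exists (fun=> 0).
  by have [j h1 h2] := eqX s sT; exists j.
exists Xc, (fun p s w => J s w p 0); split => //; split.
- move=> p s sT; have /andP[s0 sT'] := sT.
  have [hI _] := hJ s sT.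
  have := ItoP_of_is_ito (H' := fun r w => \matrix_(p, k) cls T sigma p k (r, Xc r w)) cP BM p (lexx 0) s0 _ _ hI.
  rewrite (_ : (fun k r w => (\matrix_(p, k) cls T sigma p k (r, Xc r w)) p k) =
    fun k r w => cls T sigma p k (r, Xc r w)); last first.
    by apply/funext => k; apply/funext => r; apply/funext => w; rewrite mxE.
  apply.
  + move=> i k; rewrite (_ : (fun u => _) = fun u : R * Omega => cls T sigma i k (u.1, Xc u.1 u.2)).
      exact: jm_sigma.
    by apply/funext => u; rewrite mxE.
  + apply: filterS aeE => w E r /andP[r0 rs]; apply/matrixP => i k.
    have rT : 0 <= r <= T by rewrite r0 (le_trans rs).
    by rewrite mxE /cls /= clamp_id// E.
- move=> s sT; have /andP[s0 sT'] := sT.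
  have [_ hX] := hJ s sT; apply: filterS2 hX aeE => w h E p.
  rewrite E// h !mxE; congr (_ + _ + _); apply: eq_Rintegral => r; rewrite inE/= in_itv/= => /andP[r0 rs].
  have rT : 0 <= r <= T by rewrite r0 (le_trans rs).
  by rewrite /clb /= clamp_id// E.
Qed.

End continuous_version.

Theorem theorem3p1 (R : realType) (dO : measure_display)
  (Omega : measurableType dO) (P : probability Omega R)
  (n d m : nat)
  (W : R -> Omega -> 'cV[R]_d)
  (T : R) (x0 : 'cV[R]_n)
  (b : R -> 'cV[R]_n -> 'cV[R]_n)
  (sigma : R -> 'cV[R]_n -> 'M[R]_(n, d))
  (psi : R -> 'cV[R]_n -> 'cV[R]_n -> 'cV[R]_m)
  (g : R -> R -> 'cV[R]_n -> 'cV[R]_n -> 'cV[R]_m -> 'M[R]_(m, d) -> 'cV[R]_m)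
  (Theta : R -> R -> 'cV[R]_n -> 'cV[R]_n -> 'cV[R]_m)
  (X : R -> Omega -> 'cV[R]_n)
  (Y : R -> Omega -> 'cV[R]_m)
  (Z : R -> R -> Omega -> 'M[R]_(m, d)) :
  measure_is_complete P ->
  brownian_motion P W ->
  0 < T ->
  continuous_coefficient T b -> continuous_coefficient T sigma -> sde_lipschitz T b sigma ->
  (exists2 L : R, 0 < L & psi_assumption T psi L /\ g_assumption T g L) ->
  classical_solution T b sigma psi g Theta ->
  sde_solution P (augmented_filtration P W) W T x0 b sigma X ->
  (* Fixes which classical solution "the" refers to: classical solutions are not
     unique without a growth restriction, and the conclusion itself implies
     this condition. *)
  square_integrable_pair P T
    (fun s w => Theta s s (X s w) (X s w))
    (fun t s w => jac (Theta t s (X t w)) (X s w) *m sigma s (X s w)) ->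
  bsvie_adapted_solution P (augmented_filtration P W) W T psi g X Y Z ->
  {ae lebesgue_measure, forall s : R, 0 <= s <= T ->
     {ae P, forall w, Y s w = Theta s s (X s w) (X s w)}} /\
  {ae (lebesgue_measure \x lebesgue_measure)%E, forall u : R * R,
     triangle T u ->
     {ae P, forall w, Z u.1 u.2 w =
       jac (Theta u.1 u.2 (X u.1 w)) (X u.2 w) *m sigma u.2 (X u.2 w)}}.
Proof.
move=> cP BM T0 cb cs _ [L _ [_ gA]] CS SX Th2 [[mY mZ] FYZ YZ2 eqYZ].
have [Xc [I [XcE FXc mXc cXc [II SDE]]]] := sde_continuous_version cP BM T0 cs SX.
split.
- exact: (verification_Y cP BM T0 cb cs gA CS FXc mXc cXc II SDE XcE mY mZ FYZ YZ2 Th2 eqYZ).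
- exact: (verification_Z cP BM T0 cb cs gA CS FXc mXc cXc II SDE XcE mY mZ FYZ YZ2 Th2 eqYZ).
Qed.
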